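(* Let $G=\mathrm{Sp}_6$ over $\mathbb{F}_q$. Then the function $m\mapsto\mathcal{L}(\mathrm{Sp}_6,m)$, $m\in\mathbb{Z}_{>0}$, is of Lefschetz type.
   Context: A function $f\colon\mathbb{Z}_{>0}\to\mathbb{C}$ is of Lefschetz type if $f(m)=\sum_{i=1}^r n_i\alpha_i^m$ for some $n_i\in\mathbb{Z}$, $\alpha_i\in\mathbb{C}$. Setting: $q$ is a power of a prime $p$ ($q$ may be odd or even); $X$ is a smooth projective geometrically connected curve over $\mathbb{F}_q$, $\overline{X}=X\otimes\overline{\mathbb{F}}_q$; $S$ is a finite set of closed points of $X$ with $\#S\ge2$. Fix a prime $\ell\neq p$ and $\overline{\mathbb{Q}}_\ell\cong\mathbb{C}$. $J_X$ is the multiset of eigenvalues of the geometric Frobenius $\mathrm{Fr}_q$ on $H^1_{et}(\overline{X},\mathbb{Q}_\ell)$; $J_S$ is the multiset union over $v\in S$ of all $\deg(v)$-th roots of unity; $J$ is $J_X\sqcup J_S$ with two copies of $1$ removed. Motive of a connected reductive group $H$ over $\mathbb{F}_Q$: with $T_0$ the centralizer of a maximal $\mathbb{F}_Q$-split torus, $W$ the Weyl group, $R=(\mathrm{Sym}(X^*(T_0)\otimes\mathbb{Q}))^W$, $R_+$ its positive-degree ideal, $V=R_+/R_+^2=\bigoplus_{d\ge1}V_d$ graded by degree with its Galois action, $M_H=\bigoplus_dV_d(1-d)$ and $\det(1-t\mathrm{Fr}_Q\mid M_H)\coloneqq\prod_{d\ge1}\det(1-tQ^{d-1}\mathrm{Fr}_Q\mid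 V_d)$. For $m\ge1$, $Q=q^m$, $H$ connected reductive over $\mathbb{F}_{q^m}$: $L_{S_m}(M_H)\coloneqq\frac{\det(1-\mathrm{Fr}_Q\mid M_H)}{\det(1-Q\mathrm{Fr}_Q\mid M_H)}\prod_{\alpha\in J}\det(1-\alpha^m\mathrm{Fr}_Q\mid M_H)$ (the value at $s=0$ of the $S_m$-modified $L$-function of $M_H$ for $X_m=X\otimes\mathbb{F}_{q^m}$ and the points $S_m$ over $S$). Then $\mathcal{L}(G,m)\coloneqq\sum_{[\gamma]}L_{S_m}(M_{G_\gamma})$, summed over conjugacy classes of semisimple $\gamma\in G(\mathbb{F}_{q^m})$, with $G_\gamma$ the centralizer of $\gamma$ over $\mathbb{F}_{q^m}$. *)

(* Defs.v *)
From HB Require Import structures.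
From mathcomp Require Import all_boot all_order all_algebra all_field.
From mathcomp Require Import finmap mpoly.
From mathcomp Require Import boolp classical_sets functions cardinality fsbigop reals.
From mathcomp Require Import complex.

Set Implicit Arguments.
Unset Strict Implicit.
Unset Printing Implicit Defensive.

Import Order.TTheory GRing.Theory Num.Theory.
Local Open Scope classical_set_scope.
Local Open Scope ring_scope.

(** The domain of [f] is really the set of positive integers: the value [f 0]
    is irrelevant. *)
Definition lefschetz_type (C : fieldType) (f : nat -> C) : Prop :=
  exists (r : nat) (n : 'I_r -> int) (a : 'I_r -> C),
    forall m : nat, (0 < m)%N -> f m = \sum_(i < r) (n i)%:~R * a i ^+ m.

Definition roots_seq (K : closedFieldType) (p : {poly K}) : seq K :=
  sval (closed_field_poly_normal p).

Section ValuationRings.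
Variable F : fieldType.

Definition is_subring (O : set F) : Prop :=
  O 1 /\ forall x y, O x -> O y -> O (x - y) /\ O (x * y).

(** Nontrivial valuation rings with fraction field [F]. *)
Definition valuation_ring (O : set F) : Prop :=
  [/\ is_subring O, (forall x, O x \/ O x^-1) & exists x, ~ O x].

Definition max_ideal (O : set F) : set F :=
  [set x | O x /\ (x = 0 \/ ~ O x^-1)].

End ValuationRings.

(** Smooth projective geometrically connected curves over [Fq] are encoded by
    their function fields: they correspond to the finitely generated field
    extensions of transcendence degree one in which [Fq] is algebraically
    closed, and the closed points of the curve correspond to the nontrivial
    valuation rings of the function field containing [Fq]. *)

Section FunctionField.
Variables (Fq : finFieldType) (F : fieldType) (iota : {rmorphism Fq -> F}).

Definition transcendental (t : F) : Prop := ~ algebraicOver iota t.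

Definition exact_function_field : Prop :=
  (exists t : F, transcendental t /\
     exists (d : nat) (e : 'I_d -> F), forall x : F,
       exists (a : 'I_d -> {poly Fq}) (b : {poly Fq}),
         b != 0 /\ x = \sum_(i < d)
           (map_poly iota (a i)).[t] / (map_poly iota b).[t] * e i) /\
  (forall x : F, algebraicOver iota x -> exists c : Fq, x = iota c).

End FunctionField.

Record curve (Fq : finFieldType) := Curve {
  ffield :> fieldType;
  constants : {rmorphism Fq -> ffield};
  curveP : exact_function_field constants }.

Section ClosedPoints.
Variables (Fq : finFieldType) (X : curve Fq).

(** A valuation ring contains the constants automatically, since these are
    roots of unity or zero and valuation rings are integrally closed. *)
Definition closed_point (v : set X) : Prop := valuation_ring v.

Definition residue_degree (v : set X) (d : nat) : Prop :=
  exists2 e : 'I_d -> X, (forall i, v (e i)) &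
    forall x, v x -> exists! c : {ffun 'I_d -> Fq},
      max_ideal v (x - \sum_(i < d) constants X (c i) * e i).

Definition deg (v : set X) : nat := xget 0%N [set d | residue_degree v d].

End ClosedPoints.

(** [padic_int] is, up to isomorphism, the inverse limit of the rings Z/l^n, and the
    ambient field is obtained from it by inverting [l]. *)

Definition cong_mod (K : fieldType) (Zl : set K) (l n : nat) (x y : K) : Prop :=
  exists2 z, Zl z & x - y = l%:R ^+ n * z.

Record padic_field (l : nat) := PadicField {
  padic :> fieldType;
  padic_int : set padic;
  padic_int_subring : is_subring padic_int;
  padic_natl_neq0 : (l%:R : padic) != 0;
  padic_localization : forall x : padic,
    exists n : nat, padic_int (l%:R ^+ n * x);
  padic_nontrivial : ~ cong_mod padic_int l 1 1 0;
  padic_dense : forall (x : padic) (n : nat), padic_int x ->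
    exists a : int, cong_mod padic_int l n x a%:~R;
  padic_separated : forall x : padic,
    (forall n : nat, cong_mod padic_int l n x 0) -> x = 0;
  padic_complete : forall a : nat -> int,
    (forall n : nat, ((l ^ n)%N%:Z %| a n.+1 - a n)%Z) ->
    exists2 x : padic, padic_int x &
      forall n : nat, cong_mod padic_int l n x (a n)%:~R }.

(** Let [Omega] be an algebraic closure of the function field of [X], let kbar
    be the algebraic closure of [Fq] in [Omega] and K the compositum of the
    function field and kbar, i.e. the function field of the base change Xbar
    of [X] to kbar.  The etale fundamental group of Xbar is the quotient of
    Gal(K^sep/K) = Aut(Omega/K) by the closed normal subgroup generated by all
    inertia groups, and H^1(Xbar, Q_l) is the space of continuous homomorphisms
    from it to Q_l.  All ring endomorphisms of [Omega] over the function field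
    are bijective, as [Omega] is algebraic over it. *)

Section EtaleH1.
Variables (Fq : finFieldType) (X : curve Fq).
Variables (Omega : closedFieldType) (eps : {rmorphism X -> Omega}).
Variables (l : nat) (E : padic_field l).

Local Notation endo := {rmorphism Omega -> Omega}.

Definition geom_constant (x : Omega) : Prop :=
  algebraicOver (eps \o constants X) x.

Definition fixes_ffield (g : endo) : Prop := forall x : X, g (eps x) = eps x.

Definition geom_galois : set endo :=
  [set g | fixes_ffield g /\ forall x, geom_constant x -> g x = x].

Definition inertia (O : set Omega) : set endo :=
  [set g | geom_galois g /\
           forall x, O x -> O (g x) /\ max_ideal O (g x - x)].

Definition gal_hom (chi : endo -> E) : Prop :=
  forall g h gh : endo, geom_galois g -> geom_galois h ->
    (forall x, gh x = g (h x)) -> chi gh = chi g + chi h.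

(** Krull topology on the source, l-adic topology on the target. *)
Definition gal_continuous (chi : endo -> E) : Prop :=
  forall n : nat, exists s : seq Omega, forall g : endo, geom_galois g ->
    {in s, forall x, g x = x} -> cong_mod (@padic_int l E) l n (chi g) 0.

Definition everywhere_unramified (chi : endo -> E) : Prop :=
  forall (O : set Omega) (g : endo),
    valuation_ring O -> inertia O g -> chi g = 0.

Definition H1 : set (endo -> E) :=
  [set chi | [/\ gal_hom chi, gal_continuous chi & everywhere_unramified chi]].

(** Elements of [H1] are considered through their values on [geom_galois]. *)
Definition H1_basis (r : nat) (b : 'I_r -> endo -> E) : Prop :=
  (forall i, H1 (b i)) /\
  forall chi, H1 chi -> exists! c : {ffun 'I_r -> E},
    forall g, geom_galois g -> chi g = \sum_(i < r) c i * b i g.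

(** A lift to [Omega] of the arithmetic Frobenius of kbar. *)
Definition arith_frob_lift (phi : endo) : Prop :=
  fixes_ffield phi /\ forall x, geom_constant x -> phi x = x ^+ #|Fq|.

(** The arithmetic Frobenius maps [chi] to [g |-> chi (phi^-1 g phi)], and the
    geometric Frobenius, its inverse, maps [chi] to [g |-> chi (phi g phi^-1)];
    below, [h] is [phi g phi^-1]. *)
Definition geom_frob_matrix (r : nat) (A : 'M[E]_r) : Prop :=
  exists (phi : endo) (b : 'I_r -> endo -> E),
    [/\ arith_frob_lift phi, H1_basis b &
        forall (i : 'I_r) (g h : endo), geom_galois g -> geom_galois h ->
          (forall x, h (phi x) = phi (g x)) ->
          b i h = \sum_(j < r) A i j * b j g].

End EtaleH1.

Section MultisetJ.
Variables (C : closedFieldType) (Fq : finFieldType) (X : curve Fq).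

Definition J_points (S : {fset set X}) : seq C :=
  flatten [seq roots_seq ('X^(deg v) - 1) | v <- enum_fset S].

(** When [S] has at least two elements, both copies of [1] are present. *)
Definition J_total (JX : seq C) (S : {fset set X}) : seq C :=
  rem 1 (rem 1 (JX ++ J_points S)).

End MultisetJ.

(** [k] is an algebraic closure of a finite field.  A linear algebraic group is
    identified with the set of its [k]-points in GL_n(k); it is defined over
    the subfield F_Q with [Q] elements when it is stable under [frob Q]. *)

Section AlgebraicGroups.
Variable k : closedFieldType.

Definition frob (Q n : nat) (x : 'M[k]_n) : 'M[k]_n :=
  map_mx (fun a => a ^+ Q) x.

Definition rational_points (Q n : nat) (H : set 'M[k]_n) : set 'M[k]_n :=
  [set x | H x /\ frob Q x = x].

Definition centralizer (n : nat) (H A : set 'M[k]_n) : set 'M[k]_n :=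
  [set x | H x /\ forall a, A a -> x *m a = a *m x].

Definition torus_points (r : nat) : set ('I_r -> k) :=
  [set z | forall i, z i != 0].

Definition laurent_function (r : nat) (f : ('I_r -> k) -> k) : Prop :=
  exists (p : {mpoly k[r]}) (e : nat), forall z, torus_points z ->
    f z = p.@[z] / (\prod_(i < r) z i) ^+ e.

(** Restrictions to [T] of regular functions on GL_n. *)
Definition regular_function (n : nat) (T : set 'M[k]_n) (f : 'M[k]_n -> k) :=
  exists (p : {mpoly k[(n * n)%N]}) (e : nat), forall x, T x ->
    f x = p.@[fun i => mxvec x 0 i] / \det x ^+ e.

(** [T] is a torus of rank [r] in GL_n and [chi] is an isomorphism of algebraic
    groups from [T] to G_m^r, with inverse [phi].  Equivalently, [T] is a torus
    and [chi] is a basis of its character group. *)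
Definition torus_basis (n r : nat) (T : set 'M[k]_n)
    (chi : 'I_r -> 'M[k]_n -> k) : Prop :=
  exists phi : ('I_r -> k) -> 'M[k]_n,
    [/\ forall z, torus_points z -> T (phi z) /\ phi z \in unitmx,
        forall z w, torus_points z -> torus_points w ->
          phi (fun i => z i * w i) = phi z *m phi w,
        forall a b, laurent_function (fun z => phi z a b),
        forall i, regular_function T (chi i) &
        (forall z i, torus_points z -> chi i (phi z) = z i) /\
        (forall t, T t ->
           torus_points (fun i => chi i t) /\ phi (fun i => chi i t) = t)].

(** A torus over F_Q is split when all its characters are defined over F_Q. *)
Definition split_torus (Q n : nat) (A : set 'M[k]_n) : Prop :=
  exists (r : nat) (chi : 'I_r -> 'M[k]_n -> k), torus_basis A chi /\
    forall t, A t -> A (frob Q t) /\ forall i, chi i (frob Q t) = chi i t ^+ Q.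

Definition maximal_split_torus (Q n : nat) (H A : set 'M[k]_n) : Prop :=
  [/\ split_torus Q A, A `<=` H &
      forall A', split_torus Q A' -> A' `<=` H -> A `<=` A' -> A' = A].

Definition normalizer (n : nat) (H T : set 'M[k]_n) : set 'M[k]_n :=
  [set w | H w /\ forall t, T t <-> T (invmx w *m t *m w)].

(** The character with coordinates [row i M] in the basis [chi]. *)
Definition monomial_char (n r : nat) (chi : 'I_r -> 'M[k]_n -> k)
    (M : 'M[int]_r) (i : 'I_r) (t : 'M[k]_n) : k :=
  \prod_(j < r) chi j t ^ M i j.

(** [M] is the matrix of the action of [w] on the character group of [T],
    where [w] maps [chi] to [t |-> chi (w^-1 t w)]. *)
Definition weyl_matrix (n r : nat) (T : set 'M[k]_n)
    (chi : 'I_r -> 'M[k]_n -> k) (w : 'M[k]_n) (M : 'M[int]_r) : Prop :=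
  forall i t, T t -> chi i (invmx w *m t *m w) = monomial_char chi M i t.

(** [M] is the matrix of the action of the geometric Frobenius [Fr] of F_Q,
    [(Fr chi) t = sigma^-1 (chi (sigma t))] with [sigma a = a ^+ Q]. *)
Definition frobenius_matrix (Q n r : nat) (T : set 'M[k]_n)
    (chi : 'I_r -> 'M[k]_n -> k) (M : 'M[int]_r) : Prop :=
  forall i t, T t -> chi i (frob Q t) = monomial_char chi M i t ^+ Q.

(** A basis [chi] of the character group of [T] identifies the symmetric
    algebra of X^*(T) (x) Q with [{mpoly rat[r]}]. *)

Definition sym_action (r : nat) (M : 'M[int]_r) (p : {mpoly rat[r]}) :
    {mpoly rat[r]} :=
  p \mPo [tuple \sum_(j < r) (M i j)%:~R *: 'X_j | i < r].

Definition weyl_inv (n r : nat) (H T : set 'M[k]_n)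
    (chi : 'I_r -> 'M[k]_n -> k) : set {mpoly rat[r]} :=
  [set p | forall w M, normalizer H T w -> weyl_matrix T chi w M ->
             sym_action M p = p].

Definition weyl_inv_pos (n r : nat) (H T : set 'M[k]_n)
    (chi : 'I_r -> 'M[k]_n -> k) : set {mpoly rat[r]} :=
  [set p | weyl_inv H T chi p /\ p@_0%MM = 0].

Definition weyl_decomposable (n r : nat) (H T : set 'M[k]_n)
    (chi : 'I_r -> 'M[k]_n -> k) : set {mpoly rat[r]} :=
  [set p | exists s : seq ({mpoly rat[r]} * {mpoly rat[r]}),
     {in s, forall u, weyl_inv_pos H T chi u.1 /\ weyl_inv_pos H T chi u.2} /\
     p = \sum_(u <- s) u.1 * u.2].

(** For [1 <= d]: [P] is det(1 - t Fr | V_d) as a polynomial in t, where [M] is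
    the matrix of [Fr] on the characters, and the classes of the [e i] form a
    basis of V_d in which [Fr] has matrix [B]. *)
Definition graded_det (n r : nat) (H T : set 'M[k]_n)
    (chi : 'I_r -> 'M[k]_n -> k) (M : 'M[int]_r) (d : nat)
    (P : {poly rat}) : Prop :=
  exists (s : nat) (e : 'I_s -> {mpoly rat[r]}) (B : 'M[rat]_s),
    [/\ forall i, weyl_inv_pos H T chi (e i) /\ e i \is d.-homog,
        forall p, weyl_inv_pos H T chi p -> p \is d.-homog ->
          exists! c : {ffun 'I_s -> rat},
            weyl_decomposable H T chi (p - \sum_(i < s) c i *: e i),
        forall i, weyl_decomposable H T chi
          (sym_action M (e i) - \sum_(j < s) B i j *: e j) &
        P = \det (1%:M - 'X *: map_mx polyC B)].

(** [P] is det(1 - t Fr_Q | M_H) as a polynomial in t. *)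
Definition is_motive_det (Q n : nat) (H : set 'M[k]_n) (P : {poly rat}) : Prop :=
  exists (A : set 'M[k]_n) (r : nat) (chi : 'I_r -> 'M[k]_n -> k)
         (M : 'M[int]_r) (D : nat -> {poly rat}) (N : nat),
    let T0 := centralizer H A in
    [/\ maximal_split_torus Q H A, torus_basis T0 chi,
        frobenius_matrix Q T0 chi M,
        forall d, (0 < d)%N -> graded_det H T0 chi M d (D d) &
        (forall d, (N < d)%N -> D d = 1) /\
        P = \prod_(1 <= d < N.+1) (D d \Po (Q%:R ^+ d.-1 *: 'X))].

Definition motive_det (Q n : nat) (H : set 'M[k]_n) : {poly rat} :=
  xget 0 [set P | is_motive_det Q H P].

Definition symplectic_form (n : nat) : 'M[k]_(n + n) :=
  block_mx 0 1%:M (- 1%:M) 0.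

(** The group of rank [n], in GL_(2n). *)
Definition Sp (n : nat) : set 'M[k]_(n + n) :=
  [set x | x^T *m symplectic_form n *m x = symplectic_form n].

Definition conj_class (n : nat) (G : set 'M[k]_n) (x : 'M[k]_n) : set 'M[k]_n :=
  [set h *m x *m invmx h | h in G].

Definition semisimple_classes (Q n : nat) (G : set 'M[k]_n) :
    set (set 'M[k]_n) :=
  [set conj_class (rational_points Q G) x |
     x in [set x | rational_points Q G x /\ diagonalizable x]].

Variable C : numFieldType.

(** The value at s = 0 of the modified L-function of M_H over the extension of
    degree [m] of the field with [q] elements. *)
Definition L_value (q : nat) (J : seq C) (m n : nat) (H : set 'M[k]_n) : C :=
  let P := map_poly ratr (motive_det (q ^ m) H) in
  P.[1] / P.[(q ^ m)%:R] * \prod_(a <- J) P.[a ^+ m].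

(** [xget 1%:M c] is an element of the class [c]. *)
Definition L_sum (q : nat) (J : seq C) (n : nat) (G : set 'M[k]_n) (m : nat) : C :=
  \sum_(c \in semisimple_classes (q ^ m) G)
    L_value q J m (centralizer G [set xget 1%:M c]).

End AlgebraicGroups.

(* Main.v *)
(** By Lang's theorem for [Sp_6] over [F_Q], a semisimple rational element is conjugate to a
    diagonal one by a matrix whose Frobenius twist differs from it by a signed permutation.
    The motive of its centralizer is read off from the graded invariants of the stabilizer of
    the eigenvalues in the group of signed permutations.  If some eigenvalue is not sent to
    its inverse by a power of Frobenius, the centralizer has a split central torus and the
    numerator [det(1 - Fr | M)] vanishes.  The other elements have ten types, according to
    how the eigenvalues coincide and how Frobenius permutes them, and the number of classes
    of each type is a polynomial in [Q].  For one type, [L] is a combination of powers of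
    products of elements of [J] with a denominator [det(1 - Q Fr | M)], so that neither the
    terms nor the class numbers are integral separately.  The ten contributions are combined
    by a lattice: the vectors of values at the ten types of the symmetric functions of the
    coefficients of [det(1 - x Fr | M)] lie in a [Z[Q]]-module spanned by ten vectors, and it
    suffices to check that the weighted sum of each of these is an integral polynomial
    in [Q]. *)
Require Import Defs.
From HB Require Import structures.
From mathcomp Require Import all_boot all_order all_algebra all_field.
From mathcomp Require Import finmap mpoly.
From mathcomp Require Import boolp classical_sets functions cardinality fsbigop reals.
From mathcomp Require Import complex.
From mathcomp Require Import fingroup perm ring lra zify.

Set Implicit Arguments.
Unset Strict Implicit.
Unset Printing Implicit Defensive.

Import Order.TTheory GRing.Theory Num.Theory.
Local Open Scope classical_set_scope.
Local Open Scope ring_scope.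

(** The value [motive_det] is chosen by [xget] among all polynomials arising from some maximal split
    torus and some basis of characters, so it is usable only after two facts: a maximal split torus
    exists, and every admissible choice leads to the same polynomial. For uniqueness, the
    centralizer [T0] of an unknown split torus is recognised as a diagonal torus in a symplectic
    basis merely because it is commutative, made of elements of finite order prime to the
    characteristic, and self-centralizing. For existence, the frame has to be maximally split; this
    is why an eigenspace carrying a Hermitian form receives a hyperbolic plane rather than an
    orthonormal basis. The invariants are generated, modulo decomposables, by power sums (Newton's
    identities); their independence is Springer's argument, evaluation at eigenvectors of elements
    of the reflection group. In group terms, a self-inverse eigenvalue gives a symplectic factor,
    another eigenvalue with [a ^+ Q = a^-1] a unitary group over the field with [Q] elements, and
    the types with a cycle of length 2 or 3 a rank one unitary group over the extension of that
    degree. *)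

Section FrobeniusPower.
Variables (k : fieldType) (p : nat) (hp : p \in [pchar k]) (a : nat).

Definition frobp (x : k) : k := x ^+ (p ^ a).

Lemma pnat_frobp : [pchar k].-nat (p ^ a)%N.
Proof.
rewrite pnatX; apply/orP; left.
by rewrite (eq_pnat _ (pcharf_eq hp)) pnat_id // (pcharf_prime hp).
Qed.

Fact frobp_is_zmod_morphism : zmod_morphism frobp.
Proof.
move=> x y; rewrite /frobp exprDn_pchar ?exprNn_pchar //; exact: pnat_frobp.
Qed.

Fact frobp_is_monoid_morphism : monoid_morphism frobp.
Proof. by split=> [|x y]; rewrite /frobp ?expr1n ?exprMn. Qed.

End FrobeniusPower.

(** The same function as [frobp], but carrying [hp], on which its ring morphism structures
    depend. *)
Definition frobr (k : fieldType) (p : nat) (hp : p \in [pchar k]) (a : nat) :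
  k -> k := frobp p a.

HB.instance Definition _ (k : fieldType) p (hp : p \in [pchar k]) a :=
  GRing.isZmodMorphism.Build k k (frobr hp a) (frobp_is_zmod_morphism hp a).
HB.instance Definition _ (k : fieldType) p (hp : p \in [pchar k]) a :=
  GRing.isMonoidMorphism.Build k k (frobr hp a) (@frobp_is_monoid_morphism k p a).

(** * Roots, finite subfields and averaging over Frobenius conjugates *)

Section ClosedField.
Variable k : closedFieldType.

Lemma separable_roots (P : {poly k}) : coprimep P P^`() ->
  exists rs : seq k, [/\ uniq rs, size rs = (size P).-1 & rs =i root P].
Proof.
move=> sP; have {sP}: separable_poly P by rewrite unlock.
move=> sP; have P0 := separable_poly_neq0 sP.
have : lead_coef P != 0 by rewrite lead_coef_eq0.
have [rs] := closed_field_poly_normal P.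
move: (lead_coef P) => l Prs l0; exists rs; split; last 1 first.
- by move=> x; rewrite Prs -[RHS]/(root _ x) rootZ // root_prod_XsubC.
- by rewrite -separable_prod_XsubC -(eqp_separable (eqp_scale _ l0)) -Prs.
by rewrite Prs size_scale // size_prod_XsubC.
Qed.

Lemma root_of_unity_seq (N : nat) (c : k) : c != 0 -> (N%:R : k) != 0 ->
  exists rs : seq k, [/\ uniq rs, size rs = N & forall x, (x \in rs) = (x ^+ N == c)].
Proof.
move=> c0 N0; have N_gt0 : (0 < N)%N by case: N N0 => //; rewrite eqxx.
have [|rs [u s r]] := @separable_roots ('X^N - c%:P).
  rewrite derivB derivXn derivC subr0 -scaler_nat coprimepZr //.
  apply/coprimepP => d d1 d2.
  have: d %| c%:P.
    have dX : d %| 'X^N by rewrite -(prednK N_gt0) exprS dvdp_mull.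
    by rewrite -[c%:P](subKr 'X^N) dvdp_sub.
  by move=> /dvdp_eqp1; apply; rewrite polyC_eqp1.
exists rs; split => //.
  by rewrite s size_XnsubC.
by move=> x; rewrite r -[LHS]/(root _ x) /root !hornerE subr_eq0.
Qed.

Lemma poly_nonroot (P : {poly k}) (rs : seq k) : P != 0 -> uniq rs ->
  (size P <= size rs)%N -> exists2 c, c \in rs & P.[c] != 0.
Proof.
move=> P0 u s; case: (boolP (all (root P) rs)) => [a|].
  by have := max_poly_roots P0 a u; rewrite ltnNge s.
by case/allPn => c crs; rewrite /root => c0; exists c.
Qed.

Variables (p : nat) (hp : p \in [pchar k]).
Let p_gt1 : (1 < p)%N. Proof. exact/prime_gt1/(pcharf_prime hp). Qed.

Lemma natp_eq0 b : (0 < b)%N -> (p ^ b)%:R = 0 :> k.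
Proof. by case: b => // b _; rewrite natrX (pcharf0 hp) expr0n. Qed.

Lemma frob_fixed_seq (b : nat) : (0 < b)%N ->
  exists rs : seq k, [/\ uniq rs, size rs = (p ^ b)%N & forall x, (x \in rs) = (x ^+ (p ^ b) == x)].
Proof.
move=> b0; have pb1 : (1 < p ^ b)%N by rewrite -(exp1n b) ltn_exp2r.
have [|rs [u s r]] := @separable_roots ('X^(p ^ b) - 'X).
  rewrite derivB derivXn derivX -scaler_nat natp_eq0 // scale0r sub0r.
  by rewrite coprimep_sym -scaleN1r coprimepZl ?oppr_eq0 ?oner_eq0 // coprime1p.
exists rs; split => //.
  by rewrite s size_polyDl ?size_polyN ?size_polyX size_polyXn.
by move=> x; rewrite r -[LHS]/(root _ x) /root !hornerE subr_eq0.
Qed.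

Lemma frob_eq0 b (x : k) : (x ^+ (p ^ b) == 0) = (x == 0).
Proof. by rewrite expf_eq0 expn_gt0 ltnW. Qed.

Lemma frob_inj b : injective (fun x : k => x ^+ (p ^ b)).
Proof. exact: (fmorph_inj (frobr hp b)). Qed.

Lemma exp_root (N : nat) (c : k) : (0 < N)%N -> exists x : k, x ^+ N = c.
Proof.
move=> N0; have [|x] := @closed_rootP k ('X^N - c%:P) _.
  by rewrite size_XnsubC // eqSS -lt0n.
by rewrite /root !hornerE subr_eq0 => /eqP; exists x.
Qed.

(* The average of the conjugates of a suitable scalar multiple of [y]. *)
Lemma hilbert90 (V : lmodType k) (Psi : V -> V) (a s : nat) (y : V)
    (f : {linear V -> k^o}) :
  (0 < a)%N -> (0 < s)%N ->
  {morph Psi : u v / u + v} -> (forall c u, Psi (c *: u) = c ^+ (p ^ a) *: Psi u) ->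
  iter s Psi y = y -> f y != 0 ->
  exists2 c, c ^+ (p ^ (a * s)) = c &
    let z := \sum_(j < s) iter j Psi (c *: y) in Psi z = z /\ f z != 0.
Proof.
move=> a0 s0 PsiD PsiZ sy fy.
have Psi0 : Psi 0 = 0 by have := PsiZ 0 0; rewrite scaler0 expr0n expn_eq0 -leqn0 leqNgt ltnW //= scale0r.
have iterZ j c u : iter j Psi (c *: u) = c ^+ (p ^ (a * j)) *: iter j Psi u.
  elim: j => [|j IHj]; first by rewrite muln0 expr1.
  by rewrite !iterS IHj PsiZ -exprM -expnD mulnS addnC.
(* [P.[c]] is the value of [f] on the sum of the conjugates of [c *: y]. The degree of [P] is less
   than [p ^ (a * s)], so [P] cannot vanish on the whole field with that many elements. *)
pose P : {poly k} := \sum_(j < s) (f (iter j Psi y)) *: 'X^(p ^ (a * j)).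
have pinj : injective (fun j : nat => p ^ (a * j))%N.
  by move=> i j /eqP; rewrite eqn_exp2l // eqn_pmul2l // => /eqP.
have P1 : P`_1 != 0.
  rewrite coef_sum (bigD1 (Ordinal s0)) //= big1 ?addr0.
    by rewrite coefZ muln0 coefXn eqxx mulr1.
  move=> i i0; rewrite coefZ coefXn.
  suff /negPf -> : (1 != p ^ (a * i))%N by rewrite mulr0.
  apply: contra i0 => /eqP e; apply/eqP/val_inj/pinj; rewrite /= -e.
  by rewrite muln0.
have P0 : P != 0 by apply: contraNneq P1 => ->; rewrite coef0.
have [rs [urs srs mrs]] := @frob_fixed_seq (a * s) (ltac:(by rewrite muln_gt0 a0)).
have [|c] := poly_nonroot P0 urs.
  rewrite srs; apply: leq_trans (size_sum _ _ _) _; apply/bigmax_leqP => j _.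
  apply: leq_trans (size_scale_leq _ _) _; rewrite size_polyXn.
  by rewrite ltn_exp2l // ltn_pmul2l.
rewrite mrs => /eqP cs Pc; exists c => //; rewrite /=; split.
  (* [Psi] shifts the sum cyclically: the term pushed out at the end is [c *: y] again, since both
     [c] and [y] have period [s]. *)
  have -> : Psi (\sum_(j < s) iter j Psi (c *: y)) = \sum_(j < s) iter j.+1 Psi (c *: y).
    by rewrite (big_morph _ PsiD Psi0).
  case: s s0 sy cs {P P1 P0 rs urs srs mrs Pc} => // s _ sy cs.
  by rewrite big_ord_recr big_ord_recl /= addrC -iterS iterZ cs sy.
rewrite linear_sum /=.
suff -> : \sum_(j < s) f (iter j Psi (c *: y)) = P.[c] by [].
rewrite horner_sum; apply: eq_bigr => j _.
by rewrite iterZ linearZ /= hornerZ hornerXn mulrC.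
Qed.

End ClosedField.

(** * Bilinear forms on row vectors *)

Section BilinearForm.
Variables (k : fieldType) (N : nat) (G : 'M[k]_N).

(** Matrices act on rows from the right, so isometries satisfy [x *m G *m x^T = G], the transpose of
    the condition defining [Sp]; [SpP] reconciles the two. *)
Definition bform (u v : 'rV[k]_N) : k := (u *m G *m v^T) 0 0.

Lemma bformDl u v w : bform (u + v) w = bform u w + bform v w.
Proof. by rewrite /bform !mulmxDl mxE. Qed.
Lemma bformDr u v w : bform u (v + w) = bform u v + bform u w.
Proof. by rewrite /bform linearD mulmxDr mxE. Qed.
Lemma bformZl c u v : bform (c *: u) v = c * bform u v.
Proof. by rewrite /bform -!scalemxAl mxE. Qed.
Lemma bformZr c u v : bform u (c *: v) = c * bform u v.
Proof. by rewrite /bform linearZ -scalemxAr mxE. Qed.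
Lemma bform0l u : bform 0 u = 0.
Proof. by rewrite /bform !mul0mx mxE. Qed.
Lemma bform0r u : bform u 0 = 0.
Proof. by rewrite /bform trmx0 mulmx0 mxE. Qed.
Lemma bformNl u v : bform (- u) v = - bform u v.
Proof. by rewrite -scaleN1r bformZl mulN1r. Qed.
Lemma bformNr u v : bform u (- v) = - bform u v.
Proof. by rewrite -scaleN1r bformZr mulN1r. Qed.
Definition bformE := (bformDl, bformDr, bformZl, bformZr, bformNl, bformNr, bform0l, bform0r).

Lemma bform_suml I (r : seq I) (f : I -> 'rV_N) v :
  bform (\sum_(i <- r) f i) v = \sum_(i <- r) bform (f i) v.
Proof. by apply: (big_morph (bform^~ v)) => [u w|]; rewrite bformE. Qed.

Lemma bform_map (f : {rmorphism k -> k}) u v : map_mx f G = G ->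
  f (bform u v) = bform (map_mx f u) (map_mx f v).
Proof. by move=> fG; rewrite /bform -[in RHS]fG map_trmx -!map_mxM [RHS]mxE. Qed.

Lemma bform_isom x u v : x *m G *m x^T = G -> bform (u *m x) (v *m x) = bform u v.
Proof.
by move=> xG; rewrite /bform trmx_mul !mulmxA -[u *m x *m G]mulmxA -(mulmxA u) xG.
Qed.

(** An isometry multiplies the pairing of two eigenvectors by the product of their eigenvalues. *)
Lemma bform_eigen x u v c d : x *m G *m x^T = G ->
  u *m x = c *: u -> v *m x = d *: v -> c * d != 1 -> bform u v = 0.
Proof.
move=> xG ux vx cd; have := bform_isom u v xG.
rewrite ux vx !bformE mulrA => /eqP; rewrite -subr_eq0 -{2}[bform u v]mul1r -mulrBl.
by rewrite mulf_eq0 subr_eq0 (negPf cd) => /eqP.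
Qed.

Lemma bform_mx m1 m2 (A : 'M_(m1, N)) (B : 'M_(m2, N)) i j :
  (A *m G *m B^T) i j = bform (row i A) (row j B).
Proof.
rewrite /bform -row_mul mxE [RHS]mxE; apply: eq_bigr => l _.
by rewrite ![_^T _ _]mxE !mxE.
Qed.

Lemma bform_nondeg (P : 'M_N) w : G \in unitmx -> P \in unitmx ->
  (forall i, bform (row i P) w = 0) -> w = 0.
Proof.
move=> uG uP h; have: P *m G *m w^T = 0.
  by apply/matrixP => i j; rewrite bform_mx row_id // !ord1 h mxE.
move/(congr1 (mulmx (invmx (P *m G)))); rewrite mulKmx ?unitmx_mul ?uG ?uP //.
by rewrite mulmx0 => /(congr1 trmx); rewrite trmxK trmx0.
Qed.

Hypothesis alt : forall u, bform u u = 0.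
Lemma bform_sym u v : bform u v = - bform v u.
Proof.
have := alt (u + v); rewrite !bformE !alt add0r addr0 => /eqP.
by rewrite addr_eq0 => /eqP.
Qed.

(** Orthogonality to [l] imposes [size l] linear conditions, fewer than the dimension of [E]. *)
Lemma exists_orth (E : 'M_N) (l : seq 'rV_N) : (size l < \rank E)%N ->
  exists u : 'rV_N, [/\ u != 0, (u <= E)%MS & {in l, forall v, bform u v = 0}].
Proof.
move=> sl; pose C : 'M_(N, size l) := \matrix_(i, j) (G *m (nth 0 l j)^T) i 0.
have : (E :&: kermx C)%MS != 0.
  rewrite -mxrank_eq0 -lt0n.
  have := mxrank_mul_ker E C.
  have: (\rank (E *m C) <= size l)%N by exact: rank_leq_col.
  by lia.
case/rowV0Pn => u; rewrite sub_capmx => /andP[uE /sub_kermxP uC] u0.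
exists u; split => // v /(nthP 0)[j jl <-].
have /(congr1 (fun M : 'rV_(size l) => M 0 (Ordinal jl))) : u *m C = 0 by [].
rewrite [X in _ = X -> _]mxE => <-; rewrite /bform -mulmxA [LHS]mxE [RHS]mxE.
by apply: eq_bigr => i _; rewrite [in RHS]mxE.
Qed.

End BilinearForm.

Lemma diag_eigenbasis (k : fieldType) N (x : 'M[k]_N) : diagonalizable x ->
  exists2 P, P \in unitmx & forall i, exists c, row i P *m x = c *: row i P.
Proof.
case=> P uP /diagonalizable_forPex[D /(simmxPp _)].
move=> /(_ (submx_full _ _)); rewrite row_full_unit uP => /(_ isT) PD.
exists P => // i; exists (D 0 i).
by apply/rowP => j; rewrite -row_mul PD mul_diag_mx !mxE.
Qed.

(** * Hermitian and symplectic bases adapted to Frobenius *)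

Section Frobenius.
Variables (k : closedFieldType) (p : nat) (hp : p \in [pchar k]).
Hypothesis halg : forall x : k, exists2 s, (0 < s)%N & x ^+ (p ^ s) = x.

Local Notation frb a := (map_mx (frobr hp a)).

Lemma frobrD a b x : frobr hp a (frobr hp b x) = frobr hp (b + a) x.
Proof. by rewrite /frobr /frobp -exprM expnD. Qed.

Lemma frbD a b m n (u : 'M_(m, n)) : frb a (frb b u) = frb (b + a) u.
Proof. by rewrite -map_mx_comp; apply: eq_map_mx => x; rewrite /= frobrD. Qed.

Lemma frb_iter a j m n (u : 'M_(m, n)) : iter j (frb a) u = frb (a * j) u.
Proof.
elim: j => [|j IHj]; last by rewrite iterS IHj frbD -mulnSr.
by rewrite muln0; apply/matrixP => i j; rewrite mxE /frobr /frobp expr1.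
Qed.

Lemma frbZ a c m n (u : 'M_(m, n)) : frb a (c *: u) = c ^+ (p ^ a) *: frb a u.
Proof. by rewrite map_mxZ. Qed.

Lemma frobr_period (x : k) : exists2 s, (0 < s)%N & forall j, (s %| j)%N -> frobr hp j x = x.
Proof.
have [s s0 xs] := halg x; exists s => // j /dvdnP[c ->].
elim: c => [|c IHc]; first by rewrite /frobr /frobp expr1.
by rewrite mulSn -frobrD -[frobr hp s x]/(x ^+ (p ^ s)) xs.
Qed.

Lemma frobr_period_seq (l : seq k) : exists2 s, (0 < s)%N &
  forall j, (s %| j)%N -> {in l, forall x, frobr hp j x = x}.
Proof.
elim: l => [|x l [s s0 IHs]]; first by exists 1%N.
have [t t0 xt] := frobr_period x; exists (s * t)%N; first by rewrite muln_gt0 s0.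
move=> j dj y; rewrite inE => /predU1P[->|yl].
  by apply: xt; apply: dvdn_trans dj; rewrite dvdn_mull.
by apply: IHs => //; apply: dvdn_trans dj; rewrite dvdn_mulr.
Qed.

Lemma frb_period m n (u : 'M_(m, n)) : exists2 s, (0 < s)%N &
  forall j, (s %| j)%N -> frb j u = u.
Proof.
have [s s0 hs] := frobr_period_seq [seq u i.1 i.2 | i <- enum {: 'I_m * 'I_n}].
exists s => // j /hs h; apply/matrixP => i i'; rewrite mxE h //.
by apply/mapP; exists (i, i'); rewrite ?mem_enum.
Qed.

Variable N : nat.
Implicit Types (u v w y z : 'rV[k]_N).

(** Galois descent inside a subspace [P] stable under [Psi]: the fixed vector is a sum of conjugates
    of a multiple of [y], and the functional [v] certifies that this sum does not vanish. *)
Lemma semilinear_fixed (P : 'rV[k]_N -> Prop) (Psi : 'rV[k]_N -> 'rV[k]_N) a y (v : 'cV_N) :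
  (0 < a)%N ->
  {morph Psi : u w / u + w} -> (forall c u, Psi (c *: u) = c ^+ (p ^ a) *: Psi u) ->
  P 0 -> (forall u w, P u -> P w -> P (u + w)) -> (forall c u, P u -> P (c *: u)) ->
  (forall u, P u -> P (Psi u)) ->
  P y -> (exists2 s, (0 < s)%N & iter s Psi y = y) -> (y *m v) 0 0 != 0 ->
  exists z, [/\ P z, Psi z = z & (z *m v) 0 0 != 0].
Proof.
move=> a0 PsiD PsiZ P0 PD PZ PPsi Py [s s0 sy] yv.
pose f0 u : k^o := (u *m v) 0 0.
have f0l : linear f0 by move=> c u w; rewrite /f0 mulmxDl -scalemxAl !mxE.
pose fl := GRing.isLinear.Build k 'rV[k]_N k^o *:%R f0 f0l.
pose f : {linear 'rV[k]_N -> k^o} := HB.pack f0 fl.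
have [c _ [z1 z2]] := @hilbert90 k p hp _ Psi a s y f a0 s0 PsiD PsiZ sy yv.
eexists; split; [|exact: z1|exact: z2].
elim/big_ind: _ => // i _; elim: (nat_of_ord i) => [|j IHj] /=; first exact: PZ.
exact: PPsi.
Qed.

Lemma nonzero_coord u : u != 0 -> exists v : 'cV[k]_N, (u *m v) 0 0 != 0.
Proof.
case/rV0Pn => j uj; exists (delta_mx j 0).
by rewrite -colE mxE.
Qed.

(** Frobenius twisted by [eps] is still semilinear and of finite order on [y]; as [eps] is its own
    inverse, its fixed vectors are the vectors that Frobenius multiplies by [eps]. The sign 1 serves
    symplectic spaces, the sign -1 Hermitian ones. *)
Lemma frob_fixed_vector (P : 'rV[k]_N -> Prop) (eps : k) a y (v : 'cV_N) :
  (0 < a)%N -> eps = 1 \/ eps = -1 ->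
  P 0 -> (forall u w, P u -> P w -> P (u + w)) -> (forall c u, P u -> P (c *: u)) ->
  (forall u, P u -> P (frb a u)) ->
  P y -> (y *m v) 0 0 != 0 ->
  exists z, [/\ P z, frb a z = eps *: z & (z *m v) 0 0 != 0].
Proof.
move=> a0 heps P0 PD PZ PF Py yv.
have ee : eps * eps = 1 by case: heps => ->; rewrite ?mulrNN mulr1.
have eF j : eps ^+ (p ^ j) = eps.
  by case: heps => ->; rewrite ?expr1n // -[LHS]/(frobr hp j (-1)) rmorphN1.
pose Psi u := eps *: frb a u.
have iterPsi j : iter j Psi y = eps ^+ j *: frb (a * j) y.
  elim: j => [|j IHj].
    by rewrite expr0 scale1r -frb_iter.
  by rewrite iterS IHj /Psi frbZ -exprM mulnC exprM eF scalerA -exprS frbD -mulnSr.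
have [s s0 hs] := frb_period y.
have [||||z [Pz z1 z2]] := @semilinear_fixed P Psi a y v a0 _ _ P0 PD PZ _ Py _ yv.
- by move=> u w; rewrite /Psi map_mxD scalerDr.
- by move=> c u; rewrite /Psi frbZ !scalerA mulrC.
- by move=> u Pu; apply/PZ/PF.
(* The factor 2 makes the power of [eps] trivial. *)
- exists (s * 2)%N; first by rewrite muln_gt0 s0.
  rewrite iterPsi mulnC exprM expr2 ee expr1n scale1r hs //.
  by rewrite mulnA dvdn_mull.
exists z; split => //; rewrite -[X in _ = _ *: X]z1 /Psi scalerA ee scale1r //.
Qed.

Variables (G : 'M[k]_N).
Hypothesis alt : forall u, bform G u u = 0.
Hypothesis uG : G \in unitmx.

Section Hermitian.
Variables (x : 'M[k]_N) (lam : k) (a : nat).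
Hypotheses (a0 : (0 < a)%N) (FG : frb a G = G) (Fx : frb a x = x)
  (xG : x *m G *m x^T = G) (dx : diagonalizable x)
  (lam0 : lam != 0) (laminv : lam ^+ (p ^ a) = lam^-1).

Local Notation E := (eigenspace x lam).
Local Notation herm u v := (bform G u (frb a v)).
Local Notation anti u := (frb a (frb a u) = - u).

Lemma frb_eigen c b u : frb b x = x -> u *m x = c *: u ->
  frb b u *m x = c ^+ (p ^ b) *: frb b u.
Proof. by move=> Fbx ux; rewrite -{1}Fbx -map_mxM ux frbZ. Qed.

(** Frobenius turns [herm u v] into [bform G (frb a u) (- v)], and the sign of [anti] cancels the
    one of the alternating form. With vectors whose second Frobenius twist is [u] instead of [- u]
    the form would be skew-Hermitian. *)
Lemma herm_conj u v : anti v -> (herm u v) ^+ (p ^ a) = herm v u.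
Proof.
move=> av; rewrite -[LHS]/(frobr hp a (herm u v)) bform_map // av bformE.
by rewrite bform_sym // opprK.
Qed.

(** The vector [frb a y] has eigenvalue [lam^-1], so an eigenvector of [x] that pairs with it must
    have eigenvalue [lam]; nondegeneracy of [G] supplies one, and descent replaces it by an [anti]
    vector. *)
Lemma herm_nondeg y : (y <= E)%MS -> anti y -> y != 0 ->
  exists z, [/\ (z <= E)%MS, anti z & herm z y != 0].
Proof.
move=> yE ay y0; pose w := frb a y.
have wx : w *m x = lam^-1 *: w by rewrite -laminv -frb_eigen //; apply/eigenspaceP.
have w0 : w != 0.
  by apply: contra y0 => /eqP w0; rewrite -oppr_eq0 -ay -/w w0 map_mx0.
have [P uP Px] := diag_eigenbasis dx.
have /existsP[i iw] : [exists i, bform G (row i P) w != 0].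
  apply: contraT; rewrite negb_exists => /forallP h.
  by case/eqP: w0; apply: (bform_nondeg uG uP) => i; apply/eqP; have := h i; rewrite negbK.
have [c ci] := Px i.
have clam : c = lam.
  apply/eqP; apply: contraT => cl; case/eqP: iw; apply: (bform_eigen xG ci wx).
  by apply: contra cl => /eqP h; rewrite -[c]mulr1 -(mulVf lam0) mulrA h mul1r.
have iE : (row i P <= E)%MS by apply/eigenspaceP; rewrite ci clam.
pose v : 'cV_N := G *m w^T.
have hv u : (u *m v) 0 0 = bform G u w by rewrite /bform /v mulmxA.
have a20 : (0 < a + a)%N by rewrite addn_gt0 a0.
have [|||||z [zE z1 z2]] := @frob_fixed_vector (fun u => (u <= E)%MS : Prop) (-1) (a + a) (row i P) v a20 (or_intror erefl) _ _ _ _ iE _.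
- exact: sub0mx.
- by move=> u u'; apply: addmx_sub.
- by move=> c' u; apply: scalemx_sub.
- move=> u /eigenspaceP ux; apply/eigenspaceP.
  by rewrite -frbD !(frb_eigen Fx (frb_eigen Fx ux)) !laminv exprVn laminv invrK.
- by rewrite hv.
exists z; split => //; first by rewrite frbD z1 scaleN1r.
by rewrite -hv.
Qed.

(** Coefficients along an orthonormal family. [pairwise] records orthogonality in one order only;
    [herm_conj] gives the other. *)
Lemma herm_expand (l : seq 'rV_N) (c : 'rV_N -> k) u :
  (forall v, v \in l -> [/\ (v <= E)%MS, anti v & herm v v = 1]) ->
  pairwise (fun v w => herm v w == 0) l -> u \in l ->
  \sum_(i <- l) c i * herm i u = c u.
Proof.
elim: l => // v l IHl hl /=; rewrite inE => /andP[/allP vl pl].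
have hl' w : w \in l -> [/\ (w <= E)%MS, anti w & herm w w = 1].
  by move=> wl; apply: hl; rewrite inE wl orbT.
have p0 : (0 < p)%N by rewrite prime_gt0 ?(pcharf_prime hp).
have [_ av hvv] := hl v (mem_head _ _).
case: (boolP (u \in l)) => [ul _|ul].
  by rewrite big_cons (eqP (vl u ul)) mulr0 add0r IHl.
rewrite orbF => /eqP ->; rewrite big_cons hvv mulr1 big_seq big1 ?addr0 // => i il.
have [_ ai _] := hl' i il.
by rewrite -(herm_conj _ ai) (eqP (vl i il)) expr0n expn_eq0 -leqn0 leqNgt p0 mulr0.
Qed.

(** A Gram-Schmidt step over the field with [p ^ (a + a)] elements: an anisotropic vector is found
    in the orthogonal of [l], then normalised by solving a norm equation. *)
Lemma herm_vector (l : seq 'rV_N) :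
  (forall u, u \in l -> [/\ (u <= E)%MS, anti u & herm u u = 1]) ->
  pairwise (fun u v => herm u v == 0) l -> (size l < \rank E)%N ->
  exists t, [/\ (t <= E)%MS, anti t, herm t t = 1 & {in l, forall u, herm t u = 0}].
Proof.
move=> hl pl sl.
have a20 : (0 < a + a)%N by rewrite addn_gt0 a0.
have [|y0 [y00 y0E y0l]] := @exists_orth _ _ G E [seq frb a u | u <- l].
  by rewrite size_map.
have [v yv] := nonzero_coord y00.
pose Q u := (u <= E)%MS /\ {in l, forall w, herm u w = 0}.
have stE u : (u <= E)%MS -> (frb (a + a) u <= E)%MS.
  move=> /eigenspaceP ux; apply/eigenspaceP.
  by rewrite -frbD !(frb_eigen Fx (frb_eigen Fx ux)) !laminv exprVn laminv invrK.
have QD u w : Q u -> Q w -> Q (u + w).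
  case=> [uE ul] [wE wl]; split; first exact: addmx_sub.
  by move=> t tl; rewrite bformE ul ?wl ?addr0.
have QZ c u : Q u -> Q (c *: u).
  case=> [uE ul]; split; first exact: scalemx_sub.
  by move=> t tl; rewrite bformE ul ?mulr0.
have [|||y [[yE yl] y1 y2]] := @frob_fixed_vector Q (-1) (a + a) y0 v a20 (or_intror erefl) _ QD QZ _ _ yv.
- by split=> [|w wl]; rewrite ?sub0mx ?bformE.
- move=> u [uE ul]; split; first exact: stE.
  move=> w wl; have [_ aw _] := hl w wl.
  have := ul w wl => /(congr1 (frobr hp (a + a))); rewrite rmorph0.
  rewrite bform_map; last by rewrite -frbD !FG.
  rewrite -[frb (a + a) (frb a w)]frbD aw map_mxN bformE => /eqP.
  by rewrite oppr_eq0 => /eqP.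
- split=> // w wl; apply: y0l; exact: map_f.
have ay : anti y by rewrite frbD y1 scaleN1r.
have y_neq0 : y != 0 by apply: contraNneq y2 => ->; rewrite mul0mx mxE.
have [z0 [z0E az0 z0y]] := herm_nondeg yE ay y_neq0.
have hfix u w : anti u -> anti w -> (herm u w) ^+ (p ^ (a + a)) = herm u w.
  by move=> au aw; rewrite expnD exprM herm_conj // herm_conj.
have antiZ c u : c ^+ (p ^ (a + a)) = c -> anti u -> anti (c *: u).
  by move=> cf au; rewrite !frbZ -exprM -expnD cf au scalerN.
have antiD u w : anti u -> anti w -> anti (u + w).
  by move=> au aw; rewrite !map_mxD au aw opprD.
(* Removing from [z0] its components along [l] does not change its pairing with [y], which is
   orthogonal to [l]. *)
have [z [zE az zl zy]] : exists z, [/\ (z <= E)%MS, anti z,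
    {in l, forall u, herm z u = 0} & herm z y != 0].
  exists (z0 - \sum_(u <- l) herm z0 u *: u); split.
  - rewrite addmx_sub // eqmx_opp big_seq.
    elim/big_ind: _ => [|u w hu hw|u ul]; first exact: sub0mx.
      exact: addmx_sub.
    by rewrite scalemx_sub //; case: (hl u ul).
  - apply: (antiD) => //.
    rewrite big_seq; elim/big_ind: _ => [|u w hu hw|u ul].
    + by rewrite oppr0 !map_mx0 oppr0.
    + by rewrite opprD; apply: (antiD).
    + have [_ au _] := hl u ul; rewrite -scaleNr; apply: (antiZ) => //.
      by rewrite -[LHS]/(frobr hp (a + a) _) rmorphN /= /frobr /frobp hfix.
  - move=> u ul; rewrite bformDl bformNl bform_suml.
    suff -> : \sum_(i <- l) herm (herm z0 i *: i) u = herm z0 u by rewrite subrr.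
    rewrite (eq_bigr (fun i => herm z0 i * herm i u)) => [|i _]; last by rewrite bformE.
    exact: herm_expand.
  - rewrite bformDl bformNl bform_suml big_seq big1 ?subr0 // => u ul.
    have [_ au _] := hl u ul.
    by rewrite bformE -(herm_conj _ au) yl // expr0n expn_eq0 /= -leqn0 leqNgt (ltnW (prime_gt1 (pcharf_prime hp))) /= mulr0.
(* If [y] and [z] are both isotropic, [y + c *: z] has norm [b + b ^+ (p ^ a)] with
   [b = c * herm z y]. The polynomial [T] has fewer roots than the field with [p ^ (a + a)]
   elements, so [b] can be chosen in that field with nonzero trace. *)
have [t [tE at_ tl tt]] : exists t, [/\ (t <= E)%MS, anti t,
    {in l, forall u, herm t u = 0} & herm t t != 0].
  case: (eqVneq (herm y y) 0) => [yy0|]; last by exists y.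
  case: (eqVneq (herm z z) 0) => [zz0|]; last by exists z.
  pose T : {poly k} := 'X^(p ^ a) + 'X.
  have [rs [urs srs mrs]] := @frob_fixed_seq k p hp (a + a) a20.
  have p1 := prime_gt1 (pcharf_prime hp).
  have pa1 : (1 < p ^ a)%N by rewrite -(exp1n a) ltn_exp2r.
  have sT : size T = (p ^ a).+1 by rewrite size_polyDl ?size_polyX ?size_polyXn.
  have [||b] := @poly_nonroot k T rs _ urs.
  - by rewrite -size_poly_eq0 sT.
  - by rewrite sT srs ltn_exp2l // -addn1 leq_add2l.
  rewrite mrs => /eqP bf; rewrite !hornerE => Tb.
  pose c := b / herm z y.
  have cf : c ^+ (p ^ (a + a)) = c by rewrite exprMn bf exprVn hfix.
  exists (y + c *: z); split.
  - by rewrite addmx_sub // scalemx_sub.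
  - by apply/antiD/antiZ.
  - by move=> u ul; rewrite !bformE yl // zl // mulr0 addr0.
  rewrite map_mxD frbZ !bformE yy0 zz0 !mulr0 add0r addr0 /c divfK //.
  rewrite exprMn exprVn herm_conj // divfK //.
    by rewrite addrC.
  by rewrite -(herm_conj _ ay) (frob_eq0 hp).
have tta : (herm t t) ^+ (p ^ a) = herm t t by rewrite herm_conj.
(* The norm of [t] is fixed by Frobenius. This forces any solution [c] of the norm equation to lie
   in the field with [p ^ (a + a)] elements, so that [c *: t] is still [anti]. *)
have [c ct] := @exp_root k (p ^ a).+1 (herm t t)^-1 isT.
have cf : c ^+ (p ^ (a + a)) = c.
  have c0 : c != 0 by apply: contraNneq tt => c0; rewrite -invr_eq0 -ct c0 expr0n.
  have e1 : c ^+ (p ^ a) = (herm t t)^-1 / c by rewrite -ct exprSr mulfK.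
  by rewrite expnD exprM e1 exprMn !exprVn tta e1 invf_div mulrC divfK // invr_eq0.
exists (c *: t); split.
- exact: scalemx_sub.
- exact: (antiZ).
- by rewrite frbZ bformZl bformZr mulrA -exprS ct mulVf.
- by move=> u ul; rewrite bformE tl ?mulr0.
Qed.

Lemma herm_basis m : (m <= \rank E)%N -> exists l : seq 'rV_N,
  [/\ size l = m, forall u, u \in l -> [/\ (u <= E)%MS, anti u & herm u u = 1] &
      pairwise (fun u v => herm u v == 0) l].
Proof.
elim: m => [|m IHm] mE; first by exists [::].
have [l [sl hl pl]] := IHm (ltnW mE).
have [|t [tE at_ tt tl]] := herm_vector hl pl; first by rewrite sl.
exists (t :: l); split=> [|u|] /=; first by rewrite sl.
  by rewrite inE => /predU1P[->|/hl].
by rewrite pl andbT; apply/allP => u ul; rewrite tl.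
Qed.
End Hermitian.

Section Symplectic.
Variables (E : 'M[k]_N) (a : nat).
Hypotheses (a0 : (0 < a)%N) (FG : frb a G = G)
  (FE : forall u, (u <= E)%MS -> (frb a u <= E)%MS)
  (ndE : forall u, (u <= E)%MS -> u != 0 -> E *m G *m u^T != 0).

Definition hyperbolic (c d : 'rV[k]_N * 'rV[k]_N) :=
  [&& bform G c.1 d.1 == 0, bform G c.1 d.2 == 0,
      bform G c.2 d.1 == 0 & bform G c.2 d.2 == 0].

Local Notation fixed_pair c := [/\ (c.1 <= E)%MS, (c.2 <= E)%MS, frb a c.1 = c.1,
  frb a c.2 = c.2 & bform G c.1 c.2 = 1].

Lemma symp_expand (l : seq ('rV_N * 'rV_N)) z :
  (forall c, c \in l -> fixed_pair c) -> pairwise hyperbolic l ->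
  let z' := z - \sum_(c <- l) (bform G z c.2 *: c.1 - bform G z c.1 *: c.2) in
  forall c, c \in l -> bform G z' c.1 = 0 /\ bform G z' c.2 = 0.
Proof.
move=> hl pl z' c cl.
suff h : forall (w : 'rV_N -> k), \sum_(d <- l) (w d.2 * bform G d.1 c.1 - w d.1 * bform G d.2 c.1) = w c.1
      /\ \sum_(d <- l) (w d.2 * bform G d.1 c.2 - w d.1 * bform G d.2 c.2) = w c.2.
  have [h1 h2] := h (bform G z).
  rewrite /z' !bformDl !bformNl !bform_suml.
  split; apply/eqP; rewrite subr_eq0 eq_sym; apply/eqP.
    by rewrite -[RHS]h1; apply: eq_bigr => d _; rewrite !bformE.
  by rewrite -[RHS]h2; apply: eq_bigr => d _; rewrite !bformE.
move=> w {z z'}; elim: l hl pl cl => // d l IHl hl /= /andP[/allP dl pl].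
have hl' e : e \in l -> fixed_pair e by move=> el; apply: hl; rewrite inE el orbT.
have [_ _ _ _ d12] := hl d (mem_head _ _).
have d21 : bform G d.2 d.1 = -1 by rewrite bform_sym // d12.
rewrite inE !big_cons; case: (boolP (c \in l)) => [cl _|cl].
  have /and4P[/eqP -> /eqP -> /eqP -> /eqP ->] := dl c cl.
  by rewrite !mulr0 subr0 !add0r; apply: IHl.
rewrite orbF => /eqP ->; rewrite d12 d21 !alt !mulr0 mulr1 mulrN1 opprK subr0 add0r.
split; rewrite big_seq big1 ?addr0 // => e el;
  have /and4P[/eqP e1 /eqP e2 /eqP e3 /eqP e4] := dl e el;
  by rewrite !(bform_sym alt e.1) !(bform_sym alt e.2) ?e1 ?e2 ?e3 ?e4 !oppr0 !mulr0 subr0.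
Qed.

(** A fixed vector orthogonal to the planes already found is completed by a fixed partner, obtained
    from nondegeneracy on [E], projected off those planes and rescaled. *)
Lemma symp_basis m : (2 * m <= \rank E)%N -> exists l : seq ('rV_N * 'rV_N),
  [/\ size l = m, forall c, c \in l -> fixed_pair c & pairwise hyperbolic l].
Proof.
elim: m => [|m IHm] mE; first by exists [::].
have [|l [sl hl pl]] := IHm; first by apply: leq_trans mE; rewrite leq_pmul2l.
have [|u0 [u00 u0E u0l]] := @exists_orth _ _ G E (flatten [seq [:: c.1; c.2] | c <- l]).
  suff -> : size (flatten [seq [:: c.1; c.2] | c <- l]) = (2 * m)%N by lia.
  by rewrite -sl; elim: (l) => //= c l' ->; rewrite mulnS.
have {}u0l c : c \in l -> bform G u0 c.1 = 0 /\ bform G u0 c.2 = 0.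
  by move=> cl; split; apply: u0l; apply/flatten_mapP; exists c; rewrite ?inE ?eqxx ?orbT.
have [v0 uv0] := nonzero_coord u00.
pose Q u := (u <= E)%MS /\ forall c, c \in l -> bform G u c.1 = 0 /\ bform G u c.2 = 0.
have QD u w : Q u -> Q w -> Q (u + w).
  case=> [uE ul] [wE wl]; split; first exact: addmx_sub.
  by move=> c cl; have [e1 e2] := ul c cl; have [e3 e4] := wl c cl; rewrite !bformE e1 e2 e3 e4 !addr0.
have QZ b u : Q u -> Q (b *: u).
  case=> [uE ul]; split; first exact: scalemx_sub.
  by move=> c cl; have [e1 e2] := ul c cl; rewrite !bformE e1 e2 !mulr0.
have Q0 : Q 0 by split=> [|c _]; rewrite ?sub0mx ?bformE.
have QF u : Q u -> Q (frb a u).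
  case=> uE ul; split; first exact: FE.
  move=> c cl; have [_ _ e1 e2 _] := hl c cl; have [e3 e4] := ul c cl.
  by split; [rewrite -e1|rewrite -e2]; rewrite -bform_map // ?e3 ?e4 rmorph0.
have [u [[uE ul] uF uv]] := @frob_fixed_vector Q 1 a u0 v0 a0 (or_introl erefl) Q0 QD QZ QF (conj u0E u0l) uv0.
rewrite scale1r in uF.
have u_neq0 : u != 0 by apply: contraNneq uv => ->; rewrite mul0mx mxE.
have /matrix0Pn[i [j]] := ndE uE u_neq0.
rewrite bform_mx ord1 row_id => iju.
pose v : 'cV_N := G *m u^T.
have hv w : (w *m v) 0 0 = bform G w u by rewrite /bform /v mulmxA.
have [|||||z [zE zF zu]] := @frob_fixed_vector (fun w => (w <= E)%MS : Prop) 1 a (row i E) v a0 (or_introl erefl) _ _ _ _ (row_sub _ _) _.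
- exact: sub0mx.
- by move=> t w; apply: addmx_sub.
- by move=> c t; apply: scalemx_sub.
- exact: FE.
- by rewrite hv.
rewrite scale1r in zF; rewrite hv in zu.
pose z' := z - \sum_(c <- l) (bform G z c.2 *: c.1 - bform G z c.1 *: c.2).
have z'l c : c \in l -> bform G z' c.1 = 0 /\ bform G z' c.2 = 0 by apply: symp_expand.
have fixG t w : frb a t = t -> frb a w = w -> (bform G t w) ^+ (p ^ a) = bform G t w.
  by move=> ft fw; rewrite -[LHS]/(frobr hp a (bform G t w)) bform_map // ft fw.
have z'E : (z' <= E)%MS.
  rewrite addmx_sub // eqmx_opp big_seq.
  elim/big_ind: _ => [|t w ht hw|c cl]; [exact: sub0mx|exact: addmx_sub|].
  by have [e1 e2 _ _ _] := hl c cl; rewrite addmx_sub ?eqmx_opp ?scalemx_sub.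
have z'F : frb a z' = z'.
  rewrite /z' map_mxB zF; congr (_ - _).
  rewrite raddf_sum big_seq [RHS]big_seq.
  apply: eq_bigr => c cl; have [_ _ e1 e2 _] := hl c cl.
  by rewrite [LHS]map_mxB !frbZ !fixG // e1 e2.
have z'u : bform G z' u = bform G z u.
  rewrite /z' bformDl bformNl bform_suml big_seq big1 ?subr0 // => c cl.
  have [e1 e2] := ul c cl.
  by rewrite !bformE (bform_sym alt c.1) (bform_sym alt c.2) e1 e2 !oppr0 !mulr0 subr0.
(* The sign is needed because [bform G u z'] is the opposite of [bform G z' u]. *)
pose w := - (bform G z' u)^-1 *: z'.
exists ((u, w) :: l); split=> [|c|] /=; first by rewrite sl.
  rewrite inE => /predU1P[->|/hl//]; split => //=.
  - by rewrite scalemx_sub.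
  - rewrite frbZ z'F; congr (_ *: _).
    rewrite -[LHS]/(frobr hp a _) rmorphN fmorphV /=; congr (- (_^-1)).
    by rewrite /frobr /frobp fixG.
  - by rewrite /w bformZr (bform_sym alt u) mulrNN mulVf // z'u.
rewrite pl andbT; apply/allP => c cl; have [e1 e2] := ul c cl; have [e3 e4] := z'l c cl.
by rewrite /hyperbolic /= e1 e2 /w !bformZl e3 e4 !mulr0 eqxx.
Qed.
End Symplectic.
End Frobenius.

(** * The symplectic group, its diagonal torus and its monomial matrices *)

Lemma invmx_mulmx (k : fieldType) n (A B : 'M[k]_n) :
  A \in unitmx -> B \in unitmx -> invmx (A *m B) = invmx B *m invmx A.
Proof.
move=> uA uB; have uAB : A *m B \in unitmx by rewrite unitmx_mul uA.
apply: (can_inj (mulKmx uAB)); rewrite mulmxV // mulmxA -(mulmxA A) mulmxV // mulmx1 mulmxV //.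
Qed.

Section SymplecticGroup.
Variables (k : closedFieldType) (n : nat).
Local Notation J := (symplectic_form k n).

Lemma symplectic_formK : J *m J = - 1%:M.
Proof.
rewrite mulmx_block !mul0mx !mulmx0 !mul1mx !mulmx1 !addr0 !add0r.
by rewrite [in RHS]scalar_mx_block opp_block_mx !oppr0.
Qed.

Lemma unit_symplectic_form : J \in unitmx.
Proof.
have : J *m (- J) = 1%:M by rewrite mulmxN symplectic_formK opprK.
by move/mulmx1_unit => [].
Qed.

Lemma bform_alt (u : 'rV[k]_(n + n)) : bform J u u = 0.
Proof.
rewrite -[u]hsubmxK /bform mul_row_block !mulmx0 add0r addr0 mulmxN !mulmx1.
rewrite tr_row_mx mul_row_col mulNmx -[rsubmx u *m _]trmxK trmx_mul trmxK.
by rewrite !mxE addNr.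
Qed.

(** As the form squares to [- 1%:M], the condition for [x] exhibits a left inverse of [x]; read as a
    right inverse, it becomes the condition for the transpose. *)
Lemma SpP (x : 'M[k]_(n + n)) : @Sp k n x <-> x *m J *m x^T = J.
Proof.
have main (y : 'M[k]_(n + n)) : y^T *m J *m y = J -> y *m J *m y^T = J.
  move=> yJ; have /mulmx1C : (- J *m y^T *m J) *m y = 1%:M.
    by rewrite -!mulmxA (mulmxA y^T) yJ mulNmx symplectic_formK opprK.
  rewrite !mulNmx mulmxN !mulmxA => /eqP; rewrite eqr_oppLR => /eqP e.
  have /= := congr1 (mulmx^~ J) e.
  by rewrite -(mulmxA _ J J) symplectic_formK mulmxN mulmx1 mulNmx mul1mx => /oppr_inj.
split=> [|xJ]; first exact: main.
by have := main x^T; rewrite trmxK; apply.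
Qed.

Lemma Sp_unit (x : 'M[k]_(n + n)) : @Sp k n x -> x \in unitmx.
Proof.
move=> /(congr1 determinant); rewrite !det_mulmx => xJ.
have : \det J != 0 by have := unit_symplectic_form; rewrite unitmxE unitfE.
by rewrite unitmxE unitfE -xJ; apply: contra => /eqP ->; rewrite mulr0.
Qed.

Lemma SpM (x y : 'M[k]_(n + n)) : @Sp k n x -> @Sp k n y -> @Sp k n (x *m y).
Proof.
move=> /SpP xJ /SpP yJ; apply/SpP.
by rewrite trmx_mul !mulmxA -(mulmxA x) -(mulmxA x) yJ.
Qed.

Lemma SpV (x : 'M[k]_(n + n)) : @Sp k n x -> @Sp k n (invmx x).
Proof.
move=> xS; have ux := Sp_unit xS; move/SpP: xS => xJ; apply/SpP.
by rewrite -{1}xJ !mulmxA mulVmx // mul1mx -mulmxA -trmx_mul mulVmx // trmx1 mulmx1.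
Qed.

Lemma map_symplectic_form (f : {rmorphism k -> k}) : map_mx f J = J.
Proof. by rewrite map_block_mx !map_mx0 map_mxN map_mx1. Qed.

Lemma Sp_map (f : {rmorphism k -> k}) (x : 'M[k]_(n + n)) : @Sp k n x -> @Sp k n (map_mx f x).
Proof.
move=> /(congr1 (map_mx f)); rewrite !map_mxM map_symplectic_form -map_trmx.
by [].
Qed.

Definition symp_rows (u v : 'I_n -> 'rV[k]_(n + n)) : 'M[k]_(n + n) :=
  col_mx (\matrix_i u i) (\matrix_i v i).

Lemma symp_rows_isom (G : 'M[k]_(n + n)) u v :
  (forall w, bform G w w = 0) ->
  (forall i j, bform G (u i) (u j) = 0) -> (forall i j, bform G (v i) (v j) = 0) ->
  (forall i j, bform G (u i) (v j) = (i == j)%:R) ->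
  symp_rows u v *m G *m (symp_rows u v)^T = J.
Proof.
move=> altG uu vv uv; rewrite /symp_rows tr_col_mx mul_col_mx mul_col_row /symplectic_form.
congr block_mx; apply/matrixP => i j; rewrite bform_mx !rowK !mxE //.
by rewrite bform_sym // uv eq_sym.
Qed.

Lemma row_symp_rowsl u v i : row (lshift n i) (symp_rows u v) = u i.
Proof. by rewrite rowKu rowK. Qed.
Lemma row_symp_rowsr u v i : row (rshift n i) (symp_rows u v) = v i.
Proof. by rewrite rowKd rowK. Qed.

Definition dgval (d : 'I_n -> k) (s : 'I_(n + n)) : k :=
  match fintype.split s with inl i => d i | inr i => (d i)^-1 end.

Definition dgmx (d : 'I_n -> k) : 'M[k]_(n + n) := diag_mx (\row_s dgval d s).

Lemma dgvall d i : dgval d (lshift n i) = d i.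
Proof. by rewrite /dgval (unsplitK (inl i)). Qed.
Lemma dgvalr d i : dgval d (rshift n i) = (d i)^-1.
Proof. by rewrite /dgval (unsplitK (inr i)). Qed.

Lemma ord_addP (P : 'I_(n + n) -> Prop) :
  (forall i, P (lshift n i)) -> (forall i, P (rshift n i)) -> forall s, P s.
Proof. by move=> hl hr s; case: (fintype.splitP s) => i si; [have -> : s = lshift n i|have -> : s = rshift n i]; try exact: val_inj. Qed.

Lemma row_dgmx m d (g : 'M[k]_(n + n, m)) s : row s (dgmx d *m g) = dgval d s *: row s g.
Proof. by apply/rowP => j; rewrite mul_diag_mx !mxE. Qed.

Lemma dgmx_eq m d (g h : 'M[k]_(n + n, m)) :
  (forall s, row s h = dgval d s *: row s g) -> h = dgmx d *m g.
Proof. by move=> e; apply/row_matrixP => s; rewrite row_dgmx. Qed.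

Lemma dgmx_Sp d : (forall i, d i != 0) -> @Sp k n (dgmx d).
Proof.
move=> d0; apply/SpP; rewrite tr_diag_mx.
apply/matrixP => s t.
rewrite mul_mx_diag [LHS]mxE mul_diag_mx [X in X * _]mxE ![(\row_(_ < _) _) 0 _]mxE.
elim/ord_addP: s => i; elim/ord_addP: t => j;
  rewrite ?dgvall ?dgvalr /symplectic_form ?block_mxEul ?block_mxEur ?block_mxEdl ?block_mxEdr !mxE ?mulr0 ?mul0r //.
- by case: eqP => [->|]; rewrite ?mulr1 ?divff // mulr0 mul0r.
- by case: eqP => [->|]; rewrite ?mulrN1 ?mulNr ?mulVf // oppr0 mulr0 mul0r.
Qed.

(** A signed permutation acting on the [n + n] basis vectors: [eps i] tells whether the two halves
    of the pair [i] are exchanged on the way to the pair [sg i]. The sign [spcoef] on one half of an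
    exchanged pair is what preserves the alternating form. *)
Definition spfun (sg : {perm 'I_n}) (eps : 'I_n -> bool) (s : 'I_(n + n)) : 'I_(n + n) :=
  match fintype.split s with
  | inl i => if eps i then rshift n (sg i) else lshift n (sg i)
  | inr i => if eps i then lshift n (sg i) else rshift n (sg i) end.
Definition spcoef (eps : 'I_n -> bool) (s : 'I_(n + n)) : k :=
  match fintype.split s with inl i => 1 | inr i => (-1) ^+ eps i end.

Lemma spfunl sg eps i : spfun sg eps (lshift n i) = if eps i then rshift n (sg i) else lshift n (sg i).
Proof. by rewrite /spfun (unsplitK (inl i)). Qed.
Lemma spfunr sg eps i : spfun sg eps (rshift n i) = if eps i then lshift n (sg i) else rshift n (sg i).
Proof. by rewrite /spfun (unsplitK (inr i)). Qed.
Lemma spcoefl eps i : spcoef eps (lshift n i) = 1.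
Proof. by rewrite /spcoef (unsplitK (inl i)). Qed.
Lemma spcoefr eps i : spcoef eps (rshift n i) = (-1) ^+ eps i.
Proof. by rewrite /spcoef (unsplitK (inr i)). Qed.
Definition spE := (spfunl, spfunr, spcoefl, spcoefr).

Lemma spfun_inj sg eps : injective (spfun sg eps).
Proof.
by move=> s t; elim/ord_addP: s => i; elim/ord_addP: t => j; rewrite !spE;
  case ei: (eps i); case ej: (eps j) => // /eqP;
  rewrite ?eq_lshift ?eq_rshift ?eq_lrshift ?eq_rlshift // => /eqP /perm_inj ij;
  move: ei; rewrite ij ?ej.
Qed.

Definition nmx sg eps : 'M[k]_(n + n) := \matrix_(s, t) (spcoef eps s * (t == spfun sg eps s)%:R).

Lemma row_nmx m sg eps (g : 'M[k]_(n + n, m)) s :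
  row s (nmx sg eps *m g) = spcoef eps s *: row (spfun sg eps s) g.
Proof.
apply/rowP => j; rewrite !mxE (bigD1 (spfun sg eps s)) //= big1 ?addr0.
  by rewrite mxE eqxx mulr1.
by move=> t ts; rewrite mxE (negPf ts) mulr0 mul0r.
Qed.

Lemma nmx_eq m sg eps (g h : 'M[k]_(n + n, m)) :
  (forall s, row s h = spcoef eps s *: row (spfun sg eps s) g) -> h = nmx sg eps *m g.
Proof. by move=> e; apply/row_matrixP => s; rewrite row_nmx. Qed.

Lemma nmx_Sp sg eps : @Sp k n (nmx sg eps).
Proof.
apply/SpP; have E s t : (nmx sg eps *m J *m (nmx sg eps)^T) s t =
    spcoef eps s * spcoef eps t * J (spfun sg eps s) (spfun sg eps t).
  rewrite bform_mx.
  have rn r : row r (nmx sg eps) = spcoef eps r *: row (spfun sg eps r) 1%:M.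
    by rewrite -row_nmx mulmx1.
  by rewrite !rn bformZl bformZr mulrA -bform_mx mul1mx trmx1 mulmx1.
apply/matrixP => s t; rewrite E.
elim/ord_addP: s => i; elim/ord_addP: t => j; rewrite !spE;
  case ei: (eps i); case ej: (eps j);
  rewrite /symplectic_form ?block_mxEul ?block_mxEur ?block_mxEdl ?block_mxEdr !mxE /=
    ?mulr1 ?mul1r ?mulr0 // ?(inj_eq perm_inj) ?mulrNN ?mulr1 ?mul1r ?mulN1r ?mulrN1 ?opprK //;
  by case: eqP => [ij|_]; rewrite ?oppr0 ?mulr0 //; move: ei; rewrite ij ej.
Qed.

Lemma map_dgmx (f : {rmorphism k -> k}) d : map_mx f (dgmx d) = dgmx (fun i => f (d i)).
Proof.
apply/matrixP => s t; rewrite !mxE rmorphMn /=; congr (_ *+ _).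
by rewrite /dgval; case: fintype.split => i; rewrite ?fmorphV.
Qed.

Lemma nmx_dgmx (sg : {perm 'I_n}) eps (d d' : 'I_n -> k) : (forall i, d (sg i) = if eps i then (d' i)^-1 else d' i) ->
  dgmx d' *m nmx sg eps = nmx sg eps *m dgmx d.
Proof.
move=> dd; apply/row_matrixP => s; rewrite row_dgmx row_nmx.
have rn r : row r (nmx sg eps) = spcoef eps r *: row (spfun sg eps r) 1%:M.
  by rewrite -row_nmx mulmx1.
rewrite rn -[dgmx d]mulmx1 row_dgmx !scalerA mulrC; congr (_ * _ *: _).
by elim/ord_addP: s => i; rewrite !spE; case ei: (eps i);
  rewrite ?dgvall ?dgvalr dd ei ?invrK.
Qed.

End SymplecticGroup.

(** * Lang's theorem for monomial symplectic matrices *)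

Section Lang.
Variables (k : closedFieldType) (p : nat) (hp : p \in [pchar k]).
Hypothesis halg : forall x : k, exists2 s, (0 < s)%N & x ^+ (p ^ s) = x.
Local Notation frb a := (map_mx (frobr hp a)).
Variables (n a : nat) (a0 : (0 < a)%N) (sg : {perm 'I_n}) (eps : 'I_n -> bool).
Local Notation J := (symplectic_form k n).

Let tau : {perm 'I_(n + n)} := perm (@spfun_inj n sg eps).
Let sgn (s : 'I_(n + n)) : k := spcoef k eps s.
(** The columns of a solution [g] of [frb a g = nmx k sg eps *m g] are, written as rows, the fixed
    vectors of this semilinear map. *)
Let Psi (y : 'rV[k]_(n + n)) : 'rV[k]_(n + n) :=
  \row_t (sgn (tau^-1%g t) * (y 0 (tau^-1%g t)) ^+ (p ^ a)).

Let sgnF s j : (sgn s) ^+ (p ^ j) = sgn s.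
Proof.
rewrite -[LHS]/(frobr hp j (sgn s)) /sgn /spcoef.
by case: fintype.split => i; rewrite ?rmorph1 ?rmorph_sign.
Qed.

Let sgn2 s : sgn s * sgn s = 1.
Proof. by rewrite /sgn /spcoef; case: fintype.split => i; rewrite ?mulr1 // -expr2 sqrr_sign. Qed.

Let Psi_iter j : exists2 e : 'I_(n + n) -> k, (forall t, e t * e t = 1 /\ forall i, (e t) ^+ (p ^ i) = e t) &
  forall y t, (iter j Psi y) 0 t = e t * (y 0 ((tau^-1 ^+ j)%g t)) ^+ (p ^ (a * j)).
Proof.
elim: j => [|j [e he IHj]].
  exists (fun=> 1) => [t|y t]; first by split=> [|i]; rewrite ?mulr1 ?expr1n.
  by rewrite expg0 perm1 mul1r muln0 expr1.
exists (fun t => sgn (tau^-1%g t) * e (tau^-1%g t)) => [t|y t].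
  have [e1 e2] := he (tau^-1%g t); split=> [|i]; first by rewrite mulrACA sgn2 e1 mulr1.
  by rewrite exprMn sgnF e2.
rewrite iterS mxE IHj exprMn (he _).2 mulrA -exprM -expnD -mulnSr; congr (_ * _ ^+ _).
by rewrite expgS permM.
Qed.

Let Psi_periodic y : exists2 s, (0 < s)%N & iter s Psi y = y.
Proof.
have [s s0 hs] := frb_period hp halg y.
have [e he hj] := Psi_iter #[tau^-1%g]%g.
have [e' he' hj'] := Psi_iter (#[tau^-1%g]%g * 2 * s)%N.
(* After as many iterations as the order of [tau] only signs are left besides the powers; after
   twice as many the signs have gone too, and the period of the entries finishes. *)
have two z t : (iter (#[tau^-1%g]%g * 2) Psi z) 0 t = (z 0 t) ^+ (p ^ (a * (#[tau^-1%g]%g * 2))).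
  rewrite muln2 -addnn iterD hj expg_order perm1 hj expg_order perm1 exprMn (he t).2 mulrA (he t).1 mul1r.
  by rewrite -exprM -expnD -mulnDr.
have iter2 j z t : (iter (#[tau^-1%g]%g * 2 * j) Psi z) 0 t = (z 0 t) ^+ (p ^ (a * (#[tau^-1%g]%g * 2) * j)).
  elim: j z => [|j IHj] z; first by rewrite !muln0 expr1.
  by rewrite mulnS iterD two IHj -exprM -expnD addnC -mulnS.
exists (#[tau^-1%g]%g * 2 * s)%N; first by rewrite !muln_gt0 order_gt0 s0.
apply/rowP => t; rewrite iter2.
have := hs _ (dvdn_mull (a * (#[tau^-1%g]%g * 2)) (dvdnn s)).
by move/(congr1 (fun M : 'rV_(n + n) => M 0 t)); rewrite mxE.
Qed.

(** The fixed vectors of [Psi] span the space: as long as the rows of [A] do not, a functional [v]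
    that vanishes on them is nonzero on some other fixed vector, which enlarges [A]. *)
Lemma lang_GL : exists2 g : 'M[k]_(n + n), g \in unitmx & frb a g = nmx k sg eps *m g.
Proof.
suff [A rA hA] : exists2 A : 'M[k]_(n + n), \rank A = (n + n)%N & forall i, Psi (row i A) = row i A.
  exists A^T; first by rewrite unitmx_tr -row_full_unit /row_full rA.
  apply: nmx_eq => s; apply/rowP => i.
  have /rowP/(_ (tau s)) := hA i; rewrite !mxE permK permE => <-.
  by rewrite mulrA sgn2 mul1r.
suff H m : (m <= n + n)%N -> exists2 A : 'M[k]_(m, n + n), \rank A = m & forall i, Psi (row i A) = row i A.
  exact: H.
elim: m => [|m IHm] mn; first by exists 0 => [|[]//]; rewrite mxrank0.
have [A rA hA] := IHm (ltnW mn).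
have : kermx A^T != 0.
  by rewrite -mxrank_eq0 mxrank_ker mxrank_tr rA -lt0n subn_gt0.
case/rowV0Pn => v /sub_kermxP vA v0.
have /rV0Pn[j vj] := v0.
have [|||z [_ z1 z2]] := @semilinear_fixed k p hp (n + n) (fun=> True) Psi a (delta_mx 0 j) v^T a0 _ _ I (fun _ _ _ _ => I) (fun _ _ _ => I) (fun _ _ => I) I (Psi_periodic _).
- move=> u w; apply/rowP => t; rewrite !mxE -mulrDr; congr (_ * _).
  exact: (rmorphD (frobr hp a)).
- by move=> c u; apply/rowP => t; rewrite !mxE exprMn mulrCA.
- by rewrite -rowE !mxE.
have zA : ~~ (z <= A)%MS.
  apply: contra z2 => /submxP[D ->]; rewrite -mulmxA.
  by rewrite -[A]trmxK -trmx_mul vA trmx0 mulmx0 mxE.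
pose B : 'M_(1 + m, n + n) := col_mx z A.
suff rB : \rank B = (1 + m)%N.
  suff hB (i : 'I_(1 + m)) : Psi (row i B) = row i B by exists B.
  by case: (split_ordP i) => i' ->; rewrite /B ?rowKu ?rowKd ?row_id.
rewrite -(addsmxE z A).
have dz := mxrank_sum_cap z A; rewrite rA in dz.
have z0 : z != 0 by apply: contraNneq zA => ->; rewrite sub0mx.
rewrite rank_rV z0 in dz.
suff cap0 : \rank (z :&: A)%MS = 0%N by move: dz; rewrite cap0 addn0 add1n.
apply/eqP; rewrite mxrank_eq0; apply: contraNT zA => c0.
have c1 : (0 < \rank (z :&: A)%MS)%N by rewrite lt0n mxrank_eq0.
apply: submx_trans (capmxSr z A).
rewrite -(geq_leqif (mxrank_leqif_sup (capmxSl z A))) rank_rV z0 //.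
Qed.

(** The standard form transported by a linear solution [g0] is Frobenius-invariant, because the
    monomial matrix is symplectic. A fixed symplectic basis [h] of the transported form corrects
    [g0] into the symplectic group without changing its Frobenius twist. *)
Lemma lang_Sp : exists2 g : 'M[k]_(n + n), @Sp k n g & frb a g = nmx k sg eps *m g.
Proof.
have [g0 ug Fg] := lang_GL.
pose G := invmx g0 *m J *m (invmx g0)^T.
have FG : frb a G = G.
  rewrite /G !map_mxM map_symplectic_form -map_trmx map_invmx Fg invmx_mulmx ?(Sp_unit (nmx_Sp _ _ _)) //.
  rewrite trmx_mul !mulmxA; congr (_ *m _); rewrite -!mulmxA; congr (_ *m _).
  rewrite mulmxA; exact/SpP/SpV/nmx_Sp.
have altG u : bform G u u = 0.
  rewrite /bform /G !mulmxA -mulmxA -trmx_mul; exact: bform_alt.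
have uG : G \in unitmx.
  by rewrite /G !unitmx_mul unitmx_tr !unitmx_inv ug unit_symplectic_form.
have [|||l [sl hl pl]] := @symp_basis k p hp halg (n + n) G altG uG 1%:M a a0 FG _ _ n.
- by move=> u _; rewrite submx1.
- move=> u _ u0; apply: contra u0; rewrite mul1mx => /eqP h.
  have /eqP := congr1 (mulmx (invmx G)) h.
  by rewrite mulKmx // mulmx0 => /eqP/(congr1 trmx); rewrite trmxK trmx0 => ->.
- by rewrite mxrank1 mul2n addnn.
pose u (i : 'I_n) := (nth (0, 0) l i).1; pose v (i : 'I_n) := (nth (0, 0) l i).2.
have il (i : 'I_n) : nth (0, 0) l i \in l by rewrite mem_nth // sl.
have pij (i j : 'I_n) : (i < j)%N -> hyperbolic G (nth (0, 0) l i) (nth (0, 0) l j).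
  by move=> ij; apply: (pairwiseP (0, 0) pl) => //; rewrite inE sl.
have hJ : symp_rows u v *m G *m (symp_rows u v)^T = J.
  apply: symp_rows_isom => // i j; case: (ltngtP i j) => [ij|ij|/val_inj ->].
  - by have /and4P[/eqP] := pij _ _ ij.
  - by rewrite bform_sym //; have /and4P[/eqP] := pij _ _ ij => ->; rewrite oppr0.
  - exact: altG.
  - by have /and4P[_ _ _ /eqP] := pij _ _ ij.
  - by rewrite bform_sym //; have /and4P[_ _ _ /eqP] := pij _ _ ij => ->; rewrite oppr0.
  - exact: altG.
  - by have /and4P[_ /eqP e _ _] := pij _ _ ij; rewrite e -val_eqE /= ltn_eqF.
  - by rewrite bform_sym //; have /and4P[_ _ /eqP e _] := pij _ _ ij; rewrite e oppr0 -val_eqE /= gtn_eqF.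
  - by have [_ _ _ _ ->] := hl _ (il j); rewrite eqxx.
set h := symp_rows u v in hJ.
have Fh : frb a h = h.
  apply/row_matrixP => s; rewrite -map_row.
  by elim/ord_addP: s => i; rewrite ?row_symp_rowsl ?row_symp_rowsr; have [] := hl _ (il i).
have uh : h \in unitmx.
  have : \det J != 0 by have := unit_symplectic_form k n; rewrite unitmxE unitfE.
  by rewrite -hJ !det_mulmx !mulf_eq0 !negb_or -andbA unitmxE unitfE => /and3P[].
exists (g0 *m invmx h); last by rewrite map_mxM map_invmx Fg Fh mulmxA.
have /SpV : @Sp k n (h *m invmx g0) by apply/SpP; rewrite trmx_mul !mulmxA -[RHS]hJ /G !mulmxA.
by rewrite invmx_mulmx ?unitmx_inv // invmxK.
Qed.

End Lang.

(** * Functions and permutations of three indices *)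

Definition f3 (T : Type) (x y z : T) (i : 'I_3) : T :=
  match val i with 0 => x | 1 => y | _ => z end.

Definition o0 : 'I_3 := @Ordinal 3 0 isT.
Definition o1 : 'I_3 := @Ordinal 3 1 isT.
Definition o2 : 'I_3 := @Ordinal 3 2 isT.

Lemma I3P (P : 'I_3 -> Prop) : P o0 -> P o1 -> P o2 -> forall i, P i.
Proof.
move=> h0 h1 h2 [[|[|[|//]]] hi]; [move: h0|move: h1|move: h2];
  by congr P; apply: val_inj.
Qed.

Lemma big_I3 (R : Type) (idx : R) (op : Monoid.law idx) (F : 'I_3 -> R) :
  \big[op/idx]_i F i = op (F o0) (op (F o1) (F o2)).
Proof.
rewrite !big_ord_recl big_ord0 Monoid.mulm1; congr (op (F _) (op (F _) (F _)));
  exact: val_inj.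
Qed.

Lemma swap01_inj : injective (f3 o1 o0 o2).
Proof. by elim/I3P; elim/I3P. Qed.
Definition swap01 : {perm 'I_3} := perm swap01_inj.
Lemma rot3_inj : injective (f3 o1 o2 o0).
Proof. by elim/I3P; elim/I3P. Qed.
Definition rot3 : {perm 'I_3} := perm rot3_inj.

(** * Symplectic eigenbases on which Frobenius acts by a signed permutation *)

Section Frames.
Variables (k : closedFieldType) (p : nat) (hp : p \in [pchar k]).
Hypothesis halg : forall x : k, exists2 s, (0 < s)%N & x ^+ (p ^ s) = x.
Local Notation frb a := (map_mx (frobr hp a)).
Variables (d : nat) (d0 : (0 < d)%N).
Local Notation Q := (p ^ d)%N.

Section General.
Variables (n : nat) (x : 'M[k]_(n + n)).
Local Notation J := (symplectic_form k n).
Local Notation V := 'rV[k]_(n + n).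

Lemma frame_of_pairs (c : 'I_n -> V * V) (dl : 'I_n -> k) (sg : {perm 'I_n}) (eps : 'I_n -> bool) :
  (forall i j : 'I_n, (i < j)%N -> hyperbolic J (c i) (c j)) ->
  (forall i, bform J (c i).1 (c i).2 = 1) ->
  (forall i, (c i).1 *m x = dl i *: (c i).1 /\ (c i).2 *m x = (dl i)^-1 *: (c i).2) ->
  (forall i, frb d (c i).1 = if eps i then (c (sg i)).2 else (c (sg i)).1) ->
  (forall i, frb d (c i).2 = if eps i then - (c (sg i)).1 else (c (sg i)).2) ->
  exists g, [/\ @Sp k n g, g *m x = dgmx dl *m g & frb d g = nmx k sg eps *m g].
Proof.
move=> hh h1 hx hF1 hF2; pose u i := (c i).1; pose v i := (c i).2.
have alt := @bform_alt k n.
exists (symp_rows u v); split.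
- apply/SpP/symp_rows_isom => // i j; case: (ltngtP i j) => [ij|ij|/val_inj ->] //.
  + by have /and4P[/eqP] := hh _ _ ij.
  + by rewrite bform_sym //; have /and4P[/eqP -> _ _ _] := hh _ _ ij; rewrite oppr0.
  + by have /and4P[_ _ _ /eqP] := hh _ _ ij.
  + by rewrite bform_sym //; have /and4P[_ _ _ /eqP ->] := hh _ _ ij; rewrite oppr0.
  + by have /and4P[_ /eqP e _ _] := hh _ _ ij; rewrite e -val_eqE /= ltn_eqF.
  + by rewrite bform_sym //; have /and4P[_ _ /eqP e _] := hh _ _ ij; rewrite e oppr0 -val_eqE /= gtn_eqF.
  + by rewrite h1 eqxx.
- apply: dgmx_eq; elim/ord_addP => i; rewrite row_mul ?row_symp_rowsl ?row_symp_rowsr ?dgvall ?dgvalr.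
    by have [] := hx i.
  by have [] := hx i.
- apply: nmx_eq; elim/ord_addP => i; rewrite -map_row !spE ?row_symp_rowsl ?row_symp_rowsr.
    by rewrite scale1r /u hF1; case: (eps i); rewrite ?row_symp_rowsl ?row_symp_rowsr.
  rewrite /v hF2; case: (eps i); rewrite ?row_symp_rowsl ?row_symp_rowsr.
    by rewrite expr1 scaleN1r.
  by rewrite expr0 scale1r.
Qed.

Variables (g0 : 'M[k]_(n + n)) (dl : 'I_n -> k).
Hypotheses (Fx : frb d x = x) (Sx : @Sp k n x) (Sg0 : @Sp k n g0)
  (g0x : g0 *m x = dgmx dl *m g0).

Let xJ : x *m J *m x^T = J. Proof. exact/SpP. Qed.
Let ug0 : g0 \in unitmx. Proof. exact: Sp_unit Sg0. Qed.

Lemma conj_diagonalizable : diagonalizable x.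
Proof.
exists g0 => //; apply/diagonalizable_forPex; exists (\row_s dgval dl s).
by apply: simmxW; rewrite ?row_free_unit.
Qed.

Lemma Fx_iter j : frb (d * j) x = x.
Proof. by rewrite -frb_iter; elim: j => //= j ->. Qed.

Lemma row_eigen s : row s g0 *m x = dgval dl s *: row s g0.
Proof. by rewrite -row_mul g0x row_dgmx. Qed.

Lemma eigenspace_rank m (f : 'I_m -> 'I_(n + n)) a : injective f ->
  (forall i, dgval dl (f i) = a) -> (m <= \rank (eigenspace x a))%N.
Proof.
move=> fi fa; have le : (rowsub f g0 <= eigenspace x a)%MS.
  apply/row_subP => i; rewrite row_rowsub; apply/eigenspaceP.
  by rewrite row_eigen fa.
apply: leq_trans (mxrankS le); have -> : rowsub f g0 = rowsub f 1%:M *m g0.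
  by rewrite mul_rowsub_mx mul1mx.
rewrite mxrankMfree ?row_free_unit //.
have: rowsub f 1%:M *m (rowsub f 1%:M)^T = 1%:M :> 'M[k]_m.
  apply/matrixP => i j; rewrite !mxE (bigD1 (f i)) //= big1 ?addr0.
    by rewrite !mxE eqxx mul1r (inj_eq fi) eq_sym.
  by move=> s sf; rewrite !mxE eq_sym (negPf sf) mul0r.
by move=> e; rewrite -[X in (X <= _)%N](mxrank1 k m) -e; apply: mxrankM_maxl.
Qed.

Definition pair_in (a : k) (c : V * V) :=
  [/\ c.1 *m x = a *: c.1, c.2 *m x = a^-1 *: c.2 & bform J c.1 c.2 = 1].

(** When [a ^+ 2 = 1] the pair is fixed, as in a symplectic space over the subfield. Otherwise
    Frobenius exchanges the eigenvalues [a] and [a^-1], hence the two halves, and the sign is that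
    of [anti]. *)
Definition pair_frob (a : k) (c c' : V * V) :=
  frb d c.1 = (if a ^+ 2 == 1 then c.1 else c'.2) /\
  frb d c.2 = (if a ^+ 2 == 1 then c.2 else - c'.1).

Lemma sqr1_frob (a : k) j : a ^+ 2 = 1 -> a ^+ (p ^ j) = a.
Proof.
move/eqP; rewrite sqrf_eq1 => /orP[]/eqP ->; first exact: expr1n.
by rewrite -[LHS]/(frobr hp j (-1)) rmorphN1.
Qed.

Lemma sqr1_inv (a : k) : a ^+ 2 = 1 -> a^-1 = a.
Proof.
move=> a2; have a0 : a != 0 by apply: contra_eq_neq a2 => ->; rewrite expr0n eq_sym oner_eq0.
by apply: (mulfI a0); rewrite mulfV // -expr2 a2.
Qed.

(** For a self-inverse eigenvalue the eigenspace is stable under Frobenius and the form is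
    nondegenerate on it, because eigenvectors with other eigenvalues are orthogonal to it. *)
Lemma flagged_pairs (a : k) m : a ^+ 2 = 1 -> (2 * m <= \rank (eigenspace x a))%N ->
  exists l, [/\ size l = m, forall c, c \in l -> pair_in a c /\ forall c', pair_frob a c c'
    & pairwise (hyperbolic J) l].
Proof.
move=> a2 hm; have alt := @bform_alt k n.
have [||l [sl hl pl]] := @symp_basis k p hp halg _ J alt (unit_symplectic_form k n) (eigenspace x a) d d0 (map_symplectic_form _ _) _ _ m hm.
- move=> u /eigenspaceP ux; apply/eigenspaceP.
  by rewrite (frb_eigen Fx ux) sqr1_frob.
- move=> u /eigenspaceP ux u0.
  have /existsP[s su] : [exists s, bform J (row s g0) u != 0].
    apply: contraT; rewrite negb_exists => /forallP h; case/eqP: u0.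
    by apply: (bform_nondeg (unit_symplectic_form k n) ug0) => s; apply/eqP; have := h s; rewrite negbK.
  have sa : dgval dl s = a.
    apply/eqP; apply: contraT => sa; case/eqP: su.
    apply: (bform_eigen xJ (row_eigen s) ux); apply: contra sa => /eqP e.
    by rewrite -[dgval dl s]mulr1 -a2 mulrA e mul1r.
  have sE : (row s g0 <= eigenspace x a)%MS by apply/eigenspaceP; rewrite row_eigen sa.
  apply: contra su => /eqP h; have /submxP[D ->] := sE.
  by rewrite /bform -!(mulmxA D) h mulmx0 mxE.
exists l; split=> // c cl; have [/eigenspaceP h1 /eigenspaceP h2 h3 h4 h5] := hl c cl.
by split=> [|c']; [split; rewrite ?sqr1_inv|rewrite /pair_frob a2 eqxx].
Qed.

(** Used with [j] equal to 1 for the unitary blocks, and with 2 and 3 for eigenvalues that are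
    inverted only by the square or the cube of Frobenius. *)
Lemma unitary_vectors (lam : k) j m : (0 < j)%N -> lam != 0 -> lam ^+ (p ^ (d * j)) = lam^-1 ->
  (m <= \rank (eigenspace x lam))%N ->
  exists l : seq V, [/\ size l = m,
    forall u, u \in l -> [/\ u *m x = lam *: u, frb (d * j) (frb (d * j) u) = - u
       & bform J u (frb (d * j) u) = 1]
    & pairwise (fun u v => bform J u (frb (d * j) v) == 0) l].
Proof.
move=> j0 lam0 lamj hm; have dj0 : (0 < d * j)%N by rewrite muln_gt0 d0.
have [l [sl hl pl]] := @herm_basis k p hp halg _ J (@bform_alt k n) (unit_symplectic_form k n)
  x lam (d * j)%N dj0 (map_symplectic_form _ _) (Fx_iter j) xJ conj_diagonalizable lam0 lamj m hm.
by exists l; split=> // u /hl[/eigenspaceP].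
Qed.

(** In dimension 2 and 3 an orthonormal basis would give an anisotropic torus of the unitary group.
    Two of its vectors are therefore replaced by a hyperbolic pair; Frobenius then exchanges two
    symplectic pairs, and the torus of the frame contains a split torus of rank one. *)
Lemma unitary_pairs (a : k) : a ^+ Q.+1 = 1 -> a ^+ 2 != 1 ->
  let E := eigenspace x a in
  [/\ (1 <= \rank E)%N -> exists c0, pair_in a c0 /\ pair_frob a c0 c0,
      (2 <= \rank E)%N -> exists c0 c1,
        [/\ pair_in a c0, pair_in a c1, hyperbolic J c0 c1, pair_frob a c0 c1 & pair_frob a c1 c0] &
      (3 <= \rank E)%N -> exists c0 c1 c2,
        [/\ pair_in a c0, pair_in a c1, pair_in a c2, hyperbolic J c0 c1 &
        [/\ hyperbolic J c0 c2, hyperbolic J c1 c2, pair_frob a c0 c1, pair_frob a c1 c0 & pair_frob a c2 c2]]].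
Proof.
move=> aQ a2 E; have alt := @bform_alt k n.
have a0 : a != 0 by apply: contra_eq_neq aQ => ->; rewrite expr0n eq_sym oner_eq0.
have aV : a ^+ (p ^ d) = a^-1 by apply: (mulfI a0); rewrite -exprS aQ mulfV.
have aa : a * a != 1 by rewrite -expr2.
have aa' : a^-1 * a^-1 != 1 by rewrite -invfM invr_eq1.
have mkc0 u v : u *m x = a *: u -> v *m x = a *: v -> bform J u (frb d v) = 1 ->
    pair_in a (u, frb d v).
  by move=> ux vx uv; split=> //=; rewrite (frb_eigen Fx vx) aV.
have mkF u v : frb d (frb d v) = - v -> pair_frob a (u, frb d v) (v, frb d u).
  by move=> uu; rewrite /pair_frob (negPf a2).
have hE u u' v v' : u *m x = a *: u -> v *m x = a *: v -> u' *m x = a *: u' -> v' *m x = a *: v' ->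
    bform J u (frb d v') = 0 -> bform J (frb d u') v = 0 ->
    hyperbolic J (u, frb d u') (v, frb d v').
  move=> ux vx ux' vx' e1 e2; rewrite /hyperbolic /= e1 e2 eqxx /=.
  rewrite (bform_eigen xJ ux vx aa) eqxx /=.
  by apply/eqP/(bform_eigen xJ (frb_eigen Fx ux') (frb_eigen Fx vx')); rewrite aV.
have conj u v : frb d (frb d v) = - v -> (bform J u (frb d v)) ^+ Q = bform J v (frb d u).
  move=> av; rewrite -[LHS]/(frobr hp d _) bform_map ?map_symplectic_form // av bformNr.
  by rewrite bform_sym // opprK.
(* For orthonormal [u] and [v], the vector [u + c *: v] is isotropic as soon as [c ^+ Q.+1 = -1].
   This equation has [Q.+1] solutions, so at least two, and the vectors of two distinct solutions
   [c] and [c'] pair to [eta = 1 - c' / c], which is nonzero. *)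
have two u v : u *m x = a *: u -> v *m x = a *: v -> frb d (frb d u) = - u -> frb d (frb d v) = - v ->
    bform J u (frb d u) = 1 -> bform J v (frb d v) = 1 -> bform J u (frb d v) = 0 ->
    exists y z, [/\ y *m x = a *: y, z *m x = a *: z, frb d (frb d y) = - y, frb d (frb d z) = - z &
      [/\ bform J y (frb d z) = 1, bform J z (frb d y) = 1, bform J y (frb d y) = 0,
          bform J z (frb d z) = 0 &
          forall w, frb d (frb d w) = - w -> bform J u (frb d w) = 0 -> bform J v (frb d w) = 0 ->
            bform J y (frb d w) = 0 /\ bform J z (frb d w) = 0]].
  move=> ux vx au av uu vv uv; have vu : bform J v (frb d u) = 0.
    by rewrite -conj // uv expr0n expn_eq0 -leqn0 leqNgt (ltnW (prime_gt1 (pcharf_prime hp))).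
  have Qn : (Q.+1%:R : k) != 0 by rewrite -natr1 natp_eq0 // add0r oner_eq0.
  have [|rs [urs srs mrs]] := root_of_unity_seq (c := -1) _ Qn; first by rewrite oppr_eq0 oner_eq0.
  have p1 := prime_gt1 (pcharf_prime hp).
  have : (2 <= size rs)%N by rewrite srs ltnS expn_gt0 ltnW.
  case: rs urs srs mrs => [|c [|c' rs]] //= /andP[]; rewrite inE negb_or => /andP[cc' _] _ _ mrs _.
  have hc : c ^+ Q.+1 = -1 by apply/eqP; rewrite -mrs mem_head.
  have hc' : c' ^+ Q.+1 = -1 by apply/eqP; rewrite -mrs !inE eqxx orbT.
  have n10 : (-1 : k) != 0 by rewrite oppr_eq0 oner_eq0.
  have c0 : c != 0 by apply: contra_eq_neq hc => ->; rewrite expr0n eq_sym.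
  have c'0 : c' != 0 by apply: contra_eq_neq hc' => ->; rewrite expr0n eq_sym.
  have cQ : c ^+ Q = - c^-1 by apply: (mulfI c0); rewrite -exprS hc mulrN mulfV.
  have c'Q : c' ^+ Q = - c'^-1 by apply: (mulfI c'0); rewrite -exprS hc' mulrN mulfV.
  have NQ (b : k) : (- b) ^+ Q = - b ^+ Q by rewrite -[LHS]/(frobr hp d _) rmorphN.
  have cQQ : (c ^+ Q) ^+ Q = c by rewrite cQ NQ exprVn cQ invrN invrK opprK.
  have c'QQ : (c' ^+ Q) ^+ Q = c' by rewrite c'Q NQ exprVn c'Q invrN invrK opprK.
  pose eta := 1 - c' / c.
  have eta0 : eta != 0.
    by rewrite subr_eq0 eq_sym; apply: contra cc' => /eqP e; rewrite -[c]mul1r -e divfK.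
  have etaQ : eta ^+ Q = 1 - c / c'.
    rewrite -[LHS]/(frobr hp d _) rmorphB rmorph1 /=; congr (_ - _).
    by rewrite /frobr /frobp exprMn exprVn cQ c'Q invrN invrK mulrNN mulrC.
  have etaQQ : (eta ^+ Q) ^+ Q = eta.
    rewrite etaQ -[LHS]/(frobr hp d _) rmorphB rmorph1 /=; congr (_ - _).
    by rewrite /frobr /frobp exprMn exprVn cQ c'Q invrN invrK mulrNN mulrC.
  pose y := u + c *: v; pose z0 := u + c' *: v; pose z := eta^-1 *: z0.
  have Fy : frb d y = frb d u - c^-1 *: frb d v by rewrite map_mxD frbZ cQ scaleNr.
  have Fz0 : frb d z0 = frb d u - c'^-1 *: frb d v by rewrite map_mxD frbZ c'Q scaleNr.
  have Fz : frb d z = (eta ^+ Q)^-1 *: frb d z0 by rewrite frbZ exprVn.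
  have z0y : bform J z0 (frb d y) = eta.
    by rewrite Fy !bformE uu uv vu vv !mulr0 !mulr1 oppr0 addr0 add0r mulrN.
  have yz0 : bform J y (frb d z0) = eta ^+ Q.
    by rewrite etaQ Fz0 !bformE uu uv vu vv !mulr0 !mulr1 oppr0 addr0 add0r mulrN.
  exists y, z; split.
  - by rewrite mulmxDl -scalemxAl ux vx scalerDr !scalerA mulrC.
  - have z0x : z0 *m x = a *: z0 by rewrite mulmxDl -scalemxAl ux vx scalerDr !scalerA mulrC.
    by rewrite -scalemxAl z0x !scalerA mulrC.
  - by rewrite !map_mxD au !frbZ av cQQ scalerN opprD.
  - by rewrite !frbZ !exprVn etaQQ !map_mxD au !frbZ av c'QQ scalerN -opprD scalerN.
  - split.
    + by rewrite Fz bformZr yz0 mulVf // etaQ -etaQ expf_neq0.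
    + by rewrite bformZl z0y mulVf.
    + by rewrite Fy !bformE uu uv vu vv !mulr0 !mulr1 oppr0 addr0 add0r mulrN mulfV // subrr.
    + by rewrite Fz bformZl bformZr Fz0 !bformE uu uv vu vv !mulr0 !mulr1 oppr0 addr0 add0r mulrN mulfV // subrr !mulr0.
    + by move=> w aw uw vw; rewrite !bformE uw vw !mulr0 !addr0 mulr0.
have vec m : (m <= \rank E)%N -> exists l : seq V, [/\ size l = m,
    forall u, u \in l -> [/\ u *m x = a *: u, frb d (frb d u) = - u & bform J u (frb d u) = 1]
    & pairwise (fun u v => bform J u (frb d v) == 0) l].
  by move=> hm; have := @unitary_vectors a 1 m isT a0; rewrite !muln1; apply.
split=> hm; have [l [sl hl pl]] := vec _ hm.
- case: l sl hl pl => [|u []] //= _ hl _; have [ux au uu] := hl u (mem_head _ _).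
  by exists (u, frb d u); split; [apply: mkc0|apply: mkF].
- case: l sl hl pl => [|u [|v []]] //= _ hl; rewrite !andbT => /eqP uv.
  have [ux au uu] := hl u (mem_head _ _).
  have [|vx av vv] := hl v _; first by rewrite !inE eqxx orbT.
  have [y [z [yx zx ay az [yz zy yy zz _]]]] := two _ _ ux vx au av uu vv uv.
  exists (y, frb d z), (z, frb d y); split; [exact: mkc0|exact: mkc0| |exact: mkF|exact: mkF].
  by apply: hE => //; rewrite bform_sym // zz oppr0.
- case: l sl hl pl => [|u [|v [|t []]]] //= _ hl; rewrite !andbT => /andP[/andP[/eqP uv /eqP ut] /eqP vt].
  have [ux au uu] := hl u (mem_head _ _).
  have [|vx av vv] := hl v _; first by rewrite !inE eqxx orbT.
  have [|tx at_ tt] := hl t _; first by rewrite !inE eqxx !orbT.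
  have [y [z [yx zx ay az [yz zy yy zz h]]]] := two _ _ ux vx au av uu vv uv.
  have [yt zt] := h t at_ ut vt.
  have Q0 : 0 ^+ Q = 0 :> k.
    by rewrite expr0n expn_eq0 -leqn0 leqNgt (ltnW (prime_gt1 (pcharf_prime hp))).
  have ty : bform J t (frb d y) = 0 by rewrite -conj // yt.
  have tz : bform J t (frb d z) = 0 by rewrite -conj // zt.
  exists (y, frb d z), (z, frb d y), (t, frb d t); split; [exact: mkc0|exact: mkc0|exact: mkc0| |split].
  + by apply: hE => //; rewrite bform_sym // zz oppr0.
  + by apply: hE => //; rewrite bform_sym // tz oppr0.
  + by apply: hE => //; rewrite bform_sym // ty oppr0.
  + exact: mkF.
  + exact: mkF.
  + exact: mkF.
Qed.

Lemma eigenspace_rank_seq (s : seq 'I_(n + n)) a : uniq s -> (forall i, i \in s -> dgval dl i = a) ->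
  (size s <= \rank (eigenspace x a))%N.
Proof.
move=> us hs; apply: (@eigenspace_rank _ (tnth (in_tuple s))) => [|i].
  move=> i j; have x0 := tnth (in_tuple s) i; rewrite !(tnth_nth x0) => /eqP.
  by rewrite nth_uniq // => /eqP /val_inj.
by apply: hs; apply: mem_tnth.
Qed.

Lemma group_pairs a (l : seq 'I_n) : a ^+ Q.+1 = 1 -> uniq l -> (forall i, i \in l -> dl i = a) ->
  [/\ size l = 1%N -> exists c0, pair_in a c0 /\ pair_frob a c0 c0,
      size l = 2%N -> exists c0 c1,
        [/\ pair_in a c0, pair_in a c1, hyperbolic J c0 c1, pair_frob a c0 c1 & pair_frob a c1 c0] &
      size l = 3%N -> exists c0 c1 c2,
        [/\ pair_in a c0, pair_in a c1, pair_in a c2, hyperbolic J c0 c1 &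
        [/\ hyperbolic J c0 c2, hyperbolic J c1 c2, pair_frob a c0 c1, pair_frob a c1 c0 & pair_frob a c2 c2]]].
Proof.
move=> aQ ul hl.
have r1 : (size l <= \rank (eigenspace x a))%N.
  have := @eigenspace_rank_seq [seq lshift n i | i <- l] a; rewrite size_map; apply.
    by rewrite map_inj_uniq //; apply: lshift_inj.
  by move=> i /mapP[j jl ->]; rewrite dgvall hl.
have [a2|a2] := eqVneq (a ^+ 2) 1; last first.
  by have [h1 h2 h3] := unitary_pairs aQ a2; split=> e; rewrite e in r1; [apply: h1|apply: h2|apply: h3].
(* A self-inverse eigenvalue occurs in both halves of the frame, which doubles the dimension of its
   eigenspace. *)
have r2 : (2 * size l <= \rank (eigenspace x a))%N.
  have := @eigenspace_rank_seq ([seq lshift n i | i <- l] ++ [seq rshift n i | i <- l]) a.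
  rewrite size_cat !size_map (addnn (size l)) -mul2n; apply.
    rewrite cat_uniq !map_inj_uniq ?ul //; [|exact: rshift_inj|exact: lshift_inj].
    rewrite andbT; apply/hasPn => i /mapP[j jl ->]; apply/mapP => -[j' _] /eqP.
    by rewrite eq_rlshift.
  move=> i; rewrite mem_cat => /orP[] /mapP[j jl ->]; first by rewrite dgvall hl.
  by rewrite dgvalr hl // sqr1_inv.
have [l' [sl' hl' pl]] := flagged_pairs a2 r2.
split=> e; rewrite e in sl'.
- case: l' sl' hl' {pl} => [|c0 []] //= _ hl'; exists c0; have [h1 h2] := hl' c0 (mem_head _ _).
  by split.
- case: l' sl' hl' pl => [|c0 [|c1 []]] //= _ hl' /andP[/andP[h01 _] _].
  have [h1 h2] := hl' c0 (mem_head _ _).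
  have [|h3 h4] := hl' c1 _; first by rewrite !inE eqxx orbT.
  by exists c0, c1.
- case: l' sl' hl' pl => [|c0 [|c1 [|c2 []]]] //= _ hl' /and3P[/and3P[h01 h02 _] /andP[h12 _] _].
  have [h1 h2] := hl' c0 (mem_head _ _).
  have [|h3 h4] := hl' c1 _; first by rewrite !inE eqxx orbT.
  have [|h5 h6] := hl' c2 _; first by rewrite !inE eqxx !orbT.
  by exists c0, c1, c2.
Qed.

Lemma pair_cross a b c c' : a != 0 -> b != 0 -> a != b -> a * b != 1 ->
  c.1 *m x = a *: c.1 -> c.2 *m x = a^-1 *: c.2 -> c'.1 *m x = b *: c'.1 -> c'.2 *m x = b^-1 *: c'.2 ->
  hyperbolic J c c'.
Proof.
move=> a0 b0 ab ab1 h1 h2 h3 h4; rewrite /hyperbolic.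
rewrite (bform_eigen xJ h1 h3) // (bform_eigen xJ h1 h4); last first.
  by apply: contra ab => /eqP e; rewrite -[b]mul1r -e divfK.
rewrite (bform_eigen xJ h2 h3); last first.
  by apply: contra ab => /eqP e; rewrite -[a]mulr1 -e mulrA mulfV // mul1r.
by rewrite (bform_eigen xJ h2 h4) ?eqxx // -invfM invr_eq1.
Qed.

End General.

Section Patterns.
Variables (x g0 : 'M[k]_(3 + 3)).
Hypotheses (Fx : frb d x = x) (Sx : @Sp k 3 x) (Sg0 : @Sp k 3 g0).
Local Notation J := (symplectic_form k 3).
Local Notation framed dl sg eps := (exists g, [/\ @Sp k 3 g, g *m x = dgmx dl *m g & frb d g = nmx k sg eps *m g]).

Let exp_neq0 (a : k) j : a ^+ j.+1 = 1 -> a != 0.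
Proof. by move=> aQ; apply: contra_eq_neq aQ => ->; rewrite expr0n eq_sym oner_eq0. Qed.

Lemma frame_aaa a : a ^+ Q.+1 = 1 -> g0 *m x = dgmx (f3 a a a) *m g0 ->
  framed (f3 a a a) (if a ^+ 2 == 1 then 1%g else swap01) (fun=> a ^+ 2 != 1).
Proof.
move=> aQ g0x.
have [|_ _ /(_ erefl)[c0 [c1 [c2 [[x0 x0' b0] [x1 x1' b1] [x2 x2' b2] h01 [h02 h12 [f0 f0'] [f1 f1'] [f2 f2']]]]]]] :=
  group_pairs Fx Sx Sg0 g0x (l := [:: o0; o1; o2]) aQ isT.
  by elim/I3P.
apply: (@frame_of_pairs _ x (f3 c0 c1 c2)).
- by elim/I3P; elim/I3P.
- by elim/I3P.
- by elim/I3P.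
- by elim/I3P; move: f0 f1 f2; case: ifP; rewrite ?perm1 ?permE.
- by elim/I3P; move: f0' f1' f2'; case: ifP; rewrite ?perm1 ?permE.
Qed.

Lemma frame_aab a b : a ^+ Q.+1 = 1 -> b ^+ Q.+1 = 1 -> a != b -> a * b != 1 ->
  g0 *m x = dgmx (f3 a a b) *m g0 ->
  framed (f3 a a b) (if a ^+ 2 == 1 then 1%g else swap01) (f3 (a ^+ 2 != 1) (a ^+ 2 != 1) (b ^+ 2 != 1)).
Proof.
move=> aQ bQ ab ab1 g0x; have a0 := exp_neq0 aQ; have b0 := exp_neq0 bQ.
have [|_ /(_ erefl)[c0 [c1 [[x0 x0' b0'] [x1 x1' b1] h01 [f0 f0'] [f1 f1']]]] _] :=
  group_pairs Fx Sx Sg0 g0x (l := [:: o0; o1]) aQ isT.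
  by elim/I3P.
have [|/(_ erefl)[c2 [[x2 x2' b2] [f2 f2']]] _ _] :=
  group_pairs Fx Sx Sg0 g0x (l := [:: o2]) bQ isT.
  by elim/I3P.
apply: (@frame_of_pairs _ x (f3 c0 c1 c2)).
- by elim/I3P; elim/I3P => // _; apply: (pair_cross Sx a0 b0).
- by elim/I3P.
- by elim/I3P.
- by elim/I3P; move: f0 f1 f2; case: ifP; case: ifP; rewrite ?perm1 ?permE.
- by elim/I3P; move: f0' f1' f2'; case: ifP; case: ifP; rewrite ?perm1 ?permE.
Qed.

Lemma frame_abc a b c : a ^+ Q.+1 = 1 -> b ^+ Q.+1 = 1 -> c ^+ Q.+1 = 1 ->
  a != b -> a * b != 1 -> a != c -> a * c != 1 -> b != c -> b * c != 1 ->
  g0 *m x = dgmx (f3 a b c) *m g0 ->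
  framed (f3 a b c) 1%g (f3 (a ^+ 2 != 1) (b ^+ 2 != 1) (c ^+ 2 != 1)).
Proof.
move=> aQ bQ cQ ab ab1 ac ac1 bc bc1 g0x.
have a0 := exp_neq0 aQ; have b0 := exp_neq0 bQ; have c0 := exp_neq0 cQ.
have [|/(_ erefl)[p0 [[x0 x0' b0'] [f0 f0']]] _ _] := group_pairs Fx Sx Sg0 g0x (l := [:: o0]) aQ isT.
  by elim/I3P.
have [|/(_ erefl)[p1 [[x1 x1' b1] [f1 f1']]] _ _] := group_pairs Fx Sx Sg0 g0x (l := [:: o1]) bQ isT.
  by elim/I3P.
have [|/(_ erefl)[p2 [[x2 x2' b2] [f2 f2']]] _ _] := group_pairs Fx Sx Sg0 g0x (l := [:: o2]) cQ isT.
  by elim/I3P.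
apply: (@frame_of_pairs _ x (f3 p0 p1 p2)).
- elim/I3P; elim/I3P => // _; [exact: (pair_cross Sx a0 b0)|exact: (pair_cross Sx a0 c0)|exact: (pair_cross Sx b0 c0)].
- by elim/I3P.
- by elim/I3P.
- by elim/I3P; rewrite perm1; move: f0 f1 f2; case: ifP; case: ifP; case: ifP.
- by elim/I3P; rewrite perm1; move: f0' f1' f2'; case: ifP; case: ifP; case: ifP.
Qed.

Let frob1 (u v : 'rV[k]_(3 + 3)) : bform J u v = 1 -> bform J (frb d u) (frb d v) = 1.
Proof. by move=> e; rewrite -bform_map ?map_symplectic_form // e rmorph1. Qed.

(** With F for Frobenius, a vector [u] of norm 1 for the Hermitian form attached to F^2 gives the
    pairs (u, F^2 u) and (F u, F^3 u). Frobenius runs through these four vectors and closes up with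
    F^4 u = - u, which is the single sign of the signed permutation. *)
Lemma frame_quad lam c : lam ^+ (p ^ (d * 2)) = lam^-1 -> lam != 0 -> lam ^+ 2 != 1 -> c ^+ Q.+1 = 1 ->
  g0 *m x = dgmx (f3 lam (lam ^+ Q) c) *m g0 ->
  framed (f3 lam (lam ^+ Q) c) swap01 (f3 false true (c ^+ 2 != 1)).
Proof.
move=> lamj lam0 lam2 cQ g0x; have c_neq0 := exp_neq0 cQ.
have QQ (a : k) : (a ^+ Q) ^+ Q = a ^+ (p ^ (d * 2)) by rewrite -exprM -expnD addnn -muln2.
have lQ0 : lam ^+ Q != 0 by rewrite expf_neq0.
have hl1 : lam != lam ^+ Q.
  apply: contra lam2 => /eqP e; move: lamj; rewrite -QQ -!e => e2.
  by rewrite expr2 {2}e2 mulfV.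
have hl2 : lam * lam ^+ Q != 1.
  apply: contra lam2 => /eqP e; have e1 : lam ^+ Q = lam^-1 by apply: (mulfI lam0); rewrite e mulfV.
  move: lamj; rewrite -QQ e1 exprVn e1 invrK => e2.
  by rewrite expr2 {2}e2 mulfV.
(* No Frobenius conjugate of [lam] is a root of unity of order dividing [Q.+1], whereas [c] and
   [c^-1] are. *)
have cross j : lam ^+ (p ^ j) != c /\ lam ^+ (p ^ j) * c != 1.
  have hinj (a : k) : a ^+ (p ^ j) = 1 -> a = 1.
    by move=> e; apply: (@frob_inj k p hp j); rewrite /= expr1n.
  have key (b : k) : b ^+ Q.+1 = 1 -> lam ^+ (p ^ j) != b.
    move=> bQ; apply: contra hl2 => /eqP e; rewrite -exprS; apply/eqP/hinj.
    by rewrite exprAC e bQ.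
  split; first exact: key.
  apply: contraTneq (key c^-1 _) => [e|]; last by rewrite exprVn cQ invr1.
  by rewrite negbK; apply/eqP; apply: (mulIf c_neq0); rewrite e mulVf.
have e2 (v : 'rV[k]_(3 + 3)) : frb (d * 2) v = frb d (frb d v) by rewrite frbD (addnn d) -muln2.
have rk : (1 <= \rank (eigenspace x lam))%N.
  by apply: (@eigenspace_rank_seq _ x g0 _ Sg0 g0x [:: lshift 3 o0]) => // i; rewrite inE => /eqP ->; rewrite dgvall.
have [[|u us] [sl hu _]] := @unitary_vectors _ x g0 _ Fx Sx Sg0 g0x lam 2 1 isT lam0 lamj rk; first by [].
have {hu} [ux au uu] := hu u (mem_head _ _); rewrite !e2 in au uu.
have [|/(_ erefl)[p2 [[x2 x2' b2] [f2 f2']]] _ _] := group_pairs Fx Sx Sg0 g0x (l := [:: o2]) cQ isT.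
  by elim/I3P.
have u1x := frb_eigen Fx ux; have u2x := frb_eigen Fx u1x; have u3x := frb_eigen Fx u2x.
rewrite QQ lamj in u2x u3x; rewrite exprVn in u3x.
apply: (@frame_of_pairs _ x (f3 (u, frb d (frb d u)) (frb d u, frb d (frb d (frb d u))) p2)).
- elim/I3P; elim/I3P => // _.
  + exact: (pair_cross Sx lam0 lQ0).
  + by have [h1 h2] := cross 0%N; rewrite expr1 in h1 h2; apply: (pair_cross Sx lam0 c_neq0).
  + by have [h1 h2] := cross d; apply: (pair_cross Sx lQ0 c_neq0).
- by elim/I3P => //=; apply: frob1.
- by elim/I3P.
- by elim/I3P; rewrite permE //; move: f2; case: ifP.
- by elim/I3P; rewrite permE //; move: f2'; case: ifP.
Qed.

(** As for the quadratic case, with the Hermitian form attached to the cube of Frobenius: the six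
    conjugates of [u] form three pairs and the sixth twist of [u] is [- u]. *)
Lemma frame_cubic lam : lam ^+ (p ^ (d * 3)) = lam^-1 -> lam != 0 -> lam ^+ Q.+1 != 1 ->
  g0 *m x = dgmx (f3 lam (lam ^+ Q) (lam ^+ Q ^+ Q)) *m g0 ->
  framed (f3 lam (lam ^+ Q) (lam ^+ Q ^+ Q)) rot3 (f3 false false true).
Proof.
move=> lamj lam0 lamQ g0x.
have QQ (a : k) : ((a ^+ Q) ^+ Q) ^+ Q = a ^+ (p ^ (d * 3)).
  by rewrite -!exprM -!expnD; congr (_ ^+ (_ ^ _)); lia.
have lQ0 : lam ^+ Q != 0 by rewrite expf_neq0.
have lQQ0 : lam ^+ Q ^+ Q != 0 by rewrite expf_neq0.
have hl1 : lam * lam ^+ Q != 1 by rewrite -exprS.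
have hl2 : lam != lam ^+ Q.
  apply: contra lamQ => /eqP e; move: lamj; rewrite -QQ -!e => e2.
  by rewrite exprS -e {2}e2 mulfV.
have hl3 : lam != lam ^+ Q ^+ Q.
  apply: contra lamQ => /eqP e; move: lamj; rewrite -QQ -e => e2.
  by rewrite exprS e2 mulfV.
have hl4 : lam * lam ^+ Q ^+ Q != 1.
  apply: contra hl2 => /eqP e; have e1 : lam ^+ Q ^+ Q = lam^-1 by apply: (mulfI lam0); rewrite e mulfV.
  by move: lamj; rewrite -QQ e1 exprVn => /invr_inj ->.
have hl5 : lam ^+ Q != lam ^+ Q ^+ Q.
  by apply: contra hl2 => /eqP /(@frob_inj k p hp d) <-.
have hl6 : lam ^+ Q * lam ^+ Q ^+ Q != 1.
  rewrite -exprMn; apply: contra hl1 => /eqP e; apply/eqP/(@frob_inj k p hp d).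
  by rewrite /= expr1n.
have e3 (v : 'rV[k]_(3 + 3)) : frb (d * 3) v = frb d (frb d (frb d v)).
  by rewrite !frbD (_ : (d * 3 = d + (d + d))%N) //; lia.
have rk : (1 <= \rank (eigenspace x lam))%N.
  by apply: (@eigenspace_rank_seq _ x g0 _ Sg0 g0x [:: lshift 3 o0]) => // i; rewrite inE => /eqP ->; rewrite dgvall.
have [[|u us] [sl hu _]] := @unitary_vectors _ x g0 _ Fx Sx Sg0 g0x lam 3 1 isT lam0 lamj rk; first by [].
have {hu} [ux au uu] := hu u (mem_head _ _); rewrite !e3 in au uu.
have u1x := frb_eigen Fx ux; have u2x := frb_eigen Fx u1x; have u3x := frb_eigen Fx u2x.
have u4x := frb_eigen Fx u3x; have u5x := frb_eigen Fx u4x.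
rewrite QQ lamj in u3x u4x u5x; rewrite !exprVn in u4x u5x.
apply: (@frame_of_pairs _ x (f3 (u, frb d (frb d (frb d u))) (frb d u, frb d (frb d (frb d (frb d u))))
   (frb d (frb d u), frb d (frb d (frb d (frb d (frb d u))))))).
- elim/I3P; elim/I3P => // _.
  + exact: (pair_cross Sx lam0 lQ0).
  + exact: (pair_cross Sx lam0 lQQ0).
  + exact: (pair_cross Sx lQ0 lQQ0).
- by elim/I3P => //=; do ?apply: frob1.
- by elim/I3P.
- by elim/I3P; rewrite permE.
- by elim/I3P; rewrite permE.
Qed.

End Patterns.
End Frames.

(** * Self-centralizing commutative sets of semisimple symplectic matrices *)

Lemma finite_order_diagonalizable (k : closedFieldType) m (t : 'M[k]_m.+1) N :
  (N%:R : k) != 0 -> t ^+ N = 1 -> diagonalizable t.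
Proof.
move=> N0 tN; have N_gt0 : (0 < N)%N by case: N N0 {tN} => //; rewrite eqxx.
have [rs [urs srs mrs]] := root_of_unity_seq (c := 1) (oner_neq0 _) N0.
apply/diagonalizableP; exists rs => //.
have -> : \prod_(x <- rs) ('X - x%:P) = 'X^N - 1%:P :> {poly k}.
  rewrite (@all_roots_prod_XsubC _ ('X^N - 1%:P) rs).
  - by rewrite lead_coefXnsubC // scale1r.
  - by rewrite size_XnsubC // srs.
  - by apply/allP => x; rewrite mrs /root !hornerE subr_eq0.
  - by rewrite uniq_rootsE.
apply: mxminpoly_min; rewrite rmorphB /= rmorphXn /= horner_mx_X horner_mx_C tN.
exact: subrr.
Qed.

(** Reduces the simultaneous diagonalization of an infinite set to that of a finite family. Without
    a maximal independent family the ranks would grow beyond [m * n]. *)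
Lemma exists_matrix_span (k : fieldType) m n (T : set 'M[k]_(m, n)) :
  exists ts : seq 'M[k]_(m, n), (forall t, t \in ts -> T t) /\
    forall t, T t -> exists c : 'I_(size ts) -> k, t = \sum_i c i *: ts`_i.
Proof.
pose mat (ts : seq 'M[k]_(m, n)) := \matrix_(i < size ts) mxvec ts`_i.
have [ts [hts hmax]] : exists ts : seq 'M[k]_(m, n), (forall t, t \in ts -> T t) /\
    forall t, T t -> (mxvec t <= mat ts)%MS.
  apply: contrapT => hno.
  have {hno} step ts : (forall t, t \in ts -> T t) ->
      exists2 t, T t & ~~ (mxvec t <= mat ts)%MS.
    move=> hts; apply: contrapT => h; apply: hno; exists ts; split=> // t Tt.
    by apply: contrapT => /negP ht; apply: h; exists t.
  have [ts [hts rts]] : exists ts : seq 'M[k]_(m, n), (forall t, t \in ts -> T t) /\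
      ((m * n).+1 <= \rank (mat ts))%N.
    elim: (m * n).+1 => [|j [ts [hts rts]]]; first by exists [::].
    have [t Tt nt] := step ts hts; exists (t :: ts); split.
      by move=> u; rewrite inE => /predU1P[->|/hts].
    have le1 : (mat ts <= mat (t :: ts))%MS.
      apply/row_subP => i; rewrite rowK.
      have -> : mxvec ts`_i = row (lift ord0 i) (mat (t :: ts)) by rewrite rowK.
      exact: row_sub.
    have lt : (mat ts < mat (t :: ts))%MS.
      rewrite ltmxE le1 /=; apply: contra nt; apply: submx_trans.
      have -> : mxvec t = row ord0 (mat (t :: ts)) by rewrite rowK.
      exact: row_sub.
    exact: leq_ltn_trans rts (rank_ltmx lt).
  by have := leq_trans rts (rank_leq_col _); rewrite ltnn.
exists ts; split=> // t /hmax /submxP[D tD]; exists (D 0).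
apply: (can_inj mxvecK); rewrite tD linear_sum mulmx_sum_row /=.
by apply: eq_bigr => i _; rewrite linearZ rowK.
Qed.

(** Chooses one element in each orbit of a free involution; applied to opposite weights, it selects
    the first half of a symplectic basis. *)
Lemma half_system (n : nat) (I : finType) (bar : I -> I) (A : {set I}) :
  involutive bar -> (forall i, bar i != i) -> {in A, forall i, bar i \in A} -> #|A| = (n + n)%N ->
  exists h : 'I_n -> I, [/\ forall i, h i \in A, injective h & forall i j, bar (h i) != h j].
Proof.
move=> barK barN; elim: n A => [|n IHn] A hA cA.
  by exists (fun i : 'I_0 => match i with Ordinal _ h => False_rect I (notF h) end); split; case.
have [a aA] : exists a, a \in A by apply/set0Pn; rewrite -card_gt0 cA addnS.
have ba : bar a \in A by apply: hA.
have [||h [hh hi hb]] := IHn (A :\ a :\ bar a).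
- move=> i; rewrite !inE => /and3P[h1 h2 h3]; rewrite hA // andbT.
  by rewrite (can_eq barK) h2 -(can_eq barK) barK h1.
- have := cardsD1 a A; rewrite aA cA /= add1n addSn => -[].
  have := cardsD1 (bar a) (A :\ a); rewrite !inE barN ba /= add1n => -> /eqP.
  by rewrite addnS eqSS => /eqP.
have hn i : [/\ h i != a, h i != bar a & h i \in A].
  by have := hh i; rewrite !inE => /and3P[].
exists (fun i => if unlift ord0 i is Some j then h j else a); split.
- by move=> i; case: unliftP => [j _|_] //; have [] := hn j.
- move=> i j; case: (unliftP ord0 i) => [i'|] ->; case: (unliftP ord0 j) => [j'|] -> //.
  + by move=> /hi ->.
  + by have [/eqP h1 _ _] := hn i' => /h1.
  + by have [/eqP h1 _ _] := hn j' => /esym/h1.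
- move=> i j; case: (unliftP ord0 i) => [i' _|_]; case: (unliftP ord0 j) => [j' _|_] //.
  + by have [_ h1 _] := hn i'; apply: contra h1 => /eqP <-; rewrite barK.
  + by have [_ h1 _] := hn j'; rewrite eq_sym.
Qed.

Section SelfCentralizing.
Variables (k : closedFieldType) (n0 : nat).
Local Notation n := n0.+1.
Local Notation J := (symplectic_form k n).
Local Notation V := 'rV[k]_(n + n).
Variable T : set 'M[k]_(n + n).
Hypotheses (TSp : T `<=` @Sp k n) (Tcomm : forall s t, T s -> T t -> s *m t = t *m s)
  (Tfin : forall t, T t -> exists2 N, (N%:R : k) != 0 & (t : 'M[k]_((n0 + n).+1)) ^+ N = 1)
  (Tcent : forall x, @Sp k n x -> (forall t, T t -> x *m t = t *m x) -> T x).

Definition weight_vector (u : V) := forall t, T t -> exists c, u *m t = c *: u.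

Lemma codiagonal_basis : exists2 P : 'M[k]_(n + n), P \in unitmx & forall i, weight_vector (row i P).
Proof.
have [ts [hts span]] := exists_matrix_span T.
have : codiagonalizable (ts : seq 'M[k]_((n0 + n).+1)).
  apply/codiagonalizableP; split=> [|t /hts /Tfin [N N0 tN]].
    by move=> s t /hts Ts /hts Tt; apply: Tcomm.
  exact: finite_order_diagonalizable tN.
case=> P uP /allP hP; exists P => // i t /span[c ->].
have /choice[e he] : forall j : 'I_(size ts), exists e, row i P *m ts`_j = e *: row i P.
  move=> j; have /diagonalizable_forPex[D] := hP ts`_j (mem_nth _ (ltn_ord j)).
  move/(simmxPp (stablemx_unit _ uP)) => PD; exists (D 0 i).
  by apply/rowP => l; rewrite -row_mul PD mul_diag_mx !mxE.
exists (\sum_j c j * e j); rewrite mulmx_sumr scaler_suml; apply: eq_bigr => j _.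
by rewrite -scalemxAr he scalerA.
Qed.

Let alt := @bform_alt k n.
Let uJ := unit_symplectic_form k n.

(** The unipotent [1%:M + N] is symplectic and commutes with [T], so it belongs to [T]. Elements of
    [T] are diagonalizable, and a diagonalizable unipotent is trivial. *)
Lemma nilpotent_centralizer (N : 'M[k]_(n + n)) : N *m N = 0 ->
  (forall y z, bform J (y *m N) z + bform J y (z *m N) + bform J (y *m N) (z *m N) = 0) ->
  (forall t, T t -> N *m t = t *m N) -> N = 0.
Proof.
move=> NN NJ Nt; have [P uP hP] := codiagonal_basis.
have Tx : T (1%:M + N).
  apply: Tcent => [|t Tt]; last by rewrite mulmxDl mulmxDr mul1mx mulmx1 Nt.
  apply/SpP/matrixP => i j; rewrite bform_mx.
  have -> : J i j = bform J (row i 1%:M) (row j 1%:M) by rewrite -bform_mx mul1mx trmx1 mulmx1.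
  have rN l : row l (1%:M + N) = row l 1%:M + row l 1%:M *m N by rewrite linearD /= -row_mul mul1mx.
  rewrite !rN bformDl !bformDr -[RHS]addr0 -[X in _ = _ + X](NJ (row i 1%:M) (row j 1%:M)).
  by ring.
have PN : P *m N = 0.
  apply/row_matrixP => i; rewrite row_mul row0; have [c hc] := hP i _ Tx.
  have Nc : row i P *m N = (c - 1) *: row i P.
    by rewrite scalerBl scale1r -hc mulmxDr mulmx1 addrAC subrr add0r.
  have : (c - 1) * (c - 1) *: row i P = 0 by rewrite -scalerA -Nc scalemxAl -Nc -mulmxA NN mulmx0.
  move/eqP; rewrite scaler_eq0 mulf_eq0 orbb => /orP[/eqP e|/eqP e]; first by rewrite Nc e scale0r.
  by rewrite e mul0mx.
by rewrite -[N](mulKmx uP) PN mulmx0.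
Qed.

Lemma dual_weight (u : V) t c : u != 0 -> T t -> u *m t = c *: u -> c != 0.
Proof.
move=> u0 Tt ut; have ut_ := Sp_unit (TSp Tt); apply: contra u0 => /eqP c0.
by rewrite -[u](mulmxK ut_) ut c0 scale0r mul0mx.
Qed.

(** If [u] and [v] were orthogonal, the map [N0] sending [y] to
    [bform J y u *: v + bform J y v *: u] would have square zero and commute with [T], hence vanish.
    Then [v] is a multiple of [u], and the same argument kills the map sending [y] to
    [bform J y u *: u], which is absurd. *)
Lemma weight_pairing (u v : V) : u != 0 -> v != 0 ->
  (forall t, T t -> exists2 c, u *m t = c *: u & v *m t = c^-1 *: v) -> bform J u v != 0.
Proof.
move=> u0 v0 huv; apply/negP => /eqP uv.
have vu : bform J v u = 0 by rewrite bform_sym // uv oppr0.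
have ex (w : V) : w != 0 -> exists y : V, bform J y w != 0.
  move=> w0; apply: contrapT => h; case/eqP: w0; apply: (bform_nondeg uJ (unitmx1 _ _)) => i.
  by apply: contrapT => /eqP h'; apply: h; exists (row i 1%:M).
have comm (w w' : V) : (forall t, T t -> exists2 c, w *m t = c *: w & w' *m t = c^-1 *: w') ->
    forall t, T t -> (J *m w^T *m w') *m t = t *m (J *m w^T *m w').
  move=> h t Tt; have [c wc w'c] := h t Tt.
  have tJ : t *m J = J *m (invmx t)^T.
    have ut := Sp_unit (TSp Tt); have /SpP e := TSp Tt.
    by rewrite -[t *m J](mulmxK (_ : t^T \in unitmx)) ?unitmx_tr // e trmx_inv.
  have [w0|w0] := eqVneq w 0; first by rewrite w0 trmx0 mulmx0 !mul0mx mulmx0.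
  have wV : w *m invmx t = c^-1 *: w.
    have ut := Sp_unit (TSp Tt); apply: (can_inj (mulmxK ut)); rewrite mulmxKV //.
    by rewrite -scalemxAl wc scalerA mulVf ?scale1r // (dual_weight w0 Tt wc).
  rewrite -(mulmxA _ w') w'c -scalemxAr !mulmxA tJ -(mulmxA J) -trmx_mul wV.
  by rewrite linearZ /= -scalemxAr -scalemxAl.
have act (w w' y : V) : y *m (J *m w^T *m w') = bform J y w *: w'.
  rewrite mulmxA /bform [y *m (J *m w^T)]mx11_scalar mul_scalar_mx !mulmxA //.
have [N0 hN0] : exists N, N = J *m u^T *m v + J *m v^T *m u by eexists.
have actN y : y *m N0 = bform J y u *: v + bform J y v *: u by rewrite hN0 mulmxDr !act.
have hvu t : T t -> exists2 c, v *m t = c *: v & u *m t = c^-1 *: u.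
  by move=> /huv[c h1 h2]; exists c^-1; rewrite ?invrK.
have NN (y : V) : y *m N0 *m N0 = 0.
  by rewrite (actN y) mulmxDl -!scalemxAl !actN !alt uv vu !scale0r !addr0 !scaler0 addr0.
have NZ : N0 = 0.
  apply: nilpotent_centralizer.
  - by apply/row_matrixP => i; rewrite rowE mulmxA NN row0.
  - move=> y z; rewrite !actN !bformE !alt uv vu (bform_sym alt v z) (bform_sym alt u z).
    by ring.
  - by move=> t Tt; rewrite hN0 mulmxDl mulmxDr !comm.
have [y yu] := ex u u0.
have := actN y; rewrite NZ mulmx0 => /esym/eqP; rewrite addr_eq0 => /eqP e.
have {e} vE : v = (- bform J y v / bform J y u) *: u.
  by rewrite mulNr scaleNr mulrC -scalerA -scalerN -e scalerA mulVf // scale1r.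
move: (- _ / _) vE => b vE.
have NZ2 : J *m u^T *m u = 0.
  apply: nilpotent_centralizer.
  - have uJu : u *m J *m u^T = 0 by apply/matrixP => i j; rewrite !ord1 [RHS]mxE; apply: alt.
    have -> : J *m u^T *m u *m (J *m u^T *m u) = J *m u^T *m (u *m J *m u^T) *m u by rewrite !mulmxA.
    by rewrite uJu mulmx0 mul0mx.
  - by move=> w z; rewrite !act !bformE !alt (bform_sym alt u z); ring.
  - apply: comm => t Tt; have [c uc vc] := huv t Tt; exists c => //.
    have b0 : b != 0 by apply: contraNneq v0 => b0; rewrite vE b0 scale0r.
    apply: (scalerI b0); rewrite scalemxAl -vE vc vE !scalerA mulrC //.
have := act u u y; rewrite NZ2 mulmx0 => /esym/eqP.
by rewrite scaler_eq0 (negPf yu) (negPf u0).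
Qed.

(** Every weight line has exactly one dual line, so a weight basis splits into [n] opposite pairs
    and rescales to a symplectic basis. Self-centralization then puts in [T] every diagonal matrix
    of that basis, which makes [T] the whole diagonal torus. *)
Lemma torus_frame : exists2 g : 'M[k]_(n + n), @Sp k n g &
  forall t, T t <-> exists2 d : 'I_n -> k, (forall i, d i != 0) & g *m t = dgmx d *m g.
Proof.
have [P uP hP] := codiagonal_basis; pose b i := row i P.
have bind i j c : i != j -> b j != c *: b i.
  move=> ij; apply/negP => /eqP/(congr1 (mulmx^~ (invmx P))).
  rewrite -scalemxAl -!row_mul mulmxV // => /rowP/(_ j); rewrite !mxE eqxx (negPf ij) mulr0.
  by move/eqP; rewrite oner_eq0.
have b0 i : b i != 0.
  apply/negP => /eqP/(congr1 (mulmx^~ (invmx P))); rewrite mul0mx -row_mul mulmxV //.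
  by move/rowP/(_ i); rewrite !mxE eqxx => /eqP; rewrite oner_eq0.
pose dual i j := forall t, T t -> exists2 c, b i *m t = c *: b i & b j *m t = c^-1 *: b j.
have dual_of i j : bform J (b i) (b j) != 0 -> dual i j.
  move=> ij t Tt; have [c hc] := hP i t Tt; have [c' hc'] := hP j t Tt; exists c => //.
  suff /eqP e : c * c' == 1.
    by rewrite hc' -[c' in LHS]mul1r -(mulVf (dual_weight (b0 i) Tt hc)) -mulrA e mulr1.
  apply: contraT => h; case/eqP: ij; apply: (bform_eigen _ hc hc' h); exact/SpP/TSp.
have dual_pair i j : dual i j -> bform J (b i) (b j) != 0 by move=> h; apply: weight_pairing.
have dual_sym i j : dual i j -> dual j i.
  by move=> h t /h[c h1 h2]; exists c^-1; rewrite ?invrK.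
have dual_uniq i j j' : dual i j -> dual i j' -> j = j'.
  move=> h h'; apply/eqP; apply: contraT => jj'.
  have hij := dual_pair _ _ h.
  (* A combination of two vectors dual to [b i] still has the opposite weight; chosen orthogonal to
     [b i], it contradicts [weight_pairing]. *)
  pose w := b j' - (bform J (b i) (b j') / bform J (b i) (b j)) *: b j.
  have w0 : w != 0 by rewrite subr_eq0 bind.
  have : bform J (b i) w != 0.
    apply: weight_pairing => // t Tt; have [c h1 h2] := h t Tt; have [c' h1' h2'] := h' t Tt.
    have cc' : c = c'.
      apply/eqP; rewrite -subr_eq0; have := b0 i; apply: contraNT => c0.
      by have /eqP : (c - c') *: b i = 0; rewrite ?scaler_eq0 ?(negPf c0) // scalerBl -h1 -h1' subrr.
    by exists c => //; rewrite mulmxBl -scalemxAl h2 h2' -cc' scalerBr !scalerA [_^-1 * _]mulrC.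
  by rewrite bformDr bformNr bformZr divfK // subrr eqxx.
have /choice[bar hbar] : forall i, exists j, dual i j.
  move=> i; apply: contrapT => h; case/eqP: (b0 i).
  apply: (bform_nondeg uJ uP) => j; apply/eqP; apply: contraT => ji.
  by exfalso; apply: h; exists j; apply/dual_sym/dual_of.
have barK : involutive bar by move=> i; apply/esym/(dual_uniq (bar i)) => //; apply/dual_sym.
have barN i : bar i != i.
  by apply/eqP => e; have := dual_pair _ _ (hbar i); rewrite e alt eqxx.
have [||h [_ hi hb]] := @half_system n _ bar finset.setT barK barN.
- by move=> i _; rewrite inE.
- by rewrite cardsT card_ord.
pose u i := b (h i); pose c i := bform J (u i) (b (bar (h i))).
pose v i := (c i)^-1 *: b (bar (h i)).
have c0 i : c i != 0 by apply: dual_pair.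
have zero i j : j != bar i -> bform J (b i) (b j) = 0.
  move=> ji; apply/eqP; apply: contraT => h'; case/eqP: ji.
  by apply: (dual_uniq i) => //; apply: dual_of.
pose g := symp_rows u v.
have Sg : @Sp k n g.
  apply/SpP/symp_rows_isom => // i j.
  - by apply: zero; rewrite eq_sym.
  - by rewrite bformZl bformZr zero ?mulr0 // barK.
  - rewrite bformZr; case: (eqVneq i j) => [->|ij]; first by rewrite mulVf.
    rewrite zero ?mulr0 // (can_eq barK) eq_sym; apply: contra ij => /eqP /hi ->.
    exact: eqxx.
have ug := Sp_unit Sg; exists g => // t.
have toT s : T s -> exists2 d : 'I_n -> k, (forall i, d i != 0) & g *m s = dgmx d *m g.
  move=> Ts; have /choice[d hd] : forall i : 'I_n, exists a, u i *m s = a *: u i /\ v i *m s = a^-1 *: v i.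
    move=> i; have [a h1 h2] := hbar (h i) s Ts; exists a; split=> //.
    by rewrite -scalemxAl h2 !scalerA mulrC.
  exists d => [i|]; first by have [h1 _] := hd i; apply: (dual_weight (b0 (h i)) Ts h1).
  apply: dgmx_eq; elim/ord_addP => i; rewrite row_mul ?row_symp_rowsl ?row_symp_rowsr ?dgvall ?dgvalr;
    by have [] := hd i.
split; first exact: toT.
case=> d d0 gt; apply: Tcent => [|s /toT[d' d'0 gs]].
  have -> : t = invmx g *m (dgmx d *m g) by rewrite -gt mulKmx.
  by apply/SpM/SpM; [apply: SpV|apply: dgmx_Sp|].
apply: (can_inj (mulKmx ug)); rewrite !mulmxA gt gs -!mulmxA gt gs !mulmxA.
by congr (_ *m _); rewrite diag_mxC.
Qed.

End SelfCentralizing.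

(** * Determinants on the indecomposables of a graded ring of invariants *)

Section GradedDet.
Variables (r : nat) (Inv : set {mpoly rat[r]}) (Fr : {mpoly rat[r]} -> {mpoly rat[r]}).
Local Notation mp := {mpoly rat[r]}.

Definition inv_pos (p : mp) : Prop := Inv p /\ p@_0%MM = 0.

Definition inv_dec (p : mp) : Prop := exists s : seq (mp * mp),
  {in s, forall u, inv_pos u.1 /\ inv_pos u.2} /\ p = \sum_(u <- s) u.1 * u.2.

Definition lincomb s (e : 'I_s -> mp) (c : 'I_s -> rat) : mp := \sum_(i < s) c i *: e i.

(** This is [graded_det] with the invariants and the Frobenius as parameters, so that it can be
    computed and transported without mention of a group. *)
Definition inv_gdet (d : nat) (P : {poly rat}) : Prop :=
  exists (s : nat) (e : 'I_s -> mp) (B : 'M[rat]_s),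
    [/\ forall i, inv_pos (e i) /\ e i \is d.-homog,
        forall p, inv_pos p -> p \is d.-homog ->
          exists! c : {ffun 'I_s -> rat}, inv_dec (p - \sum_(i < s) c i *: e i),
        forall i, inv_dec (Fr (e i) - \sum_(j < s) B i j *: e j) &
        P = \det (1%:M - 'X *: map_mx polyC B)].

Hypotheses (InvD : forall p q, Inv p -> Inv q -> Inv (p + q))
  (InvZ : forall c p, Inv p -> Inv (c *: p)).

Lemma inv_pos0 p : inv_pos p -> inv_pos 0.
Proof. by case=> Ip _; split; [rewrite -(scale0r p); apply: InvZ|rewrite mcoeff0]. Qed.

Lemma inv_posD p q : inv_pos p -> inv_pos q -> inv_pos (p + q).
Proof. by case=> Ip p0 [Iq q0]; split; [apply: InvD|rewrite mcoeffD p0 q0 addr0]. Qed.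

Lemma inv_posZ c p : inv_pos p -> inv_pos (c *: p).
Proof. by case=> Ip p0; split; [apply: InvZ|rewrite mcoeffZ p0 mulr0]. Qed.

Lemma inv_dec0 : inv_dec 0.
Proof. by exists [::]; rewrite big_nil. Qed.

Lemma inv_decD p q : inv_dec p -> inv_dec q -> inv_dec (p + q).
Proof.
case=> s [hs ->] [t [ht ->]]; exists (s ++ t); rewrite big_cat; split=> // u.
by rewrite mem_cat => /orP[/hs|/ht].
Qed.

Lemma inv_decZ c p : inv_dec p -> inv_dec (c *: p).
Proof.
case=> s [hs ->]; exists [seq (c *: u.1, u.2) | u <- s]; split.
  by move=> u /mapP[v vs ->]; have [h1 h2] := hs v vs; split=> //; apply: inv_posZ.
by rewrite big_map scaler_sumr; apply: eq_bigr => u _; rewrite scalerAl.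
Qed.

Lemma inv_decN p : inv_dec p -> inv_dec (- p).
Proof. by rewrite -scaleN1r; apply: inv_decZ. Qed.

Lemma inv_decB p q : inv_dec p -> inv_dec q -> inv_dec (p - q).
Proof. by move=> hp hq; apply/inv_decD/inv_decN. Qed.

Lemma inv_decM p q : inv_pos p -> inv_pos q -> inv_dec (p * q).
Proof.
by move=> hp hq; exists [:: (p, q)]; rewrite big_seq1; split=> // u; rewrite inE => /eqP ->.
Qed.

Lemma inv_dec_sum I (l : seq I) (P : pred I) (f : I -> mp) :
  (forall i, P i -> inv_dec (f i)) -> inv_dec (\sum_(i <- l | P i) f i).
Proof. by move=> hf; elim/big_ind: _ => //; [apply: inv_dec0|move=> x y; apply: inv_decD]. Qed.

Lemma lincombD s (e : 'I_s -> mp) c c' :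
  lincomb e (fun i => c i + c' i) = lincomb e c + lincomb e c'.
Proof. by rewrite -big_split; apply: eq_bigr => i _; rewrite scalerDl. Qed.

Lemma lincombZ s (e : 'I_s -> mp) a c : lincomb e (fun i => a * c i) = a *: lincomb e c.
Proof. by rewrite scaler_sumr; apply: eq_bigr => i _; rewrite scalerA. Qed.

Lemma inv_gdet_intro d s (e : 'I_s -> mp) (B : 'M[rat]_s) :
  (forall i, inv_pos (e i) /\ e i \is d.-homog) ->
  (forall p, inv_pos p -> p \is d.-homog -> exists c, inv_dec (p - lincomb e c)) ->
  (forall c, inv_dec (lincomb e c) -> forall i, c i = 0) ->
  (forall i, inv_dec (Fr (e i) - lincomb e (B i))) ->
  inv_gdet d (\det (1%:M - 'X *: map_mx polyC B)).
Proof.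
move=> he hs hi hB; exists s, e, B; split=> // p pp pd.
have [c hc] := hs p pp pd; exists (finfun c); split.
  by rewrite (eq_bigr (fun i => c i *: e i)) // => i _; rewrite ffunE.
move=> c' hc'; apply/ffunP => i; rewrite ffunE; apply/eqP; rewrite -subr_eq0; apply/eqP.
apply: (hi (fun i => c i - c' i)).
have := inv_decB hc' hc; rewrite opprB addrC addrA subrK.
rewrite /lincomb -sumrB; congr inv_dec.
by apply: eq_bigr => j _; rewrite scalerBl.
Qed.

Lemma inv_gdet_indep d s (e : 'I_s -> mp) c :
  (forall i, inv_pos (e i) /\ e i \is d.-homog) ->
  (forall p, inv_pos p -> p \is d.-homog ->
     exists! c : {ffun 'I_s -> rat}, inv_dec (p - \sum_(i < s) c i *: e i)) ->
  inv_dec (lincomb e c) -> forall i, c i = 0.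
Proof.
move=> he hs hc i.
have e0 : inv_pos 0 by have [[h _] _] := conj (he i) I; apply: inv_pos0 h.
have [c0 [_ cu]] := hs 0 e0 (dhomog0 _ _ _).
have /ffunP/(_ i) : finfun (fun i => - c i) = finfun (fun=> 0) :> {ffun 'I_s -> rat}.
  rewrite -(cu (finfun (fun i => - c i))); first apply: cu.
    by rewrite big1 ?subr0; [exact: inv_dec0|move=> j _; rewrite ffunE scale0r].
  rewrite sub0r -sumrN; have := hc; congr inv_dec.
  by apply: eq_bigr => j _; rewrite ffunE scaleNr opprK.
by rewrite !ffunE => /eqP; rewrite oppr_eq0 => /eqP.
Qed.

Hypotheses (FrD : {morph Fr : p q / p + q}) (FrZ : forall c p, Fr (c *: p) = c *: Fr p)
  (Frpos : forall p, inv_pos p -> inv_pos (Fr p)) (FrM : {morph Fr : p q / p * q}).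

Lemma Fr_dec p : inv_dec p -> inv_dec (Fr p).
Proof.
have Fr0 : Fr 0 = 0 by have := FrZ 0 0; rewrite !scale0r.
case=> s [hs ->]; rewrite (big_morph _ FrD Fr0).
exists [seq (Fr u.1, Fr u.2) | u <- s]; split.
  by move=> u /mapP[v vs ->]; have [h1 h2] := hs v vs; split; apply: Frpos.
by rewrite big_map; apply: eq_bigr => u _; rewrite FrM.
Qed.

Lemma Fr_lincomb s (e : 'I_s -> mp) c : Fr (lincomb e c) = lincomb (fun i => Fr (e i)) c.
Proof.
have Fr0 : Fr 0 = 0 by have := FrZ 0 0; rewrite !scale0r.
by rewrite /lincomb (big_morph _ FrD Fr0); apply: eq_bigr => i _; rewrite FrZ.
Qed.

Lemma lincomb_dec s t (e : 'I_s -> mp) (f : 'I_t -> mp) (A : 'I_s -> 'I_t -> rat) c :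
  (forall i, inv_dec (e i - lincomb f (A i))) ->
  inv_dec (lincomb e c - lincomb f (fun j => \sum_i c i * A i j)).
Proof.
move=> h; have -> : lincomb f (fun j => \sum_i c i * A i j) = \sum_i c i *: lincomb f (A i).
  rewrite /lincomb; under eq_bigr do rewrite scaler_suml.
  rewrite exchange_big /=; apply: eq_bigr => i _; rewrite scaler_sumr.
  by apply: eq_bigr => j _; rewrite scalerA.
rewrite -sumrB; apply: inv_dec_sum => i _; rewrite -scalerBr; exact: inv_decZ.
Qed.

(** Two bases modulo decomposables are related by mutually inverse matrices, so they have the same
    size and the two Frobenius matrices are conjugate. That [Fr] descends to the quotient is
    [Fr_dec]. *)
Lemma inv_gdet_uniq d P P' : inv_gdet d P -> inv_gdet d P' -> P = P'.
Proof.
case=> s [e [B [he hs hB ->]]] [s' [e' [B' [he' hs' hB' ->]]]].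
have /choice[C hC] : forall i, exists c : 'I_s -> rat, inv_dec (e' i - lincomb e c).
  move=> i.
  by have [h1 h2] := he' i; have [c [hc _]] := hs _ h1 h2; exists c.
have /choice[C' hC'] : forall i, exists c : 'I_s' -> rat, inv_dec (e i - lincomb e' c).
  move=> i.
  by have [h1 h2] := he i; have [c [hc _]] := hs' _ h1 h2; exists c.
have inv_of t t' (f : 'I_t -> mp) (g : 'I_t' -> mp) (A : 'I_t -> 'I_t' -> rat) (A' : 'I_t' -> 'I_t -> rat) :
   (forall c, inv_dec (lincomb f c) -> forall i, c i = 0) ->
   (forall i, inv_dec (f i - lincomb g (A i))) -> (forall i, inv_dec (g i - lincomb f (A' i))) ->
   (\matrix_(i, j) A i j) *m (\matrix_(i, j) A' i j) = 1%:M.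
  move=> hi hA hA'; apply/matrixP => i j; rewrite !mxE.
  rewrite (eq_bigr (fun l => A i l * A' l j)) => [|l _]; last by rewrite !mxE.
  apply/eqP; rewrite -subr_eq0; apply/eqP.
  apply: (hi (fun j => \sum_l A i l * A' l j - (i == j)%:R)).
  have := inv_decD (hA i) (lincomb_dec (A i) hA'); rewrite addrA subrK.
  move/inv_decN; rewrite opprB; congr inv_dec.
  rewrite (_ : (fun j0 => _ - _) = (fun j0 => \sum_i0 A i i0 * A' i0 j0 + -1 * (i == j0)%:R)); last first.
    by apply: funext => l; rewrite mulN1r.
  rewrite lincombD lincombZ scaleN1r; congr (_ - _).
  rewrite /lincomb (bigD1 i) //= eqxx scale1r big1 ?addr0 // => l li.
  by rewrite eq_sym (negPf li) scale0r.
have ind := inv_gdet_indep he hs; have ind' := inv_gdet_indep he' hs'.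
pose Cm : 'M[rat]_(s', s) := \matrix_(i, j) C i j.
pose Cm' : 'M[rat]_(s, s') := \matrix_(i, j) C' i j.
have CC' : Cm *m Cm' = 1%:M by apply: inv_of hC hC' => c; apply: ind'.
have C'C : Cm' *m Cm = 1%:M by apply: inv_of hC' hC => c; apply: ind.
have BC : B' *m Cm = Cm *m B.
  apply/matrixP => i j; apply/eqP; rewrite -subr_eq0; apply/eqP.
  have e1 := inv_decD (hB' i) (lincomb_dec (B' i) hC); rewrite addrA subrK in e1.
  have e2 := Fr_dec (hC i); rewrite FrD -scaleN1r FrZ scaleN1r Fr_lincomb in e2.
  have e3 : inv_dec (Fr (e' i) - lincomb e (fun j => \sum_l C i l * B l j)).
    have := inv_decD e2 (lincomb_dec (C i) hB); congr inv_dec.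
    by rewrite addrA; congr (_ - _); exact: subrK.
  have := inv_decB e3 e1; rewrite opprB addrC addrA subrK => e4.
  apply: (ind (fun j => (B' *m Cm) i j - (Cm *m B) i j)); move: e4; congr inv_dec.
  rewrite -scaleN1r -lincombZ -lincombD; congr lincomb; apply: funext => l.
  rewrite mulN1r !mxE; congr (_ - _); apply: eq_bigr => t _; rewrite !mxE //.
have ss' : s' = s by apply/eqP; rewrite eqn_leq (mulmx1_min CC') (mulmx1_min C'C).
clear hs hs' he he' hB hB' hC hC' inv_of ind ind'.
move: Cm Cm' CC' C'C BC; clear C C' e'; subst s' => Cm Cm' CC' C'C BC.
have -> : B' = Cm *m B *m Cm' by rewrite -BC -mulmxA CC' mulmx1.
have -> : 1%:M - 'X *: map_mx polyC (Cm *m B *m Cm') =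
   map_mx polyC Cm *m (1%:M - 'X *: map_mx polyC B) *m map_mx polyC Cm'.
  rewrite mulmxBr mulmxBl mulmx1 -map_mxM CC' map_mx1; congr (_ - _).
  by rewrite !map_mxM -scalemxAr -scalemxAl.
rewrite !det_mulmx mulrAC -det_mulmx -map_mxM CC' map_mx1 det1 mul1r //.
Qed.

End GradedDet.

(** * Integral linear substitutions of variables *)

Section LinearSubstitution.

(** For a square matrix this is [sym_action]. Rectangular matrices occur because the size [r] of an
    unknown basis of characters is not identified with 3. *)
Definition lin_sub (r r' : nat) (N : 'M[int]_(r, r')) (p : {mpoly rat[r]}) : {mpoly rat[r']} :=
  p \mPo [tuple \sum_(j < r') (N i j)%:~R *: 'X_j | i < r].

Lemma lin_subX r r' (N : 'M[int]_(r, r')) i : lin_sub N 'X_i = \sum_(j < r') (N i j)%:~R *: 'X_j.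
Proof. by rewrite /lin_sub comp_mpolyXU -tnth_nth tnth_mktuple. Qed.

Lemma lin_subD r r' (N : 'M[int]_(r, r')) : {morph lin_sub N : p q / p + q}.
Proof. exact: comp_mpolyD. Qed.
Lemma lin_subZ r r' (N : 'M[int]_(r, r')) c p : lin_sub N (c *: p) = c *: lin_sub N p.
Proof. exact: comp_mpolyZ. Qed.
Lemma lin_subM r r' (N : 'M[int]_(r, r')) : {morph lin_sub N : p q / p * q}.
Proof. by move=> p q; rewrite /lin_sub rmorphM. Qed.

Lemma lin_sub_sum r r' (N : 'M[int]_(r, r')) I (l : seq I) (f : I -> {mpoly rat[r]}) :
  lin_sub N (\sum_(i <- l) f i) = \sum_(i <- l) lin_sub N (f i).
Proof. by apply: (big_morph _ (lin_subD N)); rewrite /lin_sub comp_mpoly0. Qed.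

Lemma lin_sub_sum' r r' (N : 'M[int]_(r, r')) I (l : seq I) (P : pred I) (f : I -> {mpoly rat[r]}) :
  lin_sub N (\sum_(i <- l | P i) f i) = \sum_(i <- l | P i) lin_sub N (f i).
Proof. by apply: (big_morph _ (lin_subD N)); rewrite /lin_sub comp_mpoly0. Qed.

Lemma comp_mpoly_comp (r r' r'' : nat) (lq : r.-tuple {mpoly rat[r']}) (lq' : r'.-tuple {mpoly rat[r'']}) p :
  (p \mPo lq) \mPo lq' = p \mPo [tuple (tnth lq i) \mPo lq' | i < r].
Proof.
elim/mpolyind: p => [|c m p _ _ IHp]; first by rewrite !comp_mpoly0.
rewrite !comp_mpolyD IHp; congr (_ + _); rewrite !comp_mpolyZ; congr (_ *: _).
rewrite !comp_mpolyX rmorph_prod; apply: eq_bigr => i _ /=.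
by rewrite rmorphXn /= tnth_mktuple.
Qed.

Lemma lin_sub_comp r r' r'' (N : 'M[int]_(r, r')) (N' : 'M[int]_(r', r'')) p :
  lin_sub N' (lin_sub N p) = lin_sub (N *m N') p.
Proof.
rewrite /lin_sub comp_mpoly_comp; congr (_ \mPo _); apply: eq_from_tnth => i.
rewrite !tnth_mktuple -/(lin_sub N' _) lin_sub_sum.
under eq_bigr do rewrite lin_subZ lin_subX scaler_sumr.
rewrite exchange_big; apply: eq_bigr => j _ /=.
rewrite mxE rmorph_sum scaler_suml; apply: eq_bigr => l _.
by rewrite scalerA rmorphM.
Qed.

Lemma lin_sub1 r p : lin_sub (1%:M : 'M[int]_r) p = p.
Proof.
rewrite -[RHS]comp_mpoly_id; congr (_ \mPo _); apply: eq_from_tnth => i.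
rewrite !tnth_mktuple (bigD1 i) //= mxE eqxx scale1r big1 ?addr0 // => j ji.
by rewrite mxE eq_sym (negPf ji) scale0r.
Qed.

Lemma lin_sub_homog r r' (N : 'M[int]_(r, r')) d p :
  p \is d.-homog -> lin_sub N p \is d.-homog.
Proof.
move=> /dhomogP hp; rewrite /lin_sub comp_mpolyEX; rewrite big_seq.
apply: rpred_sum => m ms; apply: rpredZ; rewrite comp_mpolyX.
rewrite -(hp m ms) /= mdegE.
elim/big_ind2: _ => [|x1 x2 y1 y2 h1 h2|i _]; first exact: dhomog1.
  exact: dhomogM.
rewrite tnth_mktuple.
suff h1 : (\sum_(j < r') (N i j)%:~R *: 'X_j : {mpoly rat[r']}) \is 1.-homog.
  by have := dhomogMn (m i) h1; rewrite mul1n.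
by apply: rpred_sum => j _; apply: rpredZ; rewrite dhomogX /= mdeg1.
Qed.

Lemma lin_sub_const r r' (N : 'M[int]_(r, r')) p : (lin_sub N p)@_0%MM = p@_0%MM.
Proof.
elim/mpolyind: p => [|c m p _ _ IHp]; first by rewrite /lin_sub comp_mpoly0 !mcoeff0.
rewrite lin_subD lin_subZ !mcoeffD IHp !mcoeffZ mcoeffX; congr (_ * _ + _).
have hm : lin_sub N 'X_[m] \is (mdeg m).-homog by apply: lin_sub_homog; rewrite dhomogX.
have [->|m0] := eqVneq m 0%MM; first by rewrite mpolyX0 /lin_sub comp_mpoly1 mcoeff1 eqxx.
by apply: (dhomog_nemf_coeff hm); rewrite /= mdeg0 eq_sym mdeg_eq0.
Qed.

(** Serves both to change the basis of characters of a torus and to change the frame that describes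
    it. *)
Lemma inv_gdet_lin_sub r r' (N : 'M[int]_(r, r')) (N' : 'M[int]_(r', r)) Inv Inv' (Fr Fr' : 'M[int]_(_, _)) d P :
  N *m N' = 1%:M -> N' *m N = 1%:M ->
  (forall p, Inv p <-> Inv' (lin_sub N p)) ->
  Fr *m N = N *m Fr' ->
  inv_gdet Inv (lin_sub Fr) d P -> inv_gdet Inv' (lin_sub Fr') d P.
Proof.
move=> NN' N'N hInv hFr [s [e [B [he hs hB ->]]]].
have K p : lin_sub N' (lin_sub N p) = p by rewrite lin_sub_comp NN' lin_sub1.
have K' p : lin_sub N (lin_sub N' p) = p by rewrite lin_sub_comp N'N lin_sub1.
have hpos p : inv_pos Inv p <-> inv_pos Inv' (lin_sub N p).
  by rewrite /inv_pos lin_sub_const; split=> -[/hInv h1 h2].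
have hdec p : inv_dec Inv p <-> inv_dec Inv' (lin_sub N p).
  split=> -[l [hl e1]].
    exists [seq (lin_sub N u.1, lin_sub N u.2) | u <- l]; split.
      by move=> u /mapP[v vl ->]; have [h1 h2] := hl v vl; split; apply/hpos.
    by rewrite big_map e1 lin_sub_sum; apply: eq_bigr => u _; rewrite lin_subM.
  exists [seq (lin_sub N' u.1, lin_sub N' u.2) | u <- l]; split.
    by move=> u /mapP[v vl ->]; have [h1 h2] := hl v vl; split; apply/hpos; rewrite K'.
  rewrite big_map -[LHS]K e1 lin_sub_sum.
  by apply: eq_bigr => u _; rewrite lin_subM.
have hlin p c : lin_sub N (p - \sum_(i < s) c i *: e i) = lin_sub N p - \sum_(i < s) c i *: lin_sub N (e i).
  rewrite lin_subD -scaleN1r lin_subZ scaleN1r lin_sub_sum; congr (_ - _).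
  by apply: eq_bigr => i _; rewrite lin_subZ.
exists s, (fun i => lin_sub N (e i)), B; split=> //.
- by move=> i; have [h1 h2] := he i; split; [apply/hpos|apply: lin_sub_homog].
- move=> p pp pd; have [||c [hc hu]] := hs (lin_sub N' p).
  + by apply/hpos; rewrite K'.
  + exact: lin_sub_homog.
  exists c; split; first by move/hdec: hc; rewrite hlin K'.
  by move=> c' hc'; apply: hu; apply/hdec; rewrite hlin K'.
- move=> i; move/hdec: (hB i); rewrite hlin; congr (inv_dec _ (_ - _)).
  by rewrite !lin_sub_comp hFr.
Qed.

End LinearSubstitution.

(** * Generators modulo decomposables: Newton's identities and symmetrized monomials *)

Section Blocks.
Variables (Inv : set {mpoly rat[3]}) (Fr : {mpoly rat[3]} -> {mpoly rat[3]}).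
Local Notation mp := {mpoly rat[3]}.
Hypotheses (InvD : forall p q, Inv p -> Inv q -> Inv (p + q))
  (InvZ : forall c p, Inv p -> Inv (c *: p)) (InvM : forall p q, Inv p -> Inv q -> Inv (p * q)).

(** A functional of this kind isolates the coefficient of [g] modulo decomposables. Its values are
    in [algC] because it evaluates polynomials at vectors whose coordinates are roots of unity. *)
Definition separating (g : mp) (P : mp -> Prop) := exists L : mp -> algC,
  [/\ {morph L : p q / p + q}, forall c p, L (c *: p) = ratr c * L p,
      forall p, inv_dec Inv p -> L p = 0, L g != 0 & forall h, P h -> L h = 0].

Lemma gdet_all n t (g : 'I_t -> mp) (B : 'M[rat]_t) :
  (forall b, inv_pos Inv (g b) /\ g b \is n.-homog) ->
  (forall p, inv_pos Inv p -> p \is n.-homog -> exists c, inv_dec Inv (p - lincomb g c)) ->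
  (forall b, separating (g b) (fun h => exists2 b', b' != b & h = g b')) ->
  (forall b, Fr (g b) = lincomb g (B b)) ->
  inv_gdet Inv Fr n (\det (1%:M - 'X *: map_mx polyC B)).
Proof.
move=> hg hs hi hF; apply: (inv_gdet_intro InvZ hg hs) => [c hc b|b]; last first.
  by rewrite hF subrr; apply: inv_dec0.
have [L [LD LZ Ldec Lb Lb']] := hi b.
have L0 : L 0 = 0 by have := LZ 0 0; rewrite scale0r rmorph0 mul0r.
have /eqP := Ldec _ hc; rewrite /lincomb (big_morph L LD L0) (bigD1 b) //= big1 ?addr0.
  by rewrite LZ mulf_eq0 (negPf Lb) orbF fmorph_eq0 => /eqP.
by move=> b' bb'; rewrite LZ Lb' ?mulr0 //; exists b'.
Qed.

(** Candidates outside [vb] may appear in an expansion as long as their terms are decomposable. The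
    expansion can then be written uniformly in the degree, before deciding which candidates are true
    generators. *)
Lemma gdet_blocks n t (g : 'I_t -> mp) (vb : pred 'I_t) (sg : 'I_t -> rat) :
  (forall b, vb b -> inv_pos Inv (g b) /\ g b \is n.-homog) ->
  (forall p, inv_pos Inv p -> p \is n.-homog -> exists c : 'I_t -> rat,
     (forall b, ~~ vb b -> inv_dec Inv (c b *: g b)) /\ inv_dec Inv (p - lincomb g c)) ->
  (forall b, vb b -> separating (g b) (fun h => exists b', [/\ vb b', b' != b & h = g b'])) ->
  (forall b, vb b -> Fr (g b) = sg b *: g b) ->
  inv_gdet Inv Fr n (\prod_(b | vb b) (1 - sg b *: 'X)).
Proof.
move=> hg hs hi hF.
have vA (i : 'I_#|vb|) : vb (enum_val i) by have := enum_valP i.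
have := @gdet_all n #|vb| (fun i => g (enum_val i)) (diag_mx (\row_i sg (enum_val i))).
have -> : \det (1%:M - 'X *: map_mx polyC (diag_mx (\row_(i < #|vb|) sg (enum_val i)))) =
   \prod_(b | vb b) (1 - sg b *: 'X).
  have -> : 1%:M - 'X *: map_mx polyC (diag_mx (\row_(i < #|vb|) sg (enum_val i))) =
    diag_mx (\row_(i < #|vb|) (1 - sg (enum_val i) *: 'X)).
    apply/matrixP => i j; rewrite !mxE; case: eqP => [->|_].
      by rewrite !mulr1n mulrC -mul_polyC.
    by rewrite !mulr0n polyC0 mulr0 subr0.
  rewrite det_diag (eq_bigr (fun i => 1 - sg (enum_val i) *: 'X)) => [|i _]; last by rewrite mxE.
  rewrite -(big_enum_val (A := vb) (fun b => 1 - sg b *: 'X)).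
  by [].
apply.
- by move=> i; apply/hg/vA.
- move=> p pp pd; have [c [hc1 hc2]] := hs p pp pd.
  exists (fun i => c (enum_val i)); rewrite /lincomb -(big_enum_val (A := vb) (fun b => c b *: g b)).
  have := hc2; rewrite /lincomb (bigID vb) /= => h.
  have := inv_decD h (inv_dec_sum (index_enum 'I_t) hc1); congr (inv_dec _ _).
  by rewrite opprD addrA subrK.
- move=> i; have [L [LD LZ Ldec Lb Lb']] := hi _ (vA i); exists L; split=> // h [j ji ->].
  by apply: Lb'; exists (enum_val j); split=> //; rewrite (inj_eq enum_val_inj).
- move=> i; rewrite hF // /lincomb (bigD1 i) //= !mxE eqxx mulr1n big1 ?addr0 // => j ji.
  by rewrite !mxE eq_sym (negPf ji) mulr0n scale0r.
Qed.

Lemma inv_posM p q : inv_pos Inv p -> inv_pos Inv q -> inv_pos Inv (p * q).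
Proof.
case=> Ip p0 [Iq q0]; split; first exact: InvM.
by rewrite rmorphM /= p0 mul0r || rewrite mcoeff0M p0 mul0r.
Qed.

Section Newton.
Variables (y : 'I_3 -> mp).

Lemma dec_pow1 : (forall j, (0 < j)%N -> inv_pos Inv (y o0 ^+ j)) ->
  forall j, (2 <= j)%N -> inv_dec Inv (y o0 ^+ j).
Proof. by move=> h [|[|j]] // _; rewrite exprS; apply: inv_decM; [apply: (h 1%N)|apply: h]. Qed.

(** Newton's identity for two variables, multiplied by 2 in order to express the second elementary
    symmetric function by power sums. *)
Lemma dec_pow2 : (forall j, (0 < j)%N -> inv_pos Inv (y o0 ^+ j + y o1 ^+ j)) ->
  forall j, (3 <= j)%N -> inv_dec Inv (y o0 ^+ j + y o1 ^+ j).
Proof.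
move=> h [|[|[|j]]] // _; pose P j := y o0 ^+ j + y o1 ^+ j.
have e : 2%:R *: P j.+3 = 2%:R *: (P 1%N * P j.+2) - (P 1%N * P 1%N - P 2%N) * P j.+1.
  rewrite !scaler_nat /P !exprS; ring.
have : inv_dec Inv (2%:R *: P j.+3).
  rewrite e; apply: inv_decB => //; first by apply/inv_decZ/inv_decM; [|apply: h|apply: h].
  apply: inv_decM; last exact: h.
  by rewrite -[X in _ - X]scale1r -scaleNr; apply/inv_posD; [|apply: inv_posM; apply: h|apply/inv_posZ/h].
move=> /(inv_decZ InvZ (2%:R^-1)); rewrite scalerA mulVf ?scale1r //.
Qed.

(** Newton's identity for three variables, multiplied by 6; the two brackets are [3 * (P1^2 - P2)],
    up to scaling, and [P1^3 - 3 P1 P2 + 2 P3], that is 6 times the elementary symmetric functions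
    of degree 2 and 3. *)
Lemma dec_pow3 : (forall j, (0 < j)%N -> inv_pos Inv (y o0 ^+ j + y o1 ^+ j + y o2 ^+ j)) ->
  forall j, (4 <= j)%N -> inv_dec Inv (y o0 ^+ j + y o1 ^+ j + y o2 ^+ j).
Proof.
move=> h [|[|[|[|j]]]] // _; pose P j := y o0 ^+ j + y o1 ^+ j + y o2 ^+ j.
have e : 6%:R *: P j.+4 = 6%:R *: (P 1%N * P j.+3) + (-3%:R) *: ((P 1%N * P 1%N + (-1) *: P 2%N) * P j.+2)
    + (P 1%N * (P 1%N * P 1%N) + (-3%:R) *: (P 1%N * P 2%N) + 2%:R *: P 3%N) * P j.+1.
  rewrite scaleN1r !scaleNr !scaler_nat /P !exprS; ring.
have hP i : inv_pos Inv (P i.+1) by apply: h.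
have : inv_dec Inv (6%:R *: P j.+4).
  rewrite e; apply: inv_decD; [apply: inv_decD|]; first 2 last.
  - apply: inv_decM => //; apply: inv_posD => //; last exact: inv_posZ.
    by apply: inv_posD => //; [apply: inv_posM => //; apply: inv_posM|apply: inv_posZ => //; apply: inv_posM].
  - by apply: inv_decZ => //; apply: inv_decM.
  - apply: inv_decZ => //; apply: inv_decM => //; apply: inv_posD => //; first exact: inv_posM.
    exact: inv_posZ.
move=> /(inv_decZ InvZ (6%:R^-1)); rewrite scalerA mulVf ?scale1r //.
Qed.

End Newton.

Section Symmetrized.
Variables (x y z : mp) (s s' : nat).
Let P j := x ^+ j + y ^+ j + z ^+ j.
Let R j := x ^+ j + y ^+ j.

(** Expanding products of power sums and removing the coincidences of indices reduces a symmetrized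
    monomial to a multiple of a single power sum. The step [s] is 1 or 2: in a symplectic block only
    even power sums are invariant. *)
Lemma sym3_dec : (forall j, (0 < j)%N -> (s %| j)%N -> inv_pos Inv (P j)) ->
  forall a b c, (s %| a)%N -> (s %| b)%N -> (s %| c)%N -> (0 < a + b + c)%N ->
  exists u, inv_dec Inv (x ^+ a * y ^+ b * z ^+ c + x ^+ a * z ^+ b * y ^+ c + y ^+ a * x ^+ b * z ^+ c
     + y ^+ a * z ^+ b * x ^+ c + z ^+ a * x ^+ b * y ^+ c + z ^+ a * y ^+ b * x ^+ c - u *: P (a + b + c)%N).
Proof.
move=> h a b c sa sb sc abc.
have two i j : (0 < i)%N -> (0 < j)%N -> (s %| i)%N -> (s %| j)%N -> forall T, T = P i * P j -> inv_dec Inv T.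
  by move=> i0 j0 si sj T ->; apply: inv_decM; apply: h.
case: (posnP a) sa abc => [->|a0] sa; case: (posnP b) sb => [->|b0] sb; case: (posnP c) sc => [->|c0] sc //= _.
- exists 2%:R; rewrite (_ : _ - _ = 0); first exact: inv_dec0.
  by rewrite scaler_nat /P !add0n !expr0; ring.
- exists 2%:R; rewrite (_ : _ - _ = 0); first exact: inv_dec0.
  by rewrite scaler_nat /P !add0n !addn0 !expr0; ring.
- exists (-1); apply: (two b c) => //; rewrite scaleN1r /P add0n !exprD !expr0; ring.
- exists 2%:R; rewrite (_ : _ - _ = 0); first exact: inv_dec0.
  by rewrite scaler_nat /P !addn0 !expr0; ring.
- exists (-1); apply: (two a c) => //; rewrite scaleN1r /P !addn0 !exprD !expr0; ring.
- exists (-1); apply: (two a b) => //; rewrite scaleN1r /P !addn0 !exprD !expr0; ring.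
- exists 2%:R; rewrite (_ : _ - _ = (P a * P b + (-1) *: P (a + b)%N) * P c + (-1) *: (P (a + c)%N * P b + P (b + c)%N * P a)); last first.
    by rewrite !scaleN1r scaler_nat /P !exprD; ring.
  have sab : (s %| a + b)%N by rewrite dvdn_add.
  have sac : (s %| a + c)%N by rewrite dvdn_add.
  have sbc : (s %| b + c)%N by rewrite dvdn_add.
  apply: inv_decD; last by apply: inv_decZ => //; apply: inv_decD; apply: inv_decM; apply: h; rewrite ?addn_gt0 ?a0 ?b0.
  apply: inv_decM; last exact: h.
  apply: inv_posD => //; first by apply: inv_posM; apply: h.
  by apply: inv_posZ => //; apply: h; rewrite ?addn_gt0 ?a0.
Qed.

(** The case of a block of two variables next to a block of one, with possibly different steps [s]
    and [s']. The divisibility clauses keep the surviving power sums invariant. *)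
Lemma sym2_dec : (forall j, (0 < j)%N -> (s %| j)%N -> inv_pos Inv (R j)) ->
  (forall j, (0 < j)%N -> (s' %| j)%N -> inv_pos Inv (z ^+ j)) ->
  forall a b c, (s %| a)%N -> (s %| b)%N -> (s' %| c)%N -> (0 < a + b + c)%N ->
  exists u v, [/\ u != 0 -> (s %| a + b + c)%N, v != 0 -> (s' %| a + b + c)%N &
    inv_dec Inv ((x ^+ a * y ^+ b + y ^+ a * x ^+ b) * z ^+ c - (u *: R (a + b + c)%N + v *: z ^+ (a + b + c)))].
Proof.
move=> h h' a b c sa sb sc abc.
have sab : (s %| a + b)%N by rewrite dvdn_add.
have E0 (A : Prop) : (0 : rat) != 0 -> A by rewrite eqxx.
case: (posnP c) sc abc => [->|c0] sc abc.
  rewrite addn0 in abc *; rewrite expr0 mulr1.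
  case: (posnP a) sa abc sab => [->|a0] sa abc sab; last case: (posnP b) sb sab => [->|b0] sb sab.
  - exists 1, 0; split; [by move=> _|exact: E0|].
    rewrite (_ : _ - _ = 0); first exact: inv_dec0.
    by rewrite scale0r scale1r /R add0n !expr0; ring.
  - exists 1, 0; split; [by move=> _|exact: E0|].
    rewrite (_ : _ - _ = 0); first exact: inv_dec0.
    by rewrite scale0r scale1r /R addn0 !expr0; ring.
  - exists (-1), 0; split; [by move=> _|exact: E0|].
    rewrite (_ : _ - _ = R a * R b); first by apply: inv_decM; apply: h.
    by rewrite scale0r scaleN1r /R !exprD; ring.
case: (posnP a) sa abc sab => [->|a0] sa abc sab; last first.
  exists 0, 0; split; [exact: E0|exact: E0|rewrite !scale0r addr0 subr0].
  case: (posnP b) sb => [->|b0] sb.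
    rewrite (_ : _ * _ = R a * z ^+ c); first by apply: inv_decM; [apply: h|apply: h'].
    by rewrite /R !expr0; ring.
  rewrite (_ : _ * _ = (R a * R b + (-1) *: R (a + b)%N) * z ^+ c); last first.
    by rewrite scaleN1r /R !exprD; ring.
  apply: inv_decM; last exact: h'.
  apply: inv_posD => //; first by apply: inv_posM; apply: h.
  by apply: inv_posZ => //; apply: h; rewrite ?addn_gt0 ?a0.
case: (posnP b) sb sab => [->|b0] sb sab.
  exists 0, 2%:R; rewrite !add0n; split; [exact: E0|by move=> _|].
  rewrite (_ : _ - _ = 0); first exact: inv_dec0.
  by rewrite scale0r scaler_nat !expr0; ring.
exists 0, 0; split; [exact: E0|exact: E0|rewrite !scale0r addr0 subr0].
rewrite (_ : _ * _ = R b * z ^+ c); first by apply: inv_decM; [apply: h|apply: h'].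
by rewrite /R !expr0; ring.
Qed.

End Symmetrized.
End Blocks.

(** * Signed permutations of the variables and Springer's argument *)

Local Notation mp := {mpoly rat[3]}.

Lemma Xn_homog r (i : 'I_r) n : ('X_i ^+ n : {mpoly rat[r]}) \is n.-homog.
Proof. by rewrite mpolyXn dhomogX /= mdegMn mdeg1 mul1n. Qed.

Definition sgmx (sg : {perm 'I_3}) (eps : 'I_3 -> bool) : 'M[int]_3 :=
  \matrix_(i, j) ((-1) ^+ eps i * (j == sg i)%:R).

Lemma lin_sub_sgmxX sg eps i : lin_sub (sgmx sg eps) 'X_i = (-1) ^+ eps i *: 'X_(sg i).
Proof.
rewrite lin_subX (bigD1 (sg i)) //= big1 ?addr0.
  by rewrite mxE eqxx mulr1 rmorph_sign.
by move=> j ji; rewrite mxE (negPf ji) mulr0 scale0r.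
Qed.

Lemma lin_sub_sgmxXn sg eps i n : lin_sub (sgmx sg eps) ('X_i ^+ n) = (-1) ^+ (eps i * n) *: 'X_(sg i) ^+ n.
Proof. by rewrite /lin_sub rmorphXn /= -/(lin_sub _ _) lin_sub_sgmxX exprZn exprM. Qed.

Lemma lin_sub_sgmx_monomial sg eps (m : 'X_{1..3}) :
  lin_sub (sgmx sg eps) 'X_[m] = \prod_i (-1) ^+ (eps i * m i) *: \prod_i 'X_(sg i) ^+ m i.
Proof.
rewrite /lin_sub comp_mpolyX -scaler_prod; apply: eq_bigr => i _.
by rewrite tnth_mktuple -lin_subX lin_sub_sgmxX exprZn exprM.
Qed.

Section Springer.

(** Restriction to the line spanned by [v]: the coefficient of degree [n] is the value at [v] of the
    homogeneous component of degree [n]. *)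
Definition line_poly (v : 'I_3 -> algC) (p : mp) : {poly algC} :=
  mmap (polyC \o ratr) (fun i => v i *: 'X) p.

Lemma line_polyD v : {morph line_poly v : p q / p + q}.
Proof. by move=> p q; rewrite /line_poly mmapD. Qed.

Lemma line_polyZ v c p : line_poly v (c *: p) = ratr c *: line_poly v p.
Proof. by rewrite /line_poly mmapZ /= mul_polyC. Qed.

Lemma line_polyM v : {morph line_poly v : p q / p * q}.
Proof. by move=> p q; rewrite /line_poly rmorphM. Qed.

Lemma line_polyX v i n : line_poly v ('X_i ^+ n) = v i ^+ n *: 'X^n.
Proof. by rewrite /line_poly rmorphXn /= mmapX mmap1U exprZn. Qed.

Lemma line_poly_sgmx v sg eps p :
  line_poly v (lin_sub (sgmx sg eps) p) = line_poly (fun i => (-1) ^+ eps i * v (sg i)) p.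
Proof.
elim/mpolyind: p => [|c m p _ _ IHp].
  by rewrite /lin_sub comp_mpoly0 /line_poly !mmap0.
rewrite lin_subD lin_subZ !line_polyD !line_polyZ IHp; congr (_ *: _ + _).
rewrite lin_sub_sgmx_monomial line_polyZ mpolyXE_id.
have lp w (f : 'I_3 -> mp) : line_poly w (\prod_i f i) = \prod_i line_poly w (f i).
  by rewrite /line_poly rmorph_prod.
rewrite !lp rmorph_prod -scaler_prod; apply: eq_bigr => i _.
by rewrite !line_polyX scalerA exprMn rmorph_sign -exprM.
Qed.

Lemma line_poly_scale z v p j : (line_poly (fun i => z * v i) p)`_j = z ^+ j * (line_poly v p)`_j.
Proof.
elim/mpolyind: p => [|c m p _ _ IHp].
  by rewrite /line_poly !mmap0 !coef0 mulr0.
rewrite !line_polyD !line_polyZ !coefD !coefZ mulrDr IHp mulrCA; congr (_ * _ + _).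
have lp w : line_poly w 'X_[m] = (\prod_i w i ^+ m i) *: 'X^(mdeg m).
  rewrite /line_poly mmapX /mmap1 mdegE.
  by rewrite (eq_bigr (fun i => w i ^+ m i *: 'X^(m i))) => [|i _]; rewrite ?exprZn // scaler_prod -expr_sum.
rewrite !lp !coefZ coefXn; case: eqP => [->|_]; last by rewrite !mulr0.
rewrite !mulr1 mdegE -prodrXr -big_split /=.
by apply: eq_bigr => i _; rewrite exprMn.
Qed.

Variables (k : fieldType) (dl : 'I_3 -> k).

Definition preserves (sg : {perm 'I_3}) (eps : 'I_3 -> bool) :=
  forall i, (if eps i then (dl (sg i))^-1 else dl (sg i)) = dl i.

Definition Inv : set mp := [set p | forall sg eps, preserves sg eps -> lin_sub (sgmx sg eps) p = p].

Lemma Inv_D p q : Inv p -> Inv q -> Inv (p + q).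
Proof. by move=> hp hq sg eps h; rewrite lin_subD hp ?hq. Qed.
Lemma Inv_Z c p : Inv p -> Inv (c *: p).
Proof. by move=> hp sg eps h; rewrite lin_subZ hp. Qed.
Lemma Inv_M p q : Inv p -> Inv q -> Inv (p * q).
Proof. by move=> hp hq sg eps h; rewrite lin_subM hp ?hq. Qed.

(** When an element of the stabilizer multiplies [v] by [z], the component of degree [j] of an
    invariant vanishes at [v] unless [z ^+ j = 1]. A product of two invariants without constant term
    therefore vanishes at [v] in degree [n], since one factor always has a degree strictly between 0
    and [n] or a zero constant term. *)
Lemma springer v sg eps z n (g : mp) (P : mp -> Prop) : (0 < n)%N -> preserves sg eps ->
  (forall i, (-1) ^+ eps i * v (sg i) = z * v i) -> (forall j, (0 < j < n)%N -> z ^+ j != 1) ->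
  (line_poly v g)`_n != 0 -> (forall h, P h -> (line_poly v h)`_n = 0) -> separating Inv g P.
Proof.
move=> n0 hpres hv hz hg hP; exists (fun p => (line_poly v p)`_n); split=> //.
- by move=> p q; rewrite line_polyD coefD.
- by move=> c p; rewrite line_polyZ coefZ.
move=> p [l [hl ->]].
have LD := line_polyD v; have L0 : line_poly v 0 = 0 by rewrite /line_poly mmap0.
rewrite (big_morph _ LD L0) coef_sum big_seq big1 // => u ul; have [h1 h2] := hl u ul.
have low q j : inv_pos Inv q -> (j < n)%N -> (line_poly v q)`_j = 0.
  case=> Iq q0; case: j => [_|j jn].
    have := line_poly_scale 0 v q 0; rewrite expr0 mul1r => <-.
    have -> : line_poly (fun i => 0 * v i) q = (ratr q@_0%MM)%:P.
      elim/mpolyind: q {Iq q0} => [|c m q _ _ IHq].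
        by rewrite /line_poly mmap0 mcoeff0 rmorph0.
      rewrite line_polyD line_polyZ IHq mcoeffD mcoeffZ mcoeffX rmorphD polyCD; congr (_ + _).
      have rM (w w' : rat) : ratr (w * w') = ratr w * ratr w' :> algC by exact: rmorphM.
      transitivity (ratr c *: ((ratr (m == 0%MM)%:R)%:P : {poly algC})); last by rewrite -mul_polyC -polyCM -rM.
      congr (_ *: _).
      rewrite /line_poly mmapX /mmap1 (eq_bigr (fun i => 0 ^+ m i)) => [|i _]; last by rewrite mul0r scale0r.
      have [->|m0] := eqVneq m 0%MM.
        by rewrite big1 ?rmorph1 // => i _; rewrite mnm0E.
      rewrite rmorph0; apply/eqP; rewrite prodf_seq_eq0; apply/hasP.
      move: m0; rewrite -mdeg_eq0 mdegE sum_nat_eq0 negb_forall => /existsP[i mi].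
      by exists i; rewrite ?mem_index_enum //= expr0n; move: mi => /= /negPf ->.
    by rewrite q0 rmorph0 coef0.
  have := congr1 (fun r => (line_poly v r)`_j.+1) (Iq _ _ hpres).
  rewrite line_poly_sgmx (_ : (fun i => _) = (fun i => z * v i)); last exact/funext.
  rewrite line_poly_scale => /eqP; rewrite -subr_eq0 -{2}[(_)`_j.+1]mul1r -mulrBl mulf_eq0 subr_eq0.
  by rewrite (negPf (hz j.+1 _)) // => /eqP.
rewrite line_polyM coefM big_ord_recr /= subnn (low _ 0%N h2) // mulr0 addr0.
by rewrite big1 // => i _; rewrite low ?mul0r.
Qed.

Lemma nonroot_prim n (z : algC) : n.-primitive_root z -> forall j, (0 < j < n)%N -> z ^+ j != 1.
Proof.
move=> pz j /andP[j0 jn]; rewrite -(prim_order_dvd pz).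
by apply: contraL jn => /(dvdn_leq j0); rewrite -leqNgt.
Qed.

(** The degrees of the basic invariants of a block are the multiples of this number: 2, 4, 6 for the
    symplectic block of a self-inverse eigenvalue, 1, 2, 3 for a linear block. *)
Definition stp (a : k) := if a ^+ 2 == 1 then 2%N else 1%N.

(** A primitive root of unity of order [stp a * j] is an eigenvalue of a [j]-cycle with sign -1 for
    a symplectic block and sign 1 for a linear one; the last clause records this sign. *)
Lemma prim_stp (a : k) j n : (0 < j)%N -> n = (stp a * j)%N -> exists z : algC,
  [/\ forall i, (0 < i < n)%N -> z ^+ i != 1, z ^+ n = 1 & z ^+ j = (-1) ^+ (a ^+ 2 == 1)].
Proof.
move=> j0 ->; have n0 : (0 < stp a * j)%N by rewrite muln_gt0 j0 /stp; case: ifP.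
have [z pz] := C_prim_root_exists n0; exists z; split; first exact: nonroot_prim.
  exact: prim_expr_order.
move: pz; rewrite /stp; case: (a ^+ 2 == 1); last by rewrite mul1n expr0 => /prim_expr_order.
move=> pz; have := prim_expr_order pz; rewrite mulnC exprM => /eqP; rewrite sqrf_eq1 => /orP[/eqP e|/eqP //].
by have := nonroot_prim pz (j := j); rewrite e eqxx => /(_ _)/negP; rewrite j0 mul2n -addnn -{1}[j]addn0 ltn_add2l j0 => /(_ isT).
Qed.

Lemma sqr1V (a : k) : a ^+ 2 = 1 -> a^-1 = a.
Proof.
move=> a2; have a0 : a != 0 by apply: contra_eq_neq a2 => ->; rewrite expr0n eq_sym oner_eq0.
by apply: (mulfI a0); rewrite mulfV // -expr2 a2.
Qed.

Lemma line_coef v i n : (line_poly v ('X_i ^+ n))`_n = v i ^+ n.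
Proof. by rewrite line_polyX coefZ coefXn eqxx mulr1. Qed.

Lemma line_coefD v n p q : (line_poly v (p + q))`_n = (line_poly v p)`_n + (line_poly v q)`_n.
Proof. by rewrite line_polyD coefD. Qed.

Lemma springer1 i a n (g : mp) (P : mp -> Prop) : dl i = a -> n = stp a ->
  (line_poly (fun j => (j == i)%:R) g)`_n != 0 ->
  (forall h, P h -> (line_poly (fun j => (j == i)%:R) h)`_n = 0) -> separating Inv g P.
Proof.
move=> ia na hg hP; have [z [hz zn zj]] := @prim_stp a 1 n isT (etrans na (esym (muln1 _))).
apply: (@springer _ 1%g (fun j => (j == i) && (a ^+ 2 == 1)) z n) hg hP => //.
- by rewrite na /stp; case: ifP.
- move=> j; rewrite perm1; case: eqP => //= ->; case: eqP => // a2.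
  by rewrite ia sqr1V.
- move=> j; rewrite perm1; case: eqP => //= _; last by rewrite !mulr0.
  by rewrite !mulr1 -zj expr1.
Qed.

(** The element used is a cycle of length two, with one sign change when [a ^+ 2 = 1]; it multiplies
    [(1, z, 0)] by [z]. The next lemma does the same with a cycle of length three. *)
Lemma springer2 a n (g : mp) (P : mp -> Prop) : dl o0 = a -> dl o1 = a -> n = (stp a * 2)%N ->
  (forall z, z ^+ n = 1 -> (line_poly (f3 1 z 0) g)`_n != 0) ->
  (forall z h, z ^+ n = 1 -> P h -> (line_poly (f3 1 z 0) h)`_n = 0) -> separating Inv g P.
Proof.
move=> a0 a1 na hg hP; have [z [hz zn zj]] := @prim_stp a 2 n isT na.
apply: (@springer (f3 1 z 0) swap01 (f3 false (a ^+ 2 == 1) false) z n) (hg z zn) (fun h => hP z h zn) => //.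
- by rewrite na /stp; case: ifP.
- elim/I3P; rewrite permE /= ?a0 ?a1 //; case: eqP => // a2; by rewrite sqr1V.
- elim/I3P; rewrite permE /= ?mulr1 ?mul1r ?mulr0 // -?zj ?expr2 // -exprS.
Qed.

Lemma springer3 a n (g : mp) (P : mp -> Prop) : (forall i, dl i = a) -> n = (stp a * 3)%N ->
  (forall z, z ^+ n = 1 -> (line_poly (f3 1 z (z ^+ 2)) g)`_n != 0) ->
  (forall z h, z ^+ n = 1 -> P h -> (line_poly (f3 1 z (z ^+ 2)) h)`_n = 0) -> separating Inv g P.
Proof.
move=> da na hg hP; have [z [hz zn zj]] := @prim_stp a 3 n isT na.
apply: (@springer (f3 1 z (z ^+ 2)) rot3 (f3 false false (a ^+ 2 == 1)) z n) (hg z zn) (fun h => hP z h zn) => //.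
- by rewrite na /stp; case: ifP.
- elim/I3P; rewrite !da //=; case: eqP => // a2; by rewrite sqr1V.
- elim/I3P; rewrite permE /= ?mulr1 ?mul1r ?mulr0 // -?zj ?expr2 // -exprS.
Qed.

End Springer.

(** * Power sums over blocks of equal eigenvalues *)

Section PowerSums.
Variables (k : fieldType) (dl : 'I_3 -> k).
Local Notation Inv := (Inv dl).

Definition psum (a : k) n : mp := \sum_(i | dl i == a) 'X_i ^+ n.
(** Expresses that of two distinct inverse eigenvalues only one is listed in [dl]. An element of the
    stabilizer then preserves the block of [a], and changes signs in it only if [a ^+ 2 = 1]. *)
Definition isolated (a : k) := forall i, dl i = a^-1 -> a ^+ 2 = 1.

Lemma stp_gt0 (a : k) : (0 < stp a)%N. Proof. by rewrite /stp; case: ifP. Qed.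

Lemma preserves_block a sg eps : isolated a -> preserves dl sg eps ->
  forall i, (dl (sg i) == a) = (dl i == a) /\ (dl i == a -> eps i -> a ^+ 2 == 1).
Proof.
move=> ha hp i; have := hp i.
case: (eps i) => [e|<-]; last by split.
split.
  apply/eqP/eqP => [sa|ia]; last first.
    have sa : dl (sg i) = a^-1 by rewrite -ia -e invrK.
    by rewrite sa sqr1V // (ha (sg i)).
  have ia : dl i = a^-1 by rewrite -e sa.
  by rewrite ia sqr1V // (ha i).
by move=> /eqP ia _; apply/eqP/(ha (sg i)); rewrite -ia -e invrK.
Qed.

Lemma psum_inv a n : isolated a -> (stp a %| n)%N -> (0 < n)%N -> inv_pos Inv (psum a n).
Proof.
move=> ha sn n0; split; last first.
  rewrite raddf_sum big1 // => i _; have hm := Xn_homog i n.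
  by apply: (dhomog_nemf_coeff hm); rewrite /= mdeg0 eq_sym -lt0n.
move=> sg eps hp; rewrite /psum lin_sub_sum'.
rewrite (eq_bigr (fun i => 'X_(sg i) ^+ n)) => [|i ia]; last first.
  rewrite lin_sub_sgmxXn; have [_ h] := preserves_block ha hp i.
  case ei: (eps i); last by rewrite mul0n expr0 scale1r.
  have a2 := h ia ei; move: sn; rewrite /stp a2 mul1n => /dvdnP[j ->].
  by rewrite mulnC exprM sqrrN !expr1n scale1r.
rewrite [RHS](reindex_inj (@perm_inj _ sg)) /=.
by apply: eq_bigl => i; have [-> _] := preserves_block ha hp i.
Qed.

Lemma psum_homog a n : psum a n \is n.-homog.
Proof.
by apply: rpred_sum => i _; apply: Xn_homog.
Qed.

(** As [a ^+ Q = a^-1], Frobenius permutes the block of [a]. If [a] is not self-inverse every sign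
    is negative, which gives the scalar [(-1) ^+ n]; if it is, the signs disappear because [n] is
    even. *)
Lemma Frob_psum (Q : nat) (tau : {perm 'I_3}) (eps : 'I_3 -> bool) a n : injective (fun x : k => x ^+ Q) ->
  (forall i, dl i = (if eps i then (dl (tau i))^-1 else dl (tau i)) ^+ Q) ->
  a ^+ Q = a^-1 -> isolated a -> (stp a %| n)%N ->
  lin_sub (sgmx tau eps) (psum a n) = (if a ^+ 2 == 1 then 1 else -1) ^+ n *: psum a n.
Proof.
move=> Qinj hF aQ ha sn.
have key i : dl i = a -> dl (tau i) = a /\ (a ^+ 2 != 1 -> eps i).
  move=> ia; have : (if eps i then (dl (tau i))^-1 else dl (tau i)) = a^-1.
    by apply: Qinj; rewrite /= -hF ia exprVn aQ invrK.
  case: (eps i) => [/invr_inj -> //|ti].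
  by have a2 := ha _ ti; rewrite ti sqr1V // a2 eqxx.
have key' i : dl (tau i) = a -> dl i = a.
  move=> ti; have := hF i; rewrite ti; case: (eps i) => e.
    by rewrite e exprVn aQ invrK.
  have a2 : a ^+ 2 = 1 by apply: (ha i); rewrite e.
  by rewrite e aQ sqr1V.
rewrite /psum lin_sub_sum' scaler_sumr.
rewrite [RHS](reindex_inj (@perm_inj _ tau)) /=.
have iff i : (dl (tau i) == a) = (dl i == a) by apply/eqP/eqP => [/key'|/key[]].
rewrite (eq_bigl _ _ iff); apply: eq_bigr => i /eqP ia; rewrite lin_sub_sgmxXn.
congr (_ *: _); have [_ h] := key i ia; move: sn h; rewrite /stp; case: eqP => [a2|_] sn h.
  by move/dvdnP: sn => [j ->]; rewrite mulnA exprM sqrr_sign expr1n.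
by rewrite h // mul1n.
Qed.

(** The change of sign of the variable [i] alone belongs to the stabilizer. *)
Lemma msupp_even p (m : 'X_{1..3}) i : Inv p -> m \in msupp p -> dl i ^+ 2 = 1 -> (2 %| m i)%N.
Proof.
move=> hp mp_ i2; pose eps j := j == i.
have hpres : preserves dl 1%g eps.
  by move=> j; rewrite /eps perm1; case: eqP => // ->; rewrite sqr1V.
have sgn (m' : 'X_{1..3}) : \prod_j (-1) ^+ (eps j * m' j) = (-1) ^+ m' i :> rat.
  rewrite (bigD1 i) //= /eps eqxx mul1n big1 ?mulr1 // => j /negPf ->.
  by rewrite mul0n.
have := congr1 (mcoeff m) (hp _ _ hpres).
rewrite {1}[p]mpolyE lin_sub_sum raddf_sum /=.
rewrite (bigD1_seq m) ?msupp_uniq //= big1 ?addr0 => [|m' mm'].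
  rewrite lin_subZ lin_sub_sgmx_monomial sgn (eq_bigr (fun j => 'X_j ^+ m j)) => [|j _]; last by rewrite perm1.
  rewrite -mpolyXE_id mcoeffZ mcoeffZ mcoeffX eqxx mulr1 => /eqP.
  rewrite -subr_eq0 -{2}[p@_m]mulr1 -mulrBr mulf_eq0 mcoeff_eq0 mp_ /= subr_eq0.
  by rewrite -signr_odd dvdn2; case: (odd _) => //; rewrite expr1 eqNr oner_eq0.
rewrite lin_subZ lin_sub_sgmx_monomial sgn (eq_bigr (fun j => 'X_j ^+ m' j)) => [|j _]; last by rewrite perm1.
by rewrite -mpolyXE_id !mcoeffZ mcoeffX (negPf mm') !mulr0.
Qed.

Lemma msupp_stp p (m : 'X_{1..3}) i : Inv p -> m \in msupp p -> (stp (dl i) %| m i)%N.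
Proof.
move=> hp hm; rewrite /stp; case: eqP => [i2|_]; last exact: dvd1n.
exact: (msupp_even hp hm).
Qed.

End PowerSums.

(** * Graded determinants for unitary and symplectic blocks *)

Section Patterns.
Variables (k : closedFieldType) (dl : 'I_3 -> k).
Local Notation Inv := (Inv dl).
Local Notation mp := {mpoly rat[3]}.
Let ID := @Inv_D k dl.
Let IZ := @Inv_Z k dl.
Let IM := @Inv_M k dl.

(** For [0 < n] these are the degrees of the basic invariants of a block of [M] indices, and
    [block_factor] is the contribution of that block to the determinant in degree [n]. *)
Definition valid_deg (a : k) (M n : nat) := (stp a %| n)%N && (n <= stp a * M)%N.
Definition block_factor (a : k) (M n : nat) : {poly rat} :=
  if valid_deg a M n then 1 - ((if a ^+ 2 == 1 then 1 else -1) ^+ n) *: 'X else 1.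

Lemma mpolyX3 (m : 'X_{1..3}) : 'X_[m] = 'X_o0 ^+ m o0 * 'X_o1 ^+ m o1 * 'X_o2 ^+ m o2 :> mp.
Proof. by rewrite mpolyXE_id (big_I3 _ _) /= mulrA. Qed.

Lemma homog_mdeg (p : mp) n m : p \is n.-homog -> m \in msupp p -> (m o0 + m o1 + m o2 = n)%N.
Proof. by move=> /dhomogP h /h; rewrite /= mdegE (big_I3 _ _) /= addnA. Qed.

Lemma valid_stp (a : k) (n : nat) : (0 < n)%N -> valid_deg a 1 n = (n == stp a).
Proof.
move=> n0; rewrite /valid_deg muln1; apply/andP/eqP => [[h1 h2]|->]; last by rewrite dvdnn.
by apply/eqP; rewrite eqn_leq h2 (dvdn_leq n0 h1).
Qed.

Lemma Xn_inv_pos i n : (forall j, dl j = dl i -> j = i) -> isolated dl (dl i) ->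
  (stp (dl i) %| n)%N -> (0 < n)%N -> inv_pos Inv ('X_i ^+ n).
Proof.
move=> h1 h2 sn n0; have := psum_inv h2 sn n0.
rewrite /psum (bigD1 i) //= big1 ?addr0 // => j /andP[/eqP ji].
by rewrite (h1 j ji) eqxx.
Qed.

Lemma Xn_dec i n : (forall j, dl j = dl i -> j = i) -> isolated dl (dl i) ->
  (stp (dl i) %| n)%N -> (stp (dl i) < n)%N -> inv_dec Inv ('X_i ^+ n).
Proof.
move=> h1 h2 sn n0; rewrite -(subnK (ltnW n0)) exprD; apply: inv_decM.
  by apply: Xn_inv_pos => //; [rewrite dvdn_sub|rewrite subn_gt0].
by apply: Xn_inv_pos => //; rewrite stp_gt0.
Qed.

Section Distinct.
Hypotheses (dinj : injective dl) (diso : forall i, isolated dl (dl i)).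

(** Without repeated eigenvalues the stabilizer only changes signs. A monomial in several variables
    is then a product of invariant powers, and so is a pure power of degree above [stp]; only the
    pure powers of degree exactly [stp] remain. *)
Lemma distinct_gen n p : (0 < n)%N -> Inv p -> p \is n.-homog ->
  inv_dec Inv (p - \sum_(i | stp (dl i) == n) p@_(U_(i) *+ n) *: 'X_i ^+ n).
Proof.
move=> n0 Ip pn; have Xpos i j : (stp (dl i) %| j)%N -> (0 < j)%N -> inv_pos Inv ('X_i ^+ j).
  by move=> h1 h2; apply: Xn_inv_pos => // l /dinj.
pose q (m : 'X_{1..3}) : mp := \sum_(i | stp (dl i) == n) (m == (U_(i) *+ n)%MM)%:R *: 'X_i ^+ n.
have -> : \sum_(i | stp (dl i) == n) p@_(U_(i) *+ n) *: 'X_i ^+ n = \sum_(m <- msupp p) p@_m *: q m.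
  under [RHS]eq_bigr do rewrite scaler_sumr.
  rewrite exchange_big /=; apply: eq_bigr => i _.
  have [mi|mi] := boolP ((U_(i) *+ n)%MM \in msupp p).
    rewrite (bigD1_seq _ mi) ?msupp_uniq //= eqxx scale1r big1 ?addr0 // => m /negPf ->.
    by rewrite scale0r scaler0.
  rewrite big_seq big1 ?memN_msupp_eq0 ?scale0r // => m mp_.
  case: eqP => [e|]; last by rewrite scale0r scaler0.
  by rewrite -e mp_ in mi.
rewrite {1}[p]mpolyE -sumrB big_seq; apply: inv_dec_sum => m hm; rewrite -scalerBr; apply: inv_decZ => //.
have sm i := msupp_stp i Ip hm; have := homog_mdeg pn hm.
have Um (i : 'I_3) : (forall j, j != i -> m j = 0%N) -> m = (U_(i) *+ (m o0 + m o1 + m o2)%N)%MM.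
  move=> h; apply/mnmP => j; rewrite mulmnE mnm1E.
  case: eqP => [<-|/eqP ij]; last by rewrite mul0n h // eq_sym.
  rewrite [(true * _)%N]mul1n; move: h; move: i {j}; elim/I3P => h;
    [rewrite (h o1) // (h o2) // !addn0 //|rewrite (h o0) // (h o2) // addn0 add0n //|rewrite (h o0) // (h o1) // !add0n //].
have single (i : 'I_3) : (forall j, j != i -> m j = 0%N) -> (m o0 + m o1 + m o2 = n)%N -> inv_dec Inv ('X_[m] - q m).
  move=> h e; have mE := Um i h; rewrite e in mE.
  have mi : m i = n by rewrite mE mulmnE mnm1E eqxx mul1n.
  have XE : 'X_[m] = 'X_i ^+ n :> mp by rewrite mpolyXn -mE.
  have qE : q m = if stp (dl i) == n then 'X_i ^+ n else 0.
    rewrite /q big_mkcond (bigD1 i) //= big1 ?addr0 => [|j ji].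
      by rewrite -mE eqxx scale1r.
    case: ifP => // _; case: eqP => [e'|]; last by rewrite scale0r.
    have := congr1 (fun m' : 'X_{1..3} => m' i) e'; rewrite mi mulmnE mnm1E (negPf ji) mul0n => n00.
    by rewrite n00 in n0.
  rewrite XE qE; case: eqP => [_|/eqP ne]; first by rewrite subrr; apply: inv_dec0.
  rewrite subr0; apply: Xn_dec => //; first by move=> l /dinj.
    by rewrite -mi.
  by rewrite ltn_neqAle ne dvdn_leq // -mi.
have multi (i j l : 'I_3) : 'X_[m] = 'X_i ^+ m i * 'X_j ^+ m j * 'X_l ^+ m l :> mp -> i != j ->
    (0 < m i)%N -> (0 < m j)%N -> inv_dec Inv ('X_[m] - q m).
  move=> XE ij mi mj; have -> : q m = 0.
    rewrite /q big1 // => b _; case: eqP => [e|]; last by rewrite scale0r.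
    have [bi|bi] := eqVneq b i.
      by move: mj; rewrite e mulmnE mnm1E bi (negPf ij).
    by move: mi; rewrite e mulmnE mnm1E (negPf bi).
  rewrite subr0 XE -mulrA; apply: inv_decM; first exact: Xpos.
  have [->|l0] := posnP (m l); first by rewrite expr0 mulr1; apply: Xpos.
  by apply: inv_posM => //; apply: Xpos.
have [e0|p0] := posnP (m o0); have [e1|p1] := posnP (m o1); have [e2|p2] := posnP (m o2).
- by rewrite e0 e1 e2 => e; rewrite -e in n0.
- by apply: (single o2); elim/I3P.
- by apply: (single o1); elim/I3P.
- by move=> _; apply: (multi o1 o2 o0) => //; rewrite mpolyX3; ring.
- by apply: (single o0); elim/I3P.
- by move=> _; apply: (multi o0 o2 o1) => //; rewrite mpolyX3; ring.
- by move=> _; apply: (multi o0 o1 o2) => //; rewrite mpolyX3; ring.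
- by move=> _; apply: (multi o0 o1 o2) => //; rewrite mpolyX3; ring.
Qed.

Lemma distinct_sep n i (P : mp -> Prop) : (0 < n)%N -> stp (dl i) = n ->
  (forall h, P h -> exists2 j, j != i & h = 'X_j ^+ n) -> separating Inv ('X_i ^+ n) P.
Proof.
move=> n0 sn hP; apply: (@springer1 k dl i (dl i) n) => //.
  by rewrite line_coef eqxx expr1n oner_eq0.
move=> h /hP[j ji ->]; rewrite line_coef (negPf ji) expr0n.
by rewrite gtn_eqF.
Qed.

Lemma distinct_gdet Fr n t (f : 'I_t -> 'I_3) (B : 'M[rat]_t) : (0 < n)%N -> injective f ->
  (forall i, stp (dl i) == n = (i \in codom f)) ->
  (forall b, Fr ('X_(f b) ^+ n) = \sum_c B b c *: 'X_(f c) ^+ n) ->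
  inv_gdet Inv Fr n (\det (1%:M - 'X *: map_mx polyC B)).
Proof.
move=> n0 fi hf hB; have sf b : stp (dl (f b)) = n by apply/eqP; rewrite hf codom_f.
apply: (@gdet_all Inv Fr IZ n t (fun b => 'X_(f b) ^+ n)).
- move=> b; split; last exact: Xn_homog.
  by apply: Xn_inv_pos => //; [move=> l /dinj|rewrite sf].
- move=> p [Ip _] pn; exists (fun b => p@_(U_(f b) *+ n)).
  have := distinct_gen n0 Ip pn; congr (inv_dec _ (_ - _)).
  rewrite (eq_bigl (fun i => i \in codom f)) //.
  rewrite /lincomb -(big_map f xpredT (fun i => p@_(U_(i) *+ n) *: 'X_i ^+ n)) -big_filter.
  apply: perm_big; apply: uniq_perm; rewrite ?filter_uniq ?map_inj_uniq ?index_enum_uniq // => i.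
  rewrite mem_filter mem_index_enum andbT.
  by apply/codomP/mapP => [[b ->]|[b _ ->]]; exists b; rewrite ?mem_index_enum.
- move=> b; apply: distinct_sep => // h [b' bb' ->]; exists (f b') => //.
  by rewrite (inj_eq fi).
- by move=> b; rewrite hB.
Qed.

Variables (Q : nat) (tau : {perm 'I_3}) (eps : 'I_3 -> bool).
Hypotheses (Qinj : injective (fun x : k => x ^+ Q))
  (hF : forall i, dl i = (if eps i then (dl (tau i))^-1 else dl (tau i)) ^+ Q).

Lemma distinct_unitary_gdet n : (forall i, dl i ^+ Q = (dl i)^-1) -> (0 < n)%N ->
  inv_gdet Inv (lin_sub (sgmx tau eps)) n (\prod_i block_factor (dl i) 1 n).
Proof.
move=> hQ n0; pose g i : mp := psum dl (dl i) n.
have gE i : g i = 'X_i ^+ n.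
  rewrite /g /psum (bigD1 i) //= big1 ?addr0 // => j /andP[/eqP/dinj ->].
  by rewrite eqxx.
pose sg i : rat := (if dl i ^+ 2 == 1 then 1 else -1) ^+ n.
have -> : \prod_i block_factor (dl i) 1 n = \prod_(i | stp (dl i) == n) (1 - sg i *: 'X).
  by rewrite [RHS]big_mkcond; apply: eq_bigr => i _; rewrite /block_factor valid_stp // eq_sym.
apply: (@gdet_blocks Inv (lin_sub (sgmx tau eps)) IZ n 3 g).
- move=> b /eqP sb; rewrite gE; split; last exact: Xn_homog.
  by apply: Xn_inv_pos => //; [move=> l /dinj|rewrite sb].
- move=> p [Ip _] pn; exists (fun i => if stp (dl i) == n then p@_(U_(i) *+ n) else 0); split.
    by move=> b /negPf ->; rewrite scale0r; apply: inv_dec0.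
  have := distinct_gen n0 Ip pn; congr (inv_dec _ (_ - _)); rewrite /lincomb big_mkcond.
  by apply: eq_bigr => i _; rewrite gE; case: ifP => // _; rewrite scale0r.
- move=> b /eqP sb; rewrite gE; apply: distinct_sep => // h [b' [_ bb' ->]].
  by exists b'; rewrite ?gE.
- move=> b /eqP sb; apply: (Frob_psum Qinj hF) => //.
  by rewrite sb.
Qed.

End Distinct.

Section Repeated.
Variables (Q : nat) (tau : {perm 'I_3}) (eps : 'I_3 -> bool).
Hypotheses (Qinj : injective (fun x : k => x ^+ Q))
  (hF : forall i, dl i = (if eps i then (dl (tau i))^-1 else dl (tau i)) ^+ Q).
Local Notation Fr := (lin_sub (sgmx tau eps)).

(** Gives as many expansions of an invariant as there are permutations of a block; adding them up
    expresses a multiple of [p] by symmetrized monomials. *)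
Lemma perm_mcoeff (p : mp) i j l (hs : injective (f3 i j l)) : (forall b, dl (f3 i j l b) = dl b) -> Inv p ->
  p = \sum_(m <- msupp p) p@_m *: ('X_i ^+ m o0 * 'X_j ^+ m o1 * 'X_l ^+ m o2).
Proof.
move=> hd Ip; have hp : preserves dl (perm hs) (fun=> false) by move=> b; rewrite permE.
rewrite -{1}(Ip _ _ hp) {1}[p]mpolyE lin_sub_sum; apply: eq_bigr => m _.
rewrite lin_subZ lin_sub_sgmx_monomial big1 ?scale1r => [|b _]; last by rewrite mul0n.
by rewrite (big_I3 _ _) /= !permE /= mulrA.
Qed.

Lemma psum_Frob a n : a ^+ Q = a^-1 -> isolated dl a -> (stp a %| n)%N ->
  Fr (psum dl a n) = ((if a ^+ 2 == 1 then 1 else -1) ^+ n : rat) *: psum dl a n.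
Proof. exact: (Frob_psum Qinj hF). Qed.

(** The two expansions of [p] add up to [2 p], which [sym2_dec] reduces to the power sums of the two
    blocks. Newton's identities discard the degrees that are too large, and Springer's functionals
    separate the others. *)
Lemma two_gdet n : dl o0 = dl o1 -> dl o2 != dl o0 -> isolated dl (dl o0) -> isolated dl (dl o2) ->
  (forall i, dl i ^+ Q = (dl i)^-1) -> (0 < n)%N ->
  inv_gdet Inv Fr n (block_factor (dl o0) 2 n * block_factor (dl o2) 1 n).
Proof.
move=> d01 d20 isoa isob hQ n0; set a := dl o0 in d20 isoa *; set b := dl o2 in d20 isob *.
have psA j : psum dl a j = 'X_o0 ^+ j + 'X_o1 ^+ j.
  rewrite /psum big_mkcond (big_I3 _ _) /= -/b -d01 -/a eqxx (negPf d20).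
  by rewrite addr0.
have psB j : psum dl b j = 'X_o2 ^+ j.
  rewrite /psum big_mkcond (big_I3 _ _) /= -/b -d01 -/a eqxx eq_sym (negPf d20).
  by rewrite !add0r.
have RA j : (0 < j)%N -> (stp a %| j)%N -> inv_pos Inv ('X_o0 ^+ j + 'X_o1 ^+ j).
  by move=> j0 sj; rewrite -psA; apply: psum_inv.
have RB j : (0 < j)%N -> (stp b %| j)%N -> inv_pos Inv ('X_o2 ^+ j).
  by move=> j0 sj; rewrite -psB; apply: psum_inv.
pose g : 'I_2 -> mp := fun i => if i == ord0 then psum dl a n else psum dl b n.
pose vb : pred 'I_2 := fun i => if i == ord0 then valid_deg a 2 n else valid_deg b 1 n.
pose ep (c : k) : rat := (if c ^+ 2 == 1 then 1 else -1) ^+ n.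
pose sg : 'I_2 -> rat := fun i => if i == ord0 then ep a else ep b.
have -> : block_factor a 2 n * block_factor b 1 n = \prod_(i | vb i) (1 - sg i *: 'X).
  by rewrite big_mkcond big_ord_recl big_ord1 /vb /sg /= /block_factor.
have I2P (P : 'I_2 -> Prop) : P ord0 -> P ord_max -> forall i, P i.
  by move=> P0 P1 [[|[|i]] hi] //; [move: P0|move: P1]; congr P; apply: val_inj.
apply: (@gdet_blocks Inv Fr IZ n 2 g).
- apply: I2P => /andP[sn _]; rewrite /g /=; split; try exact: psum_homog; exact: psum_inv.
- move=> p [Ip _] pn.
  have e1 : p = \sum_(m <- msupp p) p@_m *: ('X_o0 ^+ m o0 * 'X_o1 ^+ m o1 * 'X_o2 ^+ m o2).
    by apply: perm_mcoeff => //; elim/I3P => //; elim/I3P.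
  have e2 : p = \sum_(m <- msupp p) p@_m *: ('X_o1 ^+ m o0 * 'X_o0 ^+ m o1 * 'X_o2 ^+ m o2).
    by apply: (perm_mcoeff swap01_inj) => //; elim/I3P.
  have /choice [uv huv] : forall m : 'X_{1..3}, exists uv : rat * rat, m \in msupp p ->
      [/\ uv.1 != 0 -> (stp a %| n)%N, uv.2 != 0 -> (stp b %| n)%N &
       inv_dec Inv (('X_o0 ^+ m o0 * 'X_o1 ^+ m o1 + 'X_o1 ^+ m o0 * 'X_o0 ^+ m o1) * 'X_o2 ^+ m o2
         - (uv.1 *: ('X_o0 ^+ n + 'X_o1 ^+ n) + uv.2 *: 'X_o2 ^+ n))].
    move=> m; case: (boolP (m \in msupp p)) => [mp_|_]; last by exists (0, 0).
    have mn := homog_mdeg pn mp_.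
    have [||||u [v [h1 h2 h3]]] := @sym2_dec Inv ID IZ IM 'X_o0 'X_o1 'X_o2 (stp a) (stp b) RA RB (m o0) (m o1) (m o2).
    - exact: (msupp_stp o0 Ip mp_).
    - by have := msupp_stp o1 Ip mp_; rewrite -d01.
    - exact: (msupp_stp o2 Ip mp_).
    - by rewrite mn.
    by rewrite mn in h1 h2 h3; exists (u, v).
  pose c (i : 'I_2) : rat := 2^-1 * \sum_(m <- msupp p) p@_m * (if i == ord0 then (uv m).1 else (uv m).2).
  exists c; split.
    have c0 i : c i != 0 -> exists2 m, m \in msupp p & (if i == ord0 then (uv m).1 else (uv m).2) != 0.
      move=> ci; case: (boolP (has (fun m => (if i == ord0 then (uv m).1 else (uv m).2) != 0) (msupp p))).
        by move/hasP.
      move=> /hasPn h; case/eqP: ci; rewrite /c big_seq big1 ?mulr0 // => m /h.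
      by rewrite negbK => /eqP ->; rewrite mulr0.
    have z0 i : c i = 0 -> inv_dec Inv (c i *: g i) by move=> ->; rewrite scale0r; apply: inv_dec0.
    apply: I2P => vi.
      have [/z0 //|/c0[m mp_ /= um]] := eqVneq (c ord0) 0; have [h1 _ _] := huv m mp_.
      apply: inv_decZ => //; rewrite /g /=; move: vi; rewrite /vb /valid_deg /=.
      have sn := h1 um; rewrite sn -ltnNge psA; move/dvdnP: sn => [j nE].
      rewrite nE (mulnC j) ltn_mul2l => /andP[_ j2].
      have := @dec_pow2 Inv ID IZ IM (fun i => 'X_i ^+ stp a) _ j j2; rewrite -!exprM; apply.
      by move=> l l0; rewrite -!exprM; apply: RA; rewrite ?dvdn_mulr // muln_gt0 stp_gt0.
    have [/z0 //|/c0[m mp_ /= um]] := eqVneq (c ord_max) 0; have [_ h2 _] := huv m mp_.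
    apply: inv_decZ => //; rewrite /g /=; move: vi; rewrite /vb /valid_deg /=.
    have sn := h2 um; rewrite sn -ltnNge psB; move/dvdnP: sn => [j nE].
    rewrite nE (mulnC j) ltn_mul2l => /andP[_ j2].
    have := @dec_pow1 Inv (fun=> 'X_o2 ^+ stp b) _ j j2; rewrite -!exprM; apply.
    by move=> l l0; rewrite -!exprM; apply: RB; rewrite ?dvdn_mulr // muln_gt0 stp_gt0.
  rewrite /lincomb big_ord_recl big_ord1 /g /= /c /= psA psB.
  have -> : p - ((2^-1 * (\sum_(m <- msupp p) p@_m * (uv m).1)) *: ('X_o0 ^+ n + 'X_o1 ^+ n)
      + (2^-1 * (\sum_(m <- msupp p) p@_m * (uv m).2)) *: 'X_o2 ^+ n) =
    2^-1 *: \sum_(m <- msupp p) p@_m *: (('X_o0 ^+ m o0 * 'X_o1 ^+ m o1 + 'X_o1 ^+ m o0 * 'X_o0 ^+ m o1) * 'X_o2 ^+ m o2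
         - ((uv m).1 *: ('X_o0 ^+ n + 'X_o1 ^+ n) + (uv m).2 *: 'X_o2 ^+ n)).
    under [in RHS]eq_bigr do rewrite mulrDl scalerBr !scalerDr !scalerA.
    rewrite sumrB !big_split /= -!scaler_suml -e1 -e2 -!scalerA -!scalerDr scalerBr; congr (_ - _).
    by rewrite -mulr2n -scaler_nat scalerA mulVf ?scale1r.
  apply: inv_decZ => //; rewrite big_seq; apply: inv_dec_sum => m /huv[_ _ h].
  exact: inv_decZ.
- have oth0 b' : b' != ord0 -> g b' = 'X_o2 ^+ n by move: b'; apply: I2P => //= _; rewrite /g /= psB.
  have oth1 b' : b' != ord_max -> g b' = 'X_o0 ^+ n + 'X_o1 ^+ n by move: b'; apply: I2P => //= _; rewrite /g /= psA.
  have n00 : (0 : algC) ^+ n = 0 by rewrite expr0n gtn_eqF.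
  apply: I2P.
    (* Here [n = stp a * j] with [j] equal to 1 or 2, and an eigenvector supported on [j]
       coordinates of the block detects the power sum. *)
    move=> /andP[sn nle]; case/dvdnP: sn => j nE; rewrite nE mulnC leq_mul2l eqn0Ngt stp_gt0 /= in nle.
    rewrite {1}/g /= psA; case: j nE nle => [|[|[|]]] // nE _; first by rewrite nE in n0.
      rewrite mul1n in nE; apply: (@springer1 k dl o0 a n) => //.
        by rewrite line_coefD !line_coef eqxx /= expr1n n00 addr0 oner_eq0.
      by move=> h [b' [_ /oth0 b0 ->]]; rewrite b0 line_coef.
    apply: (@springer2 k dl a n) => //.
      by rewrite nE mulnC.
      by move=> z zn; rewrite line_coefD !line_coef /f3 /= expr1n zn (_ : 1 + 1 = 2%:R) // pnatr_eq0.
    by move=> z h zn [b' [_ /oth0 b0 ->]]; rewrite b0 line_coef.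
  rewrite /vb /= valid_stp // => /eqP sn; rewrite {1}/g /= psB; apply: (@springer1 k dl o2 b n) => //.
    by rewrite line_coef eqxx /= expr1n oner_eq0.
  by move=> h [b' [_ /oth1 b1 ->]]; rewrite b1 line_coefD !line_coef /= n00 addr0.
- by apply: I2P => /andP[sn _]; [exact: (psum_Frob (hQ o0) isoa sn)|exact: (psum_Frob (hQ o2) isob sn)].
Qed.

(** As for two blocks, with six expansions and [sym3_dec]; the generators of degree [stp a * j] are
    detected by eigenvectors with [j] nonzero coordinates, for [j] from 1 to 3. *)
Lemma one_gdet n : (forall i, dl i = dl o0) -> isolated dl (dl o0) ->
  (forall i, dl i ^+ Q = (dl i)^-1) -> (0 < n)%N ->
  inv_gdet Inv Fr n (block_factor (dl o0) 3 n).
Proof.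
move=> dE isoa hQ n0; set a := dl o0 in dE isoa *.
have psA j : psum dl a j = 'X_o0 ^+ j + 'X_o1 ^+ j + 'X_o2 ^+ j.
  by rewrite /psum big_mkcond (big_I3 _ _) /= !dE eqxx addrA.
have RA j : (0 < j)%N -> (stp a %| j)%N -> inv_pos Inv ('X_o0 ^+ j + 'X_o1 ^+ j + 'X_o2 ^+ j).
  by move=> j0 sj; rewrite -psA; apply: psum_inv.
pose g : 'I_1 -> mp := fun=> psum dl a n.
pose vb : pred 'I_1 := fun=> valid_deg a 3 n.
pose sg : 'I_1 -> rat := fun=> (if a ^+ 2 == 1 then 1 else -1) ^+ n.
have -> : block_factor a 3 n = \prod_(i | vb i) (1 - sg i *: 'X).
  by rewrite big_mkcond big_ord1 /vb /sg /= /block_factor.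
apply: (@gdet_blocks Inv Fr IZ n 1 g).
- move=> b /andP[sn _]; split; [exact: psum_inv|exact: psum_homog].
- move=> p [Ip _] pn.
  have pm i j l (hs : injective (f3 i j l)) := @perm_mcoeff p i j l hs (fun b => etrans (dE _) (esym (dE b))) Ip.
  have e1 : p = \sum_(m <- msupp p) p@_m *: ('X_o0 ^+ m o0 * 'X_o1 ^+ m o1 * 'X_o2 ^+ m o2) by apply: pm; elim/I3P; elim/I3P.
  have e2 : p = \sum_(m <- msupp p) p@_m *: ('X_o0 ^+ m o0 * 'X_o2 ^+ m o1 * 'X_o1 ^+ m o2) by apply: pm; elim/I3P; elim/I3P.
  have e3 : p = \sum_(m <- msupp p) p@_m *: ('X_o1 ^+ m o0 * 'X_o0 ^+ m o1 * 'X_o2 ^+ m o2) by apply: pm; elim/I3P; elim/I3P.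
  have e4 : p = \sum_(m <- msupp p) p@_m *: ('X_o1 ^+ m o0 * 'X_o2 ^+ m o1 * 'X_o0 ^+ m o2) by apply: pm; elim/I3P; elim/I3P.
  have e5 : p = \sum_(m <- msupp p) p@_m *: ('X_o2 ^+ m o0 * 'X_o0 ^+ m o1 * 'X_o1 ^+ m o2) by apply: pm; elim/I3P; elim/I3P.
  have e6 : p = \sum_(m <- msupp p) p@_m *: ('X_o2 ^+ m o0 * 'X_o1 ^+ m o1 * 'X_o0 ^+ m o2) by apply: pm; elim/I3P; elim/I3P.
  pose S (m : 'X_{1..3}) : mp :=
     'X_o0 ^+ m o0 * 'X_o1 ^+ m o1 * 'X_o2 ^+ m o2 + 'X_o0 ^+ m o0 * 'X_o2 ^+ m o1 * 'X_o1 ^+ m o2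
     + 'X_o1 ^+ m o0 * 'X_o0 ^+ m o1 * 'X_o2 ^+ m o2 + 'X_o1 ^+ m o0 * 'X_o2 ^+ m o1 * 'X_o0 ^+ m o2
     + 'X_o2 ^+ m o0 * 'X_o0 ^+ m o1 * 'X_o1 ^+ m o2 + 'X_o2 ^+ m o0 * 'X_o1 ^+ m o1 * 'X_o0 ^+ m o2.
  have /choice [u hu] : forall m : 'X_{1..3}, exists u : rat, m \in msupp p -> inv_dec Inv (S m - u *: psum dl a n).
    move=> m; case: (boolP (m \in msupp p)) => [mp_|_]; last by exists 0.
    have mn := homog_mdeg pn mp_.
    have [||||u h] := @sym3_dec Inv ID IZ IM 'X_o0 'X_o1 'X_o2 (stp a) RA (m o0) (m o1) (m o2).
    - exact: (msupp_stp o0 Ip mp_).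
    - by have := msupp_stp o1 Ip mp_; rewrite dE.
    - by have := msupp_stp o2 Ip mp_; rewrite dE.
    - by rewrite mn.
    by rewrite mn -psA in h; exists u.
  have snn : p != 0 -> (stp a %| n)%N.
    rewrite -msupp_eq0; case E: (msupp p) => [|m ms] // _.
    have mp_ : m \in msupp p by rewrite E mem_head.
    rewrite -(homog_mdeg pn mp_); rewrite !dvdn_add //.
    - exact: (msupp_stp o0 Ip mp_).
    - by have := msupp_stp o1 Ip mp_; rewrite dE.
    - by have := msupp_stp o2 Ip mp_; rewrite dE.
  have [p0|p0] := eqVneq p 0.
    exists (fun=> 0); split=> [b _|]; first by rewrite scale0r; apply: inv_dec0.
    by rewrite p0 /lincomb big1 ?subrr => [|i _]; [apply: inv_dec0|rewrite scale0r].
  exists (fun=> 6%:R^-1 * \sum_(m <- msupp p) p@_m * u m); split.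
    move=> b; rewrite /vb /valid_deg (snn p0) /= -ltnNge => nlt; apply: inv_decZ => //.
    rewrite /g psA; have /dvdnP[j nE] := snn p0.
    move: nlt; rewrite nE (mulnC j) ltn_mul2l => /andP[_ j2].
    have := @dec_pow3 Inv ID IZ IM (fun i => 'X_i ^+ stp a) _ j j2; rewrite -!exprM; apply.
    by move=> l l0; rewrite -!exprM; apply: RA; rewrite ?dvdn_mulr // muln_gt0 stp_gt0.
  rewrite /lincomb big_ord1.
  have -> : p - (6%:R^-1 * \sum_(m <- msupp p) p@_m * u m) *: g ord0 =
      6%:R^-1 *: \sum_(m <- msupp p) p@_m *: (S m - u m *: psum dl a n).
    under [in RHS]eq_bigr do rewrite scalerBr !scalerDr !scalerA.
    rewrite sumrB !big_split /= -!scaler_suml -e1 -e2 -e3 -e4 -e5 -e6 scalerBr scalerA.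
    congr (_ - _); rewrite (_ : _ + p = 6%:R *: p) ?scalerA ?mulVf ?scale1r //.
    by rewrite scaler_nat !mulrSr mulr0n add0r.
  apply: inv_decZ => //; rewrite big_seq; apply: inv_dec_sum => m /hu h.
  exact: inv_decZ.
- have n00 : (0 : algC) ^+ n = 0 by rewrite expr0n gtn_eqF.
  have noP (P : Prop) h : (exists b' : 'I_1, [/\ vb b', b' != ord0 & h = g b']) -> P.
    by case=> b'; rewrite (ord1 b') eqxx => -[].
  move=> b /andP[sn nle]; rewrite (ord1 b); case/dvdnP: sn => j nE; rewrite nE mulnC leq_mul2l eqn0Ngt stp_gt0 /= in nle.
  rewrite {1}/g /= psA; case: j nE nle => [|[|[|[|]]]] // nE _; first by rewrite nE in n0.
  + rewrite mul1n in nE; apply: (@springer1 k dl o0 a n) => //; last by move=> h; apply: noP.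
    by rewrite !line_coefD !line_coef eqxx /= expr1n n00 !addr0 oner_eq0.
  + apply: (@springer2 k dl a n) => //; [by rewrite nE mulnC| |by move=> z h _; apply: noP].
    by move=> z zn; rewrite !line_coefD !line_coef /f3 /= expr1n zn n00 addr0 (_ : 1 + 1 = 2%:R) // pnatr_eq0.
  + apply: (@springer3 k dl a n) => //; [by rewrite nE mulnC| |by move=> z h _; apply: noP].
    move=> z zn; rewrite !line_coefD !line_coef /f3 /= expr1n exprAC zn expr1n.
    by rewrite -addrA (_ : 1 + (1 + 1) = 3%:R) // pnatr_eq0.
- by move=> b /andP[sn _]; exact: (psum_Frob (hQ o0) isoa sn).
Qed.

End Repeated.
End Patterns.

(** * Monomial maps and Laurent functions on tori *)

Section Monomials.
Variable k : closedFieldType.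

(** A root of [P * 'X - 1] is nonzero and is not a root of [P]. *)
Lemma exists_nonroot (P : {poly k}) : P != 0 -> exists2 y : k, y != 0 & P.[y] != 0.
Proof.
move=> P0; have sz : (1 < size (P * 'X)%R)%N by rewrite size_mulX // ltnS size_poly_gt0.
have : size (P * 'X - 1) != 1%N.
  rewrite size_polyDl ?neq_ltn ?sz ?orbT // size_polyN size_poly1.
  exact: sz.
case/closed_rootP => y; rewrite rootE !hornerE subr_eq0 => /eqP e.
have := oner_neq0 k; rewrite -e mulf_eq0 negb_or => /andP[h1 h2].
by exists y.
Qed.

Lemma exists_pow_neq (a b : int) : a != b -> exists2 y : k, y != 0 & y ^ a != y ^ b.
Proof.
move=> ab; have [n [n0 hn]] : exists n : nat, (0 < n)%N /\ forall y : k, y != 0 -> y ^ a = y ^ b -> y ^+ n = 1.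
  wlog : a b ab / (a <= b)%R.
    move=> h; case: (leP a b) => [|/ltW] ba; first exact: h.
    have ba' : b != a by rewrite eq_sym.
    have [n [n0 hn]] := h b a ba' ba.
    by exists n; split=> // y y0 e; apply: hn.
  move=> ab'; exists `|b - a|%N; split; first by rewrite absz_gt0 subr_eq0 eq_sym.
  move=> y y0 e; rewrite exprnP gez0_abs ?subr_ge0 // expfzDr // -e -expfzDr //.
  by rewrite subrr expr0z.
have [|y y0 hy] := @exists_nonroot ('X^n - 1).
  by rewrite -size_poly_eq0 size_XnsubC.
exists y => //; apply: contra hy => /eqP/(hn y y0) e.
by rewrite !hornerE e subrr.
Qed.

Definition mono a b (M : 'M[int]_(a, b)) (z : 'I_b -> k) (i : 'I_a) : k := \prod_j z j ^ M i j.

Lemma mono_torus a b (M : 'M[int]_(a, b)) z : torus_points z -> torus_points (mono M z).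
Proof. by move=> hz i; rewrite prodf_seq_neq0; apply/allP => j _ /=; rewrite expfz_neq0. Qed.

Lemma prod_exprz (I : Type) (s : seq I) (F : I -> k) (e : int) : (\prod_(i <- s) F i) ^ e = \prod_(i <- s) F i ^ e.
Proof. by elim/big_rec2: _ => [|i y x _ <-]; rewrite ?exp1rz // exprzMl_field || rewrite expfzMl. Qed.

Lemma mono_mul a b c (N : 'M[int]_(a, b)) (M : 'M[int]_(b, c)) z : torus_points z ->
  mono N (mono M z) = mono (N *m M) z.
Proof.
move=> hz; apply/funext => i; rewrite /mono.
under eq_bigr do rewrite prod_exprz; rewrite exchange_big /=; apply: eq_bigr => j _.
rewrite mxE; elim/big_rec2: _ => [|l y x _ ->]; first by rewrite expr0z.
by rewrite expfzDr // exprz_exp [M l j * _]mulrC.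
Qed.

Lemma mono1 a (z : 'I_a -> k) : mono 1%:M z = z.
Proof.
apply/funext => i; rewrite /mono (bigD1 i) //= mxE eqxx expr1z big1 ?mulr1 // => j ji.
by rewrite mxE eq_sym (negPf ji) expr0z.
Qed.

Lemma mono_inj a b (M M' : 'M[int]_(a, b)) :
  (forall z, torus_points z -> mono M z = mono M' z) -> M = M'.
Proof.
move=> h; apply/matrixP => i j; apply/eqP; apply: contraT => /exists_pow_neq[y y0].
pose z l := if l == j then y else 1.
have hz : torus_points z by move=> l; rewrite /z; case: ifP; rewrite ?y0 ?oner_eq0.
have zE (N : 'M[int]_(a, b)) : mono N z i = y ^ N i j.
  rewrite /mono (bigD1 j) //= /z eqxx big1 ?mulr1 // => l /negPf ->.
  by rewrite exp1rz.
by rewrite -!zE (h z hz) eqxx.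
Qed.

Lemma mono_expn a b (M : 'M[int]_(a, b)) z Q : mono M (fun j => z j ^+ Q) = fun i => mono M z i ^+ Q.
Proof.
apply/funext => i; rewrite /mono -prodrXl; apply: eq_bigr => j _.
by rewrite !exprnP !exprz_exp mulrC.
Qed.

Lemma torusM r (z w : 'I_r -> k) : torus_points z -> torus_points w -> torus_points (fun i => z i * w i).
Proof. by move=> hz hw i; rewrite mulf_neq0. Qed.

(** Independence of characters: translating the relation by a torus point that separates two
    monomials, and subtracting a multiple of the original one, removes a term. *)
Lemma monomials_indep r (s : seq 'X_{1..r}) (c : 'X_{1..r} -> k) : uniq s ->
  (forall z, torus_points z -> \sum_(m <- s) c m * \prod_i z i ^+ m i = 0) -> {in s, forall m, c m = 0}.
Proof.
elim: s c => // m0 s IH c /= /andP[m0s us] h.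
have cs m : m \in s -> c m = 0.
  move=> ms; have [i mi] : exists i, m i != m0 i.
    apply/existsP; rewrite -negb_forall; apply: contra m0s => /forallP e.
    by rewrite (_ : m0 = m) //; apply/mnmP => i; apply/esym/eqP.
  have [y y0 hy] : exists2 y : k, y != 0 & y ^+ m i != y ^+ m0 i.
    by have [|y y0 hy] := @exists_pow_neq (m i) (m0 i); [|exists y].
  pose w l := if l == i then y else 1.
  have hw : torus_points w by move=> l; rewrite /w; case: ifP; rewrite ?y0 ?oner_eq0.
  have wE (l : 'X_{1..r}) : \prod_j w j ^+ l j = y ^+ l i.
    by rewrite (bigD1 i) //= /w eqxx big1 ?mulr1 // => j /negPf ->; rewrite expr1n.
  have /(_ m ms)/eqP : {in s, forall m, c m * (y ^+ m i - y ^+ m0 i) = 0}.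
    apply: (IH (fun m => c m * (y ^+ m i - y ^+ m0 i)) us) => z hz.
    have := h _ (torusM hw hz); have := h z hz; rewrite !big_cons => e1 e2.
    transitivity ((c m0 * \prod_i (w i * z i) ^+ m0 i + \sum_(m <- s) c m * \prod_i (w i * z i) ^+ m i)
      - y ^+ m0 i * (c m0 * \prod_i z i ^+ m0 i + \sum_(m <- s) c m * \prod_i z i ^+ m i)).
      have pE (l : 'X_{1..r}) : \prod_i (w i * z i) ^+ l i = y ^+ l i * \prod_i z i ^+ l i.
        by rewrite -wE -big_split; apply: eq_bigr => j _; rewrite exprMn.
      rewrite pE mulrDr opprD addrACA mulrCA subrr add0r mulr_sumr -sumrB.
      by apply: eq_bigr => l _; rewrite pE; ring.
    by rewrite e1 e2 mulr0 subr0.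
  by rewrite mulf_eq0 subr_eq0 (negPf hy) orbF => /eqP.
move=> m; rewrite inE => /orP[/eqP ->|/cs //].
have e1 : \prod_(i < r) (1 : k) ^+ m0 i = 1 by rewrite big1 // => i _; rewrite expr1n.
have := h (fun=> 1) (fun=> oner_neq0 k); rewrite big_cons e1 mulr1 => <-.
by rewrite big_seq big1 ?addr0 // => l ls; rewrite cs // mul0r.
Qed.

(** For fixed [z], the identity [p(z w) = p(z) p(w)] is a relation between monomials in [w].
    Independence shows that [p(z)] equals every monomial in the support of [p]; the denominator
    shifts the exponents by [e]. *)
Lemma laurent_monomial r (f : ('I_r -> k) -> k) : laurent_function f ->
  (forall z w, torus_points z -> torus_points w -> f (fun i => z i * w i) = f z * f w) ->
  f (fun=> 1) != 0 -> exists m : 'I_r -> int, forall z, torus_points z -> f z = \prod_j z j ^ m j.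
Proof.
case=> p [e hf] fM f1; pose D (z : 'I_r -> k) := \prod_i z i.
have D0 z : torus_points z -> D z != 0 by move=> hz; rewrite prodf_seq_neq0; apply/allP => i _ /=.
have pf z : torus_points z -> p.@[z] = f z * D z ^+ e.
  by move=> hz; rewrite hf // divfK // expf_neq0 // D0.
have pM z w : torus_points z -> torus_points w -> p.@[fun i => z i * w i] = p.@[z] * p.@[w].
  move=> hz hw; rewrite !pf //; last exact: torusM.
  by rewrite fM // /D big_split /= exprMn; ring.
have : p != 0.
  by apply: contra_neq f1 => p0; rewrite hf ?p0 ?meval0 ?mul0r // => i; rewrite oner_eq0.
rewrite -msupp_eq0; case E: (msupp p) => [|m ms] // _.
have mp_ : m \in msupp p by rewrite E mem_head.
exists (fun j => (m j)%:Z - e%:Z) => z hz.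
have key : p@_m * (\prod_i z i ^+ m i - p.@[z]) = 0.
  apply: (monomials_indep (s := msupp p) (c := fun m => p@_m * (\prod_i z i ^+ m i - p.@[z]))) => // w hw.
  rewrite (eq_bigr (fun l => p@_l * \prod_i (z i * w i) ^+ l i - p.@[z] * (p@_l * \prod_i w i ^+ l i))) => [|l _].
    rewrite sumrB -mulr_sumr -[X in _ - _ * X]mevalE -[X in X - _]mevalE pM //.
    by rewrite subrr.
  by under [in RHS]eq_bigr do rewrite exprMn; rewrite big_split /=; ring.
move/eqP: key; rewrite mulf_eq0 mcoeff_eq0 mp_ /= subr_eq0 => /eqP pz.
rewrite hf // -pz /D -prodrXl -prodf_div; apply: eq_bigr => i _.
by rewrite expfzDr // -invr_expz !exprnP.
Qed.

Section Laurent.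
Variable r : nat.
Implicit Types f h : ('I_r -> k) -> k.
Let D : {mpoly k[r]} := \prod_i 'X_i.
Let DE z : D.@[z] = \prod_i z i.
Proof. by rewrite /D rmorph_prod; apply: eq_bigr => i _; rewrite /= mevalXU. Qed.
Let D0 (z : 'I_r -> k) e : torus_points z -> (\prod_i z i) ^+ e != 0.
Proof. by move=> hz; rewrite expf_neq0 // prodf_seq_neq0; apply/allP => i _ /=. Qed.

Lemma laurent_ext f h : (forall z, torus_points z -> f z = h z) -> laurent_function f -> laurent_function h.
Proof. by move=> fh [p [e hf]]; exists p, e => z hz; rewrite -fh // hf. Qed.

Lemma laurent_poly (p : {mpoly k[r]}) : laurent_function (fun z => p.@[z]).
Proof. by exists p, 0%N => z _; rewrite expr0 divr1. Qed.

Lemma laurent_const c : laurent_function (fun _ : 'I_r -> k => c).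
Proof. by apply: (@laurent_ext (fun z => (c%:MP : {mpoly k[r]}).@[z])) (laurent_poly _) => z _; rewrite mevalC. Qed.

Lemma laurent_var i : laurent_function (fun z : 'I_r -> k => z i).
Proof. by apply: (@laurent_ext (fun z => ('X_i : {mpoly k[r]}).@[z])) (laurent_poly _) => z _; rewrite mevalXU. Qed.

Lemma laurent_inv i : laurent_function (fun z : 'I_r -> k => (z i)^-1).
Proof.
exists (\prod_(j | j != i) 'X_j), 1%N => z hz; rewrite expr1 rmorph_prod /=.
rewrite [X in _ / X](bigD1 i) //= invfM mulrCA (eq_bigr (fun j => z j)) => [|j _]; last by rewrite mevalXU.
rewrite mulfV ?mulr1 // prodf_seq_neq0; apply/allP => j _; apply/implyP => _.
exact: hz.
Qed.

Lemma laurentD f h : laurent_function f -> laurent_function h -> laurent_function (fun z => f z + h z).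
Proof.
case=> p [e hf] [p' [e' hh]]; exists (p * D ^+ e' + p' * D ^+ e), (e + e')%N => z hz.
rewrite hf // hh // mevalD !mevalM !rmorphXn /= DE exprD.
by have := D0 e hz; have := D0 e' hz; move=> h1 h2; field; rewrite h1 h2.
Qed.

Lemma laurentM f h : laurent_function f -> laurent_function h -> laurent_function (fun z => f z * h z).
Proof.
case=> p [e hf] [p' [e' hh]]; exists (p * p'), (e + e')%N => z hz.
rewrite hf // hh // mevalM exprD.
by have := D0 e hz; have := D0 e' hz; move=> h1 h2; field; rewrite h1 h2.
Qed.

Lemma laurent_sum I (s : seq I) (F : I -> ('I_r -> k) -> k) : (forall i, laurent_function (F i)) ->
  laurent_function (fun z => \sum_(i <- s) F i z).
Proof.
move=> hF; elim: s => [|i s IH].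
  by apply: (laurent_ext _ (laurent_const 0)) => z _; rewrite big_nil.
by apply: (laurent_ext _ (laurentD (hF i) IH)) => z _; rewrite big_cons.
Qed.

Lemma laurent_prod I (s : seq I) (F : I -> ('I_r -> k) -> k) : (forall i, laurent_function (F i)) ->
  laurent_function (fun z => \prod_(i <- s) F i z).
Proof.
move=> hF; elim: s => [|i s IH].
  by apply: (laurent_ext _ (laurent_const 1)) => z _; rewrite big_nil.
by apply: (laurent_ext _ (laurentM (hF i) IH)) => z _; rewrite big_cons.
Qed.

Lemma laurent_exp f n : laurent_function f -> laurent_function (fun z => f z ^+ n).
Proof.
move=> hf; have := laurent_prod (index_enum 'I_n) (fun=> hf).
by apply: laurent_ext => z _; rewrite prodr_const card_ord.
Qed.

Lemma laurent_comp n (p : {mpoly k[n]}) (F : 'I_n -> ('I_r -> k) -> k) : (forall i, laurent_function (F i)) ->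
  laurent_function (fun z => p.@[fun i => F i z]).
Proof.
move=> hF; have : laurent_function (fun z => \sum_(m <- msupp p) p@_m * \prod_i F i z ^+ m i).
  apply: laurent_sum => m; apply: laurentM (laurent_const _) _.
  by apply: laurent_prod => i; apply: laurent_exp.
by apply: laurent_ext => z _; rewrite mevalE.
Qed.

Lemma laurent_mulmx a b c (A : 'M[k]_(a, b)) (F : ('I_r -> k) -> 'M[k]_(b, c)) i j :
  (forall i j, laurent_function (fun z => F z i j)) -> laurent_function (fun z => (A *m F z) i j).
Proof.
move=> hF; have : laurent_function (fun z => \sum_l A i l * F z l j).
  by apply: laurent_sum => l; apply: laurentM (laurent_const _) _.
by apply: laurent_ext => z _; rewrite mxE.
Qed.

Lemma laurent_mulmxr a b c (A : 'M[k]_(b, c)) (F : ('I_r -> k) -> 'M[k]_(a, b)) i j :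
  (forall i j, laurent_function (fun z => F z i j)) -> laurent_function (fun z => (F z *m A) i j).
Proof.
move=> hF; have : laurent_function (fun z => \sum_l F z i l * A l j).
  by apply: laurent_sum => l; apply: laurentM (hF _ _) (laurent_const _).
by apply: laurent_ext => z _; rewrite mxE.
Qed.

End Laurent.
End Monomials.

(** * The torus attached to a symplectic frame *)

Section FramedTorus.
Variable k : closedFieldType.
Local Notation M6 := 'M[k]_(3 + 3).

Definition frame_torus (g : M6) : set M6 :=
  [set t | exists2 d : 'I_3 -> k, (forall i, d i != 0) & g *m t = dgmx d *m g].

Definition frame_coord (g : M6) (i : 'I_3) (t : M6) : k :=
  (g *m t *m invmx g) (lshift 3 i) (lshift 3 i).

Variables (g : M6) (Sg : @Sp k 3 g).
Let ug : g \in unitmx. Proof. exact: Sp_unit Sg. Qed.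

Lemma frame_coordE t d : g *m t = dgmx d *m g -> (fun i => frame_coord g i t) = d.
Proof.
move=> e; apply/funext => i; rewrite /frame_coord e mulmxK // /dgmx !mxE eqxx.
by rewrite dgvall.
Qed.

Definition frame_elt (d : 'I_3 -> k) : M6 := invmx g *m dgmx d *m g.

Lemma frame_eltE d : g *m frame_elt d = dgmx d *m g.
Proof. by rewrite /frame_elt !mulmxA mulmxV // mul1mx. Qed.

Lemma frame_coord_elt d : (fun i => frame_coord g i (frame_elt d)) = d.
Proof. exact/frame_coordE/frame_eltE. Qed.

Lemma frame_coordK d i : frame_coord g i (frame_elt d) = d i.
Proof. by rewrite -[LHS]/((fun i => frame_coord g i (frame_elt d)) i) frame_coord_elt. Qed.

Lemma frame_torus_elt d : (forall i, d i != 0) -> frame_torus g (frame_elt d).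
Proof. by move=> d0; exists d => //; apply: frame_eltE. Qed.

Lemma frame_torusP t : frame_torus g t -> torus_points (fun i => frame_coord g i t) /\
  g *m t = dgmx (fun i => frame_coord g i t) *m g.
Proof. by case=> d d0 e; rewrite (frame_coordE e). Qed.

Lemma dgmxM (d e : 'I_3 -> k) : dgmx d *m dgmx e = dgmx (fun i => d i * e i).
Proof.
rewrite /dgmx mulmx_diag; congr diag_mx; apply/rowP => s; rewrite !mxE.
by move: s; elim/ord_addP => i; rewrite ?dgvall ?dgvalr // invfM.
Qed.

Lemma frame_eltM d e : frame_elt (fun i => d i * e i) = frame_elt d *m frame_elt e.
Proof. by rewrite /frame_elt -dgmxM !mulmxA mulmxK. Qed.

Lemma frame_elt_inj_eq t t' d : g *m t = dgmx d *m g -> g *m t' = dgmx d *m g -> t = t'.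
Proof. by move=> e e'; rewrite -(mulKmx ug t) e -e' mulKmx. Qed.

Lemma det_frame_elt d : torus_points d -> \det (frame_elt d) = 1.
Proof.
move=> d0; rewrite /frame_elt !det_mulmx det_inv mulrAC mulVf ?mul1r; last by rewrite -unitfE -unitmxE.
rewrite det_diag big_split_ord /= -big_split /= big1 // => i _.
by rewrite !mxE dgvall dgvalr mulfV.
Qed.

(** The characters [chi] and the frame coordinates are multiplicative Laurent functions of one
    another, hence monomials; [mono_inj] shows that the two exponent matrices are inverse to each
    other. *)
Lemma torus_basis_frame r (chi : 'I_r -> M6 -> k) : torus_basis (frame_torus g) chi ->
  exists (mu : 'M[int]_(r, 3)) (nu : 'M[int]_(3, r)),
  [/\ mu *m nu = 1%:M, nu *m mu = 1%:M &
    forall t, frame_torus g t ->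
      (fun j => chi j t) = mono mu (fun i => frame_coord g i t) /\
      (fun i => frame_coord g i t) = mono nu (fun j => chi j t)].
Proof.
case=> phi [phiT phiM phiL chiR [chi_phi phi_chi]].
have T1 (n : nat) : torus_points (fun _ : 'I_n => 1 : k) by move=> i; rewrite oner_eq0.
have chiM s t j : frame_torus g s -> frame_torus g t -> chi j (s *m t) = chi j s * chi j t.
  move=> Ts Tt; have [h1 e1] := phi_chi s Ts; have [h2 e2] := phi_chi t Tt.
  by rewrite -{1}e1 -{1}e2 -phiM // chi_phi //; apply: torusM.
have /choice [mu hmu] : forall j : 'I_r, exists m : 'I_3 -> int, forall d, torus_points d ->
    chi j (frame_elt d) = \prod_i d i ^ m i.
  move=> j; apply: (@laurent_monomial k 3 (fun d => chi j (frame_elt d))).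
  - have [p [e hp]] := chiR j.
    (* Elements of the torus have determinant 1, which removes the denominator of a regular
       function. *)
    apply: (@laurent_ext k 3 (fun d => p.@[fun s => mxvec (frame_elt d) 0 s])) => [d d0|].
      by rewrite hp ?det_frame_elt ?expr1n ?divr1 //; apply: frame_torus_elt.
    apply: laurent_comp => s; case/mxvec_indexP: s => a b.
    apply: (@laurent_ext k 3 (fun d => frame_elt d a b)) => [d _|]; first by rewrite mxvecE.
    rewrite /frame_elt; apply: laurent_mulmxr => {}a {}b; apply: laurent_mulmx => {}a {}b.
    have [->|ab] := eqVneq a b.
      apply: (@laurent_ext k 3 (fun d => dgval d b)) => [d _|]; first by rewrite /dgmx !mxE eqxx.
      move: b; elim/ord_addP => i.
        by apply: (laurent_ext _ (laurent_var k i)) => d _; rewrite dgvall.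
      by apply: (laurent_ext _ (laurent_inv k i)) => d _; rewrite dgvalr.
    by apply: (laurent_ext _ (laurent_const _ 0)) => d _; rewrite /dgmx !mxE (negPf ab).
  - move=> d e d0 e0; rewrite frame_eltM chiM //; exact: frame_torus_elt.
  - have T := frame_torus_elt (T1 3); have [h _] := phi_chi _ T; exact: h.
have /choice [nu hnu] : forall i : 'I_3, exists m : 'I_r -> int, forall z, torus_points z ->
    frame_coord g i (phi z) = \prod_j z j ^ m j.
  move=> i; apply: (@laurent_monomial k r (fun z => frame_coord g i (phi z))).
  - rewrite /frame_coord; apply: laurent_mulmxr => a b; apply: laurent_mulmx => {}a {}b.
    exact: phiL.
  - move=> z w z0 w0; rewrite phiM //; have [/frame_torusP[_ ez] _] := phiT z z0.
    have [/frame_torusP[_ ew] _] := phiT w w0.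
    have := @frame_coordE (phi z *m phi w) (fun i => frame_coord g i (phi z) * frame_coord g i (phi w)).
    rewrite mulmxA ez -mulmxA ew mulmxA dgmxM => /(_ erefl) e.
    by rewrite -[LHS]/((fun i => frame_coord g i (phi z *m phi w)) i) e.
  - by have [/frame_torusP[h _] _] := phiT _ (T1 r); apply: h.
pose Mu : 'M[int]_(r, 3) := \matrix_(j, i) mu j i; pose Nu : 'M[int]_(3, r) := \matrix_(i, j) nu i j.
have eMu d : torus_points d -> (fun j => chi j (frame_elt d)) = mono Mu d.
  move=> d0; apply/funext => j; rewrite hmu //; apply: eq_bigr => i _; by rewrite mxE.
have eNu z : torus_points z -> (fun i => frame_coord g i (phi z)) = mono Nu z.
  move=> z0; apply/funext => i; rewrite hnu //; apply: eq_bigr => j _; by rewrite mxE.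
have key t : frame_torus g t -> (fun j => chi j t) = mono Mu (fun i => frame_coord g i t) /\
      (fun i => frame_coord g i t) = mono Nu (fun j => chi j t).
  move=> Tt; split.
    have [h e] := frame_torusP Tt; rewrite -eMu //.
    by rewrite (frame_elt_inj_eq e (frame_eltE _)) frame_coord_elt.
  by have [h e] := phi_chi t Tt; rewrite -eNu // e.
exists Mu, Nu; split=> //; apply: mono_inj => z z0; rewrite -mono_mul // mono1.
  have [Tz _] := phiT z z0; have [k1 k2] := key _ Tz.
  have ez : (fun j => chi j (phi z)) = z by apply/funext => j; rewrite chi_phi.
  by rewrite -[in mono Nu z]ez -k2 -k1 ez.
have Tz := frame_torus_elt z0; have [k1 k2] := key _ Tz.
by rewrite -[in mono Mu z](frame_coord_elt z) -k1 -k2 frame_coord_elt.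
Qed.

(** A nonzero entry in row [i] of [h] forces [d i] to be a fixed coordinate of [d'] or its inverse,
    for all intertwined [d] and [d']. Different rows select different coordinates because those of
    [d] vary independently. *)
Lemma monomial_of_conj (h : M6) : h \in unitmx ->
  (forall d, torus_points d -> exists2 d', torus_points d' & dgmx d *m h = h *m dgmx d') ->
  exists (sg : {perm 'I_3}) (eps : 'I_3 -> bool), forall d d', dgmx d *m h = h *m dgmx d' ->
    d = fun i => if eps i then (d' (sg i))^-1 else d' (sg i).
Proof.
move=> uh hd.
have /choice [f hf] : forall i : 'I_3, exists f : 'I_3 * bool, forall d d', dgmx d *m h = h *m dgmx d' ->
    d i = if f.2 then (d' f.1)^-1 else d' f.1.
  move=> i; have : row (lshift 3 i) h != 0.
    apply: contraTneq uh => r0; rewrite -row_free_unit; apply/negP => /row_freeP[B hB].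
    have := congr1 (row (lshift 3 i)) hB; rewrite row_mul r0 mul0mx row1 => /rowP/(_ (lshift 3 i)).
    by rewrite !mxE !eqxx => /esym/eqP; rewrite oner_eq0.
  case/rV0Pn => s; rewrite mxE => hs.
  have ent d d' : dgmx d *m h = h *m dgmx d' -> d i = dgval d' s.
    move=> e; have := congr1 (fun x : M6 => x (lshift 3 i) s) e.
    rewrite /dgmx mul_diag_mx mul_mx_diag !mxE dgvall mulrC => /(mulfI hs) //.
  move: s hs ent; elim/ord_addP => j hs ent.
    by exists (j, false) => d d' /ent; rewrite dgvall.
  by exists (j, true) => d d' /ent; rewrite dgvalr.
have inj : injective (fun i => (f i).1).
  move=> i j e; apply/eqP; apply: contraT => ij.
  have [|y y0 hy] := @exists_nonroot k ('X - 1); first by rewrite polyXsubC_eq0.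
  pose d l := if l == i then y else 1.
  have [|d' d'0 e'] := hd d; first by move=> l; rewrite /d; case: ifP; rewrite ?y0 ?oner_eq0.
  have ei := hf i _ _ e'; have ej := hf j _ _ e'.
  move: hy; rewrite !hornerE /=; have di : d i = y by rewrite /d eqxx.
  have dj : d j = 1 by rewrite /d eq_sym (negPf ij).
  rewrite di in ei; rewrite dj -e in ej; have c1 : d' (f i).1 = 1.
    by move: ej; case: (f j).2 => ej //; rewrite -[d' _]invrK -ej invr1.
  by rewrite ei c1; case: (f i).2; rewrite ?invr1 subrr eqxx.
exists (perm inj), (fun i => (f i).2) => d d' e; apply/funext => i.
by rewrite permE (hf i _ _ e).
Qed.

End FramedTorus.

Section SignedPermutations.
Variable k : closedFieldType.

Definition inv_eps (sg : {perm 'I_3}) (eps : 'I_3 -> bool) i := eps (sg^-1%g i).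

Lemma mono_sgmx sg eps (z : 'I_3 -> k) i : mono (sgmx sg eps) z i = if eps i then (z (sg i))^-1 else z (sg i).
Proof.
rewrite /mono (bigD1 (sg i)) //= mxE eqxx mulr1 big1 ?mulr1 => [|j ji].
  by case: (eps i); rewrite ?expr1 ?expr0 ?expr1z // exprN1.
by rewrite mxE (negPf ji) mulr0 expr0z.
Qed.

Lemma mono_sgmxV sg eps (z w : 'I_3 -> k) : mono (sgmx sg eps) z = w <-> mono (sgmx sg^-1 (inv_eps sg eps)) w = z.
Proof.
split=> <-; apply/funext => i; rewrite !mono_sgmx /inv_eps ?permKV ?permK; case: (eps _); by rewrite ?invrK.
Qed.

(** Integer matrices are compared through their action on torus points, which is faithful by
    [mono_inj]. *)
Lemma sgmx_inv sg eps : sgmx sg eps *m sgmx sg^-1 (inv_eps sg eps) = 1%:M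
  /\ sgmx sg^-1 (inv_eps sg eps) *m sgmx sg eps = 1%:M.
Proof.
split; apply: (@mono_inj k) => z z0; rewrite -mono_mul // mono1.
  exact: ((mono_sgmxV sg eps (mono (sgmx sg^-1 (inv_eps sg eps)) z) z).2 erefl).
exact: ((mono_sgmxV sg eps z (mono (sgmx sg eps) z)).1 erefl).
Qed.

End SignedPermutations.

Lemma conj_cancel (R : comUnitRingType) n (A w t : 'M[R]_n) : w \in unitmx ->
  A *m w *m (invmx w *m t *m w) = A *m t *m w.
Proof. by move=> uw; rewrite !mulmxA mulmxK. Qed.

(** * Weyl invariants and Frobenius in frame coordinates *)

Section MotiveOfFrame.
Variables (k : closedFieldType) (gam : 'M[k]_(3 + 3)).
Local Notation M6 := 'M[k]_(3 + 3).
Local Notation H := (centralizer (@Sp k 3) [set gam]).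

Lemma centralizer1P x : H x <-> @Sp k 3 x /\ x *m gam = gam *m x.
Proof. by split=> [[h1 h2]|[h1 h2]]; split=> //; [apply: h2|move=> a ->]. Qed.

Variables (g : M6) (Sg : @Sp k 3 g) (dl : 'I_3 -> k) (dl0 : torus_points dl).
Hypothesis ggam : g *m gam = dgmx dl *m g.
Let ug : g \in unitmx. Proof. exact: Sp_unit Sg. Qed.
Local Notation T := (frame_torus g).
Local Notation cg t := (fun i => frame_coord g i t).

(** Rewrites conjugation by [w] on the torus as an intertwining relation for [h], the matrix of [w]
    in the frame. *)
Let conj_elt (w : M6) : @Sp k 3 w -> let h := g *m w *m invmx g in
  @Sp k 3 h /\ forall t d d', g *m t = dgmx d *m g ->
    (g *m (invmx w *m t *m w) = dgmx d' *m g <-> dgmx d *m h = h *m dgmx d').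
Proof.
move=> Sw h; have uw := Sp_unit Sw; split; first by apply: SpM; [apply: SpM|apply: SpV].
move=> t d d' e; split=> [e'|e'].
  have -> : h *m dgmx d' = g *m w *m (invmx g *m (dgmx d' *m g)) *m invmx g.
    by rewrite /h !mulmxA mulmxK.
  by rewrite -e' mulKmx // !mulmxA mulmxK // e /h ?mulmxA.
apply: (can_inj (mulKmx (_ : g *m w *m invmx g \in unitmx))); first by rewrite !unitmx_mul ug uw unitmx_inv.
have hg : h *m g = g *m w by rewrite /h mulmxKV.
rewrite -/h [RHS]mulmxA -e' -[RHS]mulmxA hg mulmxA hg.
by rewrite conj_cancel // e mulmxA.
Qed.

(** The normalizer acts on the frame coordinates exactly through the signed permutations that
    preserve [dl]: each of these is realised by a monomial matrix commuting with [gam], and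
    conversely an element of the normalizer is monomial in the frame and fixes [gam]. *)
Lemma weyl_inv_frame r (chi : 'I_r -> M6 -> k) (mu : 'M[int]_(r, 3)) (nu : 'M[int]_(3, r)) :
  mu *m nu = 1%:M -> nu *m mu = 1%:M ->
  (forall t, T t -> (fun j => chi j t) = mono mu (cg t) /\ cg t = mono nu (fun j => chi j t)) ->
  forall p, weyl_inv H T chi p <-> Inv dl (lin_sub mu p).
Proof.
move=> mn nm hchi p.
have wact w (M : 'M[int]_r) sg eps : weyl_matrix T chi w M ->
    (forall t, T t -> T (invmx w *m t *m w)) ->
    (forall t, T t -> cg t = mono (sgmx sg eps) (cg (invmx w *m t *m w))) ->
    sgmx sg eps *m (nu *m M *m mu) = 1%:M.
  move=> hM wT hw; apply: (@mono_inj k) => d d0; rewrite mono1.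
  have Td := frame_torus_elt Sg d0; have [k1 k2] := hchi _ Td.
  have Tw := wT _ Td; have [k3 k4] := hchi _ Tw.
  have e1 : (fun j => chi j (invmx w *m frame_elt g d *m w)) = mono M (fun j => chi j (frame_elt g d)).
    by apply/funext => j; apply: hM.
  have [cd _] := frame_torusP Sg Td.
  rewrite -mono_mul // -[in LHS](frame_coord_elt Sg d) -mono_mul // -mono_mul; last exact: mono_torus.
  by rewrite -k1 -e1 -k4 -hw // frame_coord_elt.
split=> [hp sg eps hpres|hp w M Hw hM].
  pose h := nmx k sg eps; pose w := invmx g *m h *m g.
  have Sh : @Sp k 3 h by apply: nmx_Sp.
  have hE : g *m w *m invmx g = h by rewrite /w !mulmxA mulmxV // mul1mx mulmxK.
  have Sw : @Sp k 3 w by apply: SpM => //; apply: SpM => //; apply: SpV.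
  have [_ cw] := conj_elt Sw; rewrite hE in cw.
  have hd (d d' : 'I_3 -> k) : mono (sgmx sg eps) d' = d -> dgmx d *m h = h *m dgmx d'.
    by move=> e; apply: nmx_dgmx => i; rewrite -e mono_sgmx; case: (eps i); rewrite ?invrK.
  have wT t : T t -> T (invmx w *m t *m w) /\ cg t = mono (sgmx sg eps) (cg (invmx w *m t *m w)).
    move=> Tt; have [d0 e] := frame_torusP Sg Tt; pose d' := mono (sgmx sg^-1 (inv_eps sg eps)) (cg t).
    have e' : mono (sgmx sg eps) d' = cg t by apply/mono_sgmxV.
    have /cw : g *m t = dgmx (cg t) *m g by [].
    move=> /(_ d')[_ /(_ (hd _ _ e')) e2]; split; last by rewrite (frame_coordE Sg e2).
    by exists d' => //; apply: mono_torus.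
  have Hw : normalizer H T w.
    split=> [|t]; last split=> [/wT[] //|[d' d'0 e']].
      apply/centralizer1P; split=> //.
      have : dgmx dl *m h = h *m dgmx dl.
        apply: hd; apply/funext => i; rewrite mono_sgmx; exact: hpres.
      have [_ /(_ gam dl dl ggam)[_ h2]] := conj_elt Sw; rewrite hE in h2.
      move/h2; rewrite -ggam => /(can_inj (mulKmx ug)) e.
      by rewrite -{1}e !mulmxA mulmxV ?(Sp_unit Sw) // mul1mx.
    exists (mono (sgmx sg eps) d'); first exact: mono_torus.
    apply: (can_inj (mulmxK (Sp_unit Sw))); have e2 := hd _ _ (erefl (mono (sgmx sg eps) d')).
    have -> : g *m t *m w = g *m w *m (invmx w *m t *m w) by rewrite conj_cancel ?(Sp_unit Sw).
    have -> : g *m w = h *m g by rewrite /w !mulmxA mulmxV // mul1mx.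
    by rewrite -mulmxA e' mulmxA -e2 -!mulmxA; congr (_ *m _); rewrite /w !mulmxA mulmxV // mul1mx.
  have [s1 s2] := sgmx_inv k sg eps.
  pose M := mu *m sgmx sg^-1 (inv_eps sg eps) *m nu.
  have hM : weyl_matrix T chi w M.
    move=> j t Tt; have [Tw e] := wT t Tt; have [k1 k2] := hchi _ Tw; have [k3 k4] := hchi _ Tt.
    have [c0 _] := frame_torusP Sg Tt.
    have chi0 : torus_points (fun j => chi j t) by rewrite k3; apply: mono_torus.
    have {}e : mono (sgmx sg^-1 (inv_eps sg eps)) (cg t) = cg (invmx w *m t *m w).
      exact: ((mono_sgmxV sg eps (cg (invmx w *m t *m w)) _).1 (esym e)).
    rewrite -[LHS]/((fun j => chi j (invmx w *m t *m w)) j) k1 -e k4.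
    by rewrite mono_mul //; last exact: mono_torus; rewrite mono_mul.
  have := hp w M Hw hM; rewrite -[sym_action M p]/(lin_sub M p) => e.
  have {}e : lin_sub (sgmx sg^-1 (inv_eps sg eps)) (lin_sub mu p) = lin_sub mu p.
    rewrite -{2}e !lin_sub_comp /M -!mulmxA nm mulmx1 //.
  by rewrite -{1}e lin_sub_comp s2 lin_sub1.
have [Hw1 Hw2] := Hw; have /centralizer1P[Sw wgam] := Hw1.
have [Sh cw] := conj_elt Sw; set h := g *m w *m invmx g in Sh cw.
have hT t : T t -> T (invmx w *m t *m w) by move/Hw2.
have [|sg [eps hse]] := @monomial_of_conj k h (Sp_unit Sh).
  move=> d d0; have Td := frame_torus_elt Sg d0; have [d' d'0 e'] := hT _ Td.
  by exists d' => //; apply/(cw (frame_elt g d)) => //; apply: frame_eltE.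
have hw t : T t -> cg t = mono (sgmx sg eps) (cg (invmx w *m t *m w)).
  move=> Tt; have [_ e] := frame_torusP Sg Tt; have [_ e'] := frame_torusP Sg (hT t Tt).
  by have /hse {1}-> := (cw t _ _ e).1 e'; apply/funext => i; rewrite mono_sgmx.
have e1 := wact w M sg eps hM hT hw.
have hpres : preserves dl sg eps.
  have e : g *m (invmx w *m gam *m w) = dgmx dl *m g.
    by rewrite -mulmxA -wgam mulKmx ?(Sp_unit Sw).
  by move=> i; have /hse e2 := (cw gam _ _ ggam).1 e; rewrite [in RHS]e2.
have {}hp := hp _ _ hpres.
have e2 : lin_sub (nu *m M *m mu) (lin_sub mu p) = lin_sub mu p.
  by rewrite -{1}hp lin_sub_comp e1 lin_sub1.
rewrite -[LHS]/(lin_sub M p) -[p in RHS]lin_sub1 -mn -lin_sub_comp -e2 !lin_sub_comp.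
by rewrite -!mulmxA mn mulmx1 mulmxA mn mul1mx.
Qed.

Variables (Q : nat) (sg : {perm 'I_3}) (eps : 'I_3 -> bool).
Hypotheses (Q0 : (0 < Q)%N) (Qinj : injective (fun x : k => x ^+ Q)).
Hypothesis frobT : forall t, T t -> T (frob Q t) /\
  (fun i => frame_coord g i t ^+ Q) = mono (sgmx sg eps) (cg (frob Q t)).
Hypothesis frob_gam : frob Q gam = gam.

Let S' := sgmx sg^-1 (inv_eps sg eps).

Lemma frob_dl i : dl i = (if inv_eps sg eps i then (dl (sg^-1%g i))^-1 else dl (sg^-1%g i)) ^+ Q.
Proof.
have Tg : T gam by exists dl.
have [_] := frobT Tg; rewrite frob_gam (frame_coordE Sg ggam) => e.
rewrite -mono_sgmx -[RHS]/((fun i => mono S' dl i ^+ Q) i) -mono_expn.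
have e2 : (fun i => dl i ^+ Q) = mono (sgmx sg eps) dl.
  by rewrite -e; apply/funext => j; have /(congr1 (@^~ j)) := frame_coordE Sg ggam => ->.
by rewrite e2; have /mono_sgmxV -> : mono (sgmx sg eps) dl = mono (sgmx sg eps) dl by [].
Qed.

(** The hypothesis on [frob Q] expresses the [Q]-th powers of the coordinates of [t] by the
    coordinates of its Frobenius image, so the geometric Frobenius acts on characters by the inverse
    matrix [S']. *)
Lemma frobenius_frame r (chi : 'I_r -> M6 -> k) mu nu M :
  mu *m nu = 1%:M -> nu *m mu = 1%:M ->
  (forall t, T t -> (fun j => chi j t) = mono mu (cg t) /\ cg t = mono nu (fun j => chi j t)) ->
  frobenius_matrix Q T chi M <-> M *m mu = mu *m S'.
Proof.
move=> mn nm hchi; have [s1 s2] := sgmx_inv k sg eps.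
have main t : T t -> (fun j => chi j (frob Q t)) = fun j => mono (mu *m S') (cg t) j ^+ Q.
  move=> Tt; have [Ft e] := frobT Tt; have [k1 _] := hchi _ Ft; have [c0 _] := frame_torusP Sg Tt.
  have e' : mono S' (fun i => frame_coord g i t ^+ Q) = cg (frob Q t).
    exact: ((mono_sgmxV sg eps (cg (frob Q t)) _).1 (esym e)).
  by rewrite k1 -e' -mono_expn mono_mul // => i; rewrite expf_neq0.
split=> [hM|e i t Tt].
  apply: (@mono_inj k) => d d0; apply/funext => j; apply: Qinj; have Td := frame_torus_elt Sg d0.
  have [k1 _] := hchi _ Td; have := hM j _ Td; rewrite -[LHS]/((fun j => chi j _) j) main // frame_coord_elt //.
  by move=> ->; congr (_ ^+ _); rewrite -mono_mul // -[d in mono mu d](frame_coord_elt Sg) -k1.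
have [k1 _] := hchi _ Tt; have [c0 _] := frame_torusP Sg Tt.
rewrite -[LHS]/((fun j => chi j _) i) main // -e -mono_mul // -k1.
by [].
Qed.

Lemma graded_det_frame r (chi : 'I_r -> M6 -> k) mu nu M d P :
  mu *m nu = 1%:M -> nu *m mu = 1%:M ->
  (forall t, T t -> (fun j => chi j t) = mono mu (cg t) /\ cg t = mono nu (fun j => chi j t)) ->
  frobenius_matrix Q T chi M ->
  graded_det H T chi M d P <-> inv_gdet (Inv dl) (lin_sub S') d P.
Proof.
move=> mn nm hchi /(frobenius_frame M mn nm hchi) e; have hw := weyl_inv_frame mn nm hchi.
have e' : S' *m nu = nu *m M.
  by rewrite -[S']mul1mx -nm -(mulmxA nu) -e -!mulmxA mn mulmx1.
split=> [hP|]; first exact: (@inv_gdet_lin_sub _ _ mu nu (weyl_inv H T chi) _ M S').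
move=> hP; apply: (@inv_gdet_lin_sub _ _ nu mu (Inv dl) (weyl_inv H T chi) S' M) hP => // p.
by rewrite hw lin_sub_comp nm lin_sub1.
Qed.

End MotiveOfFrame.

(** * Uniqueness and existence of the motive of a centralizer *)

Section MotiveOfCentralizer.
Variables (k : closedFieldType) (p : nat) (hp : p \in [pchar k]).
Hypothesis halg : forall x : k, exists2 s, (0 < s)%N & x ^+ (p ^ s) = x.
Local Notation frb a := (map_mx (frobr hp a)).
Variables (d : nat) (d0 : (0 < d)%N).
Local Notation Q := (p ^ d)%N.
Local Notation M6 := 'M[k]_(3 + 3).
Variable gam : M6.
Hypotheses (Sgam : @Sp k 3 gam) (Fgam : frb d gam = gam).
Local Notation H := (centralizer (@Sp k 3) [set gam]).

Let Qinj : injective (fun x : k => x ^+ Q). Proof. exact: (@frob_inj k p hp d). Qed.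
Let p1 : (1 < p)%N. Proof. exact: prime_gt1 (pcharf_prime hp). Qed.
Let Q0 : (0 < Q)%N. Proof. by rewrite expn_gt0 ltnW. Qed.

Let frobE n (x : 'M[k]_n) : frob Q x = frb d x. Proof. by []. Qed.

(** The exponent [(p ^ s).-1] is nonzero in [k], where it equals -1. *)
Lemma root_of_unity_order (x : k) : x != 0 -> exists2 N, (N%:R : k) != 0 & x ^+ N = 1.
Proof.
move=> x0; have [s s0 xs] := halg x; exists (p ^ s).-1.
  have e : ((p ^ s).-1%:R : k) + 1 = 0.
    by rewrite natr1 prednK ?natp_eq0 // expn_gt0 ltnW.
  by apply: contra_eq_neq e => ->; rewrite add0r oner_eq0.
by apply: (mulIf x0); rewrite mul1r -exprSr prednK // expn_gt0 ltnW.
Qed.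

Lemma torus_common_order r (z : 'I_r -> k) : torus_points z ->
  exists2 N, (N%:R : k) != 0 & forall i, z i ^+ N = 1.
Proof.
move=> z0; have /choice [f hf] : forall i, exists N, (N%:R : k) != 0 /\ z i ^+ N = 1.
  by move=> i; have [N h1 h2] := root_of_unity_order (z0 i); exists N.
exists (\prod_i f i)%N => [|i].
  by rewrite natr_prod prodf_seq_neq0; apply/allP => i _; have [] := hf i.
by rewrite (bigD1 i) //= exprM; have [_ ->] := hf i; rewrite expr1n.
Qed.

Lemma frame_frob g h : @Sp k 3 g -> frb d g = h *m g ->
  (forall t, frame_torus g t -> frame_torus g (frb d t)) ->
  forall t, frame_torus g t ->
    dgmx (fun i => frame_coord g i t ^+ Q) *m h = h *m dgmx (fun i => frame_coord g i (frb d t)).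
Proof.
move=> Sg Fg hT t Tt; have [_ e] := frame_torusP Sg Tt; have [_ e'] := frame_torusP Sg (hT t Tt).
have := congr1 (fun x => frb d x) e; rewrite !map_mxM Fg map_dgmx -mulmxA e' !mulmxA => h1.
by apply: (can_inj (mulmxK (Sp_unit Sg))); rewrite h1.
Qed.

(** This controls the choice hidden in [motive_det]. The centralizer [T0] of the given split torus
    contains both that torus and [gam], so whatever commutes with [T0] already lies in it;
    [torus_frame] provides a frame, and stability of [T0] under Frobenius makes Frobenius a signed
    permutation there. *)
Lemma motive_det_frame P : is_motive_det Q H P ->
  exists (g : M6) (dl : 'I_3 -> k) (sg : {perm 'I_3}) (eps : 'I_3 -> bool),
  [/\ @Sp k 3 g, torus_points dl, g *m gam = dgmx dl *m g,
     forall i, dl i = (if eps i then (dl (sg i))^-1 else dl (sg i)) ^+ Q &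
   exists (D : nat -> {poly rat}) N,
    [/\ forall n, (0 < n)%N -> inv_gdet (Inv dl) (lin_sub (sgmx sg eps)) n (D n),
        forall n, (N < n)%N -> D n = 1 &
        P = \prod_(1 <= n < N.+1) (D n \Po (Q%:R ^+ n.-1 *: 'X))]].
Proof.
case=> A [r [chi [M [D [N [[Asplit AH _] bT hM hD [DN PE]]]]]]].
set T0 := centralizer H A in bT hM hD.
have [r' [chi' [bA FA]]] := Asplit.
have comm_of_basis B s (psi : 'I_s -> M6 -> k) : torus_basis B psi ->
    forall x y, B x -> B y -> x *m y = y *m x.
  case=> phi [_ phiM _ _ [_ hB]] x y Bx By; have [h1 <-] := hB x Bx; have [h2 <-] := hB y By.
  by rewrite -!phiM //; congr phi; apply/funext => i; rewrite mulrC.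
have T0H t : T0 t -> H t by case.
have Hgam : H gam by apply/centralizer1P.
have T0gam : T0 gam by split=> // a /AH/centralizer1P[_ ->].
have T0A : A `<=` T0 by move=> a Aa; split; [exact: AH|move=> b Ab; exact: (comm_of_basis _ _ _ bA)].
have [g Sg Tg] : exists2 g : M6, @Sp k 3 g &
    forall t, T0 t <-> exists2 dl : 'I_3 -> k, (forall i, dl i != 0) & g *m t = dgmx dl *m g.
  apply: (@torus_frame k 2 T0).
  - by move=> t /T0H/centralizer1P[].
  - exact: (comm_of_basis _ _ _ bT).
  - move=> t Tt; have [phi [phiT phiM _ _ [_ hB]]] := bT; have [z0 tE] := hB t Tt.
    have [m m0 zm] := torus_common_order z0; exists m => //.
    have phi1 : phi (fun=> 1) = 1%:M.
      have o1 : torus_points (fun _ : 'I_r => 1 : k) by move=> i; rewrite oner_eq0.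
      have [_ u] := phiT _ o1; have := phiM _ _ o1 o1.
      rewrite (_ : (fun i => _) = (fun=> 1)); last by apply/funext => i; rewrite mulr1.
      by move/(congr1 (mulmx (invmx (phi (fun=> 1))))); rewrite mulKmx // mulVmx.
    have : forall j, (t : 'M[k]_((2 + 3).+1)) ^+ j = phi (fun i => chi i t ^+ j).
      elim=> [|j IH]; first by rewrite expr0 -[LHS]phi1; congr phi; apply/funext => i; rewrite expr0.
      rewrite exprS IH -{1}tE -[LHS]/(phi (fun i => chi i t) *m phi (fun i => chi i t ^+ j)) -phiM //.
        by congr phi; apply/funext => i; rewrite exprS.
      by move=> i; rewrite expf_neq0.
    by move=> ->; rewrite -[RHS]phi1; congr phi; apply/funext => i; rewrite zm.
  - move=> x Sx hx; split; last by move=> a /T0A; apply: hx.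
    by apply/centralizer1P; split=> //; apply: hx.
have TE : T0 = frame_torus g by apply/seteqP; split=> t /Tg.
have FT t : T0 t -> T0 (frb d t).
  case=> /centralizer1P[St tg] tA; split.
    by apply/centralizer1P; split; [apply: Sp_map|rewrite -{1}Fgam -map_mxM tg map_mxM Fgam].
  (* Frobenius has finite order on [a], so [a] is the Frobenius twist of another element of [A],
     with which [t] commutes. *)
  move=> a Aa; have [s s0 hs] := @frb_period k p hp halg _ _ a.
  have Ait j : A (iter j (frb d) a) by elim: j => //= j /FA[].
  have := tA _ (Ait (s.-1)) => /(congr1 (fun x => frb d x)); rewrite !map_mxM -iterS prednK //.
  by rewrite frb_iter hs ?dvdn_mull.
have [dl dl0 ggam] : frame_torus g gam by rewrite -TE.
pose h := frb d g *m invmx g.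
have Fg : frb d g = h *m g by rewrite /h mulmxKV // (Sp_unit Sg).
have Sh : @Sp k 3 h by apply: SpM; [apply: Sp_map|apply: SpV].
rewrite TE in FT; have key := frame_frob Sg Fg FT.
have [|sg [eps hse]] := @monomial_of_conj k h (Sp_unit Sh).
  (* Every torus point is the Frobenius image of one, by extraction of [Q]-th roots in [k]. *)
  move=> e e0; have /choice [f hf] : forall i, exists x : k, x ^+ Q = e i.
    by move=> i; have [x] := @exp_root k Q (e i) Q0; exists x.
  have f0 : torus_points f by move=> i; have := e0 i; rewrite -hf expf_eq0 Q0.
  have Tf := frame_torus_elt Sg f0; have [c0 _] := frame_torusP Sg (FT _ Tf).
  exists (fun i => frame_coord g i (frb d (frame_elt g f))) => //.
  rewrite -key //; congr (dgmx _ *m _); apply/funext => i.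
  by rewrite -[frame_coord g i _]/((fun i => frame_coord g i (frame_elt g f)) i) frame_coord_elt.
have frobT t : frame_torus g t -> frame_torus g (frob Q t) /\
    (fun i => frame_coord g i t ^+ Q) = mono (sgmx sg eps) (fun i => frame_coord g i (frob Q t)).
  move=> Tt; split; first exact: FT.
  by rewrite (hse _ _ (key t Tt)); apply/funext => i; rewrite mono_sgmx.
rewrite TE in bT hM hD.
have [mu [nu [mn nm hchi]]] := torus_basis_frame Sg bT.
exists g, dl, sg^-1%g, (inv_eps sg eps); split=> //.
  exact: (frob_dl Sg dl0 ggam frobT Fgam).
exists D, N; split=> // n n0.
exact: (graded_det_frame Sg ggam Qinj frobT n (D n) mn nm hchi hM).1 (hD n n0).
Qed.

Section Existence.
Variables (g : M6) (dl : 'I_3 -> k) (sg : {perm 'I_3}) (eps : 'I_3 -> bool).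
Hypotheses (Sg : @Sp k 3 g) (dl0 : torus_points dl) (ggam : g *m gam = dgmx dl *m g)
  (Fg : frb d g = nmx k sg eps *m g).
Let ug : g \in unitmx. Proof. exact: Sp_unit Sg. Qed.

(* The maximal split torus consists of the elements whose coordinates are [w (f i) ^ c i]. *)
Variables (pv : pred 'I_3) (f : 'I_3 -> 'I_3) (c : 'I_3 -> int).
Hypotheses (pvf : forall i, pv i -> f i = i /\ c i = 1) (pvc : forall i, c i != 0 -> pv (f i))
  (hfrob : forall i, c i = (-1) ^+ eps i * c (sg i) /\ (c i != 0 -> f i = f (sg i)))
  (hmax : forall e : 'I_3 -> k, torus_points e -> (forall i, e i = if eps i then (e (sg i))^-1 else e (sg i)) ->
     forall i, e i ^+ 2 = (e (f i) ^+ 2) ^ c i)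
  (hsep : exists2 w : 'I_3 -> k, torus_points w & forall s t, s != t ->
     dgval dl s != dgval dl t \/ dgval (fun i => w (f i) ^ c i) s != dgval (fun i => w (f i) ^ c i) t).

Let split_coord (w : 'I_3 -> k) i : k := w (f i) ^ c i.
Let A : set M6 := [set frame_elt g (split_coord w) | w in @torus_points k 3].

Let split_coord0 w : torus_points w -> torus_points (split_coord w).
Proof. by move=> w0 i; rewrite expfz_neq0. Qed.

Let AT t : A t -> frame_torus g t.
Proof. by case=> w w0 <-; apply: frame_torus_elt => //; apply: split_coord0. Qed.

Let split_coord_frob w i : torus_points w ->
  split_coord w i = if eps i then (split_coord w (sg i))^-1 else split_coord w (sg i).
Proof.
move=> w0; have [h1 h2] := hfrob i; rewrite /split_coord.
have [ci|/h2 ->] := eqVneq (c i) 0.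
  have -> : c (sg i) = 0.
    by move/eqP: h1; rewrite ci eq_sym mulf_eq0 signr_eq0 /= => /eqP.
  by rewrite ci !expr0z invr1; case: ifP.
by rewrite h1; case: (eps i); rewrite ?expr1 ?expr0 ?mulN1r ?mul1r ?invr_expz.
Qed.

Let frob_elt e : torus_points e -> exists e', [/\ torus_points e', frb d (frame_elt g e) = frame_elt g e' &
  mono (sgmx sg eps) e' = fun i => e i ^+ Q].
Proof.
move=> e0; pose e' := mono (sgmx sg^-1 (inv_eps sg eps)) (fun i => e i ^+ Q).
have m : mono (sgmx sg eps) e' = fun i => e i ^+ Q by apply/mono_sgmxV.
exists e'; split=> //; first by apply: mono_torus => i; rewrite expf_neq0.
apply: (can_inj (mulKmx (_ : nmx k sg eps *m g \in unitmx))).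
  by rewrite unitmx_mul ug (Sp_unit (nmx_Sp k sg eps)).
rewrite -{1}Fg -map_mxM frame_eltE // map_mxM map_dgmx Fg -[RHS]mulmxA frame_eltE // !mulmxA; congr (_ *m _).
apply: nmx_dgmx => i.
have mi : (if eps i then (e' (sg i))^-1 else e' (sg i)) = e i ^+ Q by rewrite -mono_sgmx m.
by rewrite -[RHS]/(if eps i then (e i ^+ Q)^-1 else e i ^+ Q) -mi; case: (eps i); rewrite ?invrK.
Qed.

Let FT t : frame_torus g t -> frame_torus g (frob Q t) /\
    (fun i => frame_coord g i t ^+ Q) = mono (sgmx sg eps) (fun i => frame_coord g i (frob Q t)).
Proof.
move=> Tt; have [e0 e] := frame_torusP Sg Tt; have [e' [e'0 Fe m]] := frob_elt e0.
have tE := frame_elt_inj_eq Sg e (frame_eltE Sg _); rewrite frobE {1 3}tE Fe; split.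
  exact: frame_torus_elt.
by rewrite frame_coord_elt // m.
Qed.

Let laurent_frame_elt r (F : 'I_3 -> ('I_r -> k) -> k) a b :
  (forall i, laurent_function (F i)) -> (forall i, laurent_function (fun z => (F i z)^-1)) ->
  laurent_function (fun z => frame_elt g (fun i => F i z) a b).
Proof.
move=> h1 h2; rewrite /frame_elt; apply: laurent_mulmxr => {}a {}b; apply: laurent_mulmx => {}a {}b.
have [->|ab] := eqVneq a b.
  apply: (@laurent_ext k r (fun z => dgval (fun i => F i z) b)) => [z _|]; first by rewrite /dgmx !mxE eqxx.
  move: b; elim/ord_addP => i.
    by apply: (laurent_ext _ (h1 i)) => z _; rewrite dgvall.
  by apply: (laurent_ext _ (h2 i)) => z _; rewrite dgvalr.
by apply: (laurent_ext _ (laurent_const _ 0)) => z _; rewrite /dgmx !mxE (negPf ab).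
Qed.

Let frame_coord_regular (T : set M6) i : regular_function T (frame_coord g i).
Proof.
exists (\sum_a \sum_b (g (lshift 3 i) a * invmx g b (lshift 3 i)) *: 'X_(mxvec_index a b)), 0%N => x _.
rewrite expr0 divr1 /frame_coord mxE raddf_sum /=.
under eq_bigr do rewrite mxE mulr_suml.
rewrite exchange_big /=; apply: eq_bigr => a _; rewrite raddf_sum /=; apply: eq_bigr => b _.
by rewrite mevalZ mevalXU mxvecE mulrAC.
Qed.

Let frame_basis : torus_basis (frame_torus g) (frame_coord g).
Proof.
exists (frame_elt g); split.
- move=> z z0; have Tz := frame_torus_elt Sg z0; split=> //.
  by rewrite unitmxE det_frame_elt // unitr1.
- by move=> z w z0 w0; apply: frame_eltM.
- move=> a b; apply: (@laurent_frame_elt 3 (fun i z => z i)) => i; first exact: laurent_var.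
  exact: laurent_inv.
- by move=> i; apply: frame_coord_regular.
- split=> [z i z0|t Tt]; first by rewrite -[LHS]/((fun i => frame_coord g i _) i) frame_coord_elt.
  have [c0 e] := frame_torusP Sg Tt; split=> //.
  exact: esym (frame_elt_inj_eq Sg e (frame_eltE Sg _)).
Qed.

Let r := #|pv|.
Let e (j : 'I_r) : 'I_3 := enum_val j.
(** Extension by 1 outside the free indices, written as a product of integral powers so that it is
    visibly a Laurent function. *)
Let ext (z : 'I_r -> k) (i : 'I_3) : k := \prod_(j < r) z j ^ (i == e j)%:Z.

Let ext_e z j : ext z (e j) = z j.
Proof.
rewrite /ext (bigD1 j) //= eqxx expr1z big1 ?mulr1 // => l lj.
by rewrite (inj_eq enum_val_inj) eq_sym (negPf lj) expr0z.
Qed.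

Let ext0 z : torus_points z -> torus_points (ext z).
Proof. by move=> z0 i; rewrite prodf_seq_neq0; apply/allP => j _; rewrite /= expfz_neq0. Qed.

Let split_coord_eq w w' : (forall j, w (e j) = w' (e j)) -> split_coord w = split_coord w'.
Proof.
move=> h; apply/funext => i; rewrite /split_coord.
have [->|/pvc fi] := eqVneq (c i) 0; first by rewrite !expr0z.
by have := h (enum_rank_in fi (f i)); rewrite /e enum_rankK_in // => ->.
Qed.

Let A_basis : torus_basis A (fun j : 'I_r => frame_coord g (e j)).
Proof.
have pve j : f (e j) = e j /\ c (e j) = 1 by apply/pvf/(enum_valP j).
exists (fun z => frame_elt g (split_coord (ext z))); split.
- move=> z z0; have w0 := ext0 z0; split; first by exists (ext z).
  by rewrite unitmxE det_frame_elt ?unitr1 //; apply: split_coord0.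
- move=> z w z0 w0; rewrite -frame_eltM //; congr frame_elt; apply/funext => i.
  rewrite /split_coord -expfzMl; congr (_ ^ _); rewrite /ext -big_split; apply: eq_bigr => j _.
  by rewrite expfzMl.
- have lauz (F : ('I_r -> k) -> k) (m : int) : laurent_function F -> laurent_function (fun z => (F z)^-1) ->
      laurent_function (fun z => F z ^ m).
    by case: m => m h1 h2; [exact: laurent_exp|apply: (laurent_ext _ (laurent_exp m.+1 h2)) => z _; rewrite exprVn NegzE exprnN].
  have lext i : laurent_function (fun z => ext z i) /\ laurent_function (fun z => (ext z i)^-1).
    split; first by apply: laurent_prod => j; apply: lauz; [exact: laurent_var|exact: laurent_inv].
    apply: (@laurent_ext k r (fun z => \prod_(j < r) (z j)^-1 ^ (i == e j)%:Z)) => [z _|].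
      by rewrite /ext -prodfV; apply: eq_bigr => j _; rewrite exprz_inv invr_expz.
    apply: laurent_prod => j; apply: lauz; first exact: laurent_inv.
    by apply: (laurent_ext _ (laurent_var k j)) => z _; rewrite invrK.
  move=> a b; apply: laurent_frame_elt => i; have [l1 l2] := lext (f i); first exact: lauz.
  apply: (@laurent_ext k r (fun z => (ext z (f i)) ^ (- c i))) => [z _|]; last exact: lauz.
  by rewrite /split_coord invr_expz.
- by move=> j; apply: frame_coord_regular.
- have cE w j : frame_coord g (e j) (frame_elt g (split_coord w)) = w (e j).
    rewrite -[LHS]/((fun i => frame_coord g i _) (e j)) frame_coord_elt // /split_coord.
    by have [-> ->] := pve j; rewrite expr1z.
  split=> [z j z0|t [w w0 <-]]; first by rewrite cE ext_e.
  split=> [j|]; first by rewrite cE.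
  by congr frame_elt; apply: split_coord_eq => j; rewrite ext_e cE.
Qed.

Let frob_pow t : A t -> frb d t = frame_elt g (fun i => frame_coord g i t ^+ Q).
Proof.
case=> w w0 <-; have s0 := split_coord0 w0; have [e' [e'0 -> m]] := frob_elt s0.
have [s1 s2] := sgmx_inv k sg eps; congr frame_elt; apply/funext => i; rewrite (frame_coordK Sg).
have -> : e' = mono (sgmx sg^-1 (inv_eps sg eps)) (mono (sgmx sg eps) e') by rewrite mono_mul // s2 mono1.
rewrite m mono_expn; congr (_ ^+ _); rewrite mono_sgmx /inv_eps (@split_coord_frob w (sg^-1%g i) w0) permKV.
by case: (eps _); rewrite ?invrK.
Qed.

Let A_split : split_torus Q A.
Proof.
exists r, (fun j => frame_coord g (e j)); split; first exact: A_basis.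
move=> t At; rewrite frobE frob_pow //; split.
  case: At => w w0 <-; exists (fun i => w i ^+ Q); first by move=> i; rewrite expf_neq0.
  congr frame_elt; apply/funext => i; rewrite (frame_coordK Sg).
  by rewrite /split_coord !exprnP !exprz_exp mulrC.
by move=> j; rewrite (frame_coordK Sg).
Qed.

(** By [hsep], [gam] and one element of [A] together distinguish any two vectors of the frame, so a
    matrix commuting with both is diagonal in the frame. *)
Let centralizer_A : centralizer H A = frame_torus g.
Proof.
apply/seteqP; split=> [x [/centralizer1P[Sx xgam] xA]|t Tt].
  have [w w0 hw] := hsep; pose y := g *m x *m invmx g.
  have gx : g *m x = y *m g by rewrite /y mulmxKV.
  have Sy : @Sp k 3 y by apply: SpM; [apply: SpM|apply: SpV].
  clearbody y.
  have comm t e' : g *m t = dgmx e' *m g -> x *m t = t *m x -> y *m dgmx e' = dgmx e' *m y.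
    move=> et xt; apply: (can_inj (mulmxK ug)).
    by rewrite -mulmxA -et mulmxA -gx -mulmxA xt -[RHS]mulmxA -gx [RHS]mulmxA -et -[RHS]mulmxA.
  have c1 := comm _ _ ggam xgam.
  have c2 := comm _ _ (frame_eltE Sg _) (xA _ (ex_intro2 _ _ w w0 erefl)).
  have ent e' s t : y *m dgmx e' = dgmx e' *m y -> dgval e' s != dgval e' t -> y s t = 0.
    move=> ce; have := congr1 (fun z : M6 => z s t) ce; rewrite /dgmx mul_mx_diag mul_diag_mx !mxE => h1 ne.
    apply: contraNeq ne => ys; apply/eqP; apply: (mulIf ys).
    by rewrite -h1 mulrC.
  have yd s t : s != t -> y s t = 0.
    by case/hw => h; [apply: (ent _ _ _ c1)|apply: (ent _ _ _ c2)].
  have yy i : y (lshift 3 i) (lshift 3 i) * y (rshift 3 i) (rshift 3 i) = 1.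
    have := congr1 (fun z : M6 => z (lshift 3 i) (rshift 3 i)) ((SpP _).1 Sy).
    rewrite /symplectic_form block_mxEur !mxE eqxx (bigD1 (rshift 3 i)) //= big1 ?addr0 => [|s si].
      rewrite !mxE (bigD1 (lshift 3 i)) //= big1 ?addr0 => [|s si]; last by rewrite yd ?mul0r // eq_sym.
      by rewrite block_mxEur mxE eqxx mulr1.
    by rewrite [_^T _ _]mxE (yd _ s) ?mulr0 // eq_sym.
  exists (fun i => y (lshift 3 i) (lshift 3 i)) => [i|].
    by have /eqP := yy i; apply: contraTneq => ->; rewrite mul0r eq_sym oner_eq0.
  rewrite gx; congr (_ *m _); apply/matrixP => s t; rewrite /dgmx !mxE.
  have [<-|st] := eqVneq s t; last by rewrite yd.
  move: s; elim/ord_addP => i; rewrite ?dgvall ?dgvalr mulr1n //.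
  have := yy i; have [->|y0] := eqVneq (y (lshift 3 i) (lshift 3 i)) 0.
    by rewrite mul0r => /eqP; rewrite eq_sym oner_eq0.
  by move=> yi; apply: (mulfI y0); rewrite yi mulfV.
have [c0 e'] := frame_torusP Sg Tt.
have comm u e2 : g *m u = dgmx e2 *m g -> t *m u = u *m t.
  move=> eu; apply: (can_inj (mulKmx ug)); rewrite !mulmxA e' eu -!mulmxA e' eu !mulmxA !dgmxM.
  by congr (dgmx _ *m _); apply/funext => i; rewrite mulrC.
split; last by move=> a /AT Aa; have [_ ea] := frame_torusP Sg Aa; apply: comm ea.
apply/centralizer1P; split; last exact: comm ggam.
rewrite -[t](mulKmx ug) e'; apply: SpM; first exact: SpV.
by apply: SpM => //; apply: dgmx_Sp.
Qed.

(** Maximality of [A] rests on [hmax], which bears on squares: a coordinate identified with its own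
    inverse by the signed permutation satisfies [e i ^+ 2 = 1], and need not be 1. Since the
    elements of a larger split torus are squares in that torus, this is enough. *)
Lemma motive_det_exists (D : nat -> {poly rat}) N :
  (forall n, (0 < n)%N -> inv_gdet (Inv dl) (lin_sub (sgmx sg^-1 (inv_eps sg eps))) n (D n)) ->
  (forall n, (N < n)%N -> D n = 1) ->
  is_motive_det Q H (\prod_(1 <= n < N.+1) (D n \Po (Q%:R ^+ n.-1 *: 'X))).
Proof.
move=> hD DN; exists A, 3, (frame_coord g), (sgmx sg^-1 (inv_eps sg eps)), D, N.
have idc t : frame_torus g t -> (fun j => frame_coord g j t) = mono 1%:M (fun i => frame_coord g i t) /\
    (fun i => frame_coord g i t) = mono 1%:M (fun j => frame_coord g j t) by rewrite mono1.
have m1 : (1%:M : 'M[int]_3) *m 1%:M = 1%:M by rewrite mulmx1.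
rewrite /= centralizer_A.
have hM : frobenius_matrix Q (frame_torus g) (frame_coord g) (sgmx sg^-1 (inv_eps sg eps)).
  by apply/(frobenius_frame Sg Qinj FT _ m1 m1 idc); rewrite mulmx1 mul1mx.
split; [|exact: frame_basis|exact: hM| |by split].
  split; [exact: A_split| |].
    move=> a Aa; have : frame_torus g a by apply: AT.
    by rewrite -centralizer_A; case.
  move=> A' [s [psi [bA' FA']]] A'H AA'; apply/seteqP; split=> // t A't.
  have [phi [phiT phiM _ _ [psiphi hA']]] := bA'.
  have commA' x y : A' x -> A' y -> x *m y = y *m x.
    move=> Ax Ay; have [h1 <-] := hA' x Ax; have [h2 <-] := hA' y Ay.
    by rewrite -!phiM //; congr phi; apply/funext => i; rewrite mulrC.
  have A'T x : A' x -> frame_torus g x.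
    move=> Ax; rewrite -centralizer_A; split; first exact: A'H.
    by move=> a /AA' Aa; apply: commA'.
  have A'M x y : A' x -> A' y -> A' (x *m y).
    move=> Ax Ay; have [h1 <-] := hA' x Ax; have [h2 <-] := hA' y Ay.
    by rewrite -phiM //; have [] := phiT (fun i => psi i x * psi i y) (torusM h1 h2).
  have psiM x y i : A' x -> A' y -> psi i (x *m y) = psi i x * psi i y.
    move=> Ax Ay; have [h1 e1] := hA' x Ax; have [h2 e2] := hA' y Ay.
    by rewrite -{1}e1 -{1}e2 -phiM // psiphi //; apply: torusM.
  have coordM x y : A' x -> A' y -> (fun i => frame_coord g i (x *m y)) = fun i => frame_coord g i x * frame_coord g i y.
    move=> /A'T/(frame_torusP Sg)[_ ex] /A'T/(frame_torusP Sg)[_ ey].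
    by apply: frame_coordE => //; rewrite mulmxA ex -mulmxA ey mulmxA dgmxM.
  (* On a split torus Frobenius is the [Q]-th power map. Compared with its action on frame
     coordinates, this makes the coordinates of [x] invariant under the signed permutation. *)
  have inv x : A' x -> forall i, frame_coord g i x = if eps i then (frame_coord g (sg i) x)^-1 else frame_coord g (sg i) x.
    move=> Ax; have [Fx psiF] := FA' x Ax.
    have pw n : [/\ A' (iter n (mulmx x) x), forall i, psi i (iter n (mulmx x) x) = psi i x ^+ n.+1 &
        forall i, frame_coord g i (iter n (mulmx x) x) = frame_coord g i x ^+ n.+1].
      elim: n => [|n [IH1 IH2 IH3]]; first by split.
      split=> [|i|i]; first exact: A'M.
        by rewrite iterS psiM // IH2 [RHS]exprS.
      by rewrite iterS -[LHS]/((fun i => frame_coord g i _) i) coordM // IH3 [RHS]exprS.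
    have [a1 a2 a3] := pw Q.-1; rewrite prednK // in a2 a3.
    have FQ : frob Q x = iter Q.-1 (mulmx x) x.
      have [h1 <-] := hA' _ Fx; have [h2 <-] := hA' _ a1; congr phi; apply/funext => i.
      by rewrite psiF a2.
    move=> i; have [_] := FT (A'T x Ax); rewrite FQ => /(congr1 (fun h => h i)).
    rewrite mono_sgmx !a3 => e'; apply: Qinj; rewrite /= e'.
    by case: (eps i); rewrite ?exprVn.
  have [z0 tE] := hA' t A't.
  (* A square root of [t] inside [A'], to which [hmax] is applied. *)
  have /choice [v hv] : forall i, exists x : k, x ^+ 2 = psi i t.
    by move=> i; have [x] := @exp_root k 2 (psi i t) isT; exists x.
  have v0 : torus_points v by move=> i; have := z0 i; rewrite -hv expf_eq0.
  have A'u : A' (phi v) by have [] := phiT v v0.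
  have tu : t = phi v *m phi v by rewrite -tE -phiM //; congr phi; apply/funext => i; rewrite -hv expr2.
  have cu := coordM _ _ A'u A'u; rewrite -tu in cu.
  have [u0 _] := frame_torusP Sg (A'T _ A'u); have hm := hmax u0 (inv _ A'u).
  have [t0 et] := frame_torusP Sg (A'T _ A't).
  exists (fun i => frame_coord g i t) => //; rewrite [RHS](frame_elt_inj_eq Sg et (frame_eltE Sg _)).
  have {}cu j : frame_coord g j t = frame_coord g j (phi v) ^+ 2 by have /(congr1 (@^~ j)) := cu; rewrite -expr2.
  by congr frame_elt; apply/funext => i; rewrite /split_coord !cu -hm.
by move=> n n0; apply/(graded_det_frame Sg ggam Qinj FT n (D n) m1 m1 idc hM); apply: hD.
Qed.

End Existence.
End MotiveOfCentralizer.

(** * Graded determinants when Frobenius permutes the eigenvalues *)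

Section SmallDeterminants.
Variable R : comNzRingType.

Lemma det2E (A : 'M[R]_2) : \det A =
  A ord0 ord0 * A (lift ord0 ord0) (lift ord0 ord0) - A ord0 (lift ord0 ord0) * A (lift ord0 ord0) ord0.
Proof.
rewrite (expand_det_row _ ord0) !big_ord_recl big_ord0 /cofactor !det_mx11 !mxE /= addr0 expr0 mul1r expr1 mulN1r mulrN.
by congr (_ * A _ _ - _ * A _ _); apply: val_inj.
Qed.

Lemma det3E (F : nat -> nat -> R) : \det (\matrix_(i < 3, j < 3) F i j) =
  F 0 0 * (F 1 1 * F 2 2 - F 1 2 * F 2 1) - F 0 1 * (F 1 0 * F 2 2 - F 1 2 * F 2 0)
  + F 0 2 * (F 1 0 * F 2 1 - F 1 1 * F 2 0).
Proof.
rewrite (expand_det_row _ ord0) !big_ord_recl big_ord0 /cofactor.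
by rewrite !det2E !mxE /= /bump /=; ring.
Qed.

End SmallDeterminants.

Section MixedPatterns.
Variables (k : closedFieldType) (dl : 'I_3 -> k) (Q : nat) (tau : {perm 'I_3}) (eps : 'I_3 -> bool).
Hypotheses (Qinj : injective (fun x : k => x ^+ Q))
  (hF : forall i, dl i = (if eps i then (dl (tau i))^-1 else dl (tau i)) ^+ Q)
  (dinj : injective dl) (diso : forall i, isolated dl (dl i)).
Local Notation Fr := (lin_sub (sgmx tau eps)).

(** Injectivity of the [Q]-th power and distinctness of the eigenvalues determine the image of [i].
    The sign is determined only where the eigenvalue is not its own inverse; for self-inverse ones
    the generator has degree 2 and does not see it. *)
Lemma frob_index i j b : dl i = (if b then (dl j)^-1 else dl j) ^+ Q ->
  tau i = j /\ (dl j ^+ 2 != 1 -> eps i = b).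
Proof.
move=> e; have {}e : (if eps i then (dl (tau i))^-1 else dl (tau i)) = if b then (dl j)^-1 else dl j.
  by apply: Qinj; rewrite /= -hF.
case: (eps i) b e => -[] e.
- by move/invr_inj/dinj: e => ->.
- have e' : dl (tau i) = (dl j)^-1 by rewrite -e invrK.
  have j2 := diso e'; rewrite j2 eqxx; split=> //; apply: dinj.
  by rewrite e' sqr1V.
- have j2 := diso e; rewrite j2 eqxx; split=> //; apply: dinj.
  by rewrite e sqr1V.
- by move/dinj: e => ->.
Qed.

Lemma linear_gdet : (forall i, stp (dl i) = 1%N) ->
  inv_gdet (Inv dl) Fr 1 (\det (1%:M - 'X *: map_mx polyC (\matrix_(i, j) ((-1) ^+ eps i * (j == tau i)%:R)))).
Proof.
move=> hs; apply: (@distinct_gdet k dl dinj diso Fr 1 3 id) => // [i|b].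
  by rewrite hs eqxx; apply/esym/codomP; exists i.
rewrite expr1 lin_sub_sgmxX (bigD1 (tau b)) //= big1 ?addr0 => [|j /negPf jt].
  by rewrite mxE eqxx mulr1 expr1.
by rewrite mxE jt mulr0 scale0r.
Qed.

Lemma empty_gdet n : (0 < n)%N -> (forall i, stp (dl i) != n) -> inv_gdet (Inv dl) Fr n 1.
Proof.
move=> n0 h; have := @distinct_gdet k dl dinj diso Fr n 0 (fun=> o0) 0 n0; rewrite det_mx00; apply.
- by case.
- by move=> i; rewrite (negPf (h i)); apply/esym/codomP => -[[]].
- by case.
Qed.

(** On the first two variables Frobenius is a 2-cycle with a single sign, whence the factor
    [1 + 'X^2] in degree 1. The third variable contributes in degree 1 or 2, according to whether
    its eigenvalue is self-inverse. *)
Lemma quad_gdet n : dl o0 ^+ 2 != 1 -> dl o1 ^+ 2 != 1 -> dl o1 = dl o0 ^+ Q -> dl o0 = (dl o1)^-1 ^+ Q ->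
  dl o2 = (dl o2)^-1 ^+ Q -> (0 < n)%N ->
  inv_gdet (Inv dl) Fr n ((if n == 1%N then 1 + 'X^2 else 1) * block_factor (dl o2) 1 n).
Proof.
move=> n0 n1 d1 d0 d2 npos.
have [t0 e0] := @frob_index o0 o1 true d0; have {}e0 := e0 n1.
have [t1 e1] := @frob_index o1 o0 false d1; have {}e1 := e1 n0.
have [t2 e2] := @frob_index o2 o2 true d2.
have s0 : stp (dl o0) = 1%N by rewrite /stp (negPf n0).
have s1 : stp (dl o1) = 1%N by rewrite /stp (negPf n1).
rewrite /block_factor valid_stp //; have [c2|c2] := eqVneq (dl o2 ^+ 2) 1.
  have s2 : stp (dl o2) = 2%N by rewrite /stp c2 eqxx.
  rewrite s2 expr1n; have [->|nn1] := eqVneq n 1%N.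
    rewrite mulr1; pose f (b : 'I_2) := if b == ord0 then o0 else o1.
    pose B : 'M[rat]_2 := \matrix_(i, j) (if i == j then 0 else if i == ord0 then -1 else 1).
    have -> : 1 + 'X^2 = \det (1%:M - 'X *: map_mx polyC B).
      by rewrite det2E !mxE /= polyC0 polyCN polyC1; ring.
    apply: (@distinct_gdet k dl dinj diso Fr 1 2 f) => //.
    - by move=> [[|[|]] hi] // [[|[|]] hj] //= _; apply: val_inj.
    - have cod i : (i \in codom f) = (i != o2).
        apply/codomP/idP => [[b ->]|]; first by rewrite /f; case: ifP.
        by move: i; elim/I3P => // _; [exists ord0|exists ord_max].
      by elim/I3P; rewrite cod ?s0 ?s1 ?s2.
    - move=> [[|[|]] hb] //; rewrite big_ord_recl big_ord1 !mxE /f /= expr1 lin_sub_sgmxX ?e0 ?t0 ?e1 ?t1 ?expr1 ?expr0;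
      by rewrite -?val_eqE /= ?scale0r ?add0r ?addr0.
  have [->|nn2] := eqVneq n 2%N; last first.
    by rewrite mulr1; apply: empty_gdet => //; elim/I3P; rewrite ?s0 ?s1 ?s2 eq_sym.
  rewrite mul1r; have -> : 1 - 1 *: 'X = \det (1%:M - 'X *: map_mx polyC (1%:M : 'M[rat]_1)).
    by rewrite det_mx11 !mxE /= polyC1 scale1r mulr1.
  apply: (@distinct_gdet k dl dinj diso Fr 2 1 (fun=> o2)) => //.
  - by move=> i j _; rewrite !ord1.
  - have cod i : (i \in codom (fun _ : 'I_1 => o2)) = (i == o2).
      by apply/codomP/eqP => [[b ->]|->] //; exists ord0.
    by elim/I3P; rewrite cod ?s0 ?s1 ?s2.
  - by move=> b; rewrite big_ord1 mxE !ord1 eqxx scale1r lin_sub_sgmxXn t2 mulnC exprM sqrrN !expr1n scale1r.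
have s2 : stp (dl o2) = 1%N by rewrite /stp (negPf c2).
rewrite s2; have [->|nn1] := eqVneq n 1%N; last first.
  by rewrite mulr1; apply: empty_gdet => //; elim/I3P; rewrite ?s0 ?s1 ?s2 eq_sym.
have {}e2 := e2 c2.
pose F (i j : nat) : {poly rat} := match i, j with 0%N, 0%N => 1 | 0%N, 1%N => 'X | 1%N, 0%N => - 'X | 1%N, 1%N => 1 | 2%N, 2%N => 1 + 'X | _, _ => 0 end.
have -> : (1 + 'X^2) * (1 - (-1) ^+ 1 *: 'X) = \det (\matrix_(i < 3, j < 3) F i j).
  by rewrite det3E /F /= expr1 scaleN1r; ring.
have := linear_gdet; rewrite (_ : 1%:M - _ = \matrix_(i < 3, j < 3) F i j); first by apply; elim/I3P.
apply/matrixP; elim/I3P; elim/I3P; rewrite !mxE ?e0 ?e1 ?e2 ?t0 ?t1 ?t2 -?val_eqE /F /=;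
  by rewrite ?expr1 ?expr0 ?mulr1 ?mulr0 ?polyCN ?polyC1 ?polyC0; ring.
Qed.

(** All generators have degree 1, and Frobenius is a 3-cycle with a single sign. *)
Lemma cubic_gdet n : (forall i, dl i ^+ 2 != 1) -> dl o1 = dl o0 ^+ Q -> dl o2 = dl o1 ^+ Q -> dl o0 = (dl o2)^-1 ^+ Q ->
  (0 < n)%N -> inv_gdet (Inv dl) Fr n (if n == 1%N then 1 + 'X^3 else 1).
Proof.
move=> nsq d1 d2 d0 npos.
have [t0 e0] := @frob_index o0 o2 true d0; have {}e0 := e0 (nsq _).
have [t1 e1] := @frob_index o1 o0 false d1; have {}e1 := e1 (nsq _).
have [t2 e2] := @frob_index o2 o1 false d2; have {}e2 := e2 (nsq _).
have s i : stp (dl i) = 1%N by rewrite /stp (negPf (nsq i)).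
have [->|nn1] := eqVneq n 1%N; last by apply: empty_gdet => // i; rewrite s eq_sym.
pose F (i j : nat) : {poly rat} := match i, j with 0%N, 0%N => 1 | 0%N, 2%N => 'X | 1%N, 0%N => - 'X | 1%N, 1%N => 1 | 2%N, 1%N => - 'X | 2%N, 2%N => 1 | _, _ => 0 end.
have -> : 1 + 'X^3 = \det (\matrix_(i < 3, j < 3) F i j) by rewrite det3E /F /=; ring.
have := linear_gdet; rewrite (_ : 1%:M - _ = \matrix_(i < 3, j < 3) F i j); first by apply.
apply/matrixP; elim/I3P; elim/I3P; rewrite !mxE ?e0 ?e1 ?e2 ?t0 ?t1 ?t2 -?val_eqE /F /=;
  by rewrite ?expr1 ?expr0 ?mulr1 ?mulr0 ?polyCN ?polyC1 ?polyC0; ring.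
Qed.

End MixedPatterns.

(** * Values of the motive polynomials *)

Section Evaluation.
Variables (C : numFieldType) (k : closedFieldType).

(** The product stops at 6, the largest degree of a basic invariant of the Weyl group of [Sp_6]. *)
Definition eval_motive (Q : nat) (E : nat -> {poly rat}) (x : C) : C :=
  \prod_(1 <= n < 7) (map_poly ratr (E n)).[Q%:R ^+ n.-1 * x].

Lemma motive_poly_eval (D E : nat -> {poly rat}) N Q (x : C) : (forall n, (N < n)%N -> D n = 1) ->
  (forall n, (0 < n)%N -> D n = E n) -> (forall n, (6 < n)%N -> E n = 1) ->
  (map_poly ratr (\prod_(1 <= n < N.+1) (D n \Po (Q%:R ^+ n.-1 *: 'X)))).[x] = eval_motive Q E x.
Proof.
move=> DN DE E6; pose G n : C := (map_poly ratr (E n)).[Q%:R ^+ n.-1 * x].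
transitivity (\prod_(1 <= n < N.+1) G n).
  rewrite rmorph_prod horner_prod; apply: eq_big_nat => n /andP[n0 _].
  rewrite /= map_comp_poly horner_comp DE // map_polyZ map_polyX hornerZ hornerX.
  by rewrite rmorphXn /= ratr_nat.
have tail a b : (0 < a)%N -> (a <= b)%N -> (forall n, (a <= n)%N -> G n = 1) -> \prod_(1 <= n < a) G n = \prod_(1 <= n < b) G n.
  move=> a0 ab h; rewrite [RHS](big_cat_nat _ (n := a)) //= [X in _ * X]big_nat_cond [X in _ * X]big1 ?mulr1 //.
  by move=> n /andP[/andP[an _] _]; apply: h.
(* The unknown bound [N] and the bound 6 are compared through a longer product containing both. *)
rewrite (tail N.+1 (N + 7)%N) //; first last.
- by move=> n Nn; rewrite /G -DE ?DN ?rmorph1 ?hornerC //; apply: leq_trans Nn.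
- by rewrite addnS ltnS leq_addr.
rewrite -(tail 7%N (N + 7)%N) ?leq_addl // => n n6.
by rewrite /G E6 // rmorph1 hornerC.
Qed.

Lemma eval_motiveM Q (E E' : nat -> {poly rat}) (x : C) :
  eval_motive Q (fun n => E n * E' n) x = eval_motive Q E x * eval_motive Q E' x.
Proof. by rewrite -big_split; apply: eq_bigr => n _; rewrite rmorphM hornerM. Qed.

(** Frobenius polynomial of the motive of the symplectic group of rank [M] when [flag] holds, of the
    unitary group in [M] variables otherwise. *)
Definition block_value (flag : bool) M (Q x : C) : C :=
  \prod_(j < M) (1 - (if flag then Q ^+ (2 * j + 1) else (-1) ^+ j.+1 * Q ^+ j) * x).

Lemma eval_block Q (a : k) M (x : C) : (M <= 3)%N ->
  eval_motive Q (block_factor a M) x = block_value (a ^+ 2 == 1) M Q%:R x.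
Proof.
move=> M3; rewrite /eval_motive /block_value.
have lin (c : rat) (y : C) : (map_poly ratr (1 - c *: 'X)).[y] = 1 - ratr c * y.
  by rewrite rmorphB rmorph1 /= map_polyZ map_polyX !hornerE.
have one (y : C) : (map_poly ratr (1 : {poly rat})).[y] = 1 by rewrite rmorph1 hornerC.
rewrite /index_iota /= !big_cons big_nil /=.
have sgn n : ratr ((-1) ^+ n) = (-1) ^+ n :> C by rewrite rmorph_sign.
have [a2|a2] := eqVneq (a ^+ 2) 1.
  have bE n : block_factor a M n = if (2 %| n)%N && (n <= 2 * M)%N then 1 - 1 *: 'X else 1.
    by rewrite /block_factor /valid_deg /stp a2 eqxx expr1n.
  by case: M M3 bE => [|[|[|[|]]]] // _ bE; rewrite !bE;
    do ?(case: ifP => e; vm_compute in e; try discriminate e; clear e); rewrite ?one ?lin ?rmorph1 ?big_ord_recr ?big_ord0 /=; ring.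
have bE n : block_factor a M n = if (n <= M)%N then 1 - ((-1) ^+ n) *: 'X else 1.
  by rewrite /block_factor /valid_deg /stp (negPf a2) mul1n dvd1n.
by case: M M3 bE => [|[|[|[|]]]] // _ bE; rewrite !bE;
  do ?(case: ifP => e; vm_compute in e; try discriminate e; clear e); rewrite ?one ?lin ?sgn ?big_ord_recr ?big_ord0 /=; ring.
Qed.

Lemma eval_power Q j (x : C) : eval_motive Q (fun n => if n == 1%N then 1 + 'X^j else 1) x = 1 + x ^+ j.
Proof.
rewrite /eval_motive /index_iota /= !big_cons big_nil /= !rmorph1 !hornerC !mulr1 expr0 mul1r.
by rewrite rmorphD rmorph1 /= map_polyXn !hornerE.
Qed.

End Evaluation.

(** * Closure properties of functions of Lefschetz type *)

Section Lefschetz.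
Variable C : numFieldType.

Lemma lef_ext (f g : nat -> C) : (forall m, (0 < m)%N -> f m = g m) ->
  lefschetz_type g -> lefschetz_type f.
Proof. by move=> fg [r [n [a h]]]; exists r, n, a => m m0; rewrite fg ?h. Qed.

Lemma lefD (f g : nat -> C) : lefschetz_type f -> lefschetz_type g ->
  lefschetz_type (fun m => f m + g m).
Proof.
case=> r [n [a hf]] [s [n' [a' hg]]].
exists (r + s)%N, (fun i => match fintype.split i with inl j => n j | inr j => n' j end),
  (fun i => match fintype.split i with inl j => a j | inr j => a' j end) => m m0.
rewrite hf // hg // big_split_ord; congr (_ + _); apply: eq_bigr => i _.
  by rewrite (unsplitK (inl i)).
by rewrite (unsplitK (inr i)).
Qed.

Lemma lef_sum I (l : seq I) (f : I -> nat -> C) : (forall i, lefschetz_type (f i)) ->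
  lefschetz_type (fun m => \sum_(i <- l) f i m).
Proof.
move=> hf; elim: l => [|i l IHl].
  by exists 0%N, (fun=> 0), (fun=> 0) => m _; rewrite big_nil big_ord0.
by apply: (lef_ext _ (lefD (hf i) IHl)) => m _; rewrite big_cons.
Qed.

Lemma lef_monomial (c : int) (a : C) : lefschetz_type (fun m => c%:~R * a ^+ m).
Proof. by exists 1%N, (fun=> c), (fun=> a) => m _; rewrite big_ord1. Qed.

Lemma lefM (f g : nat -> C) : lefschetz_type f -> lefschetz_type g ->
  lefschetz_type (fun m => f m * g m).
Proof.
case=> r [n [a hf]] [s [n' [a' hg]]].
apply: (lef_ext (g := fun m => \sum_(i <- index_enum 'I_r) \sum_(j <- index_enum 'I_s)
   (n i * n' j)%:~R * (a i * a' j) ^+ m)) => [m m0|].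
  rewrite hf // hg // mulr_suml; apply: eq_bigr => i _; rewrite mulr_sumr; apply: eq_bigr => j _.
  by rewrite exprMn intrM; ring.
by apply: lef_sum => i; apply: lef_sum => j; apply: lef_monomial.
Qed.

Lemma lef_int (c : int) : lefschetz_type (fun=> c%:~R : C).
Proof. by apply: (lef_ext _ (lef_monomial c 1)) => m _; rewrite expr1n mulr1. Qed.

Lemma lef_nat (c : nat) : lefschetz_type (fun=> c%:R : C).
Proof. exact: (lef_int c%:Z). Qed.

Lemma lefN (f : nat -> C) : lefschetz_type f -> lefschetz_type (fun m => - f m).
Proof. by move=> hf; apply: (lef_ext _ (lefM (lef_int (-1)) hf)) => m _; rewrite mulN1r. Qed.

Lemma lef_exp (f : nat -> C) j : lefschetz_type f -> lefschetz_type (fun m => f m ^+ j).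
Proof.
move=> hf; elim: j => [|j IHj]; first exact: (lef_nat 1).
by apply: (lef_ext _ (lefM hf IHj)) => m _; rewrite exprS.
Qed.

Lemma lef_pow (a : C) : lefschetz_type (fun m => a ^+ m).
Proof. by apply: (lef_ext _ (lef_monomial 1 a)) => m _; rewrite mul1r. Qed.

Lemma lef_natpow (q : nat) : lefschetz_type (fun m => (q ^ m)%:R : C).
Proof. by apply: (lef_ext _ (lef_pow q%:R)) => m _; rewrite natrX. Qed.
End Lefschetz.

Ltac lef_tac := repeat first [assumption | exact: (lef_nat _ 1) | apply: lef_natpow | apply: lef_pow | apply: lef_nat | apply: lefD |
  apply: lefM | apply: lefN | apply: lef_exp].

(** Frobenius polynomials of the ten motives. Writing U_r for the unitary groups, [gA] belongs to
    Sp_6, [gB] to Sp_4 x Sp_2, [gC] to Sp_4 x U_1, [gG] to U_3 and [gH] to U_1 x U_1 x U_1. Two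
    kinds of centralizers share [gD], namely U_2 x Sp_2 and Sp_2 x Sp_2 x U_1, and two share [gE],
    namely U_2 x U_1 and Sp_2 x U_1 x U_1. A rank one unitary group over the quadratic extension,
    times Sp_2 or U_1, gives [gF] or [gI]; over the cubic extension it gives [gK]. *)
Definition gA (C : numFieldType) (Q x : C) : C := (1 - Q * x) * (1 - Q ^+ 3 * x) * (1 - Q ^+ 5 * x).
Definition gB (C : numFieldType) (Q x : C) : C := (1 - Q * x) * (1 - Q * x) * (1 - Q ^+ 3 * x).
Definition gC (C : numFieldType) (Q x : C) : C := (1 - Q * x) * (1 - Q ^+ 3 * x) * (1 + x).
Definition gD (C : numFieldType) (Q x : C) : C := (1 - Q * x) * (1 - Q * x) * (1 + x).
Definition gE (C : numFieldType) (Q x : C) : C := (1 - Q * x) * (1 + x) * (1 + x).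
Definition gF (C : numFieldType) (Q x : C) : C := (1 + x ^+ 2) * (1 - Q * x).
Definition gG (C : numFieldType) (Q x : C) : C := (1 + x) * (1 - Q * x) * (1 + Q ^+ 2 * x).
Definition gH (C : numFieldType) (Q x : C) : C := (1 + x) * (1 + x) * (1 + x).
Definition gI (C : numFieldType) (Q x : C) : C := (1 + x ^+ 2) * (1 + x).
Definition gK (C : numFieldType) (Q x : C) : C := 1 + x ^+ 3.

(** * The lattice of values and the integrality certificate *)

Section Certificate.
Variables (C : numFieldType) (q : nat).
Local Notation qm m := ((q ^ m)%:R : C).

(* The vectors of values, at the ten types, of the elements of a basis of a [Z[Q]]-lattice
   that contains the constant vector 1 and is stable under multiplication by the vectors of
   coefficients of the polynomials [gA], ..., [gK].  The basis consists of 1, e1, e2, e3, e1^2,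
   e1 e2, e1 e3, one further element, e1^3 and e1^2 e2, where [g = 1 - e1 x + e2 x^2 - e3 x^3]. *)
Definition latA (Q f0 f1 f2 f3 f4 f5 f6 f7 f8 f9 : C) : C :=
  f0 * (1) + f1 * (Q + Q ^+ 3 + Q ^+ 5) + f2 * (Q ^+ 4 + Q ^+ 6 + Q ^+ 8) + f3 * (Q ^+ 9) + f4 * (Q ^+ 2 + 2 * Q ^+ 4 + 3 * Q ^+ 6 + 2 * Q ^+ 8 + Q ^+ 10) + f5 * (Q ^+ 5 + 2 * Q ^+ 7 + 3 * Q ^+ 9 + 2 * Q ^+ 11 + Q ^+ 13) + f6 * (Q ^+ 10 + Q ^+ 12 + Q ^+ 14) + f7 * (- 2 - Q - Q ^+ 2 - 3 * Q ^+ 3 - Q ^+ 4 - 4 * Q ^+ 5 - 2 * Q ^+ 6 - Q ^+ 7 - 4 * Q ^+ 8 - Q ^+ 9 - 2 * Q ^+ 10 - Q ^+ 11 - Q ^+ 13) + f8 * (Q ^+ 3 + 3 * Q ^+ 5 + 6 * Q ^+ 7 + 7 * Q ^+ 9 + 6 * Q ^+ 11 + 3 * Q ^+ 13 + Q ^+ 15) + f9 * (Q ^+ 6 + 3 * Q ^+ 8 + 6 * Q ^+ 10 + 7 * Q ^+ 12 + 6 * Q ^+ 14 + 3 * Q ^+ 16 + Q ^+ 18).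
Definition latB (Q f0 f1 f2 f3 f4 f5 f6 f7 f8 f9 : C) : C :=
  f0 * (1) + f1 * (2 * Q + Q ^+ 3) + f2 * (Q ^+ 2 + 2 * Q ^+ 4) + f3 * (Q ^+ 5) + f4 * (4 * Q ^+ 2 + 4 * Q ^+ 4 + Q ^+ 6) + f5 * (2 * Q ^+ 3 + 5 * Q ^+ 5 + 2 * Q ^+ 7) + f6 * (2 * Q ^+ 6 + Q ^+ 8) + f7 * (- 2 - 4 * Q - 3 * Q ^+ 2 - 4 * Q ^+ 3 - 5 * Q ^+ 4 - 3 * Q ^+ 5 - 2 * Q ^+ 6 - Q ^+ 7) + f8 * (8 * Q ^+ 3 + 12 * Q ^+ 5 + 6 * Q ^+ 7 + Q ^+ 9) + f9 * (4 * Q ^+ 4 + 12 * Q ^+ 6 + 9 * Q ^+ 8 + 2 * Q ^+ 10).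
Definition latC (Q f0 f1 f2 f3 f4 f5 f6 f7 f8 f9 : C) : C :=
  f0 * (1) + f1 * (- 1 + Q + Q ^+ 3) + f2 * (- Q - Q ^+ 3 + Q ^+ 4) + f3 * (- Q ^+ 4) + f4 * (1 - 2 * Q + Q ^+ 2 - 2 * Q ^+ 3 + 2 * Q ^+ 4 + Q ^+ 6) + f5 * (Q - Q ^+ 2 + Q ^+ 3 - 3 * Q ^+ 4 + Q ^+ 5 - Q ^+ 6 + Q ^+ 7) + f6 * (Q ^+ 4 - Q ^+ 5 - Q ^+ 7) + f7 * (0) + f8 * (- 1 + 3 * Q - 3 * Q ^+ 2 + 4 * Q ^+ 3 - 6 * Q ^+ 4 + 3 * Q ^+ 5 - 3 * Q ^+ 6 + 3 * Q ^+ 7 + Q ^+ 9) + f9 * (- Q + 2 * Q ^+ 2 - 2 * Q ^+ 3 + 5 * Q ^+ 4 - 5 * Q ^+ 5 + 3 * Q ^+ 6 - 5 * Q ^+ 7 + 2 * Q ^+ 8 - Q ^+ 9 + Q ^+ 10).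
Definition latD (Q f0 f1 f2 f3 f4 f5 f6 f7 f8 f9 : C) : C :=
  f0 * (1) + f1 * (- 1 + 2 * Q) + f2 * (- 2 * Q + Q ^+ 2) + f3 * (- Q ^+ 2) + f4 * (1 - 4 * Q + 4 * Q ^+ 2) + f5 * (2 * Q - 5 * Q ^+ 2 + 2 * Q ^+ 3) + f6 * (Q ^+ 2 - 2 * Q ^+ 3) + f7 * (0) + f8 * (- 1 + 6 * Q - 12 * Q ^+ 2 + 8 * Q ^+ 3) + f9 * (- 2 * Q + 9 * Q ^+ 2 - 12 * Q ^+ 3 + 4 * Q ^+ 4).
Definition latE (Q f0 f1 f2 f3 f4 f5 f6 f7 f8 f9 : C) : C :=
  f0 * (1) + f1 * (- 2 + Q) + f2 * (1 - 2 * Q) + f3 * (Q) + f4 * (4 - 4 * Q + Q ^+ 2) + f5 * (- 2 + 5 * Q - 2 * Q ^+ 2) + f6 * (- 2 * Q + Q ^+ 2) + f7 * (0) + f8 * (- 8 + 12 * Q - 6 * Q ^+ 2 + Q ^+ 3) + f9 * (4 - 12 * Q + 9 * Q ^+ 2 - 2 * Q ^+ 3).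
Definition latF (Q f0 f1 f2 f3 f4 f5 f6 f7 f8 f9 : C) : C :=
  f0 * (1) + f1 * (Q) + f2 * (1) + f3 * (Q) + f4 * (Q ^+ 2) + f5 * (Q) + f6 * (Q ^+ 2) + f7 * (- 2 - 2 * Q) + f8 * (Q ^+ 3) + f9 * (Q ^+ 2).
Definition latG (Q f0 f1 f2 f3 f4 f5 f6 f7 f8 f9 : C) : C :=
  f0 * (1) + f1 * (- 1 + Q - Q ^+ 2) + f2 * (- Q + Q ^+ 2 - Q ^+ 3) + f3 * (Q ^+ 3) + f4 * (1 - 2 * Q + 3 * Q ^+ 2 - 2 * Q ^+ 3 + Q ^+ 4) + f5 * (Q - 2 * Q ^+ 2 + 3 * Q ^+ 3 - 2 * Q ^+ 4 + Q ^+ 5) + f6 * (- Q ^+ 3 + Q ^+ 4 - Q ^+ 5) + f7 * (0) + f8 * (- 1 + 3 * Q - 6 * Q ^+ 2 + 7 * Q ^+ 3 - 6 * Q ^+ 4 + 3 * Q ^+ 5 - Q ^+ 6) + f9 * (- Q + 3 * Q ^+ 2 - 6 * Q ^+ 3 + 7 * Q ^+ 4 - 6 * Q ^+ 5 + 3 * Q ^+ 6 - Q ^+ 7).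
Definition latH (Q f0 f1 f2 f3 f4 f5 f6 f7 f8 f9 : C) : C :=
  f0 * (1) + f1 * (- 3) + f2 * (3) + f3 * (- 1) + f4 * (9) + f5 * (- 9) + f6 * (3) + f7 * (0) + f8 * (- 27) + f9 * (27).
Definition latI (Q f0 f1 f2 f3 f4 f5 f6 f7 f8 f9 : C) : C :=
  f0 * (1) + f1 * (- 1) + f2 * (1) + f3 * (- 1) + f4 * (1) + f5 * (- 1) + f6 * (1) + f7 * (0) + f8 * (- 1) + f9 * (1).
Definition latK (Q f0 f1 f2 f3 f4 f5 f6 f7 f8 f9 : C) : C :=
  f0 * (1) + f1 * (0) + f2 * (0) + f3 * (- 1) + f4 * (0) + f5 * (0) + f6 * (0) + f7 * (0) + f8 * (0) + f9 * (0).

(** The empty product is the first basis vector, and one more element of [J] multiplies by a vector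
    that preserves the lattice; the coordinates stay of Lefschetz type because the transition
    coefficients are integral polynomials in [Q] and [a ^+ m]. *)
Lemma lattice_product (J : seq C) : exists f0 f1 f2 f3 f4 f5 f6 f7 f8 f9 : nat -> C,
  [/\ [/\ lefschetz_type f0, lefschetz_type f1, lefschetz_type f2, lefschetz_type f3 & lefschetz_type f4],
      [/\ lefschetz_type f5, lefschetz_type f6, lefschetz_type f7, lefschetz_type f8 & lefschetz_type f9] &
   forall m, [/\ 
      \prod_(a <- J) gA (qm m) (a ^+ m) = latA (qm m) (f0 m) (f1 m) (f2 m) (f3 m) (f4 m) (f5 m) (f6 m) (f7 m) (f8 m) (f9 m), 
      \prod_(a <- J) gB (qm m) (a ^+ m) = latB (qm m) (f0 m) (f1 m) (f2 m) (f3 m) (f4 m) (f5 m) (f6 m) (f7 m) (f8 m) (f9 m), 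
      \prod_(a <- J) gC (qm m) (a ^+ m) = latC (qm m) (f0 m) (f1 m) (f2 m) (f3 m) (f4 m) (f5 m) (f6 m) (f7 m) (f8 m) (f9 m), 
      \prod_(a <- J) gD (qm m) (a ^+ m) = latD (qm m) (f0 m) (f1 m) (f2 m) (f3 m) (f4 m) (f5 m) (f6 m) (f7 m) (f8 m) (f9 m) & 
      \prod_(a <- J) gE (qm m) (a ^+ m) = latE (qm m) (f0 m) (f1 m) (f2 m) (f3 m) (f4 m) (f5 m) (f6 m) (f7 m) (f8 m) (f9 m)] /\ [/\ 
      \prod_(a <- J) gF (qm m) (a ^+ m) = latF (qm m) (f0 m) (f1 m) (f2 m) (f3 m) (f4 m) (f5 m) (f6 m) (f7 m) (f8 m) (f9 m), 
      \prod_(a <- J) gG (qm m) (a ^+ m) = latG (qm m) (f0 m) (f1 m) (f2 m) (f3 m) (f4 m) (f5 m) (f6 m) (f7 m) (f8 m) (f9 m), 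
      \prod_(a <- J) gH (qm m) (a ^+ m) = latH (qm m) (f0 m) (f1 m) (f2 m) (f3 m) (f4 m) (f5 m) (f6 m) (f7 m) (f8 m) (f9 m), 
      \prod_(a <- J) gI (qm m) (a ^+ m) = latI (qm m) (f0 m) (f1 m) (f2 m) (f3 m) (f4 m) (f5 m) (f6 m) (f7 m) (f8 m) (f9 m) & 
      \prod_(a <- J) gK (qm m) (a ^+ m) = latK (qm m) (f0 m) (f1 m) (f2 m) (f3 m) (f4 m) (f5 m) (f6 m) (f7 m) (f8 m) (f9 m)]].
Proof.
elim: J => [|a J [f0 [f1 [f2 [f3 [f4 [f5 [f6 [f7 [f8 [f9 [[h0 h1 h2 h3 h4] [h5 h6 h7 h8 h9] hf]]]]]]]]]]]].
  exists (fun=> 1%:R), (fun=> 0%:R), (fun=> 0%:R), (fun=> 0%:R), (fun=> 0%:R), (fun=> 0%:R), (fun=> 0%:R), (fun=> 0%:R), (fun=> 0%:R), (fun=> 0%:R).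
  split; [by split; apply: lef_nat|by split; apply: lef_nat|].
  move=> m; split; split; rewrite big_nil; rewrite /latA /latB /latC /latD /latE /latF /latG /latH /latI /latK; ring.
(* Coordinates after multiplication by [1 - e1 x + e2 x^2 - e3 x^3] at [x = a ^+ m]. In each of the
   ten formulas the three brackets are the corresponding rows of the matrices of multiplication by
   e1, e2 and e3 in the chosen basis, and stability of the lattice is the integrality of their
   coefficients. The final [ring] checks the formulas at each type. *)
pose f0' m := f0 m - a ^+ m * ((- 2 * (qm m) ^+ 2 - (qm m) ^+ 4) * f6 m + (2 * (qm m) + (qm m) ^+ 3) * f7 m + (- 2 + 4 * (qm m) - 7 * (qm m) ^+ 2 + 5 * (qm m) ^+ 3 - 3 * (qm m) ^+ 4 + 3 * (qm m) ^+ 5) * f8 m + (2 - 6 * (qm m) + 3 * (qm m) ^+ 2 - 10 * (qm m) ^+ 3 + 2 * (qm m) ^+ 4 - 5 * (qm m) ^+ 5 + 2 * (qm m) ^+ 6) * f9 m) + (a ^+ m) ^+ 2 * ((2 - 2 * (qm m)) * f2 m + (2 * (qm m) - 2 * (qm m) ^+ 2) * f3 m + (2 * (qm m) - 4 * (qm m) ^+ 2 + (qm m) ^+ 3 - 2 * (qm m) ^+ 4) * f5 m + (4 * (qm m) ^+ 2 - 4 * (qm m) ^+ 3 + 2 * (qm m) ^+ 4 - 2 * (qm m) ^+ 5) * f6 m + (- 2 + 3 * (qm m) ^+ 2 + 2 * (qm m) ^+ 4) * f7 m + (2 - 6 * (qm m) + 3 * (qm m) ^+ 2 - 10 * (qm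 m) ^+ 3 + 2 * (qm m) ^+ 4 - 5 * (qm m) ^+ 5 + 2 * (qm m) ^+ 6) * f8 m + (- 2 + 8 * (qm m) + (qm m) ^+ 2 + 3 * (qm m) ^+ 3 - 3 * (qm m) ^+ 4 - 2 * (qm m) ^+ 5 - 5 * (qm m) ^+ 6) * f9 m) - (a ^+ m) ^+ 3 * ((2 * (qm m) - 2 * (qm m) ^+ 2) * f2 m + (2 * (qm m) ^+ 2 - (qm m) ^+ 3) * f3 m + (- 2 * (qm m) ^+ 2 - (qm m) ^+ 4) * f4 m + (4 * (qm m) ^+ 2 - 4 * (qm m) ^+ 3 + 2 * (qm m) ^+ 4 - 2 * (qm m) ^+ 5) * f5 m + (4 * (qm m) ^+ 3 - 2 * (qm m) ^+ 4 + 2 * (qm m) ^+ 5 - (qm m) ^+ 6) * f6 m + (- 2 * (qm m) + (qm m) ^+ 3 + (qm m) ^+ 5) * f7 m + (2 * (qm m) + 4 * (qm m) ^+ 2 - (qm m) ^+ 3 + (qm m) ^+ 4 - 3 * (qm m) ^+ 5 - 2 * (qm m) ^+ 6 - (qm m) ^+ 7) * f8 m + (- 2 * (qm m) - 2 * (qm m) ^+ 2 + 7 * (qm m) ^+ 3 - 4 * (qm m) ^+ 4 + 7 * (qm m) ^+ 5 - 4 * (qm m) ^+ 6 - 2 * (qm m) ^+ 8) * f9 m).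
pose f1' m := f1 m - a ^+ m * ((1) * f0 m + (3 * (qm m) - 2 * (qm m) ^+ 2 + 2 * (qm m) ^+ 3 + (qm m) ^+ 5 + (qm m) ^+ 6) * f6 m + (- 2 + 2 * (qm m) - (qm m) ^+ 2 - (qm m) ^+ 5) * f7 m + (- 3 + 10 * (qm m) - 7 * (qm m) ^+ 2 + (qm m) ^+ 3 + (qm m) ^+ 4 + (qm m) ^+ 6 - (qm m) ^+ 7) * f8 m + (3 - (qm m) + 4 * (qm m) ^+ 2 + 4 * (qm m) ^+ 3 - 3 * (qm m) ^+ 4 + 7 * (qm m) ^+ 5 + 4 * (qm m) ^+ 6 + 2 * (qm m) ^+ 7 + 2 * (qm m) ^+ 8 + (qm m) ^+ 10) * f9 m) + (a ^+ m) ^+ 2 * ((3 - 2 * (qm m) - (qm m) ^+ 2 + (qm m) ^+ 3) * f2 m + (3 * (qm m) - 2 * (qm m) ^+ 2 + (qm m) ^+ 4) * f3 m + (6 * (qm m) - 6 * (qm m) ^+ 2 + 4 * (qm m) ^+ 3 + (qm m) ^+ 5 + 2 * (qm m) ^+ 6 + (qm m) ^+ 8) * f5 m + (- 3 * (qm m) + 8 * (qm m) ^+ 2 - 8 * (qm m) ^+ 3 + 4 * (qm m) ^+ 4 - (qm m) ^+ 5 + 2 * (qm m) ^+ 7 + (qm m) ^+ 9) * f6 m + (- 3 - 2 * (qm m) + 4 * (qm m) ^+ 2 - 3 * (qm m) ^+ 3 - (qm m) ^+ 5 - 2 * (qm m) ^+ 6 - (qm m) ^+ 8) * f7 m + (3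 - (qm m) + 4 * (qm m) ^+ 2 + 4 * (qm m) ^+ 3 - 3 * (qm m) ^+ 4 + 7 * (qm m) ^+ 5 + 4 * (qm m) ^+ 6 + 2 * (qm m) ^+ 7 + 2 * (qm m) ^+ 8 + (qm m) ^+ 10) * f8 m + (- 3 - 8 * (qm m) + 18 * (qm m) ^+ 2 - 24 * (qm m) ^+ 3 + 25 * (qm m) ^+ 4 - 21 * (qm m) ^+ 5 + 7 * (qm m) ^+ 6 + 8 * (qm m) ^+ 7 + 9 * (qm m) ^+ 9 - (qm m) ^+ 10 + 4 * (qm m) ^+ 11 + (qm m) ^+ 13) * f9 m) - (a ^+ m) ^+ 3 * ((3 * (qm m) - 2 * (qm m) ^+ 2 + (qm m) ^+ 4) * f2 m + (2 * (qm m) ^+ 2 - 2 * (qm m) ^+ 3 + (qm m) ^+ 5) * f3 m + (3 * (qm m) - 2 * (qm m) ^+ 2 + 2 * (qm m) ^+ 3 + (qm m) ^+ 5 + (qm m) ^+ 6) * f4 m + (- 3 * (qm m) + 8 * (qm m) ^+ 2 - 8 * (qm m) ^+ 3 + 4 * (qm m) ^+ 4 - (qm m) ^+ 5 + 2 * (qm m) ^+ 7 + (qm m) ^+ 9) * f5 m + (- 3 * (qm m) ^+ 2 + 6 * (qm m) ^+ 3 - 6 * (qm m) ^+ 4 + 2 * (qm m) ^+ 5 - (qm m) ^+ 6 - (qm m) ^+ 7 + (qm m) ^+ 8 + (qm m) ^+ 10) * f6 m + (- 3 * (qm m) + 2 * (qm m) ^+ 3 - 2 * (qm m) ^+ 4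 - (qm m) ^+ 6 - (qm m) ^+ 7 - (qm m) ^+ 9) * f7 m + (- 9 * (qm m) + 10 * (qm m) ^+ 2 - 11 * (qm m) ^+ 3 + 11 * (qm m) ^+ 4 - 8 * (qm m) ^+ 5 + 2 * (qm m) ^+ 6 + 4 * (qm m) ^+ 7 + (qm m) ^+ 8 + 3 * (qm m) ^+ 9 + (qm m) ^+ 11) * f8 m + (9 * (qm m) - 19 * (qm m) ^+ 2 + 24 * (qm m) ^+ 3 - 28 * (qm m) ^+ 4 + 25 * (qm m) ^+ 5 - 14 * (qm m) ^+ 6 + 4 * (qm m) ^+ 8 - 2 * (qm m) ^+ 9 + 7 * (qm m) ^+ 10 - (qm m) ^+ 11 + 3 * (qm m) ^+ 12 + (qm m) ^+ 14) * f9 m).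
pose f2' m := f2 m - a ^+ m * ((- 2 * (qm m) ^+ 2 - (qm m) ^+ 4) * f6 m + (2 * (qm m) + (qm m) ^+ 3) * f7 m + (- 3 * (qm m) + (qm m) ^+ 3 + 2 * (qm m) ^+ 4 + (qm m) ^+ 5) * f8 m + (3 * (qm m) - 11 * (qm m) ^+ 2 + (qm m) ^+ 3 - 7 * (qm m) ^+ 4 + 2 * (qm m) ^+ 5) * f9 m) + (a ^+ m) ^+ 2 * ((1) * f0 m + (1 - (qm m) - (qm m) ^+ 2) * f2 m + ((qm m) - (qm m) ^+ 2) * f3 m + (2 * (qm m) - 4 * (qm m) ^+ 2 + (qm m) ^+ 3 - 2 * (qm m) ^+ 4) * f5 m + (4 * (qm m) ^+ 2 - 4 * (qm m) ^+ 3 + 2 * (qm m) ^+ 4 - 2 * (qm m) ^+ 5) * f6 m + (- 2 + 3 * (qm m) ^+ 2 + 2 * (qm m) ^+ 4) * f7 m + (3 * (qm m) - 11 * (qm m) ^+ 2 + (qm m) ^+ 3 - 7 * (qm m) ^+ 4 + 2 * (qm m) ^+ 5) * f8 m + (- 3 * (qm m) + 24 * (qm m) ^+ 2 - 22 * (qm m) ^+ 3 + 17 * (qm m) ^+ 4 - 18 * (qm m) ^+ 5 + 4 * (qm m) ^+ 6 - 2 * (qm m) ^+ 7) * f9 m) - (a ^+ m) ^+ 3 * (((qm m) - (qm m) ^+ 2) * f2 m + ((qm m) + (qm m) ^+ 2 - (qm m) ^+ 3) * f3 m + (- 2 * (qm m) ^+ 2 - (qm m) ^+ 4) * f4 m +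 (4 * (qm m) ^+ 2 - 4 * (qm m) ^+ 3 + 2 * (qm m) ^+ 4 - 2 * (qm m) ^+ 5) * f5 m + (4 * (qm m) ^+ 3 - 2 * (qm m) ^+ 4 + 2 * (qm m) ^+ 5 - (qm m) ^+ 6) * f6 m + (- 2 * (qm m) + (qm m) ^+ 3 + (qm m) ^+ 5) * f7 m + (11 * (qm m) ^+ 2 - 8 * (qm m) ^+ 3 + 5 * (qm m) ^+ 4 - 8 * (qm m) ^+ 5 - (qm m) ^+ 7) * f8 m + (- 11 * (qm m) ^+ 2 + 21 * (qm m) ^+ 3 - 15 * (qm m) ^+ 4 + 16 * (qm m) ^+ 5 - 11 * (qm m) ^+ 6 + 2 * (qm m) ^+ 7 - 2 * (qm m) ^+ 8) * f9 m).
pose f3' m := f3 m - a ^+ m * ((- 2 * (qm m) ^+ 2 - (qm m) ^+ 4) * f6 m + (2 * (qm m) + (qm m) ^+ 3) * f7 m + (- 2 + 4 * (qm m) - 7 * (qm m) ^+ 2 + 5 * (qm m) ^+ 3 - 3 * (qm m) ^+ 4 + 3 * (qm m) ^+ 5) * f8 m + (2 - 6 * (qm m) + 3 * (qm m) ^+ 2 - 10 * (qm m) ^+ 3 + 2 * (qm m) ^+ 4 - 5 * (qm m) ^+ 5 + 2 * (qm m) ^+ 6) * f9 m) + (a ^+ m) ^+ 2 * ((2 - 2 * (qm m)) * f2 m + (2 * (qm m) - 2 * (qm m) ^+ 2) * f3 m + (2 * (qm m) - 4 * (qm m) ^+ 2 + (qm m) ^+ 3 - 2 * (qm m) ^+ 4)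 * f5 m + (4 * (qm m) ^+ 2 - 4 * (qm m) ^+ 3 + 2 * (qm m) ^+ 4 - 2 * (qm m) ^+ 5) * f6 m + (- 2 + 3 * (qm m) ^+ 2 + 2 * (qm m) ^+ 4) * f7 m + (2 - 6 * (qm m) + 3 * (qm m) ^+ 2 - 10 * (qm m) ^+ 3 + 2 * (qm m) ^+ 4 - 5 * (qm m) ^+ 5 + 2 * (qm m) ^+ 6) * f8 m + (- 2 + 8 * (qm m) + (qm m) ^+ 2 + 3 * (qm m) ^+ 3 - 3 * (qm m) ^+ 4 - 2 * (qm m) ^+ 5 - 5 * (qm m) ^+ 6) * f9 m) - (a ^+ m) ^+ 3 * ((1) * f0 m + (2 * (qm m) - 2 * (qm m) ^+ 2) * f2 m + (- 1 + 2 * (qm m) ^+ 2 - (qm m) ^+ 3) * f3 m + (- 2 * (qm m) ^+ 2 - (qm m) ^+ 4) * f4 m + (4 * (qm m) ^+ 2 - 4 * (qm m) ^+ 3 + 2 * (qm m) ^+ 4 - 2 * (qm m) ^+ 5) * f5 m + (4 * (qm m) ^+ 3 - 2 * (qm m) ^+ 4 + 2 * (qm m) ^+ 5 - (qm m) ^+ 6) * f6 m + (- 2 * (qm m) + (qm m) ^+ 3 + (qm m) ^+ 5) * f7 m + (2 * (qm m) + 4 * (qm m) ^+ 2 - (qm m) ^+ 3 + (qm m) ^+ 4 - 3 * (qm m) ^+ 5 - 2 * (qm m) ^+ 6 - (qm m) ^+ 7) * f8 m + (- 2 * (qm m) - 2 * (qm m) ^+ 2 + 7 * (qm m) ^+ 3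 - 4 * (qm m) ^+ 4 + 7 * (qm m) ^+ 5 - 4 * (qm m) ^+ 6 - 2 * (qm m) ^+ 8) * f9 m).
pose f4' m := f4 m - a ^+ m * ((1) * f1 m + (- 1 + 3 * (qm m) + 2 * (qm m) ^+ 3 + (qm m) ^+ 4 + (qm m) ^+ 5 + (qm m) ^+ 6) * f6 m + (- 2 - (qm m) ^+ 2 - (qm m) ^+ 3 - (qm m) ^+ 5) * f7 m + (- 3 + 8 * (qm m) + 2 * (qm m) ^+ 2 - 3 * (qm m) ^+ 3 - (qm m) ^+ 5 + (qm m) ^+ 6 - (qm m) ^+ 7) * f8 m + (- 1 + 5 * (qm m) + 15 * (qm m) ^+ 3 + 6 * (qm m) ^+ 5 + 4 * (qm m) ^+ 6 + 2 * (qm m) ^+ 7 + 2 * (qm m) ^+ 8 + (qm m) ^+ 10) * f9 m) + (a ^+ m) ^+ 2 * ((1 + (qm m) ^+ 3) * f2 m + ((qm m) - (qm m) ^+ 2 + (qm m) ^+ 4) * f3 m + (- 1 + 5 * (qm m) - 3 * (qm m) ^+ 2 + 3 * (qm m) ^+ 3 + 2 * (qm m) ^+ 4 + (qm m) ^+ 5 + 2 * (qm m) ^+ 6 + (qm m) ^+ 8) * f5 m + (1 - 4 * (qm m) + 5 * (qm m) ^+ 2 - 4 * (qm m) ^+ 3 + 2 * (qm m) ^+ 4 + (qm m) ^+ 5 + 2 * (qm m) ^+ 7 + (qm m) ^+ 9) * f6 m + (- 1 - 2 * (qm m) + (qm m) ^+ 2 - 3 * (qm m) ^+ 3 - 2 *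 (qm m) ^+ 4 - (qm m) ^+ 5 - 2 * (qm m) ^+ 6 - (qm m) ^+ 8) * f7 m + (- 1 + 5 * (qm m) + 15 * (qm m) ^+ 3 + 6 * (qm m) ^+ 5 + 4 * (qm m) ^+ 6 + 2 * (qm m) ^+ 7 + 2 * (qm m) ^+ 8 + (qm m) ^+ 10) * f8 m + (5 - 22 * (qm m) + 19 * (qm m) ^+ 2 - 29 * (qm m) ^+ 3 + 24 * (qm m) ^+ 4 - 8 * (qm m) ^+ 5 + 4 * (qm m) ^+ 6 + 10 * (qm m) ^+ 7 + 9 * (qm m) ^+ 9 - (qm m) ^+ 10 + 4 * (qm m) ^+ 11 + (qm m) ^+ 13) * f9 m) - (a ^+ m) ^+ 3 * (((qm m) - (qm m) ^+ 2 + (qm m) ^+ 4) * f2 m + ((qm m) ^+ 2 - (qm m) ^+ 3 + (qm m) ^+ 5) * f3 m + (- 1 + 3 * (qm m) + 2 * (qm m) ^+ 3 + (qm m) ^+ 4 + (qm m) ^+ 5 + (qm m) ^+ 6) * f4 m + (1 - 4 * (qm m) + 5 * (qm m) ^+ 2 - 4 * (qm m) ^+ 3 + 2 * (qm m) ^+ 4 + (qm m) ^+ 5 + 2 * (qm m) ^+ 7 + (qm m) ^+ 9) * f5 m + ((qm m) - 4 * (qm m) ^+ 2 + 2 * (qm m) ^+ 3 - 4 * (qm m) ^+ 4 - (qm m) ^+ 7 + (qm m) ^+ 8 + (qm m) ^+ 10) * f6 m + (- (qm m) + (qm m) ^+ 3 - 2 * (qm m) ^+ 4 - (qm m) ^+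 5 - (qm m) ^+ 6 - (qm m) ^+ 7 - (qm m) ^+ 9) * f7 m + (4 - 13 * (qm m) + 5 * (qm m) ^+ 2 - 12 * (qm m) ^+ 3 + 9 * (qm m) ^+ 4 - (qm m) ^+ 5 + 2 * (qm m) ^+ 6 + 5 * (qm m) ^+ 7 + (qm m) ^+ 8 + 3 * (qm m) ^+ 9 + (qm m) ^+ 11) * f8 m + (- 4 + 17 * (qm m) - 18 * (qm m) ^+ 2 + 18 * (qm m) ^+ 3 - 25 * (qm m) ^+ 4 + 13 * (qm m) ^+ 5 - 4 * (qm m) ^+ 6 - 2 * (qm m) ^+ 7 + 6 * (qm m) ^+ 8 - 2 * (qm m) ^+ 9 + 7 * (qm m) ^+ 10 - (qm m) ^+ 11 + 3 * (qm m) ^+ 12 + (qm m) ^+ 14) * f9 m).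
pose f5' m := f5 m - a ^+ m * ((1) * f2 m + (3 * (qm m) + 2 * (qm m) ^+ 3 + (qm m) ^+ 4 + (qm m) ^+ 5 + (qm m) ^+ 6) * f6 m + (- 2 - (qm m) ^+ 2 - (qm m) ^+ 3 - (qm m) ^+ 5) * f7 m + (4 - 4 * (qm m) + 2 * (qm m) ^+ 2 + (qm m) ^+ 3 - (qm m) ^+ 5 + (qm m) ^+ 6 - (qm m) ^+ 7) * f8 m + (- 4 + 17 * (qm m) - 8 * (qm m) ^+ 2 + 11 * (qm m) ^+ 3 + 4 * (qm m) ^+ 4 + 6 * (qm m) ^+ 5 + 4 * (qm m) ^+ 6 + 2 * (qm m) ^+ 7 + 2 * (qm m) ^+ 8 + (qm m) ^+ 10) * f9 m) + (a ^+ m) ^+ 2 * ((1) * f1 m + ((qm m) ^+ 3) * f2 m + ((qm m) - (qm m) ^+ 2 + (qm m) ^+ 4) * f3 m + (- 1 + 5 * (qm m) - 3 * (qm m) ^+ 2 + 3 * (qm m) ^+ 3 + 2 * (qm m) ^+ 4 + (qm m) ^+ 5 + 2 * (qm m) ^+ 6 + (qm m) ^+ 8) * f5 m + (- 4 * (qm m) + 5 * (qm m) ^+ 2 - 4 * (qm m) ^+ 3 + 2 * (qm m) ^+ 4 + (qm m) ^+ 5 + 2 * (qm m) ^+ 7 + (qm m) ^+ 9) * f6 m + (- 1 - 2 * (qm m) + (qm m) ^+ 2 - 3 * (qm m) ^+ 3 - 2 * (qm m) ^+ 4 - (qm m) ^+ 5 - 2 * (qm m) ^+ 6 - (qm m)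 ^+ 8) * f7 m + (- 4 + 17 * (qm m) - 8 * (qm m) ^+ 2 + 11 * (qm m) ^+ 3 + 4 * (qm m) ^+ 4 + 6 * (qm m) ^+ 5 + 4 * (qm m) ^+ 6 + 2 * (qm m) ^+ 7 + 2 * (qm m) ^+ 8 + (qm m) ^+ 10) * f8 m + (4 - 30 * (qm m) + 35 * (qm m) ^+ 2 - 33 * (qm m) ^+ 3 + 16 * (qm m) ^+ 4 - 4 * (qm m) ^+ 5 + 4 * (qm m) ^+ 6 + 10 * (qm m) ^+ 7 + 9 * (qm m) ^+ 9 - (qm m) ^+ 10 + 4 * (qm m) ^+ 11 + (qm m) ^+ 13) * f9 m) - (a ^+ m) ^+ 3 * (((qm m) - (qm m) ^+ 2 + (qm m) ^+ 4) * f2 m + ((qm m) ^+ 2 - (qm m) ^+ 3 + (qm m) ^+ 5) * f3 m + (3 * (qm m) + 2 * (qm m) ^+ 3 + (qm m) ^+ 4 + (qm m) ^+ 5 + (qm m) ^+ 6) * f4 m + (- 4 * (qm m) + 5 * (qm m) ^+ 2 - 4 * (qm m) ^+ 3 + 2 * (qm m) ^+ 4 + (qm m) ^+ 5 + 2 * (qm m) ^+ 7 + (qm m) ^+ 9) * f5 m + ((qm m) - 4 * (qm m) ^+ 2 + 2 * (qm m) ^+ 3 - 4 * (qm m) ^+ 4 - (qm m) ^+ 7 + (qm m) ^+ 8 + (qm m) ^+ 10) * f6 m + (- (qm m) + (qm m) ^+ 3 - 2 * (qm m) ^+ 4 - (qm m) ^+ 5 - (qm m) ^+ 6 - (qm m)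 ^+ 7 - (qm m) ^+ 9) * f7 m + (- 13 * (qm m) + 13 * (qm m) ^+ 2 - 12 * (qm m) ^+ 3 + 5 * (qm m) ^+ 4 - (qm m) ^+ 5 + 2 * (qm m) ^+ 6 + 5 * (qm m) ^+ 7 + (qm m) ^+ 8 + 3 * (qm m) ^+ 9 + (qm m) ^+ 11) * f8 m + (13 * (qm m) - 26 * (qm m) ^+ 2 + 26 * (qm m) ^+ 3 - 21 * (qm m) ^+ 4 + 9 * (qm m) ^+ 5 - 4 * (qm m) ^+ 6 - 2 * (qm m) ^+ 7 + 6 * (qm m) ^+ 8 - 2 * (qm m) ^+ 9 + 7 * (qm m) ^+ 10 - (qm m) ^+ 11 + 3 * (qm m) ^+ 12 + (qm m) ^+ 14) * f9 m).
pose f6' m := f6 m - a ^+ m * ((1) * f3 m + (3 * (qm m) + 2 * (qm m) ^+ 3 + (qm m) ^+ 4 + (qm m) ^+ 5 + (qm m) ^+ 6) * f6 m + (- 2 - (qm m) ^+ 2 - (qm m) ^+ 3 - (qm m) ^+ 5) * f7 m + (4 * (qm m) - 7 * (qm m) ^+ 2 + 3 * (qm m) ^+ 3 - (qm m) ^+ 4 - (qm m) ^+ 5 + (qm m) ^+ 6 - (qm m) ^+ 7) * f8 m + (3 + 5 * (qm m) + 9 * (qm m) ^+ 2 + 7 * (qm m) ^+ 4 + 5 * (qm m) ^+ 5 + 4 * (qm m) ^+ 6 + 2 * (qm m) ^+ 7 + 2 * (qm m) ^+ 8 + (qm m) ^+ 10) * f9 m) + (a ^+ m) ^+ 2 * ((2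 - (qm m) + (qm m) ^+ 3) * f2 m + (- 1 + 2 * (qm m) - (qm m) ^+ 2 + (qm m) ^+ 4) * f3 m + (4 * (qm m) - 2 * (qm m) ^+ 2 + 3 * (qm m) ^+ 3 + 2 * (qm m) ^+ 4 + (qm m) ^+ 5 + 2 * (qm m) ^+ 6 + (qm m) ^+ 8) * f5 m + (- 3 * (qm m) + 4 * (qm m) ^+ 2 - 4 * (qm m) ^+ 3 + 2 * (qm m) ^+ 4 + (qm m) ^+ 5 + 2 * (qm m) ^+ 7 + (qm m) ^+ 9) * f6 m + (- 1 - 2 * (qm m) + (qm m) ^+ 2 - 3 * (qm m) ^+ 3 - 2 * (qm m) ^+ 4 - (qm m) ^+ 5 - 2 * (qm m) ^+ 6 - (qm m) ^+ 8) * f7 m + (3 + 5 * (qm m) + 9 * (qm m) ^+ 2 + 7 * (qm m) ^+ 4 + 5 * (qm m) ^+ 5 + 4 * (qm m) ^+ 6 + 2 * (qm m) ^+ 7 + 2 * (qm m) ^+ 8 + (qm m) ^+ 10) * f8 m + (- 6 - 11 * (qm m) + 6 * (qm m) ^+ 2 - 5 * (qm m) ^+ 3 + 2 * (qm m) ^+ 4 + 3 * (qm m) ^+ 6 + 10 * (qm m) ^+ 7 + 9 * (qm m) ^+ 9 - (qm m) ^+ 10 + 4 * (qm m) ^+ 11 + (qm m) ^+ 13) * f9 m) - (a ^+ m) ^+ 3 * ((1) * f1 m + (- 1 + 2 * (qm m) - (qm m) ^+ 2 + (qm m) ^+ 4) * f2 m + (- (qm m) + (qm m) ^+ 2 - (qm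 m) ^+ 3 + (qm m) ^+ 5) * f3 m + (3 * (qm m) + 2 * (qm m) ^+ 3 + (qm m) ^+ 4 + (qm m) ^+ 5 + (qm m) ^+ 6) * f4 m + (- 3 * (qm m) + 4 * (qm m) ^+ 2 - 4 * (qm m) ^+ 3 + 2 * (qm m) ^+ 4 + (qm m) ^+ 5 + 2 * (qm m) ^+ 7 + (qm m) ^+ 9) * f5 m + (- 1 - 3 * (qm m) ^+ 2 + 2 * (qm m) ^+ 3 - 4 * (qm m) ^+ 4 - (qm m) ^+ 7 + (qm m) ^+ 8 + (qm m) ^+ 10) * f6 m + (- (qm m) + (qm m) ^+ 3 - 2 * (qm m) ^+ 4 - (qm m) ^+ 5 - (qm m) ^+ 6 - (qm m) ^+ 7 - (qm m) ^+ 9) * f7 m + (- 3 - 9 * (qm m) + 5 * (qm m) ^+ 2 - 3 * (qm m) ^+ 3 + 3 * (qm m) ^+ 4 + 2 * (qm m) ^+ 6 + 5 * (qm m) ^+ 7 + (qm m) ^+ 8 + 3 * (qm m) ^+ 9 + (qm m) ^+ 11) * f8 m + (3 + 6 * (qm m) - 14 * (qm m) ^+ 2 + 9 * (qm m) ^+ 3 - 10 * (qm m) ^+ 4 + 6 * (qm m) ^+ 5 - 3 * (qm m) ^+ 6 - 2 * (qm m) ^+ 7 + 6 * (qm m) ^+ 8 - 2 * (qm m) ^+ 9 + 7 * (qm m) ^+ 10 - (qm m) ^+ 11 + 3 * (qm m) ^+ 12 + (qm m) ^+ 14) * f9 m).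
pose f7' m := f7 m - a ^+ m * (((qm m) ^+ 4 + (qm m) ^+ 5 + (qm m) ^+ 6 + (qm m) ^+ 7) * f6 m + ((qm m) - (qm m) ^+ 4 - (qm m) ^+ 6) * f7 m + (- 1 + (qm m) + (qm m) ^+ 3 + (qm m) ^+ 4 + (qm m) ^+ 5 - (qm m) ^+ 6 + (qm m) ^+ 7 - (qm m) ^+ 8) * f8 m + (1 - 2 * (qm m) + (qm m) ^+ 2 - (qm m) ^+ 3 + 4 * (qm m) ^+ 4 + 4 * (qm m) ^+ 5 + 6 * (qm m) ^+ 6 + 4 * (qm m) ^+ 7 + 2 * (qm m) ^+ 8 + 2 * (qm m) ^+ 9 + (qm m) ^+ 11) * f9 m) + (a ^+ m) ^+ 2 * ((1 - (qm m) ^+ 2 + (qm m) ^+ 4) * f2 m + ((qm m) - (qm m) ^+ 3 + (qm m) ^+ 5) * f3 m + ((qm m) - (qm m) ^+ 3 + (qm m) ^+ 4 + 2 * (qm m) ^+ 5 + (qm m) ^+ 6 + 2 * (qm m) ^+ 7 + (qm m) ^+ 9) * f5 m + ((qm m) ^+ 2 - 2 * (qm m) ^+ 4 + (qm m) ^+ 6 + 2 * (qm m) ^+ 8 + (qm m) ^+ 10) * f6 m + (- 1 - (qm m) + (qm m) ^+ 2 + (qm m) ^+ 3 - (qm m) ^+ 4 - 2 * (qm m) ^+ 5 - (qm m) ^+ 6 - 2 * (qm m) ^+ 7 - (qm m) ^+ 9) * f7 m + (1 - 2 * (qm m) + (qm m) ^+ 2 - (qm m) ^+ 3 + 4 * (qm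 m) ^+ 4 + 4 * (qm m) ^+ 5 + 6 * (qm m) ^+ 6 + 4 * (qm m) ^+ 7 + 2 * (qm m) ^+ 8 + 2 * (qm m) ^+ 9 + (qm m) ^+ 11) * f8 m + (- 1 + 3 * (qm m) - 2 * (qm m) ^+ 2 + 2 * (qm m) ^+ 3 - 10 * (qm m) ^+ 4 - 2 * (qm m) ^+ 6 + 2 * (qm m) ^+ 7 + 10 * (qm m) ^+ 8 + 9 * (qm m) ^+ 10 - (qm m) ^+ 11 + 4 * (qm m) ^+ 12 + (qm m) ^+ 14) * f9 m) - (a ^+ m) ^+ 3 * (((qm m) - (qm m) ^+ 3 + (qm m) ^+ 5) * f2 m + ((qm m) ^+ 2 - (qm m) ^+ 4 + (qm m) ^+ 6) * f3 m + ((qm m) ^+ 4 + (qm m) ^+ 5 + (qm m) ^+ 6 + (qm m) ^+ 7) * f4 m + ((qm m) ^+ 2 - 2 * (qm m) ^+ 4 + (qm m) ^+ 6 + 2 * (qm m) ^+ 8 + (qm m) ^+ 10) * f5 m + ((qm m) ^+ 3 - 2 * (qm m) ^+ 5 - (qm m) ^+ 6 - (qm m) ^+ 8 + (qm m) ^+ 9 + (qm m) ^+ 11) * f6 m + (- (qm m) - (qm m) ^+ 2 + (qm m) ^+ 3 + (qm m) ^+ 4 - (qm m) ^+ 5 - (qm m) ^+ 6 - (qm m) ^+ 7 - (qm m) ^+ 8 - (qm m) ^+ 10) * f7 m + ((qm m) - (qm m) ^+ 2 - 5 * (qm m) ^+ 4 - (qm m) ^+ 5 - (qm m) ^+ 6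 + (qm m) ^+ 7 + 5 * (qm m) ^+ 8 + (qm m) ^+ 9 + 3 * (qm m) ^+ 10 + (qm m) ^+ 12) * f8 m + (- (qm m) + 2 * (qm m) ^+ 2 + 5 * (qm m) ^+ 4 - 5 * (qm m) ^+ 5 - 2 * (qm m) ^+ 7 - 4 * (qm m) ^+ 8 + 6 * (qm m) ^+ 9 - 2 * (qm m) ^+ 10 + 7 * (qm m) ^+ 11 - (qm m) ^+ 12 + 3 * (qm m) ^+ 13 + (qm m) ^+ 15) * f9 m).
pose f8' m := f8 m - a ^+ m * ((1) * f4 m + (- 1) * f6 m + (- 3 + 2 * (qm m) + 2 * (qm m) ^+ 2 - (qm m) ^+ 3) * f8 m + (- 2 - (qm m) ^+ 2 + 3 * (qm m) ^+ 3 - (qm m) ^+ 4) * f9 m) + (a ^+ m) ^+ 2 * ((- 1 + (qm m)) * f5 m + (1 - (qm m)) * f6 m + (- 2 - (qm m) ^+ 2 + 3 * (qm m) ^+ 3 - (qm m) ^+ 4) * f8 m + (6 - 6 * (qm m) + (qm m) ^+ 2 - 4 * (qm m) ^+ 3 + 4 * (qm m) ^+ 4 - (qm m) ^+ 5) * f9 m) - (a ^+ m) ^+ 3 * ((- 1) * f4 m + (1 - (qm m)) * f5 m + ((qm m)) * f6 m + (4 - 2 * (qm m) - (qm m) ^+ 2 - 2 * (qm m) ^+ 3 + (qm m) ^+ 4) * f8 m + (- 4 + 6 * (qm m) + (qm m) ^+ 3 - 3 * (qm m) ^+ 4 + (qm m) ^+ 5) * f9 m).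
pose f9' m := f9 m - a ^+ m * ((1) * f5 m + (- 1) * f6 m + (2 - (qm m) + 2 * (qm m) ^+ 2) * f8 m + (- 6 + 3 * (qm m) - 3 * (qm m) ^+ 2 + 2 * (qm m) ^+ 3) * f9 m) + (a ^+ m) ^+ 2 * ((1) * f4 m + (- 2 + (qm m)) * f5 m + (1 - (qm m)) * f6 m + (- 6 + 3 * (qm m) - 3 * (qm m) ^+ 2 + 2 * (qm m) ^+ 3) * f8 m + (9 - 8 * (qm m) + 5 * (qm m) ^+ 2 - 5 * (qm m) ^+ 3 + 2 * (qm m) ^+ 4) * f9 m) - (a ^+ m) ^+ 3 * ((- 1) * f4 m + (1 - (qm m)) * f5 m + ((qm m)) * f6 m + (4 - 2 * (qm m) + (qm m) ^+ 2 - 2 * (qm m) ^+ 3) * f8 m + (- 4 + 5 * (qm m) - 2 * (qm m) ^+ 2 + 3 * (qm m) ^+ 3 - 2 * (qm m) ^+ 4) * f9 m).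
exists f0', f1', f2', f3', f4', f5', f6', f7', f8', f9'.
split; [split; rewrite /f0' /f1' /f2' /f3' /f4'; lef_tac|split; rewrite /f5' /f6' /f7' /f8' /f9'; lef_tac|].
move=> m; have [[eA eB eC eD eE] [eF eG eH eI eK]] := hf m.
rewrite !big_cons; split; split; rewrite (eA, eB, eC, eD, eE, eF, eG, eH, eI, eK);
  rewrite /gA /gB /gC /gD /gE /gF /gG /gH /gI /gK /latA /latB /latC /latD /latE /latF /latG /latH /latI /latK
    /f0' /f1' /f2' /f3' /f4' /f5' /f6' /f7' /f8' /f9';
  move: (q ^ m)%:R (a ^+ m) (f0 m) (f1 m) (f2 m) (f3 m) (f4 m) (f5 m) (f6 m) (f7 m) (f8 m) (f9 m) => Q x y0 y1 y2 y3 y4 y5 y6 y7 y8 y9; ring.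
Qed.

Hypothesis q_gt1 : (1 < q)%N.
(** Here [eps] is the number of self-inverse eigenvalues. [N1] counts the inverse pairs of the other
    unitary eigenvalues, and [N2] and [N3] the Frobenius orbits of length 4 and 6 of eigenvalues
    inverted by the square or the cube of Frobenius. *)
Lemma sum_types_lefschetz (J : seq C) (eps : nat) (N1 N2 N3 : nat -> nat) :
  (eps == 1%N) || (eps == 2%N) ->
  (forall m, (0 < m)%N -> 2 * (N1 m)%:R + eps%:R = qm m + 1) ->
  (forall m, (0 < m)%N -> 4 * (N2 m)%:R + eps%:R = qm m ^+ 2 + 1) ->
  (forall m, (0 < m)%N -> 6 * (N3 m)%:R = qm m ^+ 3 - qm m) ->
  let L (g : C -> C -> C) m := g (qm m) 1 / g (qm m) (qm m) * \prod_(a <- J) g (qm m) (a ^+ m) in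
  let e : C := eps%:R in let n m : C := (N1 m)%:R in
  lefschetz_type (fun m =>
    e * L (@gA C) m + n m * L (@gG C) m + e * (e - 1) * L (@gB C) m + e * n m * L (@gC C) m +
    (n m * e + e * (e - 1) / 2 * n m) * L (@gD C) m +
    (n m * (n m - 1) + e * (n m * (n m - 1) / 2)) * L (@gE C) m +
    n m * (n m - 1) * (n m - 2) / 6 * L (@gH C) m +
    (N2 m)%:R * e * L (@gF C) m + (N2 m)%:R * n m * L (@gI C) m + (N3 m)%:R * L (@gK C) m).
Proof.
move=> he h1 h2 h3 L e n.
have [f0 [f1 [f2 [f3 [f4 [f5 [f6 [f7 [f8 [f9 [[l0 l1 l2 l3 l4] [l5 l6 l7 l8 l9] hf]]]]]]]]]]] := lattice_product J.

case/orP: he => /eqP he.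
(* The case of one self-inverse eigenvalue. The polynomial multiplying each [f] is the sum over the
   ten types of the class number, times [g Q 1 / g Q Q], times the value of the corresponding
   lattice vector; the denominators cancel only in this sum. *)
apply: (lef_ext (g := fun m => f0 m * (1) + f1 m * ((qm m) ^+ 2) + f2 m * ((qm m) - 2 * (qm m) ^+ 2 + 2 * (qm m) ^+ 3 - (qm m) ^+ 4 + (qm m) ^+ 5) + f3 m * (- (qm m) + 2 * (qm m) ^+ 2 - 2 * (qm m) ^+ 3 + (qm m) ^+ 4 - (qm m) ^+ 5 + (qm m) ^+ 6) + f4 m * (3 * (qm m) - 5 * (qm m) ^+ 2 + 6 * (qm m) ^+ 3 - 3 * (qm m) ^+ 4 + 3 * (qm m) ^+ 5 - (qm m) ^+ 6 + (qm m) ^+ 7) + f5 m * (- 6 * (qm m) + 13 * (qm m) ^+ 2 - 15 * (qm m) ^+ 3 + 13 * (qm m) ^+ 4 - 10 * (qm m) ^+ 5 + 8 * (qm m) ^+ 6 - 4 * (qm m) ^+ 7 + 3 * (qm m) ^+ 8 - (qm m) ^+ 9 + (qm m) ^+ 10) + f6 m * (4 * (qm m) - 9 * (qm m) ^+ 2 + 11 * (qm m) ^+ 3 - 10 * (qm m) ^+ 4 + 8 * (qm m) ^+ 5 - 7 * (qm m) ^+ 6 + 5 * (qm m) ^+ 7 - 3 * (qm m) ^+ 8 + 2 * (qm m) ^+ 9 - (qm m) ^+ 10 + (qm m) ^+ 11) + f7 m * (- 2 + (qm m) - 3 * (qm m) ^+ 2 + (qm m) ^+ 3 - 2 * (qm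 m) ^+ 4 + (qm m) ^+ 5 - 3 * (qm m) ^+ 6 + (qm m) ^+ 7 - 2 * (qm m) ^+ 8 + (qm m) ^+ 9 - (qm m) ^+ 10) + f8 m * (- 15 * (qm m) + 34 * (qm m) ^+ 2 - 41 * (qm m) ^+ 3 + 39 * (qm m) ^+ 4 - 31 * (qm m) ^+ 5 + 25 * (qm m) ^+ 6 - 15 * (qm m) ^+ 7 + 12 * (qm m) ^+ 8 - 5 * (qm m) ^+ 9 + 4 * (qm m) ^+ 10 - (qm m) ^+ 11 + (qm m) ^+ 12) + f9 m * (24 * (qm m) - 61 * (qm m) ^+ 2 + 83 * (qm m) ^+ 3 - 85 * (qm m) ^+ 4 + 77 * (qm m) ^+ 5 - 65 * (qm m) ^+ 6 + 51 * (qm m) ^+ 7 - 36 * (qm m) ^+ 8 + 27 * (qm m) ^+ 9 - 16 * (qm m) ^+ 10 + 12 * (qm m) ^+ 11 - 5 * (qm m) ^+ 12 + 4 * (qm m) ^+ 13 - (qm m) ^+ 14 + (qm m) ^+ 15))); last by lef_tac.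
  move=> m m0; have [[eA eB eC eD eE] [eF eG eH eI eK]] := hf m.
  rewrite /L eA eB eC eD eE eF eG eH eI eK.
  have {h1} e1 : n m = (qm m + 1 - e) / 2 by apply: (mulfI (x := 2)); rewrite ?pnatr_eq0 // mulrC [RHS]mulrC divfK ?pnatr_eq0 // -(h1 m m0) /n /e; ring.
  have {h2} e2 : (N2 m)%:R = (qm m ^+ 2 + 1 - e) / 4 :> C by apply: (mulfI (x := 4)); rewrite ?pnatr_eq0 // [RHS]mulrC divfK ?pnatr_eq0 // -(h2 m m0) /e; ring.
  have {h3} e3 : (N3 m)%:R = (qm m ^+ 3 - qm m) / 6 :> C by apply: (mulfI (x := 6)); rewrite ?pnatr_eq0 // [RHS]mulrC divfK ?pnatr_eq0 // h3.
  rewrite e2 e3 e1 /e he.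
  rewrite /latA /latB /latC /latD /latE /latF /latG /latH /latI /latK /gA /gB /gC /gD /gE /gF /gG /gH /gI /gK.
  (* Writing [Q = u + 2] turns each factor of the denominators into a sum of natural numbers ending
     in 1, hence nonzero. *)
  have [u Qu] : exists u : nat, qm m = u%:R + 2 by exists (q ^ m - 2)%N; rewrite -[2]/(2%:R) -natrD subnK // -(exp1n m) ltn_exp2r.
  move: (qm m) Qu (f0 m) (f1 m) (f2 m) (f3 m) (f4 m) (f5 m) (f6 m) (f7 m) (f8 m) (f9 m) => Q Qu y0 y1 y2 y3 y4 y5 y6 y7 y8 y9.
  have nz (c : nat) (z : C) : z = (c + 1)%:R -> z != 0 by move=> ->; rewrite pnatr_eq0 addn1.
  have nQ : Q + 1 != 0 by apply: (nz (u + 2)%N); rewrite Qu !natrD; ring.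
  have nQ1 : Q - 1 != 0 by apply: (nz u); rewrite Qu natrD; ring.
  have nQ2 : Q ^+ 2 + 1 != 0 by apply: (nz (u * u + 4 * u + 4)%N); rewrite Qu !natrD !natrM; ring.
  have nQ3 : Q ^+ 2 - Q + 1 != 0 by apply: (nz (u * u + 3 * u + 2)%N); rewrite Qu !natrD !natrM; ring.
  have nQ4 : Q ^+ 2 + Q + 1 != 0 by apply: (nz (u * u + 5 * u + 6)%N); rewrite Qu !natrD !natrM; ring.
  have d2 : 1 - Q * Q = - ((Q - 1) * (Q + 1)) by ring.
  have d4 : 1 - Q ^+ 3 * Q = - ((Q - 1) * (Q + 1) * (Q ^+ 2 + 1)) by ring.
  have d6 : 1 - Q ^+ 5 * Q = - ((Q - 1) * (Q + 1) * (Q ^+ 2 + Q + 1) * (Q ^+ 2 - Q + 1)) by ring.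
  have d3 : 1 + Q ^+ 2 * Q = (Q + 1) * (Q ^+ 2 - Q + 1) by ring.
  have d3' : 1 + Q ^+ 3 = (Q + 1) * (Q ^+ 2 - Q + 1) by ring.
  have n1 : 1 - Q * 1 = - (Q - 1) by ring.
  have n3 : 1 - Q ^+ 3 * 1 = - ((Q - 1) * (Q ^+ 2 + Q + 1)) by ring.
  rewrite d2 d4 d6 d3 d3' n1 n3 (addrC 1 Q) (addrC 1 (Q ^+ 2)).
  by field; apply/and5P.
(* The same sums when there are two self-inverse eigenvalues; the class numbers change, and with
   them the polynomials. *)
apply: (lef_ext (g := fun m => f0 m * (1) + f1 m * (1 + 2 * (qm m) ^+ 2) + f2 m * (- 2 + 5 * (qm m) - 4 * (qm m) ^+ 2 + 4 * (qm m) ^+ 3 - 2 * (qm m) ^+ 4 + 2 * (qm m) ^+ 5) + f3 m * (2 - 5 * (qm m) + 6 * (qm m) ^+ 2 - 4 * (qm m) ^+ 3 + 2 * (qm m) ^+ 4 - 2 * (qm m) ^+ 5 + 2 * (qm m) ^+ 6) + f4 m * (- 4 + 12 * (qm m) - 11 * (qm m) ^+ 2 + 12 * (qm m) ^+ 3 - 6 * (qm m) ^+ 4 + 6 * (qm m) ^+ 5 - 2 * (qm m) ^+ 6 + 2 * (qm m) ^+ 7) + f5 m * (10 - 29 * (qm m) + 39 * (qm m) ^+ 2 - 33 * (qm m) ^+ 3 + 28 * (qm m) ^+ 4 - 20 * (qm m) ^+ 5 + 16 * (qm m) ^+ 6 - 8 * (qm m) ^+ 7 + 6 * (qm m) ^+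 8 - 2 * (qm m) ^+ 9 + 2 * (qm m) ^+ 10) + f6 m * (- 7 + 21 * (qm m) - 30 * (qm m) ^+ 2 + 29 * (qm m) ^+ 3 - 22 * (qm m) ^+ 4 + 18 * (qm m) ^+ 5 - 14 * (qm m) ^+ 6 + 10 * (qm m) ^+ 7 - 6 * (qm m) ^+ 8 + 4 * (qm m) ^+ 9 - 2 * (qm m) ^+ 10 + 2 * (qm m) ^+ 11) + f7 m * (- 6 + 2 * (qm m) - 10 * (qm m) ^+ 2 + 2 * (qm m) ^+ 3 - 6 * (qm m) ^+ 4 + 2 * (qm m) ^+ 5 - 6 * (qm m) ^+ 6 + 2 * (qm m) ^+ 7 - 4 * (qm m) ^+ 8 + 2 * (qm m) ^+ 9 - 2 * (qm m) ^+ 10) + f8 m * (25 - 73 * (qm m) + 102 * (qm m) ^+ 2 - 92 * (qm m) ^+ 3 + 85 * (qm m) ^+ 4 - 62 * (qm m) ^+ 5 + 50 * (qm m) ^+ 6 - 30 * (qm m) ^+ 7 + 24 * (qm m) ^+ 8 - 10 * (qm m) ^+ 9 + 8 * (qm m) ^+ 10 - 2 * (qm m) ^+ 11 + 2 * (qm m) ^+ 12) + f9 m * (- 43 + 138 * (qm m) - 210 * (qm m) ^+ 2 + 223 * (qm m) ^+ 3 - 196 * (qm m) ^+ 4 + 171 * (qm m) ^+ 5 - 132 * (qm m) ^+ 6 + 104 * (qm m) ^+ 7 - 72 * (qm m) ^+ 8 + 54 * (qm m) ^+ 9 - 32 * (qm m) ^+ 10 + 24 * (qm m) ^+ 11 -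 10 * (qm m) ^+ 12 + 8 * (qm m) ^+ 13 - 2 * (qm m) ^+ 14 + 2 * (qm m) ^+ 15))); last by lef_tac.
  move=> m m0; have [[eA eB eC eD eE] [eF eG eH eI eK]] := hf m.
  rewrite /L eA eB eC eD eE eF eG eH eI eK.
  have {h1} e1 : n m = (qm m + 1 - e) / 2 by apply: (mulfI (x := 2)); rewrite ?pnatr_eq0 // mulrC [RHS]mulrC divfK ?pnatr_eq0 // -(h1 m m0) /n /e; ring.
  have {h2} e2 : (N2 m)%:R = (qm m ^+ 2 + 1 - e) / 4 :> C by apply: (mulfI (x := 4)); rewrite ?pnatr_eq0 // [RHS]mulrC divfK ?pnatr_eq0 // -(h2 m m0) /e; ring.
  have {h3} e3 : (N3 m)%:R = (qm m ^+ 3 - qm m) / 6 :> C by apply: (mulfI (x := 6)); rewrite ?pnatr_eq0 // [RHS]mulrC divfK ?pnatr_eq0 // h3.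
  rewrite e2 e3 e1 /e he.
  rewrite /latA /latB /latC /latD /latE /latF /latG /latH /latI /latK /gA /gB /gC /gD /gE /gF /gG /gH /gI /gK.
  have [u Qu] : exists u : nat, qm m = u%:R + 2 by exists (q ^ m - 2)%N; rewrite -[2]/(2%:R) -natrD subnK // -(exp1n m) ltn_exp2r.
  move: (qm m) Qu (f0 m) (f1 m) (f2 m) (f3 m) (f4 m) (f5 m) (f6 m) (f7 m) (f8 m) (f9 m) => Q Qu y0 y1 y2 y3 y4 y5 y6 y7 y8 y9.
  have nz (c : nat) (z : C) : z = (c + 1)%:R -> z != 0 by move=> ->; rewrite pnatr_eq0 addn1.
  have nQ : Q + 1 != 0 by apply: (nz (u + 2)%N); rewrite Qu !natrD; ring.
  have nQ1 : Q - 1 != 0 by apply: (nz u); rewrite Qu natrD; ring.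
  have nQ2 : Q ^+ 2 + 1 != 0 by apply: (nz (u * u + 4 * u + 4)%N); rewrite Qu !natrD !natrM; ring.
  have nQ3 : Q ^+ 2 - Q + 1 != 0 by apply: (nz (u * u + 3 * u + 2)%N); rewrite Qu !natrD !natrM; ring.
  have nQ4 : Q ^+ 2 + Q + 1 != 0 by apply: (nz (u * u + 5 * u + 6)%N); rewrite Qu !natrD !natrM; ring.
  have d2 : 1 - Q * Q = - ((Q - 1) * (Q + 1)) by ring.
  have d4 : 1 - Q ^+ 3 * Q = - ((Q - 1) * (Q + 1) * (Q ^+ 2 + 1)) by ring.
  have d6 : 1 - Q ^+ 5 * Q = - ((Q - 1) * (Q + 1) * (Q ^+ 2 + Q + 1) * (Q ^+ 2 - Q + 1)) by ring.
  have d3 : 1 + Q ^+ 2 * Q = (Q + 1) * (Q ^+ 2 - Q + 1) by ring.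
  have d3' : 1 + Q ^+ 3 = (Q + 1) * (Q ^+ 2 - Q + 1) by ring.
  have n1 : 1 - Q * 1 = - (Q - 1) by ring.
  have n3 : 1 - Q ^+ 3 * 1 = - ((Q - 1) * (Q ^+ 2 + Q + 1)) by ring.
  rewrite d2 d4 d6 d3 d3' n1 n3 (addrC 1 Q) (addrC 1 (Q ^+ 2)).
  by field; apply/and5P.
Qed.
End Certificate.

(** * Orbit representatives and combinations *)

Lemma size_filter_notin (T : eqType) (s s' : seq T) : uniq s -> uniq s' -> {subset s' <= s} ->
  (size [seq x <- s | x \notin s'] + size s' = size s)%N.
Proof.
move=> us us' ss; have e : perm_eq s' [seq x <- s | x \in s'].
  apply: uniq_perm; rewrite ?filter_uniq // => y; rewrite mem_filter.
  by case: (boolP (y \in s')) => [ys|] //=; rewrite (ss _ ys).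
by rewrite (perm_size e) addnC -size_cat (perm_size (permEl (perm_filterC (fun x => x \in s') s))).
Qed.

Section OrbitRepresentatives.
Variables (T : eqType) (f : T -> T) (n : nat).
Hypotheses (finj : injective f) (n0 : (0 < n)%N).

Lemma uniq_orbit x : (forall j, (0 < j < n)%N -> iter j f x != x) -> uniq (traject f x n).
Proof.
move=> h; rewrite -[traject f x n]/(traject f x n) (_ : traject f x n = [seq iter i f x | i <- iota 0 n]).
  rewrite map_inj_in_uniq ?iota_uniq // => i j; rewrite !mem_iota /= add0n => hi hj.
  wlog ij : i j hi hj / (i <= j)%N.
    by move=> wl e; case: (leqP i j) => [|/ltnW] le; [|apply/esym]; apply: wl.
  move=> e; apply/eqP; rewrite eqn_leq ij leqNgt; apply/negP => lt.
  have := h (j - i)%N; rewrite subn_gt0 lt (leq_ltn_trans (leq_subr _ _) hj) => /(_ isT)/eqP; apply.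
  have iinj m : injective (iter m f) by elim: m => [|m IHm] u v //= /finj /IHm.
  by apply: (iinj i); rewrite -iterD subnKC.
by apply: (@eq_from_nth _ x); rewrite ?size_traject ?size_map ?size_iota // => i hi;
  rewrite nth_traject // (nth_map 0%N) ?size_iota // nth_iota.
Qed.

(** All orbits of [f] in [s] have exactly [n] elements, so removing them one at a time yields
    representatives together with their number. *)
Lemma orbit_representatives (s : seq T) : uniq s -> (forall x, x \in s -> f x \in s) ->
  (forall x, x \in s -> iter n f x = x) ->
  (forall x, x \in s -> forall j, (0 < j < n)%N -> iter j f x != x) ->
  exists R : seq T, [/\ uniq R, {subset R <= s}, (n * size R = size s)%N,
    forall x, x \in s -> exists2 r, r \in R & exists2 j, (j < n)%N & x = iter j f r &
    forall r r' j, r \in R -> r' \in R -> r' = iter j f r -> r' = r].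
Proof.
move: {2}(size s) (leqnn (size s)) => N; elim: N s => [|N IH] s sN us sf sn sne.
  exists [::]; move: sN; rewrite leqn0 => /nilP ->; split=> //; by rewrite muln0.
case: s us sf sn sne sN => [|x s] us sf sn sne sN.
  by exists [::]; split=> //; rewrite muln0.
set S := x :: s in us sf sn sne sN *; have xS : x \in S by rewrite mem_head.
pose O := traject f x n; have uO : uniq O by apply: uniq_orbit; apply: sne.
have itS y j : y \in S -> iter j f y \in S by move=> yS; elim: j => //= j; apply: sf.
have OS : {subset O <= S} by move=> y /trajectP[j _ ->]; apply: itS.
have period j y : y \in S -> iter j f y = iter (j %% n) f y.
  move=> yS; rewrite {1}(divn_eq j n) addnC iterD; congr (iter _ f _).
  by elim: (j %/ n)%N => // i IHi; rewrite mulSn iterD IHi sn.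
have OE y : (y \in O) <-> exists j, y = iter j f x.
  split=> [/trajectP[j _ ->]|[j ->]]; first by exists j.
  by rewrite period //; apply/trajectP; exists (j %% n)%N; rewrite ?ltn_pmod.
pose s' := [seq y <- S | y \notin O].
have s'S y : (y \in s') = (y \notin O) && (y \in S) by rewrite mem_filter.
have sz : (size s' + n = size S)%N by have := size_filter_notin us uO OS; rewrite size_traject.
have back y : y \in S -> f y \in O -> y \in O.
  move=> yS /OE[j e]; apply/OE; exists (n.-1 + j)%N.
  by rewrite iterD -e -iterSr prednK // sn.
have [|||||R [uR Rs Rsz Rrep Rinj]] := IH s'.
- by rewrite -ltnS (leq_trans _ sN) // -sz -addn1 leq_add2l.
- by rewrite filter_uniq.
- by move=> y; rewrite !s'S => /andP[yO yS]; rewrite sf // andbT; apply: contra yO; apply: back.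
- by move=> y; rewrite s'S => /andP[_]; apply: sn.
- by move=> y; rewrite s'S => /andP[_]; apply: sne.
exists (x :: R); split.
- rewrite /= uR andbT; apply/negP => /Rs; rewrite s'S => /andP[/negP[]].
  by apply/OE; exists 0%N.
- by move=> y; rewrite inE => /orP[/eqP -> //|/Rs]; rewrite s'S => /andP[].
- by rewrite /= mulnS Rsz addnC sz.
- move=> y yS; case: (boolP (y \in O)) => [/trajectP[j jn ->]|yO].
    by exists x; rewrite ?mem_head //; exists j.
  have [|r rR [j jn e]] := Rrep y; first by rewrite s'S yO.
  by exists r; [rewrite inE rR orbT|exists j].
- have RO r : r \in R -> r \in S /\ r \notin O by move/Rs; rewrite s'S => /andP[].
  move=> r r' j; rewrite !inE => /orP[/eqP ->|rR] /orP[/eqP ->|r'R] // e.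
  + by have [_ /negP[]] := RO _ r'R; apply/OE; exists j.
  + have [rS /negP[]] := RO _ rR; apply/OE; exists (n - j %% n)%N.
    by rewrite e (period j r rS) -iterD subnK ?sn // ltnW // ltn_pmod.
  + exact: Rinj e.
Qed.

End OrbitRepresentatives.

Section Combinations.
Variable T : eqType.
Implicit Types s t : seq T.

(** Subsequences keep the order of [s], which gives each set of [n] elements a unique normal
    form. *)
Fixpoint combs (n : nat) s : seq (seq T) :=
  match n, s with
  | 0%N, _ => [:: [::]]
  | _, [::] => [::]
  | n'.+1, x :: s' => [seq x :: t | t <- combs n' s'] ++ combs n s'
  end.

Lemma combs0 s : combs 0 s = [:: [::]]. Proof. by case: s. Qed.
Lemma combsS n x s : combs n.+1 (x :: s) = [seq x :: t | t <- combs n s] ++ combs n.+1 s.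
Proof. by []. Qed.

Lemma mem_combs n s t : (t \in combs n s) = subseq t s && (size t == n).
Proof.
elim: s n t => [|x s IH] [|n] t; rewrite ?combs0 ?combsS.
- by rewrite inE subseq0; case: t.
- by rewrite in_nil subseq0; case: t.
- by rewrite inE; case: t => [|y t]; rewrite ?sub0seq ?andbF.
rewrite mem_cat IH; case: t => [|y t]; first by rewrite andbF orbF; apply/mapP => -[].
rewrite [subseq _ (x :: s)]/= eqSS; have [->|yx] := eqVneq y x.
  rewrite mem_map ?IH; last by move=> a b [].
  apply/orP/andP => [[/andP[]//|/andP[h ->]]|[h ->]]; last by left; rewrite h.
  by split=> //; apply: subseq_trans h; apply: subseq_cons.
by rewrite (_ : (_ \in _) = false) //; apply/mapP => -[t' _ [e _]]; rewrite e eqxx in yx.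
Qed.

Lemma uniq_combs n s : uniq s -> uniq (combs n s).
Proof.
elim: s n => [|x s IH] [|n] //=; rewrite -/(combs n.+1 s) => /andP[xs us].
rewrite cat_uniq map_inj_uniq ?IH //; last by move=> a b [].
rewrite andbT; apply/hasPn => t; rewrite mem_combs => /andP[ts _].
by apply/mapP => -[t' _ e]; move/negP: xs; apply; apply: (mem_subseq ts); rewrite e mem_head.
Qed.

End Combinations.

(** * Maximal split tori for each pattern of eigenvalues *)

Section FramePatterns.
Variables (k : closedFieldType) (p : nat) (hp : p \in [pchar k]).
Hypothesis halg : forall x : k, exists2 s, (0 < s)%N & x ^+ (p ^ s) = x.
Local Notation frb a := (map_mx (frobr hp a)).
Variables (d : nat) (d0 : (0 < d)%N).
Local Notation Q := (p ^ d)%N.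
Local Notation M6 := 'M[k]_(3 + 3).
Let Qinj : injective (fun x : k => x ^+ Q). Proof. exact: (@frob_inj k p hp d). Qed.

(** Packages the hypotheses of [motive_det_exists] on the coordinates [w (f i) ^ c i] of the split
    torus. *)
Definition split_data (dl : 'I_3 -> k) (sg : {perm 'I_3}) (eps : 'I_3 -> bool) : Prop :=
  exists (pv : pred 'I_3) (f : 'I_3 -> 'I_3) (c : 'I_3 -> int),
  [/\ forall i, pv i -> f i = i /\ c i = 1, forall i, c i != 0 -> pv (f i),
      forall i, c i = (-1) ^+ eps i * c (sg i) /\ (c i != 0 -> f i = f (sg i)),
      forall e : 'I_3 -> k, torus_points e -> (forall i, e i = if eps i then (e (sg i))^-1 else e (sg i)) ->
        forall i, e i ^+ 2 = (e (f i) ^+ 2) ^ c i &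
      exists2 w : 'I_3 -> k, torus_points w & forall s t, s != t ->
        dgval dl s != dgval dl t \/ dgval (fun i => w (f i) ^ c i) s != dgval (fun i => w (f i) ^ c i) t].

(** What is needed about a triple of eigenvalues. Frames with a prescribed Frobenius make rational
    elements with these eigenvalues conjugate, compatibility of [dl] with that Frobenius makes such
    elements exist, and [E] computes the determinants for every signed permutation [tau], [e]
    compatible with [dl], because the one underlying [motive_det] is not under control. *)
Definition frame_pattern (dl : 'I_3 -> k) (E : nat -> {poly rat}) : Prop :=
  exists (sg : {perm 'I_3}) (eps : 'I_3 -> bool),
  [/\ forall x g0 : M6, frb d x = x -> @Sp k 3 x -> @Sp k 3 g0 -> g0 *m x = dgmx dl *m g0 ->
        exists g, [/\ @Sp k 3 g, g *m x = dgmx dl *m g & frb d g = nmx k sg eps *m g],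
      forall i, dl (sg i) = if eps i then (dl i ^+ Q)^-1 else dl i ^+ Q,
      split_data dl sg eps,
      forall (tau : {perm 'I_3}) e, (forall i, dl i = (if e i then (dl (tau i))^-1 else dl (tau i)) ^+ Q) ->
        forall n, (0 < n)%N -> inv_gdet (Inv dl) (lin_sub (sgmx tau e)) n (E n) &
      forall n, (6 < n)%N -> E n = 1].

Lemma neq_inv (a : k) : a != 0 -> (a != a^-1) = (a ^+ 2 != 1).
Proof.
move=> a0; congr (~~ _); apply/eqP/eqP => [e|a2]; first by rewrite expr2 {2}e mulfV.
by rewrite sqr1V.
Qed.

Lemma neq_inv2 (a b : k) : b != 0 -> (a != b^-1) = (a * b != 1).
Proof.
move=> b0; congr (~~ _); apply/eqP/eqP => [->|e]; first by rewrite mulVf.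
by rewrite -[b^-1]mul1r -e mulfK.
Qed.

(** A point of the torus with no coincidence up to inversion among its coordinates; it separates the
    frame vectors that [dl] leaves together. *)
Lemma generic_triple : exists w : 'I_3 -> k, [/\ torus_points w, forall i, w i != (w i)^-1 &
  forall i j, i != j -> w i != w j /\ w i != (w j)^-1].
Proof.
have nz (u : k) : ('X - u%:P : {poly k}) != 0 by rewrite polyXsubC_eq0.
have X2 : ('X^2 - 1 : {poly k}) != 0 by rewrite -size_poly_eq0 size_XnsubC.
have [x x0 hx] := exists_nonroot X2.
have [|y y0 hy] := @exists_nonroot k (('X^2 - 1) * (('X - x%:P) * ('X - (x^-1)%:P))).
  by rewrite !mulf_neq0.
have [|z z0 hz] := @exists_nonroot k (('X^2 - 1) * (('X - x%:P) * ('X - (x^-1)%:P)) * (('X - y%:P) * ('X - (y^-1)%:P))).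
  by rewrite !mulf_neq0.
have nM (P R : {poly k}) u : (P * R).[u] != 0 -> P.[u] != 0 /\ R.[u] != 0.
  by rewrite hornerM mulf_eq0 negb_or => /andP.
have n2 u : ('X^2 - 1 : {poly k}).[u] != 0 -> u ^+ 2 != 1.
  by apply: contra => /eqP e; rewrite !hornerE e subrr.
have nX u v : ('X - v%:P : {poly k}).[u] != 0 -> u != v by rewrite hornerXsubC subr_eq0.
have x2 := n2 _ hx.
have [/n2 y2 /nM[/nX yx /nX yx']] := nM _ _ _ hy.
have [/nM[/n2 z2 /nM[/nX zx /nX zx']] /nM[/nX zy /nX zy']] := nM _ _ _ hz.
exists (f3 x y z); split; [by elim/I3P|by elim/I3P; rewrite /f3 /= neq_inv|].
have s (a b : k) : a != b -> a != b^-1 -> b != a /\ b != a^-1.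
  by move=> h1 h2; split; [rewrite eq_sym|apply: contra h2 => /eqP ->; rewrite invrK].
have [q1 q2] := s _ _ yx yx'; have [q3 q4] := s _ _ zx zx'; have [q5 q6] := s _ _ zy zy'.
by elim/I3P; elim/I3P.
Qed.

Lemma separated_dgval (dl v : 'I_3 -> k) : (forall i, dl i != (dl i)^-1 \/ v i != (v i)^-1) ->
  (forall i j, i != j -> (dl i != dl j \/ v i != v j) /\ (dl i != (dl j)^-1 \/ v i != (v j)^-1)) ->
  forall s t, s != t -> dgval dl s != dgval dl t \/ dgval v s != dgval v t.
Proof.
move=> h1 h2; elim/ord_addP => i; elim/ord_addP => j; rewrite ?dgvall ?dgvalr => st.
- have ij : i != j by apply: contra st => /eqP ->.
  by have [] := h2 i j ij.
- by have [<-|ij] := eqVneq i j; [|have [] := h2 i j ij].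
- have [<-|ij] := eqVneq i j; first by case: (h1 i) => h; [left|right]; rewrite eq_sym.
  have ji : j != i by rewrite eq_sym.
  by have [_ []] := h2 j i ji => h; [left|right]; rewrite eq_sym.
- have ij : i != j by apply: contra st => /eqP ->.
  by have [[] h _] := h2 i j ij; [left|right]; apply: contra h => /eqP/invr_inj ->.
Qed.

(** A coordinate inverted by Frobenius contributes nothing to the split torus, the others are
    free. *)
Lemma split_id (dl : 'I_3 -> k) (eps : 'I_3 -> bool) : torus_points dl -> (forall i, eps i -> dl i ^+ 2 != 1) ->
  (forall i j, i != j -> eps i -> eps j -> dl i != dl j /\ dl i * dl j != 1) -> split_data dl 1%g eps.
Proof.
move=> dl0 h1 h2; exists (fun i => ~~ eps i), id, (fun i => if eps i then 0 else 1); split.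
- by move=> i /negPf ->.
- by move=> i; case: (eps i).
- by move=> i; rewrite perm1; case: (eps i); split; rewrite ?mulr0 ?mulr1.
- move=> e e0 he i; have := he i; rewrite perm1; case: (eps i) => [ei|_]; last by rewrite expr1z.
  by rewrite expr0z expr2 {1}ei mulVf.
have [w [w0 w1 w2]] := generic_triple; exists w => //; apply: separated_dgval => [i|i j ij].
  by case E: (eps i); [left; rewrite neq_inv ?h1|right; rewrite expr1z].
have n1 l : 1 != w l by apply: contra (w1 l) => /eqP <-; rewrite invr1.
case Ei: (eps i); case Ej: (eps j); rewrite ?expr0z ?expr1z ?invr1.
- by have [g1 g2] := h2 i j ij Ei Ej; split; left; rewrite ?neq_inv2.
- by split; right; [apply: n1|rewrite -(inj_eq invr_inj) invr1 invrK; apply: n1].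
- by split; right; rewrite eq_sym; apply: n1.
- by have [] := w2 i j ij; split; right.
Qed.

(** Frobenius exchanges the first two coordinates and inverts them, so invariance leaves the
    one-parameter torus with coordinates [w] and [w^-1], of exponents 1 and -1. *)
Lemma split_swap a b (be : bool) : a != 0 -> b != 0 -> a ^+ 2 != 1 -> (be -> b ^+ 2 != 1) ->
  split_data (f3 a a b) swap01 (f3 true true be).
Proof.
move=> a0 b0 a2 hb; exists (f3 true false (~~ be)), (f3 o0 o0 o2), (f3 1 (-1) (if be then 0 else 1)); split.
- by elim/I3P => //; case: (be).
- by elim/I3P => //; case: (be).
- by elim/I3P; rewrite permE /f3 /=; case: (be); split.
- move=> e e0 he; elim/I3P; rewrite /f3 /= ?expr1z //.
    have := he o1; rewrite permE /f3 /= => ->.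
    by rewrite exprVn -[_ ^ _]/((e o0 ^+ 2) ^ (- 1)) -invr_expz expr1z.
  have := he o2; rewrite permE /f3 /=; case: (be) => [ei|_]; last by rewrite expr1z.
  by rewrite expr0z expr2 {1}ei mulVf.
have [w [w0 w1 w2]] := generic_triple; exists w => //.
have n1 l : 1 != w l by apply: contra (w1 l) => /eqP <-; rewrite invr1.
have n1' l : 1 != (w l)^-1 by rewrite -(inj_eq invr_inj) invr1 invrK.
have [w02 w02'] := w2 o0 o2 isT; have [w20 w20'] := w2 o2 o0 isT.
apply: separated_dgval.
  elim/I3P; rewrite /f3 /=; [by right; rewrite expr1z|by right; rewrite -invr_expz expr1z invrK eq_sym|].
  by case E: be; [left; rewrite neq_inv ?hb|right; rewrite expr1z].
have aa : a != a^-1 by rewrite neq_inv.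
have ws : w o0 != (w o0)^-1 := w1 o0; have ws' : (w o0)^-1 != w o0 by rewrite eq_sym.
have wi : (w o0)^-1 != w o2 by rewrite eq_sym.
have wi' : (w o0)^-1 != (w o2)^-1 by rewrite (inj_eq invr_inj).
have wj : w o2 != (w o0)^-1 by [].
elim/I3P; elim/I3P => // _; rewrite /f3 /= -?invr_expz ?expr1z; case: (be); rewrite ?expr0z ?expr1z ?invr1 ?invrK; split;
  by [left|right|right; rewrite eq_sym].
Qed.

(** The first two coordinates are anisotropic, and only the third may contribute to the split
    torus. *)
Lemma split_zero (dl : 'I_3 -> k) (sg : {perm 'I_3}) (eps : 'I_3 -> bool) : torus_points dl ->
  (forall e : 'I_3 -> k, torus_points e -> (forall i, e i = if eps i then (e (sg i))^-1 else e (sg i)) ->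
     e o0 ^+ 2 = 1 /\ e o1 ^+ 2 = 1) -> sg o2 = o2 -> sg o0 != o2 -> sg o1 != o2 ->
  (forall i, eps i || (i != o2) -> dl i ^+ 2 != 1) ->
  (forall i j, i != j -> eps o2 || ((i != o2) && (j != o2)) -> dl i != dl j /\ dl i * dl j != 1) ->
  split_data dl sg eps.
Proof.
move=> dl0 h s2 s0 s1 h1 h2; exists (fun i => (i == o2) && ~~ eps o2), id, (fun i => if (i == o2) && ~~ eps o2 then 1 else 0); split.
- by move=> i /[dup] /andP[/eqP -> _] ->.
- by move=> i; case: ifP.
- by elim/I3P; rewrite ?s2 ?(negPf s0) ?(negPf s1) /=; case: (eps o2); split; rewrite ?mulr0 ?mulr1.
- move=> e e0 he; have [e1 e2] := h e e0 he; elim/I3P; rewrite /= ?expr0z //.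
  have := he o2; rewrite s2; case: (eps o2) => [ei|_] /=; last by rewrite expr1z.
  by rewrite expr0z expr2 {1}ei mulVf.
have [w [w0 w1 w2]] := generic_triple; exists w => //.
have n1 l : 1 != w l by apply: contra (w1 l) => /eqP <-; rewrite invr1.
have n1' l : 1 != (w l)^-1 by rewrite -(inj_eq invr_inj) invr1 invrK.
apply: separated_dgval => [i|i j ij].
  have [i2|i2] := eqVneq i o2; last by left; rewrite neq_inv ?h1 ?i2 ?orbT.
  case E: (eps o2); first by left; rewrite neq_inv ?h1 ?i2 ?E.
  by right; rewrite expr1z.
have [i2|i2] := eqVneq i o2; have [j2|j2] := eqVneq j o2; rewrite /= ?expr0z.
- by move: ij; rewrite i2 j2.
- case E: (eps o2); first by have [|g1 g2] := h2 i j ij; [rewrite E|split; left; rewrite ?neq_inv2].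
  by rewrite /= expr1z invr1; split; right; rewrite eq_sym.
- case E: (eps o2); first by have [|g1 g2] := h2 i j ij; [rewrite E|split; left; rewrite ?neq_inv2].
  by rewrite /= expr1z; split; right.
- by have [|g1 g2] := h2 i j ij; [rewrite i2 j2 orbT|split; left; rewrite ?neq_inv2].
Qed.

Lemma split_rot (dl : 'I_3 -> k) : torus_points dl -> (forall i, dl i ^+ 2 != 1) ->
  (forall i j, i != j -> dl i != dl j /\ dl i * dl j != 1) -> split_data dl rot3 (f3 false false true).
Proof.
move=> dl0 h1 h2; exists (fun=> false), id, (fun=> 0); split=> //.
- by move=> i; rewrite mulr0.
- move=> e e0 he; have := he o0; have := he o1; have := he o2; rewrite !permE /f3 /= => e2 e1 e3 i.
  rewrite expr0z; have e00 : e o0 ^+ 2 = 1 by rewrite expr2 {1}e3 e1 e2 mulVf.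
  by move: i; elim/I3P; rewrite ?e2 -?e1 -?e3 // exprVn e00 invr1.
exists (fun=> 1) => [i|]; first exact: oner_neq0.
apply: separated_dgval => [i|i j ij]; first by left; rewrite neq_inv.
by have [g1 g2] := h2 i j ij; split; left; rewrite ?neq_inv2.
Qed.

End FramePatterns.

(** * The five patterns of eigenvalues *)

Section FramePatterns.
Variables (k : closedFieldType) (p : nat) (hp : p \in [pchar k]).
Hypothesis halg : forall x : k, exists2 s, (0 < s)%N & x ^+ (p ^ s) = x.
Local Notation frb a := (map_mx (frobr hp a)).
Variables (d : nat) (d0 : (0 < d)%N).
Local Notation Q := (p ^ d)%N.
Local Notation M6 := 'M[k]_(3 + 3).
Let Qinj : injective (fun x : k => x ^+ Q). Proof. exact: (@frob_inj k p hp d). Qed.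

Local Notation frame_pattern := (frame_pattern hp d).

Let unitaryP (a : k) : a ^+ Q.+1 = 1 -> a != 0 /\ a ^+ Q = a^-1.
Proof.
move=> aQ; have a0 : a != 0 by apply: contra_eq_neq aQ => ->; rewrite expr0n eq_sym oner_eq0.
by split=> //; apply: (mulfI a0); rewrite -exprS aQ mulfV.
Qed.

Let sgn_unitary (a : k) : a ^+ Q.+1 = 1 -> a = if a ^+ 2 != 1 then (a ^+ Q)^-1 else a ^+ Q.
Proof. by move=> /unitaryP[a0 ->]; case: eqP => /= a2; rewrite ?invrK ?sqr1V. Qed.

Let block_triv (a : k) M n : (M <= 3)%N -> (6 < n)%N -> block_factor a M n = 1.
Proof.
move=> M3 n6; rewrite /block_factor /valid_deg (_ : (n <= _)%N = false) ?andbF //.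
apply: negbTE; rewrite -ltnNge (leq_ltn_trans _ n6) // (@leq_trans (2 * 3)%N) // leq_mul //.
by rewrite /stp; case: ifP.
Qed.

Lemma pattern_aaa a : a ^+ Q.+1 = 1 -> frame_pattern (f3 a a a) (block_factor a 3).
Proof.
move=> aQ; have [a0 aV] := unitaryP aQ.
have t0 : torus_points (f3 a a a) by elim/I3P.
exists (if a ^+ 2 == 1 then 1%g else swap01), (fun=> a ^+ 2 != 1); split.
- by move=> x g0 Fx Sx Sg0; apply: frame_aaa.
- have aaa i : f3 a a a i = a by move: i; elim/I3P.
  by move=> i; rewrite !aaa; apply: sgn_unitary.
- case: eqP => [a2|/eqP a2] /=; first exact: split_id.
  rewrite (_ : (fun=> true) = f3 true true true); last by apply/funext; elim/I3P.
  exact: split_swap.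
- move=> tau e hF n n0; apply: (one_gdet Qinj hF) => //; try by elim/I3P.
  by elim/I3P; rewrite /f3 /= => e2; rewrite expr2 {1}e2 mulVf.
- by move=> n; apply: block_triv.
Qed.

Lemma pattern_aab a b : a ^+ Q.+1 = 1 -> b ^+ Q.+1 = 1 -> a != b -> a * b != 1 ->
  frame_pattern (f3 a a b) (fun n => block_factor a 2 n * block_factor b 1 n).
Proof.
move=> aQ bQ ab ab1; have [a0 aV] := unitaryP aQ; have [b0 bV] := unitaryP bQ.
have t0 : torus_points (f3 a a b) by elim/I3P.
have sq (c : k) : c != 0 -> c = c^-1 -> c ^+ 2 = 1 by move=> c0 e; rewrite expr2 {1}e mulVf.
exists (if a ^+ 2 == 1 then 1%g else swap01), (f3 (a ^+ 2 != 1) (a ^+ 2 != 1) (b ^+ 2 != 1)); split.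
- by move=> x g0 Fx Sx Sg0; apply: frame_aab.
- by elim/I3P; case: ifP => a2; rewrite ?perm1 ?permE /f3 /= ?a2 /=; have := sgn_unitary aQ; have := sgn_unitary bQ; rewrite a2.
- case: eqP => [a2|/eqP a2] /=.
    apply: split_id => //; first by elim/I3P.
    by elim/I3P; elim/I3P.
  exact: split_swap.
- move=> tau e hF n n0; apply: (two_gdet Qinj hF) => //.
  + by rewrite /f3 /= eq_sym.
  + elim/I3P; rewrite /f3 /= => e2; [exact: sq|exact: sq|].
    by case/eqP: ab1; rewrite e2 mulfV.
  + elim/I3P; rewrite /f3 /= => e2; [| |exact: sq]; by case/eqP: ab1; rewrite e2 mulVf.
  + by elim/I3P.
- by move=> n n6; rewrite !block_triv // mulr1.
Qed.

Lemma pattern_abc a b c : a ^+ Q.+1 = 1 -> b ^+ Q.+1 = 1 -> c ^+ Q.+1 = 1 ->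
  a != b -> a * b != 1 -> a != c -> a * c != 1 -> b != c -> b * c != 1 ->
  frame_pattern (f3 a b c) (fun n => block_factor a 1 n * (block_factor b 1 n * block_factor c 1 n)).
Proof.
move=> aQ bQ cQ ab ab1 ac ac1 bc bc1.
have [a0 aV] := unitaryP aQ; have [b0 bV] := unitaryP bQ; have [c0 cV] := unitaryP cQ.
have t0 : torus_points (f3 a b c) by elim/I3P.
have sep i j : i != j -> f3 a b c i != f3 a b c j /\ f3 a b c i * f3 a b c j != 1.
  by move: i j; elim/I3P; elim/I3P => // _; rewrite /f3 /=; split=> //; rewrite ?(eq_sym b a) ?(eq_sym c a) ?(eq_sym c b) // mulrC.
exists 1%g, (f3 (a ^+ 2 != 1) (b ^+ 2 != 1) (c ^+ 2 != 1)); split.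
- by move=> x g0 Fx Sx Sg0; apply: frame_abc.
- by elim/I3P; rewrite perm1 /f3 /=; apply: sgn_unitary.
- by apply: split_id => // [|i j /sep //]; elim/I3P.
- move=> tau e hF n n0; have := distinct_unitary_gdet _ _ Qinj hF; rewrite -(big_I3 _ (fun i => block_factor (f3 a b c i) 1 n)) /=; apply=> //.
  + by move=> i j e2; apply/eqP; apply: contraT => /sep[]; rewrite e2 eqxx.
  + move=> i j e2; have [ji|/sep[_]] := eqVneq j i; first by rewrite expr2 -{1}ji e2 mulVf.
    by rewrite e2 mulVf ?eqxx.
  + by elim/I3P.
- by move=> n n6; rewrite !block_triv // !mulr1.
Qed.

Lemma pattern_quad lam c : lam ^+ (p ^ (d * 2)) = lam^-1 -> lam != 0 -> lam ^+ 2 != 1 -> c ^+ Q.+1 = 1 ->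
  frame_pattern (f3 lam (lam ^+ Q) c) (fun n => (if n == 1%N then 1 + 'X^2 else 1) * block_factor c 1 n).
Proof.
move=> lj l0 l2 cQ; have [c0 cV] := unitaryP cQ.
have QQ (a : k) : (a ^+ Q) ^+ Q = a ^+ (p ^ (d * 2)) by rewrite -exprM -expnD addnn -muln2.
have lQ0 : lam ^+ Q != 0 by rewrite expf_neq0.
have t0 : torus_points (f3 lam (lam ^+ Q) c) by elim/I3P.
have sqQ (a : k) : ((a ^+ Q) ^+ 2 == 1) = (a ^+ 2 == 1).
  by rewrite exprAC; apply/eqP/eqP => [e|->]; [apply: Qinj; rewrite /= expr1n|rewrite expr1n].
have lV : (lam ^+ Q) ^+ Q = lam^-1 by rewrite QQ.
have h1 : lam != lam ^+ Q.
  by apply: contra l2 => /eqP e; rewrite expr2 {1}e {1}e lV mulVf.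
have h2 : lam * lam ^+ Q != 1.
  apply: contra l2 => /eqP e; have e1 : lam ^+ Q = lam^-1 by apply: (mulfI l0); rewrite e mulfV.
  by move: lV; rewrite e1 exprVn e1 invrK => e2; rewrite expr2 {1}e2 mulVf.
have key (x y : k) : y ^+ Q = y^-1 -> x ^+ Q != x^-1 -> x != y by move=> yV; apply: contra => /eqP ->; rewrite yV.
have lU : lam ^+ Q != lam^-1 by rewrite neq_inv2 // mulrC.
have lU2 : (lam ^+ Q) ^+ Q != (lam ^+ Q)^-1 by rewrite lV (inj_eq invr_inj).
have cV' : (c^-1) ^+ Q = (c^-1)^-1 by rewrite exprVn cV.
have sep i j : i != j -> f3 lam (lam ^+ Q) c i != f3 lam (lam ^+ Q) c j /\ f3 lam (lam ^+ Q) c i * f3 lam (lam ^+ Q) c j != 1.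
  have k1 := key _ _ cV lU; have k2 := key _ _ cV lU2.
  have := key _ _ cV' lU; have := key _ _ cV' lU2; rewrite !neq_inv2 // => k3 k4.
  by move: i j; elim/I3P; elim/I3P => // _; rewrite /f3 /=; split=> //;
    rewrite ?(eq_sym (lam ^+ Q) lam) ?(eq_sym c) // mulrC.
have inj : injective (f3 lam (lam ^+ Q) c).
  by move=> i j e2; apply/eqP; apply: contraT => /sep[]; rewrite e2 eqxx.
have iso i : isolated (f3 lam (lam ^+ Q) c) (f3 lam (lam ^+ Q) c i).
  move=> j e2; have [ji|/sep[_]] := eqVneq j i; first by rewrite expr2 -{1}ji e2 mulVf.
  by rewrite e2 mulVf ?eqxx.
exists swap01, (f3 false true (c ^+ 2 != 1)); split.
- by move=> x g0 Fx Sx Sg0; apply: frame_quad.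
- by elim/I3P; rewrite permE /f3 /= ?lV ?invrK //; apply: sgn_unitary.
- apply: split_zero => //; rewrite ?permE //.
  + move=> e e0 he; have := he o0; have := he o1; rewrite !permE /f3 /= => e1 e2.
    have e3 : e o0 ^+ 2 = 1 by rewrite expr2 {1}e2 e1 mulVf.
    by rewrite -e2.
  + by elim/I3P; rewrite /f3 /= ?sqQ ?eqxx ?orbF.
  + by move=> i j ij _; apply: sep.
- move=> tau e hF n n0; apply: (quad_gdet Qinj hF inj iso) => //; rewrite /f3 /= ?sqQ //.
  + by rewrite exprVn lV invrK.
  + by rewrite exprVn cV invrK.
- by move=> n n6; rewrite block_triv // mulr1; case: eqP n6 => // ->.
Qed.

Lemma pattern_cubic lam : lam ^+ (p ^ (d * 3)) = lam^-1 -> lam != 0 -> lam ^+ Q.+1 != 1 ->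
  frame_pattern (f3 lam (lam ^+ Q) (lam ^+ Q ^+ Q)) (fun n => if n == 1%N then 1 + 'X^3 else 1).
Proof.
move=> lj l0 lU.
have QQ (a : k) : ((a ^+ Q) ^+ Q) ^+ Q = a ^+ (p ^ (d * 3)).
  by rewrite -!exprM -!expnD; congr (_ ^+ (_ ^ _)); lia.
have lV : lam ^+ Q ^+ Q ^+ Q = lam^-1 by rewrite QQ.
have lQ0 : lam ^+ Q != 0 by rewrite expf_neq0.
have lQQ0 : lam ^+ Q ^+ Q != 0 by rewrite expf_neq0.
set dl := f3 lam (lam ^+ Q) (lam ^+ Q ^+ Q).
have t0 : torus_points dl by elim/I3P.
have l1 : lam ^+ Q != lam^-1 by rewrite neq_inv2 // mulrC -exprS.
have l2 : lam ^+ 2 != 1.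
  apply: contra l1 => /eqP a2; have aV := sqr1V a2.
  move: a2 => /eqP; rewrite sqrf_eq1 => /orP[] /eqP ->; first by rewrite expr1n invr1.
  by rewrite invrN invr1 -[X in X == _]/(frobr hp d (-1)) rmorphN1.
have h1 : lam != lam ^+ Q.
  apply: contra l2 => /eqP e; have e3 : lam = lam^-1 by rewrite -[RHS]lV -!e.
  by rewrite expr2 {2}e3 mulfV.
have h3 : lam != lam ^+ Q ^+ Q.
  by apply: contra l1 => /eqP e; rewrite -lV -e.
have h4 : lam != (lam ^+ Q ^+ Q)^-1.
  apply: contra h1 => /eqP e; have e1 : lam ^+ Q ^+ Q = lam^-1 by rewrite {2}e invrK.
  by move: lV; rewrite e1 exprVn => /invr_inj ->.
have h2 : lam != (lam ^+ Q)^-1 by apply: contra l1 => /eqP {2}->; rewrite invrK.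
have QI (x y : k) : x != y -> x ^+ Q != y ^+ Q by rewrite (inj_eq Qinj).
have sep i j : i != j -> dl i != dl j /\ dl i * dl j != 1.
  have g1 := QI _ _ h1; have g2 := QI _ _ h2; rewrite exprVn in g2.
  rewrite neq_inv2 // in h4; rewrite neq_inv2 // in h2; rewrite neq_inv2 // in g2.
  by move: i j; elim/I3P; elim/I3P => // _; rewrite /dl /f3 /=; split; first [done|by rewrite eq_sym|by rewrite mulrC].
have sq i : dl i ^+ 2 != 1.
  have sqQ (a : k) : ((a ^+ Q) ^+ 2 == 1) = (a ^+ 2 == 1).
    by rewrite exprAC; apply/eqP/eqP => [e|->]; [apply: Qinj; rewrite /= expr1n|rewrite expr1n].
  by move: i; elim/I3P; rewrite /dl /f3 /= ?sqQ.
have inj : injective dl by move=> i j e2; apply/eqP; apply: contraT => /sep[]; rewrite e2 eqxx.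
have iso i : isolated dl (dl i).
  move=> j e2; have [ji|/sep[_]] := eqVneq j i; first by rewrite expr2 -{1}ji e2 mulVf.
  by rewrite e2 mulVf ?eqxx.
exists rot3, (f3 false false true); split.
- by move=> x g0 Fx Sx Sg0; apply: frame_cubic.
- by elim/I3P; rewrite permE /dl /f3 /= ?lV ?invrK.
- exact: split_rot.
- move=> tau e hF n n0; apply: (cubic_gdet Qinj hF inj iso) => //; rewrite /dl /f3 /=.
  by rewrite exprVn lV invrK.
- by move=> n n6; case: eqP n6 => // ->.
Qed.

End FramePatterns.

(** A named function, so that Frobenius orbits can be written with [iter]. *)
Definition powq (k : closedFieldType) (Q : nat) (x : k) : k := x ^+ Q.

(** * Classification and counting of the eigenvalue triples *)

Section Canonical.
Variables (k : closedFieldType) (p : nat) (hp : p \in [pchar k]).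
Variables (d : nat) (d0 : (0 < d)%N).
Local Notation Q := (p ^ d)%N.
Local Notation fr := (@powq k Q).
Let Qinj : injective fr. Proof. exact: (@frob_inj k p hp d). Qed.
Let frV x : fr x^-1 = (fr x)^-1. Proof. exact: exprVn. Qed.
Let p1 : (1 < p)%N. Proof. exact: prime_gt1 (pcharf_prime hp). Qed.

Lemma iter_frob j (x : k) : iter j fr x = x ^+ (p ^ (d * j)).
Proof. by elim: j => [|j IH]; rewrite ?muln0 ?expr1 //= IH /powq -exprM -expnD mulnSr. Qed.

Lemma iter_frobV j (x : k) : iter j fr x^-1 = (iter j fr x)^-1.
Proof. by rewrite !iter_frob exprVn. Qed.

Lemma iter_frob_shift n (x : k) j : iter n fr x = x^-1 -> iter n fr (iter j fr x) = (iter j fr x)^-1.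
Proof. by move=> h; rewrite -iterD addnC iterD h iter_frobV. Qed.

Lemma iter_frob_eq0 j (x : k) : (iter j fr x == 0) = (x == 0).
Proof. by rewrite iter_frob frob_eq0. Qed.

Lemma iter_modn n (x : k) e : iter n fr x = x -> iter e fr x = iter (e %% n) fr x.
Proof.
move=> h; rewrite {1}(divn_eq e n) addnC iterD; congr (iter _ fr _).
by elim: (e %/ n)%N => // i IHi; rewrite mulSn iterD IHi h.
Qed.

Lemma sqr1_unitary (x : k) : x ^+ 2 = 1 -> x ^+ Q.+1 = 1.
Proof.
move=> x2; rewrite exprS; have e : x ^+ Q = x.
  move/eqP: x2; rewrite sqrf_eq1 => /orP[]/eqP ->; first exact: expr1n.
  by rewrite -[LHS]/(frobr hp d (-1)) rmorphN1.
by rewrite e -expr2.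
Qed.

Lemma unitaryE (x : k) : x != 0 -> (x ^+ Q.+1 == 1) = (fr x == x^-1).
Proof.
move=> x0; apply/eqP/eqP => [e|e]; first by apply: (mulfI x0); rewrite /powq -exprS e mulfV.
by rewrite exprS -[x ^+ Q]/(fr x) e mulfV.
Qed.

Lemma unitary_root_seq b : (0 < b)%N -> exists rs : seq k,
  [/\ uniq rs, size rs = (p ^ b).+1 & forall x, (x \in rs) = (x ^+ (p ^ b).+1 == 1)].
Proof.
move=> b0; apply: root_of_unity_seq; first exact: oner_neq0.
by rewrite -natr1 natp_eq0 // add0r oner_eq0.
Qed.

Definition flags : seq k := if p == 2 then [:: 1] else [:: 1; -1].

Lemma mem_flags (x : k) : (x \in flags) = (x ^+ 2 == 1).
Proof.
rewrite /flags sqrf_eq1; case: eqP => [p2|_]; last by rewrite !inE.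
rewrite inE (_ : -1 = 1 :> k) ?orbb //; apply/eqP; rewrite eq_sym -subr_eq0 opprK -(natrD _ 1 1).
by have := pcharf0 hp; rewrite p2 => ->.
Qed.

Lemma uniq_flags : uniq flags.
Proof.
rewrite /flags; case: eqP => // /eqP p2; rewrite /= andbT inE -subr_eq0 opprK -(natrD _ 1 1).
rewrite -(dvdn_pcharf hp) /=; apply: contra p2 => h.
by rewrite eqn_leq (dvdn_leq _ h) //= p1.
Qed.

Definition inv_reps (R : seq k) := [/\ uniq R, (2 * size R + size flags = Q.+1)%N,
  forall x, x \in R -> x ^+ Q.+1 = 1 /\ x ^+ 2 != 1,
  forall x, x ^+ Q.+1 = 1 -> x ^+ 2 != 1 -> exists2 r, r \in R & x = r \/ x = r^-1 &
  forall r r', r \in R -> r' \in R -> r' = r^-1 -> r' = r].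

Lemma exists_inv_reps : exists R, inv_reps R.
Proof.
have [rs [urs srs mrs]] := unitary_root_seq d0.
have fs : {subset flags <= rs} by move=> x; rewrite mem_flags mrs => /eqP/sqr1_unitary ->.
have sz := size_filter_notin urs uniq_flags fs; set s := [seq x <- rs | _] in sz.
have ms x : (x \in s) = (x ^+ Q.+1 == 1) && (x ^+ 2 != 1) by rewrite mem_filter mem_flags mrs andbC.
have x0 x : x \in s -> x != 0.
  by rewrite ms => /andP[/eqP e _]; apply: contra_eq_neq e => ->; rewrite expr0n eq_sym oner_eq0.
have [||||R [uR Rs Rsz Rrep Rinj]] := @orbit_representatives k (fun x => x^-1) 2 (@invr_inj k) isT s.
- by rewrite filter_uniq.
- by move=> x; rewrite !ms !exprVn => /andP[/eqP -> x2]; rewrite invr1 eqxx /= invr_eq1.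
- by move=> x _; rewrite /= invrK.
- move=> x xs [|[|j]] // _ /=; have := xs; rewrite ms => /andP[_]; apply: contra => /eqP e.
  by rewrite expr2 -{1}e mulVf ?x0.
exists R; split=> //.
- by rewrite Rsz sz srs.
- by move=> x /Rs; rewrite ms => /andP[/eqP].
- move=> x xQ x2; have [|r rR [j j2 ->]] := Rrep x; first by rewrite ms xQ eqxx.
  by exists r => //; case: j j2 => [|[|]] // _; [left|right].
- by move=> r r' rR r'R e; apply: (Rinj r r' 1%N).
Qed.

(** When the [n]-th iterate of Frobenius inverts [x], the inverse of [x] lies in its Frobenius
    orbit, so one representative per orbit also accounts for inversion. *)
Definition frob_reps (n : nat) (P : pred k) (R : seq k) := [/\ uniq R,
  forall x, x \in R -> [/\ iter n fr x = x^-1, x != 0 & P x],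
  forall x, x != 0 -> iter n fr x = x^-1 -> P x -> exists2 r, r \in R & exists2 j, (j < 2 * n)%N & x = iter j fr r &
  forall r r' j, r \in R -> r' \in R -> r' = iter j fr r -> r' = r].

(** The sequence [rs] lists all elements inverted by the [n]-th iterate, and [bad] those with
    possibly shorter orbits; on the remaining ones every orbit has length [2 * n]. *)
Lemma exists_frob_reps n (P : pred k) (bad rs : seq k) : (0 < n)%N -> uniq rs -> uniq bad -> {subset bad <= rs} ->
  (forall x, (x \in rs) = (x ^+ (p ^ (d * n)).+1 == 1)) -> (forall x, x \in rs -> P x = (x \notin bad)) ->
  (forall x, P (fr x) = P x) ->
  (forall x, x != 0 -> iter n fr x = x^-1 -> P x -> forall j, (0 < j < 2 * n)%N -> iter j fr x != x) ->
  exists R, frob_reps n P R /\ (2 * n * size R + size bad = size rs)%N.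
Proof.
move=> n0 urs ubad bs mrs PE Pf Pn.
have sz := size_filter_notin urs ubad bs; set s := [seq x <- rs | _] in sz.
have rx0 x : x \in rs -> x != 0.
  by rewrite mrs => /eqP e; apply: contra_eq_neq e => ->; rewrite expr0n eq_sym oner_eq0.
have rV x : x \in rs -> iter n fr x = x^-1.
  move=> xr; have x0 := rx0 x xr; apply: (mulfI x0); rewrite iter_frob -exprS mulfV //.
  by apply/eqP; rewrite -mrs.
have Vr x : x != 0 -> iter n fr x = x^-1 -> x \in rs.
  by move=> x0 e; rewrite mrs exprS -iter_frob e mulfV.
have ms x : (x \in s) = (x \in rs) && P x.
  by rewrite mem_filter andbC; case: (boolP (x \in rs)) => // /PE ->.
have [|||||R [uR Rs Rsz Rrep Rinj]] := @orbit_representatives k fr (2 * n) Qinj _ s.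
- by rewrite muln_gt0.
- by rewrite filter_uniq.
- move=> x; rewrite !ms Pf => /andP[xr ->]; rewrite andbT; apply: Vr.
    by have := rx0 x xr; rewrite -(iter_frob_eq0 1).
  by rewrite -iterSr iterS rV // frV.
- by move=> x; rewrite ms => /andP[xr _]; rewrite mul2n -addnn iterD (rV x xr) iter_frobV (rV x xr) invrK.
- by move=> x; rewrite ms => /andP[xr Px]; apply: Pn => //; [apply: rx0|apply: rV].
exists R; split; last by rewrite Rsz.
split=> //.
- by move=> x /Rs; rewrite ms => /andP[xr Px]; split=> //; [apply: rV|apply: rx0].
- by move=> x x0 xV Px; apply: Rrep; rewrite ms Px Vr.
Qed.

Lemma square_free_orbit (x : k) : x != 0 -> fr (fr x) = x^-1 -> x ^+ 2 != 1 ->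
  forall j, (0 < j < 4)%N -> iter j fr x != x.
Proof.
move=> x0 xV x2; have xx : x != x^-1.
  by apply: contra x2 => /eqP e; rewrite expr2 {1}e mulVf.
have h1 : fr x != x by apply: contra xx => /eqP e; rewrite -xV !e.
have h4 : iter 4 fr x = x by rewrite /= xV !frV xV invrK.
have h2 : fr (fr x) != x by rewrite xV eq_sym.
move=> [|[|[|[|j]]]] // _; first [exact: h1|exact: h2|idtac].
by apply: contra h1 => /eqP e; apply/eqP; rewrite -{1}e -[fr _]/(iter 4 fr x) h4.
Qed.

Lemma cubic_orbit (x : k) : x != 0 -> fr (fr (fr x)) = x^-1 -> fr x != x^-1 ->
  forall j, (0 < j < 6)%N -> iter j fr x != x.
Proof.
move=> x0 xV xU; have xx : x != x^-1.
  apply: contra xU => /eqP e; rewrite -unitaryE //; apply/eqP/sqr1_unitary.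
  by rewrite expr2 {1}e mulVf.
have h1 : fr x != x by apply: contra xx => /eqP e; rewrite -xV !e.
have h2 : fr (fr x) != x by apply: contra xU => /eqP e; rewrite -xV e.
have h6 : iter 6 fr x = x by rewrite /= xV !frV xV invrK.
have h3 : fr (fr (fr x)) != x by rewrite xV eq_sym.
move=> [|[|[|[|[|[|j]]]]]] // _; first [exact: h1|exact: h2|exact: h3|idtac].
  by apply: contra h2 => /eqP e; apply/eqP; rewrite -{1}e -[fr (fr _)]/(iter 6 fr x) h6.
by apply: contra h1 => /eqP e; apply/eqP; rewrite -{1}e -[fr _]/(iter 6 fr x) h6.
Qed.

Lemma exists_quad_reps : exists R, frob_reps 2 (fun x => x ^+ 2 != 1) R /\ (4 * size R + size flags = (p ^ (d * 2)).+1)%N.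
Proof.
have [|rs [urs srs mrs]] := @unitary_root_seq (d * 2)%N; first by rewrite muln_gt0 d0.
rewrite -srs; apply: (@exists_frob_reps 2) => //.
- exact: uniq_flags.
- move=> x; rewrite mem_flags mrs => /eqP x2; rewrite exprS -iter_frob /= /powq.
  have := sqr1_unitary x2; rewrite exprS => e.
  have x0 : x != 0 by apply: contra_eq_neq x2 => ->; rewrite expr0n eq_sym oner_eq0.
  have e1 : x ^+ Q = x by apply: (mulfI x0); rewrite e -x2.
  by rewrite !e1 -expr2 x2.
- by move=> x _; rewrite mem_flags.
- by move=> x; rewrite /powq exprAC -(inj_eq Qinj (x ^+ 2)) /powq expr1n.
- by move=> x x0 xV x2; apply: square_free_orbit.
Qed.

Lemma exists_cubic_reps : exists R, frob_reps 3 (fun x => x ^+ Q.+1 != 1) R /\ (6 * size R + Q.+1 = (p ^ (d * 3)).+1)%N.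
Proof.
have [|rs [urs srs mrs]] := @unitary_root_seq (d * 3)%N; first by rewrite muln_gt0 d0.
have [bad [ub sb mb]] := unitary_root_seq d0.
suff [R [h1 h2]] : exists R, frob_reps 3 (fun x => x ^+ Q.+1 != 1) R /\ (2 * 3 * size R + size bad = size rs)%N.
  by exists R; split=> //; rewrite -srs -h2 sb.
apply: (@exists_frob_reps 3) => //.
- move=> x; rewrite mb mrs => xQ; have x0 : x != 0.
    by move/eqP: xQ => e; apply: contra_eq_neq e => ->; rewrite expr0n eq_sym oner_eq0.
  move: xQ; rewrite unitaryE // => /eqP e; rewrite exprS -iter_frob.
  have -> : iter 3 fr x = x^-1 by rewrite /= e frV e invrK e.
  by rewrite mulfV.
- by move=> x _; rewrite mb.
- by move=> x; rewrite /powq -exprM mulnC exprM -(inj_eq Qinj (x ^+ Q.+1)) /powq expr1n.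
- by move=> x x0 xV; rewrite unitaryE // => xU; apply: cubic_orbit.
Qed.

Variables (O1 R2 R3 : seq k).
Hypotheses (hO1 : inv_reps O1) (hR2 : frob_reps 2 (fun x => x ^+ 2 != 1) R2)
  (hR3 : frob_reps 3 (fun x => x ^+ Q.+1 != 1) R3).
Local Notation R1 := (flags ++ O1).

Lemma uniq_R1 : uniq R1.
Proof.
have [uO _ hO _ _] := hO1; rewrite cat_uniq uniq_flags uO andbT; apply/hasPn => x /hO[_].
by rewrite mem_flags.
Qed.

Lemma R1_unitary x : x \in R1 -> x ^+ Q.+1 = 1.
Proof.
have [_ _ hO _ _] := hO1; rewrite mem_cat mem_flags => /orP[/eqP/sqr1_unitary //|/hO[]//].
Qed.

Lemma R1_neq0 x : x \in R1 -> x != 0.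
Proof. by move/R1_unitary => e; apply: contra_eq_neq e => ->; rewrite expr0n eq_sym oner_eq0. Qed.

Lemma R1_inv r r' : r \in R1 -> r' \in R1 -> r' = r^-1 -> r' = r.
Proof.
have [_ _ hO _ hinj] := hO1; rewrite !mem_cat !mem_flags => /orP[/eqP r2 _ ->|rO].
  by rewrite sqr1V.
case/orP => [/eqP r2 e|r'O]; last exact: hinj.
by move: r2; rewrite e exprVn => /eqP; rewrite invr_eq1 => r2; have [_] := hO r rO; rewrite r2.
Qed.

(** The eigenvalues of a symplectic matrix come in inverse pairs, so each coordinate matters only up
    to inversion. *)
Definition same (a b : k) := (a == b) || (a == b^-1).

Lemma same_refl a : same a a. Proof. by rewrite /same eqxx. Qed.
Lemma same_sym a b : same a b = same b a.
Proof. by rewrite /same eq_sym; congr (_ || _); rewrite -(inj_eq invr_inj) invrK eq_sym. Qed.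
Lemma same_trans a b c : same a b -> same b c -> same a c.
Proof.
by rewrite /same => /orP[]/eqP -> /orP[]/eqP ->; rewrite ?invrK ?eqxx ?orbT.
Qed.
Lemma same_frob a b : same a b -> same (fr a) (fr b).
Proof. by rewrite /same => /orP[]/eqP ->; rewrite ?frV eqxx ?orbT. Qed.
Lemma sameV a : same a^-1 a. Proof. by rewrite /same eqxx orbT. Qed.
Lemma same_unitary a b : same a b -> (a ^+ Q.+1 == 1) = (b ^+ Q.+1 == 1).
Proof. by rewrite /same => /orP[]/eqP -> //; rewrite exprVn invr_eq1. Qed.

Lemma R1_rep a : a ^+ Q.+1 = 1 -> exists2 r, r \in R1 & same a r.
Proof.
have [_ _ _ hrep _] := hO1 => aQ; have [a2|a2] := eqVneq (a ^+ 2) 1.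
  by exists a; rewrite ?same_refl // mem_cat mem_flags a2 eqxx.
have [r rO h] := hrep a aQ a2; exists r; first by rewrite mem_cat rO orbT.
by rewrite /same; case: h => ->; rewrite eqxx ?orbT.
Qed.

Lemma R1_same r r' : r \in R1 -> r' \in R1 -> same r r' -> r = r'.
Proof. by move=> h h' /orP[]/eqP // e; apply: R1_inv. Qed.

(** Normal forms of the triples, by coincidences and by cycles of Frobenius. In [types_aab] the
    repeated eigenvalue comes first, so ordered pairs are listed; distinct unordered triples are
    listed once, as combinations. *)
Definition types_aaa := [seq [:: a; a; a] | a <- R1].
Definition types_aab := [seq [:: u.1; u.1; u.2] | u <- [seq (a, b) | a <- R1, b <- R1] & u.1 != u.2].
Definition types_abc := combs 3 R1.
Definition types_quad := [seq [:: l; fr l; c] | l <- R2, c <- R1].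
Definition types_cubic := [seq [:: l; fr l; fr (fr l)] | l <- R3].
Definition canonical_types := types_aaa ++ types_aab ++ types_abc ++ types_quad ++ types_cubic.

Definition type_fun (t : seq k) : 'I_3 -> k := f3 t`_0 t`_1 t`_2.

Definition signed_rel (dl dl' : 'I_3 -> k) := exists (sg : {perm 'I_3}) (eps : 'I_3 -> bool),
  forall i, dl' i = if eps i then (dl (sg i))^-1 else dl (sg i).

Lemma signed_relI (dl : 'I_3 -> k) i j l x y z : injective (f3 i j l) ->
  same (dl i) x -> same (dl j) y -> same (dl l) z -> signed_rel (f3 x y z) dl.
Proof.
move=> inj h0 h1 h2; pose s := perm inj; exists (s^-1)%g, (fun m => dl m != f3 x y z ((s^-1)%g m)).
have h m : same (dl (s m)) (f3 x y z m) by move: m; elim/I3P; rewrite permE.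
by move=> m; have := h ((s^-1)%g m); rewrite permKV /same; case: eqP => //= _ /eqP.
Qed.

Lemma third_index (i j : 'I_3) : i != j -> exists l, injective (f3 i j l).
Proof.
have inj (a b c : 'I_3) : a != b -> a != c -> b != c -> injective (f3 a b c).
  move=> ab ac bc; elim/I3P; elim/I3P => //=; rewrite /f3 /= => e; move: ab ac bc; by rewrite e eqxx.
by move: i j; elim/I3P; elim/I3P => // _; first [by exists o2; apply: inj|by exists o1; apply: inj|by exists o0; apply: inj].
Qed.

Lemma third_unique (i j l x : 'I_3) : i != j -> l != i -> l != j -> x != j -> x != i -> x = l.
Proof. by move: i j l x; elim/I3P; elim/I3P; elim/I3P; elim/I3P. Qed.

Lemma classify_unitary (dl : 'I_3 -> k) : (forall i, dl i ^+ Q.+1 = 1) ->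
  exists2 t, t \in canonical_types & signed_rel (type_fun t) dl.
Proof.
move=> hu; have /choice [r hr] : forall i, exists r, r \in R1 /\ same (dl i) r.
  by move=> i; have [r h1 h2] := R1_rep (hu i); exists r.
have rR i : r i \in R1 by have [] := hr i.
have rs i : same (dl i) (r i) by have [] := hr i.
have [/injectiveP rinj|] := boolP (injectiveb r).
  pose t := [seq x <- R1 | x \in [:: r o0; r o1; r o2]].
  have ut : uniq [:: r o0; r o1; r o2] by rewrite /= !inE !(inj_eq rinj).
  have pt : perm_eq [:: r o0; r o1; r o2] t.
    apply: uniq_perm => //; first by rewrite filter_uniq // uniq_R1.
    by move=> x; rewrite mem_filter; case: (boolP (x \in _)) => //=; rewrite !inE => /or3P[]/eqP ->; rewrite rR.
  have st := perm_size pt; have ut' : uniq t by rewrite -(perm_uniq pt).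
  exists t; first by rewrite !mem_cat mem_combs filter_subseq -st ?eqxx !orbT.
  have ex x : x \in t -> exists i, x = r i.
    by rewrite -(perm_mem pt) !inE => /or3P[]/eqP ->; [exists o0|exists o1|exists o2].
  case: t st ut' ex {pt} => [|x [|y [|z []]]] //= _; rewrite !inE !negb_or => /and3P[/andP[xy xz] yz _] ex.
  have [|i xi] := ex x; first by rewrite inE eqxx.
  have [|j yj] := ex y; first by rewrite !inE eqxx orbT.
  have [|l zl] := ex z; first by rewrite !inE eqxx !orbT.
  apply: (@signed_relI dl i j l); rewrite /= ?xi ?yj ?zl //.
  rewrite xi yj zl in xy xz yz.
  elim/I3P; elim/I3P => //=; rewrite /f3 /= => e; move: xy xz yz; by rewrite e eqxx.
move=> /injectivePn[i [j ij rij]]; have [l inj] := third_index ij.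
have [e|e] := eqVneq (r l) (r i).
  exists [:: r i; r i; r i].
    by rewrite mem_cat (_ : _ \in types_aaa) //; apply/mapP; exists (r i).
  by apply: (signed_relI inj); [|rewrite rij|rewrite -e]; apply: rs.
exists [:: r i; r i; r l].
  rewrite !mem_cat (_ : _ \in types_aab) ?orbT //; apply/mapP; exists (r i, r l) => //.
  by rewrite mem_filter /= [r i == _]eq_sym e /=; apply/allpairsP; exists (r i, r l); split=> //=; apply: rR.
by apply: (signed_relI inj); [|rewrite rij|]; apply: rs.
Qed.

(** Up to inversion Frobenius permutes the coordinates by [tau]. If some coordinate is not unitary,
    its index lies in a cycle of length 2 or 3, and the hypothesis that some iterate of Frobenius
    inverts it makes the square or the cube do so. *)
Lemma classify (dl : 'I_3 -> k) (tau : {perm 'I_3}) (eps : 'I_3 -> bool) : torus_points dl ->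
  (forall i, dl i = (if eps i then (dl (tau i))^-1 else dl (tau i)) ^+ Q) ->
  (forall i, exists e, iter e fr (dl i) = (dl i)^-1) ->
  exists2 t, t \in canonical_types & signed_rel (type_fun t) dl.
Proof.
move=> dl0 hF hU; have hs i : same (dl i) (fr (dl (tau i))).
  by rewrite {1}hF -[_ ^+ Q]/(fr _); apply: same_frob; case: (eps i); rewrite ?sameV ?same_refl.
have fixU i : iter 1 fr (dl i) = dl i -> fr (dl i) = (dl i)^-1.
  by move=> e; have [n] := hU i; rewrite (iter_modn n e) modn1 /= => <-; rewrite -[RHS]e.
have key1 i : same (dl i) (fr (dl i)) -> dl i ^+ Q.+1 = 1.
  move=> h; apply/eqP; rewrite unitaryE //; move: h; rewrite same_sym => /orP[/eqP e|//].
  by rewrite fixU.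
have [/forallP all1|] := boolP [forall i, dl i ^+ Q.+1 == 1].
  by apply: classify_unitary => i; apply/eqP.
rewrite negb_forall => /existsP[i iU]; set a := dl i in iU.
have aU : fr a != a^-1 by rewrite -unitaryE // (dl0 i).
have a0 : a != 0 by apply: dl0.
have a2 : a ^+ 2 != 1 by apply: contra iU => /eqP/sqr1_unitary ->.
have aa : a != a^-1 by apply: contra a2 => /eqP e; rewrite expr2 {1}e mulVf.
have ji : tau i != i.
  by apply: contra iU => /eqP e; apply/eqP/key1; have := hs i; rewrite e.
have [e2|l_i] := eqVneq (tau (tau i)) i.
  set j := tau i in ji e2; have ij : i != j by rewrite eq_sym.
  have [l inj] := third_index ij.
  have li : l != i by apply/negP => /eqP e; have := inj o2 o0; rewrite /f3 /= e => /(_ erefl).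
  have lj : l != j by apply/negP => /eqP e; have := inj o2 o1; rewrite /f3 /= e => /(_ erefl).
  have tl : tau l = l.
    have n1 : tau l != j by rewrite (inj_eq perm_inj).
    have n2 : tau l != i by rewrite -{1}e2 (inj_eq perm_inj).
    exact: (@third_unique i j l).
  have lU : dl l ^+ Q.+1 = 1 by apply: key1; have := hs l; rewrite tl.
  have [r rR rs] := R1_rep lU.
  have s1 : same a (fr (dl j)) by apply: hs.
  have s2 : same (dl j) (fr a) by have := hs j; rewrite e2.
  (* Otherwise [fr (fr a) = a], and neither [a] nor [fr a], the only conjugates, would be [a^-1]. *)
  have aV : fr (fr a) = a^-1.
    have := same_trans s1 (same_frob s2); rewrite same_sym => /orP[/eqP e|/eqP //].
    have [n] := hU i; rewrite -/a (@iter_modn 2) //; case: (n %% 2)%N (ltn_pmod n (isT : 0 < 2)%N) => [|[|]] // _ /= e'.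
      by rewrite -e' eqxx in aa.
    by rewrite e' eqxx in aU.
  have [_ hR hrep _] := hR2; have [lam lR [n n4 an]] := hrep a a0 aV a2.
  have [lV l0 l2] := hR lam lR; rewrite /= in lV.
  exists [:: lam; fr lam; r].
    by rewrite !mem_cat (_ : _ \in types_quad) ?orbT //; apply/allpairsP; exists (lam, r).
  have inj' : injective (f3 j i l).
    move=> x y; move: x y; elim/I3P; elim/I3P => //; rewrite /f3 /= => e; move: ij li lj; by rewrite e eqxx.
  (* The position of [a] in the orbit of [lam] decides which of the two indices matches [lam] and
     which matches [fr lam]. *)
  case: n n4 an => [|[|[|[|]]]] // _ /= an.
  - by apply: (signed_relI inj) => //; rewrite -/a ?an ?same_refl // -an.
  - apply: (signed_relI inj') => //; last by rewrite -/a an same_refl.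
    by apply: (same_trans s2); rewrite an lV sameV.
  - apply: (signed_relI inj) => //; first by rewrite -/a an lV sameV.
    by apply: (same_trans s2); rewrite an !(frV, lV) sameV.
  - apply: (signed_relI inj') => //; last by rewrite -/a an !(frV, lV) sameV.
    by apply: (same_trans s2); rewrite an !(frV, lV) invrK same_refl.
set j := tau i in ji l_i; set l := tau j in l_i.
have lj : l != j by rewrite (inj_eq perm_inj).
have tl : tau l = i.
  have n1 : tau l != j by rewrite (inj_eq perm_inj).
  have n2 : tau l != l by rewrite (inj_eq perm_inj).
  by apply: (@third_unique j l i); rewrite // eq_sym.
have s1 : same a (fr (dl j)) by apply: hs.
have s2 : same (dl j) (fr (dl l)) by apply: hs.
have s3 : same (dl l) (fr a) by have := hs l; rewrite tl.
have s4 : same (dl j) (fr (fr a)) := same_trans s2 (same_frob s3).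
have aV : fr (fr (fr a)) = a^-1.
  have := same_trans s1 (same_frob s4); rewrite same_sym => /orP[/eqP e|/eqP //].
  have [n] := hU i; rewrite -/a (@iter_modn 3) //; case: (n %% 3)%N (ltn_pmod n (isT : 0 < 3)%N) => [|[|[|]]] // _ /= e'.
  - by rewrite -e' eqxx in aa.
  - by rewrite e' eqxx in aU.
  - by move: e; rewrite e' frV => /(congr1 (@GRing.inv k)); rewrite invrK => e; rewrite e eqxx in aU.
have [_ hR hrep _] := hR3; have [lam lR [n n6 an]] := hrep a a0 aV iU.
have [lV l0 lU] := hR lam lR; rewrite /= in lV.
have inj3 (x y z : 'I_3) : x != y -> x != z -> y != z -> injective (f3 x y z).
  move=> xy xz yz; elim/I3P; elim/I3P => //=; rewrite /f3 /= => e; move: xy xz yz; by rewrite e eqxx.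
exists [:: lam; fr lam; fr (fr lam)].
  by rewrite !mem_cat (_ : _ \in types_cubic) ?orbT //; apply/mapP; exists lam.
have ij : i != j by rewrite eq_sym. have il : i != l by rewrite eq_sym. have jl : j != l by rewrite eq_sym.
(* Likewise, the position modulo 3 rotates the three indices, and positions that differ by 3 differ
   by inversion. *)
case: n n6 an => [|[|[|[|[|[|]]]]]] // _ /= an; rewrite an in s3 s4; rewrite ?(frV, lV, invrK) in an s3 s4.
- by apply: (@signed_relI _ i l j) => //; [apply: inj3|rewrite -/a an same_refl].
- apply: (@signed_relI _ j i l) => //; [exact: inj3|exact: same_trans s4 (sameV _)|by rewrite -/a an same_refl].
- apply: (@signed_relI _ l j i) => //; [exact: inj3|exact: same_trans s3 (sameV _)|exact: same_trans s4 (sameV _)|by rewrite -/a an same_refl].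
- apply: (@signed_relI _ i l j) => //; [exact: inj3|by rewrite -/a an sameV|exact: same_trans s3 (sameV _)|exact: same_trans s4 (sameV _)].
- apply: (@signed_relI _ j i l) => //; [exact: inj3|by rewrite -/a an sameV|exact: same_trans s3 (sameV _)].
- by apply: (@signed_relI _ l j i) => //; [apply: inj3|rewrite -/a an sameV].
Qed.

(** The multiplicity of [a] as an eigenvalue of [dgmx dl], which does not depend on the frame used
    to diagonalize an element. *)
Definition multiplicity (dl : 'I_3 -> k) (a : k) := (\sum_(s < 3 + 3) (dgval dl s == a))%N.

Lemma multiplicityE dl a : multiplicity dl a = (\sum_i (dl i == a) + \sum_i ((dl i)^-1 == a))%N.
Proof.
by rewrite /multiplicity big_split_ord /=; congr (_ + _)%N; apply: eq_bigr => i _; rewrite ?dgvall ?dgvalr.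
Qed.

Lemma multiplicity_same dl dl' i : torus_points dl -> multiplicity dl =1 multiplicity dl' -> exists j, same (dl i) (dl' j).
Proof.
move=> dl0 /(_ (dl i)); rewrite !multiplicityE (bigD1 i) //= eqxx => e.
have /existsP[j hj] : [exists j, same (dl i) (dl' j)].
  apply: contraT; rewrite negb_exists => /forallP h; move: e.
  by rewrite [X in _ = (X + _)%N]big1 ?[X in _ = (_ + X)%N]big1 // => j _; have := h j; rewrite /same negb_or => /andP[h1 h2];
    rewrite eq_sym ?(negPf h1) ?(negPf h2).
by exists j.
Qed.

(** A self-inverse eigenvalue is counted in both halves of the frame, any other one in the first
    half only. *)
Lemma multiplicity_R1 t x : size t = 3%N -> {subset t <= R1} -> x \in R1 ->
  multiplicity (type_fun t) x = (count_mem x t * (if (x ^+ 2 == 1)%R then 2 else 1))%N.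
Proof.
case: t => [|a [|b [|c []]]] // _ h xR; have aR : a \in R1 by rewrite h ?inE ?eqxx.
have bR : b \in R1 by rewrite h ?inE ?eqxx ?orbT. have cR : c \in R1 by rewrite h ?inE ?eqxx ?orbT.
rewrite multiplicityE !(big_I3 _ _) /type_fun /f3 /= addn0.
have inv y : y \in R1 -> (y^-1 == x) = (y == x) && (x ^+ 2 == 1).
  move=> yR; apply/eqP/andP => [e|[/eqP -> /eqP x2]]; last by rewrite sqr1V.
  have xy : x = y by apply: R1_inv.
  have x2 : x ^+ 2 = 1 by rewrite expr2 -{1}e -xy mulVf // R1_neq0.
  by rewrite x2 eqxx -xy eqxx.
by rewrite !inv //; case: (x ^+ 2 == 1); rewrite ?andbT ?andbF //=; lia.
Qed.

Definition unitary_type t := [/\ size t = 3%N, {subset t <= R1} &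
  [\/ exists2 a, a \in R1 & t = [:: a; a; a],
      exists a b, [/\ a \in R1, b \in R1, a != b & t = [:: a; a; b]] |
      subseq t R1]].

Lemma canonical_typeP t : t \in canonical_types ->
  [\/ unitary_type t,
      exists l c, [/\ l \in R2, c \in R1 & t = [:: l; fr l; c]] |
      exists2 l, l \in R3 & t = [:: l; fr l; fr (fr l)]].
Proof.
rewrite !mem_cat => /or4P[/mapP[a aR ->]|/mapP[[a b]]|h|/orP[/allpairsP[[l c] /= [lR cR ->]]|/mapP[l lR ->]]].
- constructor 1; split=> //; first by move=> x; rewrite !inE !orbb => /eqP ->.
  by constructor 1; exists a.
- rewrite mem_filter => /andP[/= ab /allpairsP[[a' b'] /= [aR bR [ea eb]]]] ->; subst a' b'.
  constructor 1; split=> //; last by constructor 2; exists a, b.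
  by move=> x; rewrite !inE => /or3P[]/eqP ->.
- move: h; rewrite mem_combs => /andP[st /eqP sz]; constructor 1; split=> //; last by constructor 3.
  exact: mem_subseq.
- by constructor 2; exists l, c.
- by constructor 3; exists l.
Qed.

Lemma canonical_torus t : t \in canonical_types -> torus_points (type_fun t).
Proof.
case/canonical_typeP => [[st tR _]|[l [c [lR cR ->]]]|[l lR ->]].
- case: t st tR => [|a [|b [|c []]]] // _ tR.
  by elim/I3P; rewrite /type_fun /f3 /=; apply: R1_neq0; apply: tR; rewrite !inE eqxx ?orbT.
- have [_ hR _ _] := hR2; have [_ l0 _] := hR l lR.
  by elim/I3P; rewrite /type_fun /f3 /= ?expf_neq0 // R1_neq0.
- have [_ hR _ _] := hR3; have [_ l0 _] := hR l lR.
  by elim/I3P; rewrite /type_fun /f3 /= ?expf_neq0.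
Qed.

Lemma unitary_type_inj t t' : unitary_type t -> unitary_type t' -> perm_eq t t' -> t = t'.
Proof.
have const (s s' : seq k) (a : k) : size s' = 3%N -> s = [:: a; a; a] -> perm_eq s s' -> s = s'.
  move=> sz -> h; have all1 x : x \in s' -> x = a.
    by rewrite -(perm_mem h) !inE !orbb => /eqP.
  case: s' sz all1 {h} => [|x [|y [|z []]]] // _ h.
  have hx : x = a by apply: h; rewrite !inE eqxx.
  have hy : y = a by apply: h; rewrite !inE eqxx orbT.
  have hz : z = a by apply: h; rewrite !inE eqxx !orbT.
  by rewrite hx hy hz.
have cnt (s s' : seq k) x : perm_eq s s' -> count_mem x s = count_mem x s' by move/seq.permP; apply.
have uq (s : seq k) x : subseq s R1 -> (count_mem x s <= 1)%N.
  by move=> ss; rewrite count_uniq_mem ?leq_b1 //; apply: subseq_uniq ss uniq_R1.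
move=> [st tR ht] [st' tR' ht'] h.
case: ht => [[a _ e]|[a [b [_ _ ab e]]]|ss]; first exact: (const _ _ a).
  case: ht' => [[a' _ e']|[a' [b' [_ _ ab' e']]]|ss'].
  - by apply/esym; apply: (const _ _ a') => //; rewrite perm_sym.
  - have := cnt _ _ a h; have := cnt _ _ b h; rewrite e e' /= !eqxx (negPf ab) (eq_sym b a) (negPf ab).
    have [->|aa] := eqVneq a' a; last by case: eqP; case: eqP => // *; lia.
    by rewrite (negPf ab); case: eqP => [->|] //=; lia.
  - by have := uq _ a ss'; rewrite -(cnt _ _ a h) e /= eqxx.
case: ht' => [[a' _ e']|[a' [b' [_ _ ab' e']]]|ss'].
- by apply/esym; apply: (const _ _ a') => //; rewrite perm_sym.
- by have := uq _ a' ss; rewrite (cnt _ _ a' h) e' /= eqxx.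
rewrite (subseq_uniqP uniq_R1 ss) (subseq_uniqP uniq_R1 ss').
by apply: eq_filter => x /=; rewrite (perm_mem h).
Qed.

Lemma same_iter n l x j : iter n fr l = l^-1 -> same x (iter j fr l) -> exists j', x = iter j' fr l.
Proof.
move=> lV /orP[]/eqP ->; first by exists j.
by exists (j + n)%N; rewrite iterD lV iter_frobV.
Qed.

(** Being unitary is invariant under inversion and under Frobenius, so the number of unitary
    coordinates, three, one or none, separates the families. Inside a family, uniqueness of
    representatives concludes. *)
Lemma canonical_inj t t' : t \in canonical_types -> t' \in canonical_types ->
  multiplicity (type_fun t) =1 multiplicity (type_fun t') -> t = t'.
Proof.
have FU x : (fr x ^+ Q.+1 == 1) = (x ^+ Q.+1 == 1).
  by rewrite /powq -exprM mulnC exprM -[X in _ == X](expr1n k Q) (inj_eq Qinj).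
have l2U l : l \in R2 -> (l ^+ Q.+1 == 1) = false.
  have [_ hR _ _] := hR2 => /hR[/= lV l0 l2]; apply/negbTE; apply: contra l2.
  rewrite unitaryE // => /eqP e; move: lV; rewrite e frV e invrK => e1.
  by rewrite expr2 {1}e1 mulVf.
have l3U l : l \in R3 -> (l ^+ Q.+1 == 1) = false by have [_ hR _ _] := hR3 => /hR[/= lV l0 /negPf].
have U1 s i : unitary_type s -> type_fun s i ^+ Q.+1 == 1.
  case=> st sR _; apply/eqP/R1_unitary/sR; case: s st {sR} => [|a [|b [|c []]]] // _.
  by move: i; elim/I3P; rewrite /type_fun /f3 /= !inE eqxx ?orbT.
have U2 l c i : l \in R2 -> c \in R1 -> (type_fun [:: l; fr l; c] i ^+ Q.+1 == 1) = (i == o2).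
  move=> lR cR; have cU := R1_unitary cR; have lF := l2U l lR.
  by move: i; elim/I3P; rewrite /type_fun /f3 /=; [rewrite lF|rewrite FU lF|rewrite cU eqxx].
have U3 l i : l \in R3 -> (type_fun [:: l; fr l; fr (fr l)] i ^+ Q.+1 == 1) = false.
  by move=> lR; move: i; elim/I3P; rewrite /type_fun /f3 /= ?FU l3U.
move=> ht ht' e; have e' : multiplicity (type_fun t') =1 multiplicity (type_fun t) by move=> x; rewrite e.
have tj i := @multiplicity_same (type_fun t) (type_fun t') i (canonical_torus ht) e.
have tj' i := @multiplicity_same (type_fun t') (type_fun t) i (canonical_torus ht') e'.
have [u|[l [c [lR cR tE]]]|[l lR tE]] := canonical_typeP ht;
have [u'|[l' [c' [lR' cR' tE']]]|[l' lR' tE']] := canonical_typeP ht'.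
- apply: unitary_type_inj => //; apply/allP => x _; apply/eqP; have [st tR _] := u; have [st' tR' _] := u'.
  have [xR|xR] := boolP (x \in R1).
    by have := e x; rewrite !multiplicity_R1 //; case: ifP => _; lia.
  by rewrite !(count_memPn _) //; apply: contra xR; [apply: tR'|apply: tR].
- have := U2 l' c' o0 lR' cR'; rewrite -tE' => eU.
  by have [j /same_unitary] := tj' o0; rewrite eU (U1 _ j u).
- have := U3 l' o0 lR'; rewrite -tE' => eU.
  by have [j /same_unitary] := tj' o0; rewrite eU (U1 _ j u).
- have := U2 l c o0 lR cR; rewrite -tE => eU.
  by have [j /same_unitary] := tj o0; rewrite eU (U1 _ j u').
- have [_ hR _ hinj] := hR2; have [lV _ _] := hR l' lR'.
  have [j sj] := tj o0; have j2 : j != o2.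
    by have := same_unitary sj; have := U2 l c o0 lR cR; have := U2 l' c' j lR' cR'; rewrite -tE -tE' => -> ->; case: (j == o2).
  have [j' ej] : exists j', l = iter j' fr l'.
    move: j j2 sj; rewrite tE tE'; elim/I3P => // _; rewrite /type_fun /f3 /= => sj.
      exact: (@same_iter 2 l' l 0 lV sj).
    exact: (@same_iter 2 l' l 1 lV sj).
  have ll : l = l' := hinj _ _ _ lR' lR ej.
  have [j2' sj2] := tj o2; have j3 : j2' = o2.
    by have := same_unitary sj2; have := U2 l c o2 lR cR; have := U2 l' c' j2' lR' cR'; rewrite -tE -tE' => -> ->; case: (j2' =P o2).
  move: sj2; rewrite j3 tE tE' /type_fun /f3 /= => sc.
  by rewrite ll (R1_same cR cR' sc).
- have := U2 l c o2 lR cR; rewrite -tE => eU; have [j /same_unitary] := tj o2.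
  by have := U3 l' j lR'; rewrite -tE' eU => ->.
- have := U3 l o0 lR; rewrite -tE => eU.
  by have [j /same_unitary] := tj o0; rewrite eU (U1 _ j u').
- have := U2 l' c' o2 lR' cR'; rewrite -tE' => eU; have [j /same_unitary] := tj' o2.
  by have := U3 l j lR; rewrite -tE eU => ->.
- have [_ hR _ hinj] := hR3; have [lV _ _] := hR l' lR'.
  have [j sj] := tj o0.
  have [j' ej] : exists j', l = iter j' fr l'.
    move: j sj; rewrite tE tE'; elim/I3P; rewrite /type_fun /f3 /= => sj.
    - exact: (@same_iter 3 l' l 0 lV sj).
    - exact: (@same_iter 3 l' l 1 lV sj).
    - exact: (@same_iter 3 l' l 2 lV sj).
  by rewrite tE tE' (hinj _ _ _ lR' lR ej).
Qed.

End Canonical.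

(** * Transport of the invariants by signed permutations *)

Lemma sgmxM (s s' : {perm 'I_3}) (e e' : 'I_3 -> bool) :
  sgmx s e *m sgmx s' e' = sgmx (s * s')%g (fun i => e i (+) e' (s i)).
Proof.
apply: (@mono_inj algC) => z z0; rewrite -mono_mul //; apply/funext => i; rewrite !mono_sgmx permM.
by case: (e i); case: (e' _); rewrite ?invrK.
Qed.

Section InvariantTransport.
Variables (k : closedFieldType) (Q : nat).

Lemma preservesE (dl : 'I_3 -> k) sg eps : preserves dl sg eps <-> mono (sgmx sg eps) dl = dl.
Proof.
split=> [h|h i]; first by apply/funext => i; rewrite mono_sgmx h.
by rewrite -mono_sgmx h.
Qed.

Lemma inv_gdet_signed (dl dl' : 'I_3 -> k) (s : {perm 'I_3}) (e : 'I_3 -> bool) (tau' : {perm 'I_3}) (eps' : 'I_3 -> bool) :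
  torus_points dl -> dl' = mono (sgmx s e) dl ->
  (forall i, dl' i = (if eps' i then (dl' (tau' i))^-1 else dl' (tau' i)) ^+ Q) ->
  exists (tau : {perm 'I_3}) (eps : 'I_3 -> bool),
    (forall i, dl i = (if eps i then (dl (tau i))^-1 else dl (tau i)) ^+ Q) /\
    forall n P, inv_gdet (Inv dl') (lin_sub (sgmx tau' eps')) n P -> inv_gdet (Inv dl) (lin_sub (sgmx tau eps)) n P.
Proof.
move=> dl0 dlE hF; pose N := sgmx s e; pose N' := sgmx s^-1 (inv_eps s e).
have [NN' N'N] := sgmx_inv k s e; rewrite -/N -/N' in NN' N'N.
have dl'0 : torus_points dl' by rewrite dlE; apply: mono_torus.
have dlE' : dl = mono N' dl' by rewrite dlE mono_mul // N'N mono1.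
have [tau [eps tE]] : exists (tau : {perm 'I_3}) (eps : 'I_3 -> bool), N' *m sgmx tau' eps' *m N = sgmx tau eps.
  by rewrite /N' /N !sgmxM; eexists; eexists.
exists tau, eps; split.
  move=> i; rewrite -mono_sgmx -tE -mono_mul // -dlE -mono_mul // -[RHS]/((fun i => mono N' (mono (sgmx tau' eps') dl') i ^+ Q) i).
  rewrite -mono_expn [dl in LHS]dlE'; congr (mono N' _ i); apply/funext => j.
  by rewrite mono_sgmx -hF.
move=> n P; apply: (@inv_gdet_lin_sub _ _ N N') => //.
- move=> q; split=> hq t f /preservesE ht.
    have [t' [f' tE']] : exists (t' : {perm 'I_3}) (f' : 'I_3 -> bool), N *m sgmx t f *m N' = sgmx t' f'.
      by rewrite /N' /N !sgmxM; eexists; eexists.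
    have /hq : preserves dl' t' f'.
      by apply/preservesE; rewrite -tE' -mono_mul // -dlE' -mono_mul // ht dlE.
    by rewrite -tE' !lin_sub_comp => {2}<-; rewrite lin_sub_comp -!mulmxA N'N mulmx1.
  have [t' [f' tE']] : exists (t' : {perm 'I_3}) (f' : 'I_3 -> bool), N' *m sgmx t f *m N = sgmx t' f'.
    by rewrite /N' /N !sgmxM; eexists; eexists.
  have /hq : preserves dl t' f'.
    by apply/preservesE; rewrite -tE' -mono_mul // -dlE -mono_mul // ht -dlE'.
  rewrite -tE' lin_sub_comp !mulmxA NN' mul1mx => /(congr1 (lin_sub N')).
  by rewrite !lin_sub_comp -!mulmxA NN' !mulmx1 lin_sub1.
- by rewrite -tE !mulmxA NN' mul1mx.
Qed.

(** Frobenius normalizes the stabilizer of [dl]: its matrix carries the [Q]-th power of [dl], which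
    has the symmetries of [dl], to [dl] itself. *)
Lemma frob_inv_pos (dl : 'I_3 -> k) (tau : {perm 'I_3}) (eps : 'I_3 -> bool) q : torus_points dl ->
  (forall i, dl i = (if eps i then (dl (tau i))^-1 else dl (tau i)) ^+ Q) ->
  inv_pos (Inv dl) q -> inv_pos (Inv dl) (lin_sub (sgmx tau eps) q).
Proof.
move=> dl0 hF [hq q0]; split; last by rewrite lin_sub_const.
move=> t f /preservesE ht; pose S := sgmx tau eps; pose S' := sgmx tau^-1 (inv_eps tau eps).
have [SS' S'S] := sgmx_inv k tau eps; rewrite -/S -/S' in SS' S'S.
have dlQ0 : torus_points (fun i => dl i ^+ Q) by move=> i; rewrite expf_neq0.
have e1 : mono S (fun i => dl i ^+ Q) = dl.
  by rewrite mono_expn; apply/funext => i; rewrite mono_sgmx -hF.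
have e2 : mono S' dl = fun i => dl i ^+ Q by rewrite -[in LHS]e1 mono_mul // S'S mono1.
have [t' [f' tE']] : exists (t' : {perm 'I_3}) (f' : 'I_3 -> bool), S *m sgmx t f *m S' = sgmx t' f'.
  by rewrite /S' /S !sgmxM; eexists; eexists.
have /hq : preserves dl t' f'.
  apply/preservesE; rewrite -tE' -mono_mul // e2 -mono_mul // mono_expn ht e1 //.
by rewrite -tE' !lin_sub_comp => {2}<-; rewrite lin_sub_comp -!mulmxA S'S mulmx1.
Qed.

End InvariantTransport.

(** * Vanishing when an eigenvalue is not inverted by any power of Frobenius *)

Section FixedVector.
Variables (k : closedFieldType) (p : nat) (hp : p \in [pchar k]).
Hypothesis halg : forall x : k, exists2 s, (0 < s)%N & x ^+ (p ^ s) = x.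
Variables (d : nat) (d0 : (0 < d)%N).
Local Notation Q := (p ^ d)%N.
Local Notation fr := (@powq k Q).

(** The Frobenius orbit of [a] does not meet the orbit of its inverse. Weight 1 on the coordinates
    in the first orbit, -1 on those in the second and 0 elsewhere defines a linear form [V] fixed by
    the stabilizer and by Frobenius: the character of a split central torus. It is nonzero modulo
    decomposables, so 1 is an eigenvalue of Frobenius in degree 1. *)
Lemma nonunitary_gdet (dl : 'I_3 -> k) (tau : {perm 'I_3}) (eps : 'I_3 -> bool) i0 P : torus_points dl ->
  (forall i, dl i = (if eps i then (dl (tau i))^-1 else dl (tau i)) ^+ Q) ->
  (forall e, iter e fr (dl i0) <> (dl i0)^-1) ->
  inv_gdet (Inv dl) (lin_sub (sgmx tau eps)) 1 P -> P.[1] = 0.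
Proof.
move=> dl0 hF hN; set a := dl i0 in hN.
have frV x : fr x^-1 = (fr x)^-1 by apply: exprVn.
have [s s0 hs] : exists2 s, (0 < s)%N & iter s fr a = a.
  have [s s0 hs] := halg a; exists s => //; rewrite iter_frob.
  have : forall j, a ^+ (p ^ (s * j)) = a by elim=> [|j IH]; rewrite ?muln0 ?expr1 // mulnS addnC expnD exprM IH.
  by rewrite mulnC.
have itM j : iter (s * j) fr a = a by elim: j => [|j IH]; rewrite ?muln0 // mulnS iterD IH.
pose O x := `[< exists e, x = iter e fr a >].
have OF x : O (fr x) = O x.
  apply/asboolP/asboolP => [[e he]|[e ->]]; last by exists e.+1.
  exists (s.-1 + e)%N; have [s' s'0 hs'] := halg x.
  by apply: (@frob_inj k p hp d); rewrite -[LHS]/(fr x) he -[RHS]/(iter (s.-1 + e).+1 fr a) -addSn prednK // addnC iterD hs.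
have OV x : O x -> O x^-1 -> False.
  move=> /asboolP[e he] /asboolP[e' he']; apply: (hN (s * e - e + e')%N).
  rewrite iterD -he' he iter_frobV -iterD subnK ?itM //.
  by rewrite leq_pmull.
pose c x : rat := if O x then 1 else if O x^-1 then -1 else 0.
have cV x : c x^-1 = - c x.
  rewrite /c invrK; case: (boolP (O x)) => h; case: (boolP (O x^-1)) => h'; rewrite ?opprK ?oppr0 //.
  by case: (OV x h h').
have cF x : c (fr x) = c x by rewrite /c -frV !OF.
have step x y (b : bool) : x = (if b then y^-1 else y) -> c x = (-1) ^+ b * c y.
  by move=> ->; case: b; rewrite ?cV ?expr1 ?expr0 ?mulN1r ?mul1r.
pose V : {mpoly rat[3]} := \sum_i c (dl i) *: 'X_i.
have fixV (sg : {perm 'I_3}) (ep : 'I_3 -> bool) : (forall i, c (dl i) = (-1) ^+ ep i * c (dl (sg i))) ->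
    lin_sub (sgmx sg ep) V = V.
  move=> h; rewrite /V lin_sub_sum [RHS](reindex_inj (@perm_inj _ sg)) /=; apply: eq_bigr => i _.
  rewrite lin_subZ lin_sub_sgmxX scalerA h mulrAC -expr2 sqrr_sign mul1r //.
have IV : Inv dl V by move=> sg ep hpres; apply: fixV => i; apply: step.
have FV : lin_sub (sgmx tau eps) V = V.
  by apply: fixV => i; rewrite -(cF (dl (tau i))); apply: step; rewrite {1}hF; case: (eps i); rewrite // exprVn.
have Vh : V \is 1.-homog.
  by apply: rpred_sum => i _; apply: rpredZ; have := @Xn_homog 3 i 1; rewrite expr1.
have V0 : V@_0%MM = 0 by apply: (dhomog_nemf_coeff Vh); rewrite /= mdeg0.
have [L [LD LZ Ld LV _]] : separating (Inv dl) V (fun=> False).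
  apply: (@springer k dl (fun j => (j == i0)%:R) 1%g (fun=> false) 1 1) => //.
  - by move=> i; rewrite perm1.
  - by move=> i; rewrite perm1 expr0 !mul1r.
  - by move=> [|[|]].
  have -> : line_poly (fun j => (j == i0)%:R) V = 'X.
    have L0 : line_poly (fun j : 'I_3 => (j == i0)%:R) 0 = 0 by rewrite /line_poly mmap0.
    rewrite /V (big_morph _ (line_polyD _) L0) (bigD1 i0) //= big1 ?addr0 => [|j /negPf ji].
      rewrite line_polyZ -[X in line_poly _ X]expr1 line_polyX eqxx expr1n scale1r expr1 /c.
      by rewrite (_ : O _) ?rmorph1 ?scale1r //; apply/asboolP; exists 0%N.
    by rewrite line_polyZ -[X in line_poly _ X]expr1 line_polyX ji expr1 scale0r scaler0.
  by rewrite coefX oner_neq0.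
have ID := @Inv_D k dl; have IZ := @Inv_Z k dl.
case=> t [b [B [hb hex hB ->]]]; have [cc [hcc _]] := hex V (conj IV V0) Vh.
have lin := lin_sub_sum.
have e1 : inv_dec (Inv dl) (V - lincomb b cc) by [].
have FrD := @lin_subD _ _ (sgmx tau eps); have FrZ := @lin_subZ _ _ (sgmx tau eps); have FrM := @lin_subM _ _ (sgmx tau eps).
have Frpos q : inv_pos (Inv dl) q -> inv_pos (Inv dl) (lin_sub (sgmx tau eps) q) by apply: frob_inv_pos.
have e2 : inv_dec (Inv dl) (V - lincomb (fun i => lin_sub (sgmx tau eps) (b i)) cc).
  have := Fr_dec FrD FrZ Frpos FrM e1; rewrite FrD -scaleN1r FrZ scaleN1r FV.
  by rewrite (Fr_lincomb FrD FrZ).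
have e3 := lincomb_dec IZ cc hB.
have e4 : inv_dec (Inv dl) (lincomb b (fun j => \sum_i cc i * B i j + (-1) * cc j)).
  rewrite lincombD lincombZ scaleN1r.
  have -> : lincomb b (fun j => \sum_i cc i * B i j) - lincomb b cc =
    (V - lincomb b cc) - ((V - lincomb (fun i => lin_sub (sgmx tau eps) (b i)) cc) +
     (lincomb (fun i => lin_sub (sgmx tau eps) (b i)) cc - lincomb b (fun j => \sum_i cc i * B i j))) by ring.
  by apply: inv_decB => //; apply: inv_decD.
have e5 := inv_gdet_indep IZ hb hex e4.
(* The coordinates of [V] in the basis form a left eigenvector of [B] with eigenvalue 1. *)
rewrite -horner_evalE -det_map_mx; apply/eqP/det0P; exists (\row_j cc j).
  apply/eqP => /rowP z; move: LV; rewrite (_ : L V = 0) ?eqxx //.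
  have := Ld _ e1; rewrite /lincomb big1 ?subr0 // => i _; have := z i; rewrite !mxE => ->.
  by rewrite scale0r.
apply/rowP => j; rewrite !mxE; have := e5 j; rewrite mulN1r => e6.
rewrite (eq_bigr (fun i => cc i * (i == j)%:R - cc i * B i j)) => [|i _].
  rewrite sumrB (bigD1 j) //= eqxx mulr1 big1 ?addr0 => [|i /negPf ->]; last by rewrite mulr0.
  by rewrite -opprB e6 oppr0.
by rewrite !mxE /= /horner_eval; case: (i == j); rewrite ?mulr1n ?mulr0n !hornerE; ring.
Qed.

End FixedVector.

(** * Rational elements of canonical type and their motives *)

Section Values.
Variables (k : closedFieldType) (p : nat) (hp : p \in [pchar k]).
Hypothesis halg : forall x : k, exists2 s, (0 < s)%N & x ^+ (p ^ s) = x.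
Local Notation frb a := (map_mx (frobr hp a)).
Variables (d : nat) (d0 : (0 < d)%N).
Local Notation Q := (p ^ d)%N.
Local Notation M6 := 'M[k]_(3 + 3).
Local Notation fr := (@powq k Q).
Variables (O1 R2 R3 : seq k).
Hypotheses (hO1 : inv_reps p d O1) (hR2 : frob_reps p d 2 (fun x => x ^+ 2 != 1) R2)
  (hR3 : frob_reps p d 3 (fun x => x ^+ Q.+1 != 1) R3).
Local Notation types := (canonical_types p d O1 R2 R3).

Definition framed_by (x : M6) (dl : 'I_3 -> k) := exists2 g : M6, @Sp k 3 g & g *m x = dgmx dl *m g.
Definition rational_element (x : M6) := @Sp k 3 x /\ frb d x = x.

(** The change of frame [h] intertwines two diagonal matrices. A nonzero term in the expansion of
    its determinant is a permutation matching their entries. *)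
Lemma framed_multiplicity x dl dl' : framed_by x dl -> framed_by x dl' -> multiplicity dl =1 multiplicity dl'.
Proof.
case=> g Sg gx [g' Sg' gx'] a; have ug := Sp_unit Sg; pose h := g' *m invmx g.
have uh : h \in unitmx by rewrite unitmx_mul (Sp_unit Sg') unitmx_inv.
have hE : h *m dgmx dl = dgmx dl' *m h.
  apply: (can_inj (mulmxK ug)); rewrite -!mulmxA -gx /h !mulmxA mulmxKV //.
  by rewrite gx' mulmxKV.
clearbody h.
have ent s t : h s t != 0 -> dgval dl t = dgval dl' s.
  move=> hst; have := congr1 (fun z : M6 => z s t) hE; rewrite /dgmx mul_mx_diag mul_diag_mx !mxE => e.
  by apply: (mulIf hst); rewrite -e mulrC.
have [pi hpi] : exists pi : 'S_(3 + 3), forall s, h s (pi s) != 0.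
  move: uh; rewrite unitmxE unitfE /determinant => D0.
  have /existsP[pi hpi] : [exists pi : 'S_(3 + 3), (-1) ^+ pi * \prod_i h i (pi i) != 0].
    by apply: contraR D0; rewrite negb_exists => /forallP z; apply/eqP; rewrite big1 // => pi _; apply/eqP; have := z pi; rewrite negbK.
  exists pi => s; move: hpi; rewrite mulf_eq0 negb_or => /andP[_]; rewrite prodf_seq_neq0 => /allP/(_ s).
  by apply; rewrite mem_index_enum.
rewrite /multiplicity (reindex_inj (@perm_inj _ pi)) /=; apply: eq_bigr => s _.
by rewrite (ent s (pi s)).
Qed.

Lemma framed_signed x dl dl' : framed_by x dl' -> signed_rel dl dl' -> framed_by x dl.
Proof.
case=> g Sg gx [s [e h]]; have Sn := nmx_Sp k s e; have un := Sp_unit Sn.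
exists (invmx (nmx k s e) *m g); first by apply: SpM => //; apply: SpV.
have e1 : dgmx dl' *m nmx k s e = nmx k s e *m dgmx dl.
  by apply: nmx_dgmx => i; rewrite h; case: (e i); rewrite ?invrK.
rewrite -mulmxA gx mulmxA (_ : invmx (nmx k s e) *m dgmx dl' = dgmx dl *m invmx (nmx k s e)) ?mulmxA //.
by apply: (can_inj (mulmxK un)); rewrite mulmxKV // -mulmxA e1 mulKmx.
Qed.

Lemma canonical_iter t i : t \in types -> exists e, iter e fr (type_fun t i) = (type_fun t i)^-1.
Proof.
have U x : x \in flags k p ++ O1 -> exists e, iter e fr x = x^-1.
  move=> xR; exists 1%N; apply/eqP; rewrite /= -(unitaryE p d (R1_neq0 hp hO1 xR)).
  by rewrite (R1_unitary hp hO1 xR).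
case/(canonical_typeP) => [[st tR _]|[l [c [lR cR ->]]]|[l lR ->]].
- apply: U; apply: tR; case: t st => [|a [|b [|c []]]] // _.
  by move: i; elim/I3P; rewrite /type_fun /f3 /= !inE eqxx ?orbT.
- have [_ hR _ _] := hR2; have [lV l0 _] := hR l lR.
  move: i; elim/I3P; rewrite /type_fun /f3 /=; [by exists 2%N| |exact: U].
  by exists 2%N; apply: (iter_frob_shift 1 lV).
- have [_ hR _ _] := hR3; have [lV l0 _] := hR l lR.
  move: i; elim/I3P; rewrite /type_fun /f3 /=; exists 3%N => //.
    exact: (iter_frob_shift 1 lV).
  exact: (iter_frob_shift 2 lV).
Qed.

Section OneType.
Variables (t : seq k) (E : nat -> {poly rat}).
Hypotheses (ht : t \in types) (hE : frame_pattern hp d (type_fun t) E).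
Let dl := type_fun t.
Let dl0 : torus_points dl.
Proof.
exact: (canonical_torus hp hO1 hR2 hR3 ht).
Qed.

(** A solution of Lang's equation for the signed permutation of the pattern conjugates the diagonal
    matrix of [dl] to a rational one, as that permutation compensates the Frobenius of [dl]. *)
Lemma type_element : exists2 x, rational_element x & framed_by x dl.
Proof.
have [sg [eps [_ hsg _ _ _]]] := hE; have [g Sg Fg] := lang_Sp hp halg d0 sg eps.
have ug := Sp_unit Sg; have un := Sp_unit (nmx_Sp k sg eps).
have gx : g *m (invmx g *m dgmx dl *m g) = dgmx dl *m g by rewrite !mulmxA mulmxV // mul1mx.
exists (invmx g *m dgmx dl *m g); last by exists g.
split; first by apply: SpM => //; apply: SpM; [apply: SpV|apply: dgmx_Sp].
apply: (can_inj (mulKmx (_ : nmx k sg eps *m g \in unitmx))); first by rewrite unitmx_mul un ug.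
rewrite -{1}Fg -map_mxM gx map_mxM map_dgmx Fg -[RHS]mulmxA gx !mulmxA; congr (_ *m _).
apply: nmx_dgmx => i; exact: hsg.
Qed.

(** Two frames with the same monomial Frobenius differ by a rational matrix. *)
Lemma type_conjugate x y : rational_element x -> rational_element y -> framed_by x dl -> framed_by y dl ->
  exists2 h, rational_element h & y = h *m x *m invmx h.
Proof.
move=> [Sx Fx] [Sy Fy] [g0 Sg0 gx0] [g1 Sg1 gy1]; have [sg [eps [hfr _ _ _ _]]] := hE.
have [g [Sg gx Fg]] := hfr _ _ Fx Sx Sg0 gx0; have [g' [Sg' gy Fg']] := hfr _ _ Fy Sy Sg1 gy1.
have ug := Sp_unit Sg; have ug' := Sp_unit Sg'; have un := Sp_unit (nmx_Sp k sg eps).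
exists (invmx g' *m g); first split; first by apply: SpM => //; apply: SpV.
  rewrite map_mxM map_invmx Fg Fg' invmx_mulmx // !mulmxA mulmxKV //.
rewrite invmx_mulmx ?unitmx_inv // invmxK -(mulmxA (invmx g')) gx !mulmxA mulmxK // -mulmxA -gy mulKmx //.
Qed.

(** The pattern shows that a motive polynomial exists. The one selected by [motive_det] comes from
    some frame with eigenvalues [dl']; classification and multiplicities identify [dl'] with [dl] up
    to a signed permutation, and uniqueness of the graded determinants gives the value. *)
Lemma type_motive (C : numFieldType) x : rational_element x -> framed_by x dl ->
  forall y : C, (map_poly ratr (motive_det Q (centralizer (@Sp k 3) [set x]))).[y] = eval_motive Q E y.
Proof.
move=> [Sx Fx] fx y; have [sg [eps [hfr hsg hsp hg E6]]] := hE.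
have exP : exists P, is_motive_det Q (centralizer (@Sp k 3) [set x]) P.
  have [g0 Sg0 gx0] := fx; have [g [Sg gx Fg]] := hfr _ _ Fx Sx Sg0 gx0.
  have [pv [f [c [h1 h2 h3 h4 h5]]]] := hsp; exists (\prod_(1 <= n < 7) (E n \Po (Q%:R ^+ n.-1 *: 'X))).
  apply: (@motive_det_exists k p hp d x g dl sg eps Sg gx Fg pv f c h1 h2 h3 h4 h5 E 6) => // n n0.
  apply: hg => // i; rewrite /inv_eps; have := hsg (sg^-1%g i); rewrite permKV -/dl => {1}->.
  by case: (eps _); rewrite // exprVn.
have /motive_det_frame : is_motive_det Q (centralizer (@Sp k 3) [set x]) (motive_det Q (centralizer (@Sp k 3) [set x])).
  exact: (xgetPex 0 exP).
move=> /(_ hp halg Sx Fx)[g [dl' [sg' [eps' [Sg dl'0 gx hF [D [N [hD DN ->]]]]]]]].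
have fx' : framed_by x dl' by exists g.
have hU i : exists e, iter e fr (dl' i) = (dl' i)^-1.
  have [j] := @multiplicity_same k dl' dl i dl'0 (framed_multiplicity fx' fx); have [e he] := canonical_iter j ht.
  by case/orP => /eqP ->; exists e; rewrite ?iter_frobV he.
have [t' ht' rel] := classify hp hO1 hR2 hR3 dl'0 hF hU.
have fx'' := framed_signed fx' rel.
have tt' : t' = t.
  exact: (canonical_inj hp d0 hO1 hR2 hR3 ht' ht (framed_multiplicity fx'' fx)).
rewrite tt' in rel; have [s [e he]] := rel.
have dlE' : dl' = mono (sgmx s e) dl by apply/funext => i; rewrite mono_sgmx he.
have [tau [ep [hF' htr]]] := inv_gdet_signed dl0 dlE' hF.
apply: motive_poly_eval => // n n0.
have h1 := htr _ _ (hD n n0); have h2 := hg tau ep hF' n n0.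
apply: inv_gdet_uniq h1 h2; solve [exact: Inv_D|exact: Inv_Z|exact: lin_subD|exact: lin_subZ|exact: lin_subM|move=> *; exact: Inv_D|move=> *; exact: Inv_Z|by move=> *; apply: (frob_inv_pos hF')|by move=> *; apply: frob_inv_pos].
Qed.

End OneType.

(** If every eigenvalue of the underlying frame were inverted by a power of Frobenius, the
    classification would produce a type of [x]; so [nonunitary_gdet] applies to the factor of degree
    1. *)
Lemma motive_zero (C : numFieldType) x : rational_element x -> (forall t, t \in types -> ~ framed_by x (type_fun t)) ->
  (map_poly ratr (motive_det Q (centralizer (@Sp k 3) [set x]))).[1] = 0 :> C.
Proof.
move=> [Sx Fx] hno; rewrite /motive_det; set S := [set P | _].
(* If there is no motive polynomial, [motive_det] takes its default value 0, which also vanishes at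
   1. *)
have [exP|nP] := pselect (exists P, S P); last first.
  by rewrite xgetPN ?rmorph0 ?horner0 // => P SP; apply: nP; exists P.
have /motive_det_frame : S (xget 0 S) := xgetPex 0 exP.
move=> /(_ hp halg Sx Fx)[g [dl' [sg' [eps' [Sg dl'0 gx hF [D [N [hD DN ->]]]]]]]].
have fx' : framed_by x dl' by exists g.
have [hU|] := pselect (forall i, exists e, iter e fr (dl' i) = (dl' i)^-1).
  have [t' ht' rel] := classify hp hO1 hR2 hR3 dl'0 hF hU.
  by case: (hno t' ht'); apply: framed_signed fx' rel.
move/existsNP => [i /forallNP hN].
have D1 := nonunitary_gdet hp halg dl'0 hF hN (hD 1%N isT).
rewrite -[X in _.[X] = _](rmorph1 (ratr : rat -> C)) horner_map /= horner_prod.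
case: N DN => [|N] DN; first by move: D1; rewrite DN // hornerC => /eqP; rewrite oner_eq0.
by rewrite big_nat_recl //= ?expr0 scale1r comp_polyXr D1 mul0r rmorph0.
Qed.

End Values.

(** * Sums over pairs and combinations, counted by self-inverse entries *)

Section Counting.
Variables (T : eqType) (C : numFieldType) (phi : pred T).
Implicit Type s : seq T.
Local Notation e s := ((count phi s)%:R : C).
Local Notation f s := ((count (predC phi) s)%:R : C).

Lemma bin2_natr n : 'C(n, 2)%:R = n%:R * (n%:R - 1) / 2 :> C.
Proof.
elim: n => [|n IH]; first by rewrite bin0n !mul0r.
by rewrite binS bin1 natrD IH -natr1; field; rewrite ?pnatr_eq0.
Qed.

Lemma bin3_natr n : 'C(n, 3)%:R = n%:R * (n%:R - 1) * (n%:R - 2) / 6 :> C.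
Proof.
elim: n => [|n IH]; first by rewrite bin0n !mul0r.
by rewrite binS natrD IH bin2_natr -natr1; field; rewrite ?pnatr_eq0.
Qed.

Lemma sum_flag s (w : bool -> C) : \sum_(a <- s) w (phi a) = e s * w true + f s * w false.
Proof.
elim: s => [|a s IH]; first by rewrite big_nil /= !mul0r addr0.
by rewrite big_cons IH /= !natrD; case: (phi a) => /=; ring.
Qed.

Lemma sum_combs0 s (v : nat -> C) : \sum_(t <- combs 0 s) v (count phi t) = v 0%N.
Proof. by case: s => [|a s]; rewrite /= big_cons big_nil addr0. Qed.

Lemma sum_combsS n a s (v : nat -> C) : \sum_(t <- combs n.+1 (a :: s)) v (count phi t) =
  \sum_(t <- combs n s) v (phi a + count phi t)%N + \sum_(t <- combs n.+1 s) v (count phi t).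
Proof. by rewrite combsS big_cat big_map. Qed.

Lemma sum_combs1 s (v : nat -> C) : \sum_(t <- combs 1 s) v (count phi t) = e s * v 1%N + f s * v 0%N.
Proof.
elim: s => [|a s IH]; first by rewrite big_nil /= !mul0r addr0.
rewrite sum_combsS IH (sum_combs0 s (fun i => v (phi a + i)%N)) /= !natrD.
by case: (phi a) => /=; rewrite ?add1n ?add0n; ring.
Qed.

Lemma sum_combs2 s (v : nat -> C) : \sum_(t <- combs 2 s) v (count phi t) =
  'C(count phi s, 2)%:R * v 2%N + e s * f s * v 1%N + 'C(count (predC phi) s, 2)%:R * v 0%N.
Proof.
elim: s => [|a s IH]; first by rewrite big_nil /= !mul0r !addr0.
rewrite sum_combsS IH (sum_combs1 s (fun i => v (phi a + i)%N)) /=.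
by case: (phi a) => /=; rewrite ?add1n ?add0n ?binS ?bin1 ?natrD -?natr1; ring.
Qed.

Lemma sum_combs3 s (v : nat -> C) : \sum_(t <- combs 3 s) v (count phi t) =
  'C(count phi s, 3)%:R * v 3%N + 'C(count phi s, 2)%:R * f s * v 2%N +
  e s * 'C(count (predC phi) s, 2)%:R * v 1%N + 'C(count (predC phi) s, 3)%:R * v 0%N.
Proof.
elim: s => [|a s IH]; first by rewrite big_nil /= !mul0r !addr0.
rewrite sum_combsS IH (sum_combs2 s (fun i => v (phi a + i)%N)) /=.
by case: (phi a) => /=; rewrite ?add1n ?add0n ?binS ?bin1 ?natrD -?natr1; ring.
Qed.

Lemma sum_distinct_pairs s (w : bool -> bool -> C) : uniq s ->
  \sum_(u <- [seq (a, b) | a <- s, b <- s] | u.1 != u.2) w (phi u.1) (phi u.2) =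
  e s * (e s - 1) * w true true + e s * f s * w true false +
  f s * e s * w false true + f s * (f s - 1) * w false false.
Proof.
move=> us; rewrite big_mkcond big_allpairs /=.
have -> : \sum_(a <- s) \sum_(b <- s) (if a != b then w (phi a) (phi b) else 0) =
    \sum_(a <- s) \sum_(b <- s) w (phi a) (phi b) - \sum_(a <- s) w (phi a) (phi a).
  rewrite -sumrB; apply: eq_big_seq => a aS.
  rewrite (bigD1_seq a) //= eqxx add0r [X in _ = X - _](bigD1_seq a) //= [RHS]addrC addKr.
  by apply: eq_bigr => b; rewrite eq_sym => ->.
rewrite (sum_flag s (fun x => w x x)).
have -> : \sum_(a <- s) \sum_(b <- s) w (phi a) (phi b) =
    \sum_(a <- s) (e s * w (phi a) true + f s * w (phi a) false).
  by apply: eq_bigr => a _; rewrite (sum_flag s (w (phi a))).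
by rewrite (sum_flag s (fun x => e s * w x true + f s * w x false)); ring.
Qed.

End Counting.

(** * Semisimple classes and canonical types *)

Section Classes.
Variables (k : closedFieldType) (p : nat) (hp : p \in [pchar k]).
Hypothesis halg : forall x : k, exists2 s, (0 < s)%N & x ^+ (p ^ s) = x.
Local Notation frb a := (map_mx (frobr hp a)).
Variables (d : nat) (d0 : (0 < d)%N).
Local Notation Q := (p ^ d)%N.
Local Notation M6 := 'M[k]_(3 + 3).
Local Notation fr := (@powq k Q).
Local Notation Gm := (rational_points Q (@Sp k 3)).
Local Notation frame_pattern := (frame_pattern hp d).

Lemma rational_elementM x y : Gm x -> Gm y -> Gm (x *m y).
Proof.
move=> [Sx Fx] [Sy Fy]; have e : frb d (x *m y) = x *m y by rewrite map_mxM; congr (_ *m _).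
by split; [apply: SpM|apply: e].
Qed.

Lemma rational_elementV x : Gm x -> Gm (invmx x).
Proof.
move=> [Sx Fx]; have e : frb d (invmx x) = invmx x by rewrite map_invmx; congr invmx.
by split; [apply: SpV|apply: e].
Qed.

Lemma rational_element1 : Gm 1%:M.
Proof.
have e : frb d (1%:M : M6) = 1%:M by rewrite map_scalar_mx rmorph1.
by split; [rewrite /Sp /= trmx1 mul1mx mulmx1|apply: e].
Qed.

Lemma conj_class_conj h x : Gm h -> conj_class Gm (h *m x *m invmx h) = conj_class Gm x.
Proof.
move=> Gh; have [Sh _] := Gh; have uh := Sp_unit Sh; apply/seteqP; split=> y [g Gg <-]; have [Sg _] := Gg; have ug := Sp_unit Sg.
  by exists (g *m h); [apply: rational_elementM|rewrite invmx_mulmx // !mulmxA].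
exists (g *m invmx h); first by apply: rational_elementM => //; apply: rational_elementV.
by rewrite invmx_mulmx ?unitmx_inv // invmxK !mulmxA !(mulmxKV uh).
Qed.

Variables (O1 R2 R3 : seq k).
Hypotheses (hO1 : inv_reps p d O1) (hR2 : frob_reps p d 2 (fun x => x ^+ 2 != 1) R2)
  (hR3 : frob_reps p d 3 (fun x => x ^+ Q.+1 != 1) R3).
Local Notation types := (canonical_types p d O1 R2 R3).
Local Notation R1 := (flags k p ++ O1).

Lemma R1_mul a b : a \in R1 -> b \in R1 -> a != b -> a * b != 1.
Proof.
move=> aR bR; apply: contra => /eqP e; apply/eqP/esym; apply: (R1_inv hp hO1 aR bR).
by apply: (mulfI (R1_neq0 hp hO1 aR)); rewrite e mulfV // (R1_neq0 hp hO1 aR).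
Qed.

Lemma canonical_frame_aaa a : a \in R1 -> frame_pattern (type_fun [:: a; a; a]) (block_factor a 3).
Proof. by move=> aR; apply: pattern_aaa => //; apply: (R1_unitary hp hO1). Qed.

Lemma canonical_frame_aab a b : a \in R1 -> b \in R1 -> a != b ->
  frame_pattern (type_fun [:: a; a; b]) (fun n => block_factor a 2 n * block_factor b 1 n).
Proof.
move=> aR bR ab; apply: pattern_aab => //; by [apply: (R1_unitary hp hO1)|apply: R1_mul].
Qed.

Lemma canonical_frame_abc a b c : subseq [:: a; b; c] R1 ->
  frame_pattern (type_fun [:: a; b; c]) (fun n => block_factor a 1 n * (block_factor b 1 n * block_factor c 1 n)).
Proof.
move=> ss; have := subseq_uniq ss (uniq_R1 hp hO1); rewrite /= !inE negb_or andbT => /andP[/andP[ab ac] bc].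
have sub x : x \in [:: a; b; c] -> x \in R1 := mem_subseq ss (x := x).
have aR : a \in R1 by apply: sub; rewrite !inE eqxx.
have bR : b \in R1 by apply: sub; rewrite !inE eqxx orbT.
have cR : c \in R1 by apply: sub; rewrite !inE eqxx !orbT.
by apply: pattern_abc => //; by [apply: (R1_unitary hp hO1)|apply: R1_mul].
Qed.

Lemma canonical_frame_quad l c : l \in R2 -> c \in R1 ->
  frame_pattern (type_fun [:: l; fr l; c]) (fun n => (if n == 1%N then 1 + 'X^2 else 1) * block_factor c 1 n).
Proof.
move=> lR cR; have [_ hR _ _] := hR2; have [lV l0 l2] := hR l lR.
by apply: pattern_quad => //; [rewrite -iter_frob|apply: (R1_unitary hp hO1)].
Qed.

Lemma canonical_frame_cubic l : l \in R3 ->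
  frame_pattern (type_fun [:: l; fr l; fr (fr l)]) (fun n => if n == 1%N then 1 + 'X^3 else 1).
Proof.
move=> lR; have [_ hR _ _] := hR3; have [lV l0 l2] := hR l lR.
by apply: pattern_cubic => //; rewrite -iter_frob.
Qed.

Lemma canonical_pattern t : t \in types -> exists E, frame_pattern (type_fun t) E.
Proof.
case/canonical_typeP => [[st tR]|[l [c [lR cR ->]]]|[l lR ->]].
- case=> [[a aR ->]|[a [b [aR bR ab ->]]]|ss].
  + by exists (block_factor a 3); apply: canonical_frame_aaa.
  + by exists (fun n => block_factor a 2 n * block_factor b 1 n); apply: canonical_frame_aab.
  case: t st {tR} ss => [|a [|b [|c []]]] // _ ss.
  by exists (fun n => block_factor a 1 n * (block_factor b 1 n * block_factor c 1 n)); apply: canonical_frame_abc.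
- by exists (fun n => (if n == 1%N then 1 + 'X^2 else 1) * block_factor c 1 n); apply: canonical_frame_quad.
- by exists (fun n => if n == 1%N then 1 + 'X^3 else 1); apply: canonical_frame_cubic.
Qed.

(** The five families are told apart by repeated entries and by the membership in [R1] of the first
    or of the last entry. *)
Lemma uniq_canonical_types : uniq types.
Proof.
have uR := uniq_R1 hp hO1; have [u2 hm2 _ _] := hR2; have [u3 hm3 _ _] := hR3.
have n2 l : l \in R2 -> l \in R1 -> False.
  move=> lR /(R1_unitary hp hO1) lU; have [lV l0] := hm2 l lR; apply/negP; rewrite negbK.
  have e : fr l = l^-1 by apply/eqP; rewrite -(unitaryE p d l0) lU.
  have eV : fr l^-1 = (fr l)^-1 by rewrite /powq exprVn.
  move: lV; rewrite /= e eV e invrK => e1.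
  by rewrite expr2 {1}e1 mulVf.
have n3 l : l \in R3 -> l \in R1 -> False.
  by move=> lR /(R1_unitary hp hO1) lU; have [_ _] := hm3 l lR; rewrite lU eqxx.
have n3' l : l \in R3 -> fr (fr l) \in R1 -> False.
  move=> lR /(R1_unitary hp hO1); have [_ _ /negP h] := hm3 l lR => e; apply: h; apply/eqP.
  apply: (@frob_inj k p hp d); apply: (@frob_inj k p hp d); rewrite /= !expr1n -e /powq -!exprM.
  by congr (_ ^+ _); rewrite mulnC mulnA.
have abcR x : x \in types_abc p O1 -> uniq x /\ {subset x <= R1}.
  rewrite mem_combs => /andP[ss _]; split; first exact: subseq_uniq ss uR.
  by move=> y; apply: mem_subseq.
rewrite /canonical_types !cat_uniq !has_cat !negb_or; apply/and5P; split.
- by rewrite map_inj_uniq // => a b [].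
- have noR1 (s : seq (seq k)) : (forall x, x \in s -> x`_0 \in R1 -> x`_0 = x`_2 -> False) -> ~~ has (mem (types_aaa p O1)) s.
    move=> h; apply/hasPn => x xs; apply/negP => /mapP[a aR e]; apply: (h x xs); by rewrite e.
  apply/and4P; split; apply: noR1 => x.
  + by move=> /mapP[[a b]]; rewrite mem_filter => /andP[/= ab _] -> /= _ e; rewrite e eqxx in ab.
  + move=> xa _; have [+ _] := abcR x xa; move: xa; rewrite mem_combs => /andP[_].
    by case: x => [|a [|b [|c []]]] //= _ + e; rewrite e !inE eqxx orbT.
  + by move=> /allpairsP[[l c] [/= lR cR ->]] /= lR'; case: (n2 l lR lR').
  + by move=> /mapP[l lR ->] /= lR'; case: (n3 l lR lR').
- rewrite map_inj_in_uniq; last by move=> [a b] [a' b'] _ _ /= [-> _ ->].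
  by apply: filter_uniq; apply: allpairs_uniq => // -[a b] [a' b'].
- have noR1 (s : seq (seq k)) : (forall x, x \in s -> x`_0 \in R1 -> ~~ uniq x -> False) -> ~~ has (mem (types_aab p O1)) s.
    move=> h; apply/hasPn => x xs; apply/negP => /mapP[[a b]]; rewrite mem_filter => /andP[_ /allpairsP[[a' b'] [/= aR _ [ea eb]]]] e.
    by apply: (h x xs); rewrite e /= ?ea // inE eqxx.
  apply/and3P; split; apply: noR1 => x.
  + by move=> xa _; have [-> _] := abcR x xa.
  + by move=> /allpairsP[[l c] [/= lR cR ->]] /= lR'; case: (n2 l lR lR').
  + by move=> /mapP[l lR ->] /= lR'; case: (n3 l lR lR').
- apply/and5P; split.
  + exact: uniq_combs.
  + apply/andP; split; apply/hasPn => x.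
      move=> /allpairsP[[l c] [/= lR cR ->]]; apply/negP => /abcR[_ /(_ l)]; rewrite inE eqxx => /(_ isT).
      exact: n2 lR.
    move=> /mapP[l lR ->]; apply/negP => /abcR[_ /(_ l)]; rewrite inE eqxx => /(_ isT).
    exact: n3 lR.
  + by apply: allpairs_uniq => // -[l c] [l' c'] _ _ /= [-> _ ->].
  + apply/hasPn => x /mapP[l lR ->]; apply/negP => /allpairsP[[l' c] [/= lR' cR [_ _ ec]]].
    by apply: (n3' l lR); rewrite ec.
  + by rewrite map_inj_uniq // => a b [].
Qed.

Variables (C : numFieldType) (q m : nat) (J : seq C).
Hypothesis hqm : (q ^ m = Q)%N.
Local Notation value g := (g 1 / g Q%:R * \prod_(a <- J) g (a ^+ m)).

(** Each type has exactly one class, and the other classes contribute 0 through the numerator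
    [P.[1]]. The element that [xget] picks in a class is known only up to rational conjugation,
    hence the function [val], specified by the patterns. *)
Lemma L_sum_types : exists val : seq k -> C -> C,
  (forall t E, t \in types -> frame_pattern (type_fun t) E -> val t =1 eval_motive Q E) /\
  L_sum q J (@Sp k 3) m = \sum_(t <- types) value (val t).
Proof.
have ex t : exists x, t \in types -> rational_element hp d x /\ framed_by x (type_fun t).
  have [tt|] := boolP (t \in types); last by exists 0.
  have [E hE] := canonical_pattern tt; have [x rx fx] := type_element halg d0 hO1 hR2 hR3 tt hE; by exists x.
have [xt hx] := choice ex; pose cls t := conj_class Gm (xt t).
have rep x : Gm x -> exists2 h, Gm h & xget 1%:M (conj_class Gm x) = h *m x *m invmx h.
  move=> Gx; have : conj_class Gm x (xget 1%:M (conj_class Gm x)).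
    by apply: (xgetPex 1%:M); exists x; exists 1%:M; [apply: rational_element1|rewrite mul1mx invmx1 mulmx1].
  by case=> h Gh e; exists h.
have clsE t : t \in types -> rational_element hp d (xget 1%:M (cls t)) /\ framed_by (xget 1%:M (cls t)) (type_fun t).
  move=> tt; have [rx fx] := hx t tt; have [h Gh ->] := rep _ rx; have [Sh _] := Gh; split.
    by apply: (rational_elementM (rational_elementM Gh rx)); apply: rational_elementV.
  have [g Sg gx] := fx; exists (g *m invmx h); first by apply: SpM => //; apply: SpV.
  by rewrite !mulmxA mulmxKV ?(Sp_unit Sh) // gx.
have inj : {in types &, injective cls}.
  move=> t t' tt tt' e; have [_ f0] := clsE t tt; have [_ f1] := clsE t' tt'; rewrite -e in f1.
  exact: (canonical_inj hp d0 hO1 hR2 hR3 tt tt' (framed_multiplicity f0 f1)).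
have ss t : t \in types -> semisimple_classes Q (@Sp k 3) (cls t).
  move=> tt; have [rx [g Sg gx]] := hx t tt; exists (xt t) => //; split=> //.
  exact: conj_diagonalizable Sg gx.
exists (fun t y => (map_poly ratr (motive_det Q (centralizer (@Sp k 3) [set xget 1%:M (cls t)]))).[y]); split.
  move=> t E tt hE y; have [r0 f0] := clsE t tt.
  exact: (type_motive halg d0 hO1 hR2 hR3 tt hE r0 f0).
rewrite /L_sum /L_value hqm (@fsbigE _ _ _ _ _ (map cls types)).
- rewrite big_map big_seq_cond [RHS]big_seq; apply: eq_bigl => t.
  by case: (boolP (t \in types)) => //= tt; rewrite mem_set //; apply: ss.
- by rewrite map_inj_in_uniq // uniq_canonical_types.
- by move=> c /= /mapP[t tt ->]; apply: ss.
move=> c [x [Gx dx] <-] nr; have [h Gh e0] := rep x Gx.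
have r0 : rational_element hp d (xget 1%:M (conj_class Gm x)).
  by rewrite e0; apply: (rational_elementM (rational_elementM Gh Gx)); apply: rational_elementV.
(* If the chosen element were framed by a type, it would be conjugate to the element built for that
   type, and its class would be in the list. *)
have z : (map_poly ratr (motive_det Q (centralizer (@Sp k 3) [set xget 1%:M (conj_class Gm x)]))).[1] = 0 :> C.
  apply: (motive_zero halg hO1 hR2 hR3 C r0) => t tt fx; have [E hE] := canonical_pattern tt.
  have [rt ft] := hx t tt; have [h' Gh' e'] := type_conjugate hE rt r0 ft fx.
  case/negP: nr; apply/mapP; exists t => //; rewrite /cls -(conj_class_conj (xt t) Gh') -e' e0.
  by rewrite conj_class_conj.
by rewrite /= z !mul0r.
Qed.

End Classes.

(** * Contributions of the five families *)

Section LSum.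
Variables (k : closedFieldType) (p : nat) (hp : p \in [pchar k]).
Hypothesis halg : forall x : k, exists2 s, (0 < s)%N & x ^+ (p ^ s) = x.
Variables (d : nat) (d0 : (0 < d)%N).
Local Notation Q := (p ^ d)%N.
Variables (C : numFieldType) (m : nat) (J : seq C).

Definition L_weight (g : C -> C) : C := g 1 / g Q%:R * \prod_(a <- J) g (a ^+ m).
Local Notation F := L_weight.
Local Notation b := (fun f M => block_value f M (Q%:R : C)).

Lemma L_weight_ext g g' : g =1 g' -> F g = F g'.
Proof. by move=> /funext ->. Qed.

Lemma block_value_true1 x : b true 1%N x = 1 - Q%:R * x.
Proof. by rewrite /block_value !big_ord_recr big_ord0 /=; ring. Qed.
Lemma block_value_false1 x : b false 1%N x = 1 + x.
Proof. by rewrite /block_value !big_ord_recr big_ord0 /=; ring. Qed.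
Lemma block_value_true2 x : b true 2%N x = (1 - Q%:R * x) * (1 - Q%:R ^+ 3 * x).
Proof. by rewrite /block_value !big_ord_recr big_ord0 /=; ring. Qed.
Lemma block_value_false2 x : b false 2%N x = (1 + x) * (1 - Q%:R * x).
Proof. by rewrite /block_value !big_ord_recr big_ord0 /=; ring. Qed.
Lemma block_value_true3 x : b true 3%N x = gA Q%:R x.
Proof. by rewrite /block_value !big_ord_recr big_ord0 /gA /=; ring. Qed.
Lemma block_value_false3 x : b false 3%N x = gG Q%:R x.
Proof. by rewrite /block_value !big_ord_recr big_ord0 /gG /=; ring. Qed.

Variables (O1 R2 R3 : seq k).
Hypotheses (hO1 : inv_reps p d O1) (hR2 : frob_reps p d 2 (fun x => x ^+ 2 != 1) R2)
  (hR3 : frob_reps p d 3 (fun x => x ^+ Q.+1 != 1) R3).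
Local Notation types := (canonical_types p d O1 R2 R3).
Local Notation R1 := (flags k p ++ O1).
Local Notation phi := (fun x : k => x ^+ 2 == 1).
Local Notation e := ((size (flags k p))%:R : C).
Local Notation n := ((size O1)%:R : C).
Variable val : seq k -> C -> C.
Hypothesis hval : forall t E, t \in types -> frame_pattern hp d (type_fun t) E -> val t =1 eval_motive Q E.

Lemma count_flags : count phi R1 = size (flags k p).
Proof.
rewrite count_cat (_ : count phi O1 = 0%N) ?addn0; last first.
  apply/eqP; rewrite -leqn0 leqNgt -has_count; apply/hasPn => x xO.
  by have [_ _ h _ _] := hO1; have [_] := h x xO.
by apply/eqP; rewrite -all_count; apply/allP => x; rewrite mem_flags.
Qed.

Lemma count_nonflags : count (predC phi) R1 = size O1.
Proof. by apply/eqP; rewrite -(eqn_add2l (count phi R1)) count_predC count_flags size_cat. Qed.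

Lemma sum_aaa : \sum_(t <- types_aaa p O1) F (val t) = e * F (gA Q%:R) + n * F (gG Q%:R).
Proof.
rewrite big_map -(L_weight_ext block_value_true3) -(L_weight_ext block_value_false3).
rewrite -count_flags -count_nonflags -(sum_flag phi R1 (fun f => F (b f 3%N))).
apply: eq_big_seq => a aR; apply: L_weight_ext => y.
rewrite (hval _ (canonical_frame_aaa hp halg d0 hO1 aR)) ?eval_block //.
by rewrite /canonical_types !mem_cat map_f.
Qed.

Lemma sum_aab : \sum_(t <- types_aab p O1) F (val t) = e * (e - 1) * F (gB Q%:R) + e * n * F (gC Q%:R)
  + n * e * F (gD Q%:R) + n * (n - 1) * F (gE Q%:R).
Proof.
pose w f f' := F (fun y => b f 2%N y * b f' 1%N y).
have -> : F (gB Q%:R) = w true true.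
  by apply: L_weight_ext => y; rewrite block_value_true2 block_value_true1 /gB; ring.
have -> : F (gC Q%:R) = w true false.
  by apply: L_weight_ext => y; rewrite block_value_true2 block_value_false1 /gC; ring.
have -> : F (gD Q%:R) = w false true.
  by apply: L_weight_ext => y; rewrite block_value_false2 block_value_true1 /gD; ring.
have -> : F (gE Q%:R) = w false false.
  by apply: L_weight_ext => y; rewrite block_value_false2 block_value_false1 /gE; ring.
rewrite -count_flags -count_nonflags -(sum_distinct_pairs phi w (uniq_R1 hp hO1)) /types_aab big_map big_filter.
rewrite big_seq_cond [RHS]big_seq_cond; apply: eq_bigr => -[a c] /andP[uS un].
have aR : a \in R1 by case/allpairsP: uS => -[x y] /= [xR _ [-> _]].
have cR : c \in R1 by case/allpairsP: uS => -[x y] /= [_ yR [_ ->]].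
apply: L_weight_ext => y; rewrite (hval _ (canonical_frame_aab hp halg d0 hO1 aR cR un)) ?eval_motiveM ?eval_block //.
have h : [:: a; a; c] \in types_aab p O1 by apply/mapP; exists (a, c); rewrite // mem_filter un.
by rewrite /canonical_types !mem_cat h orbT.
Qed.

Lemma sum_abc : \sum_(t <- types_abc p O1) F (val t) = e * (e - 1) / 2 * n * F (gD Q%:R)
  + e * (n * (n - 1) / 2) * F (gE Q%:R) + n * (n - 1) * (n - 2) / 6 * F (gH Q%:R).
Proof.
pose v i := F (fun y => b true 1%N y ^+ i * b false 1%N y ^+ (3 - i)).
have -> : F (gD Q%:R) = v 2%N.
  by apply: L_weight_ext => y; rewrite block_value_true1 block_value_false1 /gD; ring.
have -> : F (gE Q%:R) = v 1%N.
  by apply: L_weight_ext => y; rewrite block_value_true1 block_value_false1 /gE; ring.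
have -> : F (gH Q%:R) = v 0%N.
  by apply: L_weight_ext => y; rewrite block_value_true1 block_value_false1 /gH; ring.
have := sum_combs3 phi R1 v; rewrite count_flags count_nonflags.
(* At most two eigenvalues are self-inverse, so three distinct ones never occur. *)
rewrite (_ : 'C(size (flags k p), 3) = 0%N); last by rewrite bin_small // /flags; case: ifP.
rewrite mul0r add0r !bin2_natr bin3_natr => <-; apply: eq_big_seq => t tt.
have := tt; rewrite mem_combs => /andP[ss]; case: t ss tt => [|x [|y [|z []]]] // ss tt _; apply: L_weight_ext => u.
rewrite (hval _ (canonical_frame_abc hp halg d0 hO1 ss)) ?eval_motiveM ?eval_block //; last first.
  by rewrite /canonical_types !mem_cat tt !orbT.
have [tE fE] := (block_value_true1 u, block_value_false1 u); rewrite /= in tE fE; rewrite /=.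
by case: (x ^+ 2 == 1); case: (y ^+ 2 == 1); case: (z ^+ 2 == 1); rewrite /= ?tE ?fE; ring.
Qed.

Lemma sum_quad : \sum_(t <- types_quad p d O1 R2) F (val t) =
  (size R2)%:R * e * F (gF Q%:R) + (size R2)%:R * n * F (gI Q%:R).
Proof.
pose w f := F (fun y => (1 + y ^+ 2) * b f 1%N y).
have -> : F (gF Q%:R) = w true by apply: L_weight_ext => y; rewrite block_value_true1.
have -> : F (gI Q%:R) = w false by apply: L_weight_ext => y; rewrite block_value_false1.
rewrite /types_quad big_allpairs_dep /=.
have -> : (size R2)%:R * e * w true + (size R2)%:R * n * w false = \sum_(l <- R2) (e * w true + n * w false).
  by rewrite big_const_seq count_predT iter_addr_0 -[RHS]mulr_natl; ring.
apply: eq_big_seq => l lR; rewrite -count_flags -count_nonflags -(sum_flag phi R1 w); apply: eq_big_seq => c cR.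
apply: L_weight_ext => y; rewrite (hval _ (canonical_frame_quad hp halg d0 hO1 hR2 lR cR)) ?eval_motiveM ?eval_power ?eval_block //.
have h : [:: l; powq Q l; c] \in types_quad p d O1 R2 by apply/allpairsP; exists (l, c).
by rewrite /canonical_types !mem_cat h !orbT.
Qed.

Lemma sum_cubic : \sum_(t <- types_cubic p d R3) F (val t) = (size R3)%:R * F (gK Q%:R).
Proof.
rewrite /types_cubic big_map.
have -> : (size R3)%:R * F (gK Q%:R) = \sum_(l <- R3) F (gK Q%:R).
  by rewrite big_const_seq count_predT iter_addr_0 mulr_natl.
apply: eq_big_seq => l lR.
apply: L_weight_ext => y; rewrite (hval _ (canonical_frame_cubic hp halg d0 hR3 lR)) ?eval_power //.
by rewrite /canonical_types !mem_cat map_f ?orbT.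
Qed.

End LSum.

Lemma L_sum_total (k : closedFieldType) (p : nat) (hp : p \in [pchar k])
  (halg : forall x : k, exists2 s, (0 < s)%N & x ^+ (p ^ s) = x) (d : nat) (d0 : (0 < d)%N)
  (C : numFieldType) (q m : nat) (J : seq C) (hqm : (q ^ m = p ^ d)%N) : exists N1 N2 N3 : nat,
  let L (g : C -> C -> C) := g (q ^ m)%:R 1 / g (q ^ m)%:R (q ^ m)%:R * \prod_(a <- J) g (q ^ m)%:R (a ^+ m) in
  let e := (size (flags k p))%:R : C in let n := N1%:R : C in
  [/\ 2 * n + e = (q ^ m)%:R + 1, 4 * N2%:R + e = (q ^ m)%:R ^+ 2 + 1,
      6 * N3%:R = (q ^ m)%:R ^+ 3 - (q ^ m)%:R :> C &
    L_sum q J (@Sp k 3) m = e * L (@gA C) + n * L (@gG C) + e * (e - 1) * L (@gB C) + e * n * L (@gC C) +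
      (n * e + e * (e - 1) / 2 * n) * L (@gD C) + (n * (n - 1) + e * (n * (n - 1) / 2)) * L (@gE C) +
      n * (n - 1) * (n - 2) / 6 * L (@gH C) + N2%:R * e * L (@gF C) + N2%:R * n * L (@gI C) + N3%:R * L (@gK C)].
Proof.
have [O1 hO1] := exists_inv_reps hp d0; have [R2 [hR2 s2]] := exists_quad_reps hp d0.
have [R3 [hR3 s3]] := exists_cubic_reps hp d0.
exists (size O1), (size R2), (size R3) => L e n.
have rel (c a e' b : nat) : (c * a + e')%N = b.+1 -> c%:R * a%:R + e'%:R = b%:R + 1 :> C.
  by move=> h; rewrite -natrM -natrD h -natr1.
have hQ : (q ^ m)%:R = (p ^ d)%:R :> C by rewrite hqm.
split.
- by rewrite hQ; have [_ s1 _ _ _] := hO1; exact: (rel 2%N _ _ _ s1).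
- by rewrite hQ -natrX -expnM; exact: (rel 4%N _ _ _ s2).
- have e1 : (p ^ d).+1%:R = (p ^ d)%:R + 1 :> C by rewrite -natr1.
  have e3 : (p ^ (d * 3))%:R = (p ^ d)%:R ^+ 3 :> C by rewrite expnM natrX.
  have := rel 6%N _ _ _ s3; rewrite e1 e3 => h.
  by rewrite hQ; apply: (addIr ((p ^ d)%:R + 1)); rewrite h; ring.
have [val [hval ->]] := L_sum_types hp halg d0 hO1 hR2 hR3 J hqm.
have LF (g : C -> C -> C) : L g = L_weight p d m J (g (p ^ d)%:R) by rewrite /L hQ.
rewrite !LF /canonical_types !big_cat /=.
have H1 := sum_aaa halg d0 m J hO1 hval; have H2 := sum_aab halg d0 m J hO1 hval.
have H3 := sum_abc halg d0 m J hO1 hval; have H4 := sum_quad halg d0 m J hO1 hR2 hval.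
have H5 := sum_cubic halg d0 m J hR3 hval.
rewrite /L_weight in H1 H2 H3 H4 H5 *; rewrite H1 H2 H3 H4 H5 /e /n.
by move: (size O1) (size R2) (size R3) (size _) => *; ring.
Qed.

(** Frobenius permutes the roots of a polynomial with coefficients in the finite field, so two
    iterates of [x] coincide; injectivity cancels the smaller one. *)
Lemma algebraic_frobenius_periodic (Fq : finFieldType) (k : closedFieldType) (kappa : {rmorphism Fq -> k})
  (p n : nat) (hp : p \in [pchar k]) (x : k) : #|Fq| = (p ^ n)%N -> (0 < n)%N ->
  algebraicOver kappa x -> exists2 s, (0 < s)%N & x ^+ (p ^ s) = x.
Proof.
move=> cq n0 [P P0 rx]; set fr := @powq k (p ^ n).
have kP : map_poly (frobr hp n) (map_poly kappa P) = map_poly kappa P.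
  rewrite -map_poly_comp; apply: eq_map_poly => c /=.
  by rewrite -[frobr hp n _]/(kappa c ^+ (p ^ n)) -rmorphXn -cq expf_card.
have rj j : root (map_poly kappa P) (iter j fr x).
  elim: j => [|j IH] //; rewrite iterS -[fr _]/(frobr hp n (iter j fr x)) -{1}kP /root horner_map.
  by rewrite (eqP IH) rmorph0.
set N := size (map_poly kappa P); pose rs := [seq iter j fr x | j <- iota 0 N].
have nu : ~~ uniq rs.
  apply/negP => u; have P0' : map_poly kappa P != 0 by rewrite map_poly_eq0.
  have := max_poly_roots P0' _ u; rewrite size_map size_iota ltnn => h.
  by have : false by apply: h; apply/allP => y /mapP[j _ ->].
have [i [j [ij]]] := uniqPn 0 nu; rewrite size_map size_iota => jN.
have iN := ltn_trans ij jN; rewrite !(nth_map 0%N) ?size_iota // !nth_iota // !add0n.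
have inj : injective (iter i fr) by elim: i {ij iN} => [|i IH] a b //= /(@frob_inj k p hp n) /IH.
rewrite -{1}(subnKC (ltnW ij)) iterD => /inj e; exists (n * (j - i))%N; first by rewrite muln_gt0 n0 subn_gt0.
by rewrite -iter_frob -e.
Qed.

Theorem theorem6p6
  (R : realType)
  (Fq : finFieldType)
  (k : closedFieldType) (kappa : {rmorphism Fq -> k})
  (hk : forall x : k, algebraicOver kappa x)
  (X : curve Fq)
  (S : {fset set X}) (hS : forall v, v \in S -> closed_point v)
  (hS2 : (2 <= #|` S|)%N)
  (l : nat) (hl : prime l) (hlp : l \notin [pchar Fq])
  (E : padic_field l)
  (Qlbar : closedFieldType) (jl : {rmorphism E -> Qlbar})
  (hjl : forall x : Qlbar, algebraicOver jl x)
  (sigma : {rmorphism Qlbar -> R[i]}) (hsigma : bijective sigma)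
  (Omega : closedFieldType) (eps : {rmorphism X -> Omega})
  (heps : forall x : Omega, algebraicOver eps x)
  (r : nat) (A : 'M[E]_r) (hA : geom_frob_matrix eps A) :
  let JX := [seq sigma a | a <- roots_seq (map_poly jl (char_poly A))] in
  lefschetz_type (L_sum #|Fq| (J_total JX S) (@Sp k 3)).
Proof.
move=> JX; have [p pp hpF] := finPcharP Fq.
have hp : p \in [pchar k] by rewrite (fmorph_pchar kappa).
have [n cq] : exists n, #|Fq| = (p ^ n)%N by exists (logn p #|Fq|); apply: (card_pprimeChar hpF).
have q1 : (1 < #|Fq|)%N by apply/card_gt1P; exists 0, 1; rewrite eq_sym oner_eq0.
have n0 : (0 < n)%N by move: q1; rewrite cq; case: (n).
have halg x := algebraic_frobenius_periodic hp cq n0 (hk x).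
move: (J_total JX S) => J; pose e := size (flags k p).
have e12 : (e == 1%N) || (e == 2%N) by rewrite /e /flags; case: ifP.
have exN m : exists N : nat * nat * nat, (0 < m)%N -> let L (g : R[i] -> R[i] -> R[i]) :=
    g (#|Fq| ^ m)%:R 1 / g (#|Fq| ^ m)%:R (#|Fq| ^ m)%:R * \prod_(a <- J) g (#|Fq| ^ m)%:R (a ^+ m) in
  let e := e%:R : R[i] in let n := N.1.1%:R : R[i] in
  [/\ 2 * n + e = (#|Fq| ^ m)%:R + 1, 4 * N.1.2%:R + e = (#|Fq| ^ m)%:R ^+ 2 + 1,
      6 * N.2%:R = (#|Fq| ^ m)%:R ^+ 3 - (#|Fq| ^ m)%:R :> R[i] &
    L_sum #|Fq| J (@Sp k 3) m = e * L (@gA _) + n * L (@gG _) + e * (e - 1) * L (@gB _) + e * n * L (@gC _) +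
      (n * e + e * (e - 1) / 2 * n) * L (@gD _) + (n * (n - 1) + e * (n * (n - 1) / 2)) * L (@gE _) +
      n * (n - 1) * (n - 2) / 6 * L (@gH _) + N.1.2%:R * e * L (@gF _) + N.1.2%:R * n * L (@gI _) + N.2%:R * L (@gK _)].
  (* A dummy triple at [m = 0], where nothing is claimed, makes the three counts total functions of
     [m]. *)
  have [->|m0] := posnP m; first by exists (0, 0, 0)%N.
  have hqm : (#|Fq| ^ m = p ^ (n * m))%N by rewrite cq expnM.
  have nm : (0 < n * m)%N by rewrite muln_gt0 n0.
  by have [N1 [N2 [N3 h]]] := L_sum_total hp halg nm J hqm; exists (N1, N2, N3).
have [N hN] := choice exN.
apply: lef_ext (@sum_types_lefschetz R[i] #|Fq| q1 J e (fun m => (N m).1.1) (fun m => (N m).1.2) (fun m => (N m).2) e12 _ _ _).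
- by move=> m m0; have [_ _ _] := hN m m0.
- by move=> m m0; have [] := hN m m0.
- by move=> m m0; have [_] := hN m m0.
- by move=> m m0; have [_ _] := hN m m0.
Qed.
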